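(* Let $u$ be the solution of the two-parameter boundary value problem $$-\varepsilon u''+\mu a(x)u'+b(x)u=f(x),\ x\in(0,1),\qquad u(0)=u(1)=0,$$ let $U$ be the solution of the upwind finite difference scheme on the piecewise-uniform Shishkin mesh with $N$ intervals described in the context, and let $\bar U$ be the piecewise linear interpolant of $U$ on that mesh. There is a constant $C$, independent of $\varepsilon$, $\mu$ and $N$, such that $$\Vert u-\bar U\Vert_{1,\chi}\le C N^{-1}\ln N\qquad\text{whenever } \sigma_R\le\sigma_L<\tfrac14,$$ and, in general (without assuming $\sigma_R\le \sigma_L<\tfrac14$), $$\Vert u-\bar U\Vert_{1,\chi}\le C N^{-1}(\ln N)^3 .$$
   Context: Continuous problem. $\Omega=(0,1)$, $0<\varepsilon\le 1$, $0\le\mu\le 1$. The functions $a,b,f$ are sufficiently smooth ($a\in C^7$, $b,f\in C^9$, with derivatives extending continuously to $[0,1]$), and there are constants $\alpha,\gamma>0$ with $a(x)>\alpha>0$ and $b(x)>\gamma a(x)>0$ on $\Omega$. Standing assumptions: $b\pm 2\mu\max_{[0,1]} a'>0$; with $\theta:=\max\{1,\frac{\alpha\mu^2}{\gamma\varepsilon}\}$ one has $\frac{\alpha}{\gamma\varepsilon}\ge\theta\ge 1$; and, with $$\rho_L:=\tfrac12\sqrt{\tfrac{\gamma\alpha}{\theta\varepsilon}},\qquad \rho_R:=\sqrt{\tfrac{\theta\gamma\alpha}{\varepsilon}},$$ one has $\rho_L>1$ and $\rho_R>1$. Throughout, $C$ is a generic constant which may depend on $a,b,f,\alpha,\gamma$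 but not on $\varepsilon,\mu,N$. Mesh. $N$ is a positive multiple of $4$. Put $\sigma_L:=\min\{\frac14,\frac{2}{\rho_L}\ln N\}$ and $\sigma_R:=\min\{\frac14,\frac{4}{\rho_R}\ln N\}$. The mesh $0=x_0<x_1<\dots<x_N=1$ has $N/4$ equal intervals on $[0,\sigma_L]$, $N/2$ equal intervals on $[\sigma_L,1-\sigma_R]$ and $N/4$ equal intervals on $[1-\sigma_R,1]$; $h_i:=x_i-x_{i-1}$. Scheme. For a mesh function $Z$: $D^+Z(x_i)=\frac{Z(x_{i+1})-Z(x_i)}{h_{i+1}}$, $D^-Z(x_i)=D^+Z(x_{i-1})$, $\delta^2Z(x_i)=\frac{D^+Z(x_i)-D^-Z(x_i)}{(x_{i+1}-x_{i-1})/2}$. The discrete solution $U$ satisfies $-\varepsilon\delta^2U(x_i)+\mu a(x_i)D^-U(x_i)+b(x_i)U(x_i)=f(x_i)$ for $0<i<N$, $U(0)=u(0)=0$, $U(1)=u(1)=0$. Norm. $\Vert v\Vert:=\max_{x\in[0,1]}|v(x)|$, $\tau_L:=\frac{2}{\rho_L}\ln\rho_L$, $\tau_R:=\frac{2}{\rho_R}\ln\rho_R$, and $\Vert v\Vert_{1,\chi}:=\Vert\chi v'\Vert+\Vert v\Vert$, where $$\chi(x):=\begin{cases}\sqrt{\varepsilon\theta},& x\le\tau_L,\\ 1,&\tau_L<x<1-\tau_R,\\ \sqrt{\varepsilon/\theta},& x\ge 1-\tau_R\end{cases}$$ (if the cases overlap, the first applicable one is used). The derivative of a piecewise linear function at $x\in(x_{i-1},x_i]$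 is taken to be its slope on $(x_{i-1},x_i)$, and $\Vert\cdot\Vert$ of the resulting piecewise continuous function is its supremum. *)

(* Defs.v *)
From Stdlib Require Export Reals.
From Coquelicot Require Export Coquelicot.

Open Scope R_scope.

Definition in_Omega (x : R) : Prop := 0 < x < 1.
Definition in_clOmega (x : R) : Prop := 0 <= x <= 1.

(* Values of g outside (0,1) are irrelevant: each derivative on (0,1) is only
   required to have some continuous extension to [0,1]. *)
Definition smooth (k : nat) (g : R -> R) : Prop :=
  forall j : nat, (j <= k)%nat ->
    (forall x : R, in_Omega x -> ex_derive_n g j x) /\
    exists gj : R -> R,
      continuous_on in_clOmega gj /\
      forall x : R, in_Omega x -> gj x = Derive_n g j x.

Definition sup_on (D : R -> Prop) (g : R -> R) : Rbar :=
  Lub_Rbar (fun y : R => exists x : R, D x /\ y = g x).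

(* When a' extends continuously to [0,1], its supremum over (0,1) is finite and
   is the maximum of the extension over [0,1]. *)
Definition max_deriv (a : R -> R) : R := real (sup_on in_Omega (Derive a)).

(* [ex_derive_n u 2 x] alone says only that the total function [Derive u] is
   differentiable at x, so [ex_derive u x] is required separately. *)
Definition bvp_solution (eps mu : R) (a b f u : R -> R) : Prop :=
  continuous_on in_clOmega u /\ u 0 = 0 /\ u 1 = 0 /\
  forall x : R, in_Omega x ->
    ex_derive u x /\ ex_derive_n u 2 x /\
    - eps * Derive_n u 2 x + mu * a x * Derive u x + b x * u x = f x.

Definition theta (alpha gamma eps mu : R) : R :=
  Rmax 1 (alpha * mu ^ 2 / (gamma * eps)).

Definition rho_L (alpha gamma eps mu : R) : R :=
  / 2 * sqrt (gamma * alpha / (theta alpha gamma eps mu * eps)).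

Definition rho_R (alpha gamma eps mu : R) : R :=
  sqrt (theta alpha gamma eps mu * gamma * alpha / eps).

Definition sigma_L (alpha gamma eps mu : R) (N : nat) : R :=
  Rmin (1 / 4) (2 / rho_L alpha gamma eps mu * ln (INR N)).

Definition sigma_R (alpha gamma eps mu : R) (N : nat) : R :=
  Rmin (1 / 4) (4 / rho_R alpha gamma eps mu * ln (INR N)).

Definition tau_L (alpha gamma eps mu : R) : R :=
  2 / rho_L alpha gamma eps mu * ln (rho_L alpha gamma eps mu).

Definition tau_R (alpha gamma eps mu : R) : R :=
  2 / rho_R alpha gamma eps mu * ln (rho_R alpha gamma eps mu).

(* Meant for N a positive multiple of 4, where the divisions in nat are exact. *)
Definition pw_uniform_mesh (N : nat) (sL sR : R) (i : nat) : R :=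
  if (i <=? N / 4)%nat then
    INR i * (sL / (INR N / 4))
  else if (i <=? 3 * (N / 4))%nat then
    sL + INR (i - N / 4) * ((1 - sL - sR) / (INR N / 2))
  else
    1 - sR + INR (i - 3 * (N / 4)) * (sR / (INR N / 4)).

Definition shishkin_mesh (alpha gamma eps mu : R) (N : nat) : nat -> R :=
  pw_uniform_mesh N (sigma_L alpha gamma eps mu N) (sigma_R alpha gamma eps mu N).

(* A mesh function Z is given by its nodal values: Z i stands for Z(x_i). *)
Definition Dplus (x Z : nat -> R) (i : nat) : R :=
  (Z (i + 1)%nat - Z i) / (x (i + 1)%nat - x i).

Definition Dminus (x Z : nat -> R) (i : nat) : R := Dplus x Z (i - 1).

Definition delta2 (x Z : nat -> R) (i : nat) : R :=
  (Dplus x Z i - Dminus x Z i) / ((x (i + 1)%nat - x (i - 1)%nat) / 2).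

Definition upwind_solution (eps mu : R) (a b f : R -> R) (N : nat)
    (x U : nat -> R) : Prop :=
  U 0%nat = 0 /\ U N = 0 /\
  forall i : nat, (0 < i < N)%nat ->
    - eps * delta2 x U i + mu * a (x i) * Dminus x U i + b (x i) * U i = f (x i).

(* First index j among i, ..., i + k - 1 with t <= x j, and i + k if none. *)
Fixpoint first_node_from (x : nat -> R) (t : R) (i k : nat) : nat :=
  match k with
  | O => i
  | S k' => if Rle_dec t (x i) then i else first_node_from x t (S i) k'
  end.

(* For an increasing mesh x 0 = 0, ..., x N = 1, this is the index i in 1..N
   with x (i-1) < t <= x i when 0 < t <= 1; at t = 0 it is 1. *)
Definition cell (N : nat) (x : nat -> R) (t : R) : nat :=
  first_node_from x t 1 (N - 1).

Definition pl_slope (N : nat) (x U : nat -> R) (t : R) : R :=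
  Dminus x U (cell N x t).

Definition pl_interp (N : nat) (x U : nat -> R) (t : R) : R :=
  let i := (cell N x t - 1)%nat in
  U i + pl_slope N x U t * (t - x i).

Definition chi (alpha gamma eps mu : R) (x : R) : R :=
  if Rle_dec x (tau_L alpha gamma eps mu) then
    sqrt (eps * theta alpha gamma eps mu)
  else if Rlt_dec x (1 - tau_R alpha gamma eps mu) then 1
  else sqrt (eps / theta alpha gamma eps mu).

(* Extended-real valued, so that an unbounded function has infinite norm. *)
Definition sup_norm (D : R -> Prop) (v : R -> R) : Rbar :=
  sup_on D (fun x => Rabs (v x)).

(* The derivative dv is passed separately because of the convention for
   piecewise linear functions at the nodes.  Its supremum is taken over (0,1):
   at 0 and 1 only one-sided derivatives exist, and they are limits of interior
   values, which leaves the supremum unchanged. *)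
Definition norm_1chi (w v dv : R -> R) : Rbar :=
  Rbar_plus (sup_norm in_Omega (fun x => w x * dv x)) (sup_norm in_clOmega v).

Definition error_norm (alpha gamma eps mu : R) (N : nat)
    (u : R -> R) (U : nat -> R) : Rbar :=
  let x := shishkin_mesh alpha gamma eps mu N in
  norm_1chi (chi alpha gamma eps mu)
    (fun t => u t - pl_interp N x U t)
    (fun t => Derive u t - pl_slope N x U t).

(* Main.v *)
Require Import Defs.
From Stdlib Require Import Reals Arith Lra Lia.
From Coquelicot Require Import Coquelicot.

(** With l = rho_L, r = rho_R, theta = r/(2l) and eps = gamma alpha/(2 l r), the
    solution is u = v + z, where v comes from a truncated expansion in eps and mu
    with bounded third derivative and z^(j) = O(l^j (l^-3 + exp(-l x)) + r^j exp(-3/4 r (1 - x)))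
    for j <= 3.  The value of z is bounded by the maximum principle; its derivative
    follows since the flux eps z' - mu a z is nearly constant on cells of length 1/r, or,
    when mu a z' dominates, from a first-order comparison started next to the
    outflow boundary x = 1.  In that case z' also splits into an exact
    multiple of exp((mu/eps) int a) and a part whose layer at x = 1 is weaker by the factor l/r.

    The same scheme is repeated for the mesh.  Discrete exponentials are barriers for
    the nodal error e, and the almost constant discrete flux, respectively the
    recursion for the slopes, turns the bounds of e and of the consistency error into
    bounds of the slopes of e.  On the coarse cells next to the outflow layer
    the consistency error is estimated with the splitting of z', because the factor r/l in
    front of that layer may exceed every power of N.  The weight chi absorbs one
    derivative of each layer.  If a transition point is capped at 1/4, then l <= 8 ln N,
    respectively r <= 16 ln N, and the layers only cost powers of ln N. *)

(** Two identities, 4 l^2 theta eps = ga al and r = 2 l theta, drive all estimates: they make 1/eps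
    a multiple of l r and [mu] an O(1/l), so everything is measured in powers of [l] and [r]. If
    theta = 1, the two layers have comparable widths and reaction balances diffusion; otherwise [mu]
    equals [ga / (2 * l)], and convection controls the derivatives near x = 1. The obstacle is that
    [l], [r] and N are mutually unrelated. A maximum principle bounds values only, and dividing
    differences of values by a mesh width would lose powers of N or of r/l; so derivatives and
    slopes get a stability argument of their own. The expansion of [v] has three terms because a
    residual O(l^-3) gives the third derivative of the rest a smooth component of size O(1), as a
    classical truncation bound requires; each term loses two derivatives, which explains the
    smoothness classes 7 and 9. An uncapped transition point enters through exp(-l sigma_L) = N^-2
    or exp(-(3/4) r sigma_R) = N^-3; the discrete barriers, with the rates l/2 and r/2, are O(N^-1)
    and O(N^-2) there. *)

(** * Calculus on an interval: comparison principles and the local flux argument *)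

Lemma mvt_open (f df : R -> R) (s t : R) :
  s < t ->
  (forall x, s <= x <= t -> continuity_pt f x) ->
  (forall x, s < x < t -> is_derive f x (df x)) ->
  exists c, s < c < t /\ f t - f s = df c * (t - s).
Proof.
  intros Hst Hc Hd.
  assert (pr : forall c, s < c < t -> derivable_pt f c).
  { intros c Hc'. exists (df c). apply is_derive_Reals, Hd, Hc'. }
  destruct (MVT f id s t pr (fun c _ => derivable_pt_id c) Hst Hc
              (fun c _ => derivable_continuous_pt _ _ (derivable_pt_id c)))
    as [c [P HP]].
  exists c; split; [exact P|].
  rewrite <- (derive_pt_eq_0 _ _ _ (pr c P) (proj1 (is_derive_Reals _ _ _) (Hd c P))).
  assert (E : derive_pt id c (derivable_pt_id c) = 1) by apply derive_pt_id.
  rewrite E in HP. unfold id in HP. lra.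
Qed.

Lemma derive_continuity_pt (f : R -> R) (x d : R) :
  is_derive f x d -> continuity_pt f x.
Proof.
  intros H. apply derivable_continuous_pt. exists d. now apply is_derive_Reals.
Qed.

Lemma derive_nonneg_incr (f df : R -> R) (s t : R) :
  s <= t ->
  (forall x, s <= x <= t -> continuity_pt f x) ->
  (forall x, s < x < t -> is_derive f x (df x)) ->
  (forall x, s < x < t -> 0 <= df x) ->
  f s <= f t.
Proof.
  intros [Hst| ->] Hc Hd Hp; [|lra].
  destruct (mvt_open f df s t Hst Hc Hd) as [c [Hc1 Hc2]].
  specialize (Hp c Hc1). nra.
Qed.

(** Both [g - f] and [g + f] are nondecreasing. Supplying the majorant through an antiderivative [g]
    lets exponential layers be integrated exactly without any integral. *)
Lemma increment_le (f df g dg : R -> R) (s t : R) :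
  s <= t ->
  (forall x, s <= x <= t -> continuity_pt f x) ->
  (forall x, s <= x <= t -> continuity_pt g x) ->
  (forall x, s < x < t -> is_derive f x (df x)) ->
  (forall x, s < x < t -> is_derive g x (dg x)) ->
  (forall x, s < x < t -> Rabs (df x) <= dg x) ->
  Rabs (f t - f s) <= g t - g s.
Proof.
  intros Hst Hcf Hcg Hdf Hdg Hb.
  assert (H1 : g s - f s <= g t - f t).
  { apply (derive_nonneg_incr (fun x => g x - f x) (fun x => dg x - df x)); auto.
    - intros x Hx. apply continuity_pt_minus; auto.
    - intros x Hx. apply @is_derive_minus; auto.
    - intros x Hx. specialize (Hb x Hx). unfold Rabs in Hb. destruct Rcase_abs; lra. }
  assert (H2 : g s + f s <= g t + f t).
  { apply (derive_nonneg_incr (fun x => g x + f x) (fun x => dg x + df x)); auto.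
    - intros x Hx. apply continuity_pt_plus; auto.
    - intros x Hx. apply @is_derive_plus; auto.
    - intros x Hx. specialize (Hb x Hx). unfold Rabs in Hb. destruct Rcase_abs; lra. }
  unfold Rabs; destruct Rcase_abs; lra.
Qed.

Lemma derive_neg_decr_right (f : R -> R) (c d : R) :
  is_derive f c d -> d < 0 ->
  exists dl, 0 < dl /\ forall h, 0 < h < dl -> f (c + h) < f c.
Proof.
  intros Hd Hn. apply is_derive_Reals in Hd.
  destruct (Hd (- d)) as [dl Hdl]; [lra|].
  exists dl; split; [apply cond_pos|].
  intros h Hh. specialize (Hdl h).
  assert (H : Rabs ((f (c + h) - f c) / h - d) < - d).
  { apply Hdl; [lra|]. rewrite Rabs_pos_eq; lra. }
  apply Rabs_def2 in H.
  assert (H0 : (f (c + h) - f c) / h < 0) by lra.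
  assert (H1 : (f (c + h) - f c) = (f (c + h) - f c) / h * h) by (field; lra).
  nra.
Qed.

(** If [y2 c] were negative, [y1] would be negative just to the right of its zero [c], and [y] would
    fall below its minimum. *)
Lemma interior_min_derivatives (y y1 y2 : R -> R) (c : R) :
  0 < c < 1 ->
  (forall x, 0 < x < 1 -> is_derive y x (y1 x)) ->
  (forall x, 0 < x < 1 -> is_derive y1 x (y2 x)) ->
  (forall x, 0 <= x <= 1 -> y c <= y x) ->
  y1 c = 0 /\ 0 <= y2 c.
Proof.
  intros Hc Hd1 Hd2 Hmin.
  assert (H1 : y1 c = 0).
  { assert (pr : derivable_pt y c) by (exists (y1 c); apply is_derive_Reals, Hd1, Hc).
    rewrite <- (derive_pt_eq_0 _ _ _ pr (proj1 (is_derive_Reals _ _ _) (Hd1 c Hc))).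
    apply (deriv_minimum y 0 1); try lra. intros x H0 H1. apply Hmin. lra. }
  split; [exact H1|].
  destruct (Rle_lt_dec 0 (y2 c)) as [H|H]; [exact H|exfalso].
  destruct (derive_neg_decr_right y1 c (y2 c) (Hd2 c Hc) H) as [dl [Hdl Hlt]].
  set (h := Rmin (dl / 2) ((1 - c) / 2)).
  assert (Hh : 0 < h /\ h < dl /\ c + h < 1).
  { unfold h. pose proof (Rmin_l (dl / 2) ((1 - c) / 2)).
    pose proof (Rmin_r (dl / 2) ((1 - c) / 2)).
    split; [apply Rmin_glb_lt; lra|]. split; lra. }
  destruct Hh as [Hh0 [Hh1 Hh2]].
  destruct (mvt_open y y1 c (c + h)) as [xi [Hxi1 Hxi2]].
  - lra.
  - intros x Hx. apply derive_continuity_pt with (y1 x). apply Hd1. lra.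
  - intros x Hx. apply Hd1. lra.
  - assert (y1 xi < 0).
    { replace xi with (c + (xi - c)) by ring. rewrite <- H1. apply Hlt. lra. }
    specialize (Hmin (c + h)). assert (y c <= y (c + h)) by (apply Hmin; lra). nra.
Qed.

(** At a negative minimum the convection term vanishes, the diffusion term is nonpositive and the
    reaction term is negative, so the operator would be negative there. *)
Lemma maximum_principle (eps : R) (ka b y y1 y2 : R -> R) :
  0 < eps ->
  (forall x, 0 < x < 1 -> 0 < b x) ->
  (forall x, 0 <= x <= 1 -> continuity_pt y x) ->
  (forall x, 0 < x < 1 -> is_derive y x (y1 x)) ->
  (forall x, 0 < x < 1 -> is_derive y1 x (y2 x)) ->
  (forall x, 0 < x < 1 -> 0 <= - eps * y2 x + ka x * y1 x + b x * y x) ->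
  0 <= y 0 -> 0 <= y 1 ->
  forall x, 0 <= x <= 1 -> 0 <= y x.
Proof.
  intros He Hb Hc Hd1 Hd2 HL H0 H1 x Hx.
  destruct (continuity_ab_min y 0 1) as [m [Hm1 Hm2]]; [lra|exact Hc|].
  apply Rle_trans with (y m); [|apply Hm1, Hx].
  destruct (Rle_lt_dec 0 (y m)) as [H|H]; [exact H|exfalso].
  assert (Hm : 0 < m < 1).
  { destruct (Req_dec m 0) as [->|]; [lra|]. destruct (Req_dec m 1) as [->|]; lra. }
  destruct (interior_min_derivatives y y1 y2 m Hm Hd1 Hd2 Hm1) as [E1 E2].
  specialize (HL m Hm). specialize (Hb m Hm). rewrite E1 in HL. nra.
Qed.

(** Nonnegativity travels from [t1] to the left. At a negative minimum over [s, t1] the strict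
    inequality forces [d1] to be negative, so [d] is smaller just to the right. Only the right side
    of the minimum point is inspected, because that point may be [s] itself. *)
Lemma backward_comparison (eps t1 : R) (ka d d1 : R -> R) :
  0 < eps -> t1 < 1 ->
  (forall x, 0 < x < 1 -> 0 <= ka x) ->
  (forall x, 0 < x < 1 -> is_derive d x (d1 x)) ->
  (forall x, 0 < x < t1 -> 0 < - eps * d1 x + ka x * d x) ->
  0 <= d t1 ->
  forall x, 0 < x <= t1 -> 0 <= d x.
Proof.
  intros He Ht1 Hka Hd Hpos Hend s Hs.
  destruct (Rle_lt_dec 0 (d s)) as [H|H]; [exact H|exfalso].
  destruct (continuity_ab_min d s t1) as [c [Hc1 Hc2]]; [lra| |].
  { intros x Hx. apply derive_continuity_pt with (d1 x), Hd. lra. }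
  assert (Hcs : d c <= d s) by (apply Hc1; lra).
  assert (c <> t1) by (intros ->; lra).
  assert (Hp : 0 < - eps * d1 c + ka c * d c) by (apply Hpos; lra).
  assert (Hk : 0 <= ka c) by (apply Hka; lra).
  assert (Hn : d1 c < 0) by nra.
  destruct (derive_neg_decr_right d c (d1 c)) as [dl [Hdl Hlt]]; [apply Hd; lra|exact Hn|].
  set (h := Rmin (dl / 2) ((t1 - c) / 2)).
  assert (Hh : 0 < h /\ h < dl /\ c + h < t1).
  { unfold h. pose proof (Rmin_l (dl / 2) ((t1 - c) / 2)).
    pose proof (Rmin_r (dl / 2) ((t1 - c) / 2)).
    split; [apply Rmin_glb_lt; lra|]. split; lra. }
  assert (d (c + h) < d c) by (apply Hlt; lra).
  assert (d c <= d (c + h)) by (apply Hc1; lra).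
  lra.
Qed.

(* The flux [eps y' - ka y] has a bounded derivative, so it is almost constant,
   while its average over the interval is controlled by y alone. *)
Lemma local_derivative_bound (eps K K1 Z G s h : R) (ka ka1 y y1 y2 : R -> R) :
  0 < eps -> 0 < h -> 0 <= K -> 0 <= K1 ->
  (forall x, s <= x <= s + h -> is_derive y x (y1 x)) ->
  (forall x, s <= x <= s + h -> is_derive y1 x (y2 x)) ->
  (forall x, s <= x <= s + h -> is_derive ka x (ka1 x)) ->
  (forall x, s <= x <= s + h -> Rabs (ka x) <= K) ->
  (forall x, s <= x <= s + h -> Rabs (ka1 x) <= K1) ->
  (forall x, s <= x <= s + h -> Rabs (y x) <= Z) ->
  (forall x, s <= x <= s + h -> Rabs (- eps * y2 x + ka x * y1 x) <= G) ->
  forall x, s <= x <= s + h ->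
    Rabs (y1 x) <= 2 * Z / h + (2 * K * Z + h * (G + K1 * Z)) / eps.
Proof.
  intros He Hh HK HK1 Hd1 Hd2 Hdk Hk Hk1 HZ HG x Hx.
  destruct (mvt_open y y1 s (s + h)) as [c [Hc1 Hc2]]; [lra| | |].
  { intros t Ht. apply derive_continuity_pt with (y1 t), Hd1, Ht. }
  { intros t Ht. apply Hd1. lra. }
  assert (HZ0 : 0 <= Z) by (apply Rle_trans with (Rabs (y x)); [apply Rabs_pos|apply HZ, Hx]).
  assert (HG0 : 0 <= G) by (eapply Rle_trans; [apply Rabs_pos|apply (HG x Hx)]).
  assert (Hy1c : Rabs (y1 c) <= 2 * Z / h).
  { assert (E : y1 c = (y (s + h) - y s) / h) by (rewrite Hc2; field; lra).
    rewrite E. unfold Rdiv. rewrite Rabs_mult, (Rabs_pos_eq (/ h)).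
    - apply Rmult_le_compat_r; [left; apply Rinv_0_lt_compat; lra|].
      pose proof (Rabs_triang (y (s + h)) (- y s)) as HT.
      rewrite Rabs_Ropp in HT.
      assert (Rabs (y (s + h)) <= Z) by (apply HZ; lra).
      assert (Rabs (y s) <= Z) by (apply HZ; lra).
      unfold Rminus. lra.
    - left; apply Rinv_0_lt_compat; lra. }
  set (F := fun t => eps * y1 t - ka t * y t).
  set (dF := fun t => eps * y2 t - (ka1 t * y t + ka t * y1 t)).
  assert (HdF : forall t, s <= t <= s + h -> is_derive F t (dF t)).
  { intros t Ht. unfold F, dF. apply @is_derive_minus.
    - apply is_derive_scal. auto.
    - apply (is_derive_mult (K := R_AbsRing) ka y t (ka1 t) (y1 t)); auto.
      intros u v. apply Rmult_comm. }
  assert (HbF : forall t, s <= t <= s + h -> Rabs (dF t) <= G + K1 * Z).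
  { intros t Ht. unfold dF.
    replace (eps * y2 t - (ka1 t * y t + ka t * y1 t))
      with (- (- eps * y2 t + ka t * y1 t) + - (ka1 t * y t)) by ring.
    eapply Rle_trans; [apply Rabs_triang|]. rewrite !Rabs_Ropp, Rabs_mult.
    apply Rplus_le_compat; [auto|].
    apply Rmult_le_compat; auto using Rabs_pos. }
  assert (HFx : Rabs (F x - F c) <= h * (G + K1 * Z)).
  { assert (Hinc : forall p q, s <= p -> p <= q -> q <= s + h ->
              Rabs (F q - F p) <= h * (G + K1 * Z)).
    { intros p q Hp Hpq Hq.
      apply Rle_trans with ((G + K1 * Z) * q - (G + K1 * Z) * p).
      - apply (increment_le F dF (fun t => (G + K1 * Z) * t) (fun _ => G + K1 * Z)); auto.
        + intros t Ht. apply derive_continuity_pt with (dF t), HdF. lra.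
        + intros t Ht. apply derive_continuity_pt with (G + K1 * Z).
          auto_derive; [auto|ring].
        + intros t Ht. apply HdF; lra.
        + intros t Ht. auto_derive; [auto|ring].
        + intros t Ht. apply HbF; lra.
      - assert (0 <= G + K1 * Z) by nra. nra. }
    destruct (Rle_lt_dec c x).
    - apply Hinc; lra.
    - rewrite Rabs_minus_sym. apply Hinc; lra. }
  (* The mean value point [c] provides one slope bounded by 2 Z / h; the flux carries this bound to
     every other point of the interval. *)
  assert (E : y1 x = y1 c + (F x - F c + ka x * y x - ka c * y c) / eps)
    by (unfold F; field; lra).
  rewrite E. eapply Rle_trans; [apply Rabs_triang|].
  apply Rplus_le_compat; [exact Hy1c|].
  unfold Rdiv. rewrite Rabs_mult, (Rabs_pos_eq (/ eps));
    [|left; apply Rinv_0_lt_compat; lra].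
  apply Rmult_le_compat_r; [left; apply Rinv_0_lt_compat; lra|].
  assert (Hky : forall t, s <= t <= s + h -> Rabs (ka t * y t) <= K * Z).
  { intros t Ht. rewrite Rabs_mult. apply Rmult_le_compat; auto using Rabs_pos. }
  pose proof (Hky x Hx) as A1. assert (A2 : Rabs (ka c * y c) <= K * Z) by (apply Hky; lra).
  pose proof (Rabs_triang (F x - F c + ka x * y x) (- (ka c * y c))) as T1.
  pose proof (Rabs_triang (F x - F c) (ka x * y x)) as T2.
  rewrite Rabs_Ropp in T1. unfold Rminus at 1. lra.
Qed.

(** * Layer functions and the maximum principle *)

Definition EL (l x : R) : R := exp (- l * x).
(** If [mu = ga / (2 * l)], the layer decays at least at the rate [r]. The factor 3/4 keeps the
    margin mu a - (3/4) eps r >= ga al / (8 l), which the first-order comparison needs since it has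
    no reaction term to help. *)
Definition ER (r x : R) : R := exp (- (3 / 4) * r * (1 - x)).
(* [/ l ^ 3] is the size of the residual left by the regular part. *)
Definition wt (l r : R) (j : nat) (x : R) : R :=
  l ^ j * (/ l ^ 3 + EL l x) + r ^ j * ER r x.

(* [l] and [r] stand for rho_L and rho_R.  Then theta = r / (2 l), and the two
   alternatives of [pars_case] are theta = 1 and theta = al mu^2 / (ga eps). *)
Record pars {al ga l r eps mu : R} : Prop := {
  pars_l : 1 < l;
  pars_r : 2 * l <= r;
  pars_eps : eps = ga * al / (2 * l * r);
  pars_mu0 : 0 <= mu;
  pars_mu : mu <= ga / (2 * l);
  pars_case : r = 2 * l \/ mu = ga / (2 * l) }.
Arguments pars : clear implicits.

Record coefs {al ga M : R} {a a1 a2 b b1 b2 : R -> R} : Prop := {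
  coefs_al : 0 < al;
  coefs_ga : 0 < ga;
  coefs_M : 1 <= M;
  coefs_a_lower : forall x, 0 < x < 1 -> al < a x;
  coefs_b_lower : forall x, 0 < x < 1 -> ga * a x < b x;
  coefs_da : forall x, 0 < x < 1 -> is_derive a x (a1 x);
  coefs_da1 : forall x, 0 < x < 1 -> is_derive a1 x (a2 x);
  coefs_db : forall x, 0 < x < 1 -> is_derive b x (b1 x);
  coefs_db1 : forall x, 0 < x < 1 -> is_derive b1 x (b2 x);
  coefs_a : forall x, 0 < x < 1 -> Rabs (a x) <= M;
  coefs_a1 : forall x, 0 < x < 1 -> Rabs (a1 x) <= M;
  coefs_a2 : forall x, 0 < x < 1 -> Rabs (a2 x) <= M;
  coefs_b : forall x, 0 < x < 1 -> Rabs (b x) <= M;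
  coefs_b1 : forall x, 0 < x < 1 -> Rabs (b1 x) <= M;
  coefs_b2 : forall x, 0 < x < 1 -> Rabs (b2 x) <= M }.
Arguments coefs : clear implicits.

(** The problem of the layer part: boundary values of size O(1), a residual [g] of size O(l^-3). The
    equation is stored solved for the second derivative, so that it can be differentiated again. *)
Record remainder_bvp {M l eps mu : R} {a b z z1 g g1 g2 : R -> R} : Prop := {
  rem_cont : forall x, 0 <= x <= 1 -> continuity_pt z x;
  rem_0 : Rabs (z 0) <= M;
  rem_1 : Rabs (z 1) <= M;
  rem_dz : forall x, 0 < x < 1 -> is_derive z x (z1 x);
  rem_dz1 : forall x, 0 < x < 1 ->
    is_derive z1 x ((mu * a x * z1 x + b x * z x - g x) / eps);
  rem_dg : forall x, 0 < x < 1 -> is_derive g x (g1 x);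
  rem_dg1 : forall x, 0 < x < 1 -> is_derive g1 x (g2 x);
  rem_g : forall x, 0 < x < 1 -> Rabs (g x) <= M / l ^ 3;
  rem_g1 : forall x, 0 < x < 1 -> Rabs (g1 x) <= M / l ^ 3;
  rem_g2 : forall x, 0 < x < 1 -> Rabs (g2 x) <= M / l ^ 3 }.
Arguments remainder_bvp : clear implicits.

Lemma EL_pos l x : 0 < EL l x.
Proof. apply exp_pos. Qed.

Lemma ER_pos r x : 0 < ER r x.
Proof. apply exp_pos. Qed.

Lemma is_derive_EL l x : is_derive (EL l) x (- l * EL l x).
Proof. unfold EL. auto_derive; [auto|ring]. Qed.

Lemma is_derive_ER r x : is_derive (ER r) x (3 / 4 * r * ER r x).
Proof.
  unfold ER. auto_derive; [auto|].
  replace (1 + - x) with (1 - x) by ring.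
  replace (- (3 * / 4) * r * (1 - x)) with (- (3 / 4) * r * (1 - x)) by reflexivity. field.
Qed.

Lemma exp_le_1 x : x <= 0 -> exp x <= 1.
Proof.
  intros H. rewrite <- exp_0. destruct (Req_dec x 0) as [->|]; [lra|].
  left; apply exp_increasing; lra.
Qed.

Lemma exp_mono x y : x <= y -> exp x <= exp y.
Proof. intros [H| ->]; [left; now apply exp_increasing|lra]. Qed.

Lemma EL_le_1 l x : 0 <= l -> 0 <= x -> EL l x <= 1.
Proof. intros. apply exp_le_1. nra. Qed.

Lemma ER_le_1 r x : 0 <= r -> x <= 1 -> ER r x <= 1.
Proof. intros. apply exp_le_1. nra. Qed.

Lemma EL_shift l s x : l * (x - s) <= 1 -> EL l s <= 3 * EL l x.
Proof.
  intros H. unfold EL. replace (- l * s) with (l * (x - s) + - l * x) by ring.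
  rewrite exp_plus. apply Rmult_le_compat_r; [left; apply exp_pos|].
  eapply Rle_trans; [|apply exp_le_3]. now apply exp_mono.
Qed.

Lemma ER_shift r s x : 3 / 4 * r * (s - x) <= 1 -> ER r s <= 3 * ER r x.
Proof.
  intros H. unfold ER.
  replace (- (3 / 4) * r * (1 - s)) with (3 / 4 * r * (s - x) + - (3 / 4) * r * (1 - x)) by ring.
  rewrite exp_plus. apply Rmult_le_compat_r; [left; apply exp_pos|].
  eapply Rle_trans; [|apply exp_le_3]. now apply exp_mono.
Qed.

Lemma Rabs_div_le x y c : 0 < c -> Rabs x <= y -> Rabs (x / c) <= y / c.
Proof.
  intros Hc H. unfold Rdiv. rewrite Rabs_mult, (Rabs_pos_eq (/ c)).
  - apply Rmult_le_compat_r; [left; now apply Rinv_0_lt_compat|exact H].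
  - left; now apply Rinv_0_lt_compat.
Qed.

Lemma Rabs_mult_le x y X Y : Rabs x <= X -> Rabs y <= Y -> Rabs (x * y) <= X * Y.
Proof. intros. rewrite Rabs_mult. apply Rmult_le_compat; auto using Rabs_pos. Qed.

Lemma Rabs_plus_le x y X Y : Rabs x <= X -> Rabs y <= Y -> Rabs (x + y) <= X + Y.
Proof. intros. eapply Rle_trans; [apply Rabs_triang|lra]. Qed.

Lemma Rabs_minus_le x y X Y : Rabs x <= X -> Rabs y <= Y -> Rabs (x - y) <= X + Y.
Proof. intros. apply Rabs_plus_le; [auto|now rewrite Rabs_Ropp]. Qed.

Lemma mult_le_1 p q Y : 0 <= p <= Y -> 0 <= q <= 1 -> p * q <= Y.
Proof. intros Hp Hq. nra. Qed.

Lemma Rmin_1_bounds p : 0 <= p -> 0 <= Rmin p 1 <= 1.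
Proof. intros Hp. split; [apply Rmin_glb; lra|apply Rmin_r]. Qed.

Section Weights.

Variables (l r : R).
Hypotheses (Hl : 1 < l) (Hr : 2 * l <= r).

Lemma wt_pos j x : 0 < wt l r j x.
Proof.
  unfold wt. pose proof (EL_pos l x). pose proof (ER_pos r x).
  assert (0 < l ^ j) by (apply pow_lt; lra).
  assert (0 < r ^ j) by (apply pow_lt; lra).
  assert (0 < / l ^ 3) by (apply Rinv_0_lt_compat, pow_lt; lra).
  nra.
Qed.

Lemma wt_step j x : l * wt l r j x <= wt l r (S j) x.
Proof.
  unfold wt. rewrite <- !tech_pow_Rmult. pose proof (ER_pos r x).
  assert (0 < r ^ j) by (apply pow_lt; lra).
  assert (l * (r ^ j * ER r x) <= r * (r ^ j * ER r x)) by (apply Rmult_le_compat_r; nra).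
  lra.
Qed.

Lemma wt_mono j x : wt l r j x <= wt l r (S j) x.
Proof. pose proof (wt_step j x). pose proof (wt_pos j x). nra. Qed.

Lemma wt_R j x : r ^ j * ER r x <= wt l r j x.
Proof.
  unfold wt. pose proof (EL_pos l x).
  assert (0 < l ^ j) by (apply pow_lt; lra).
  assert (0 < / l ^ 3) by (apply Rinv_0_lt_compat, pow_lt; lra).
  nra.
Qed.

Lemma wt_0 x : / l ^ 3 <= wt l r 0 x.
Proof. unfold wt. pose proof (EL_pos l x). pose proof (ER_pos r x). simpl pow. lra. Qed.

(** Over a distance 1/r each exponential changes at most by the factor e, so a weight may be taken
    at any point of the intervals of the flux argument. *)
Lemma wt_shift j s x : Rabs (s - x) <= / r -> wt l r j s <= 3 * wt l r j x.
Proof.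
  intros H. apply Rabs_le_between in H.
  assert (Hrr : r * / r = 1) by (field; lra).
  assert (H1 : EL l s <= 3 * EL l x).
  { apply EL_shift. assert (0 < / r) by (apply Rinv_0_lt_compat; lra). nra. }
  assert (H2 : ER r s <= 3 * ER r x) by (apply ER_shift; nra).
  unfold wt.
  assert (0 < l ^ j) by (apply pow_lt; lra).
  assert (0 < r ^ j) by (apply pow_lt; lra).
  assert (0 < / l ^ 3) by (apply Rinv_0_lt_compat, pow_lt; lra).
  pose proof (EL_pos l x). pose proof (ER_pos r x).
  assert (r ^ j * ER r s <= r ^ j * (3 * ER r x)) by (apply Rmult_le_compat_l; lra).
  assert (l ^ j * (/ l ^ 3 + EL l s) <= l ^ j * (3 * (/ l ^ 3 + EL l x)))
    by (apply Rmult_le_compat_l; lra).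
  lra.
Qed.

Lemma wt_le_pow j x : 0 <= x <= 1 -> wt l r j x <= 3 * r ^ j.
Proof.
  intros Hx. unfold wt.
  assert (EL l x <= 1) by (apply EL_le_1; lra).
  assert (ER r x <= 1) by (apply ER_le_1; lra).
  assert (Hp : 1 <= l ^ 3) by (apply pow_R1_Rle; lra).
  assert (/ l ^ 3 <= 1) by (rewrite <- Rinv_1; apply Rinv_le_contravar; lra).
  assert (0 < l ^ j) by (apply pow_lt; lra).
  assert (l ^ j <= r ^ j) by (apply pow_incr; lra).
  pose proof (EL_pos l x). pose proof (ER_pos r x).
  assert (0 < / l ^ 3) by (apply Rinv_0_lt_compat; lra).
  assert (l ^ j * (/ l ^ 3 + EL l x) <= r ^ j * 2) by (apply Rmult_le_compat; lra).
  assert (r ^ j * ER r x <= r ^ j * 1) by (apply Rmult_le_compat_l; lra).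
  lra.
Qed.

End Weights.

Section LayerBounds.

Context {al ga M : R} {a a1 a2 b b1 b2 : R -> R}.
Hypothesis Hco : coefs al ga M a a1 a2 b b1 b2.

Let Hal : 0 < al := coefs_al Hco.
Let Hga : 0 < ga := coefs_ga Hco.
Let HM : 1 <= M := coefs_M Hco.

Lemma gaal_pos : 0 < ga * al.
Proof. nra. Qed.

Lemma pars_eps_pos l r eps mu : pars al ga l r eps mu -> 0 < eps.
Proof.
  intros [H1 H2 -> _ _ _]. pose proof gaal_pos. apply Rdiv_lt_0_compat; nra.
Qed.

Lemma b_pos x : 0 < x < 1 -> ga * al < b x.
Proof.
  intros Hx. pose proof (coefs_a_lower Hco x Hx).
  pose proof (coefs_b_lower Hco x Hx). nra.
Qed.

Lemma eps_l2 l r eps mu : pars al ga l r eps mu -> eps * l ^ 2 <= ga * al / 4.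
Proof.
  intros [H1 H2 -> _ _ _]. pose proof gaal_pos.
  replace (ga * al / (2 * l * r) * l ^ 2) with (ga * al * (l / (2 * r))) by (field; lra).
  unfold Rdiv at 2. apply Rmult_le_compat_l; [lra|].
  apply Rmult_le_reg_r with (2 * r); [lra|]. field_simplify; lra.
Qed.

(** The reaction coefficient exceeds [ga * a]; diffusion uses eps l^2 <= ga al / 4 of it and
    convection at most half, since mu l <= ga / 2. *)
Lemma EL_supersolution l r eps mu x :
  pars al ga l r eps mu -> 0 < x < 1 ->
  0 <= - eps * (- l * (- l * EL l x)) + mu * a x * (- l * EL l x) + b x * EL l x.
Proof.
  intros Hp Hx. pose proof (eps_l2 _ _ _ _ Hp) as He.
  destruct Hp as [H1 H2 H3 H4 H5 _].
  pose proof (coefs_a_lower Hco x Hx).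
  pose proof (coefs_b_lower Hco x Hx).
  pose proof gaal_pos. pose proof (EL_pos l x).
  assert (Hm : mu * l <= ga / 2).
  { apply Rle_trans with (ga / (2 * l) * l); [apply Rmult_le_compat_r; lra|].
    right; field; lra. }
  assert (mu * l * a x <= ga / 2 * a x) by (apply Rmult_le_compat_r; lra).
  replace (- eps * (- l * (- l * EL l x)) + mu * a x * (- l * EL l x) + b x * EL l x)
    with ((b x - eps * l ^ 2 - mu * l * a x) * EL l x) by ring.
  apply Rmult_le_pos; nra.
Qed.

(** The two alternatives of [pars_case] rely on different terms. If r = 2 l, then eps r^2 = ga al
    and the reaction wins. Otherwise mu r = ga r / (2 l) and eps r^2 = ga al r / (2 l), and the
    convection term, with its factor 3/4, beats the factor 9/16 of the diffusion term. *)
Lemma ER_supersolution l r eps mu x :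
  pars al ga l r eps mu -> 0 < x < 1 ->
  0 <= - eps * (3 / 4 * r * (3 / 4 * r * ER r x)) + mu * a x * (3 / 4 * r * ER r x)
       + b x * ER r x.
Proof.
  intros Hp Hx.
  destruct Hp as [H1 H2 H3 H4 H5 H6].
  pose proof (coefs_a_lower Hco x Hx).
  pose proof (b_pos x Hx). pose proof gaal_pos. pose proof (ER_pos r x).
  replace (- eps * (3 / 4 * r * (3 / 4 * r * ER r x)) + mu * a x * (3 / 4 * r * ER r x)
       + b x * ER r x)
    with ((b x - 9 / 16 * (eps * r ^ 2) + 3 / 4 * (mu * r) * a x) * ER r x) by field.
  apply Rmult_le_pos; [|lra].
  assert (He : eps * r ^ 2 = ga * al * r / (2 * l)) by (rewrite H3; field; lra).
  destruct H6 as [H6|H6].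
  - assert (He' : eps * r ^ 2 = ga * al) by (rewrite He, H6; field; lra).
    assert (0 <= mu * r * a x) by (apply Rmult_le_pos; nra). lra.
  - assert (Hmr : mu * r = ga * (r / (2 * l))) by (rewrite H6; field; lra).
    assert (He' : eps * r ^ 2 = ga * al * (r / (2 * l))) by (rewrite He; field; lra).
    rewrite Hmr, He'. assert (0 < r / (2 * l)) by (apply Rdiv_lt_0_compat; lra).
    assert (ga * (r / (2 * l)) * al <= ga * (r / (2 * l)) * a x)
      by (apply Rmult_le_compat_l; nra).
    assert (0 < ga * (r / (2 * l))) by nra. nra.
Qed.

(** Barrier C (l^-3 + EL + ER): the constant absorbs the residual because b > ga al, which gives the
    summand M / (ga al) of C, and the exponentials absorb the boundary values, which gives the
    summand M. *)
Lemma remainder_bound :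
  exists C, 0 < C /\ forall l r eps mu z z1 g g1 g2,
    pars al ga l r eps mu -> remainder_bvp M l eps mu a b z z1 g g1 g2 ->
    forall x, 0 <= x <= 1 -> Rabs (z x) <= C * wt l r 0 x.
Proof.
  pose proof gaal_pos as Hk.
  set (C := M + M / (ga * al)).
  assert (HC : 0 < M / (ga * al)) by (apply Rdiv_lt_0_compat; lra).
  exists C; split; [unfold C; lra|].
  intros l r eps mu z z1 g g1 g2 Hp Hz x Hx.
  pose proof (pars_eps_pos _ _ _ _ Hp) as He.
  pose proof (pars_l Hp) as Hl. pose proof (pars_r Hp) as Hr.
  set (q := / l ^ 3). assert (Hq : 0 < q) by (apply Rinv_0_lt_compat, pow_lt; lra).
  set (W := fun t => C * (q + EL l t + ER r t)).
  set (W1 := fun t => C * (- l * EL l t + 3 / 4 * r * ER r t)).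
  set (W2 := fun t => C * (- l * (- l * EL l t) + 3 / 4 * r * (3 / 4 * r * ER r t))).
  assert (dW : forall t, is_derive W t (W1 t)).
  { intros t. unfold W, W1. apply is_derive_scal.
    replace (- l * EL l t + 3 / 4 * r * ER r t)
      with (0 + - l * EL l t + 3 / 4 * r * ER r t) by ring.
    apply @is_derive_plus; [apply @is_derive_plus|].
    - apply @is_derive_const.
    - apply is_derive_EL.
    - apply is_derive_ER. }
  assert (dW1 : forall t, is_derive W1 t (W2 t)).
  { intros t. unfold W1, W2. apply is_derive_scal. apply @is_derive_plus.
    - apply is_derive_scal, is_derive_EL.
    - apply is_derive_scal, is_derive_ER. }
  assert (LW : forall t, 0 < t < 1 ->
             M / l ^ 3 <= - eps * W2 t + mu * a t * W1 t + b t * W t).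
  { intros t Ht.
    pose proof (EL_supersolution l r eps mu t Hp Ht) as S1.
    pose proof (ER_supersolution l r eps mu t Hp Ht) as S2.
    pose proof (b_pos t Ht).
    assert (HCM : M <= C * b t).
    { apply Rle_trans with (C * (ga * al)); [|apply Rmult_le_compat_l; unfold C; lra].
      unfold C. rewrite Rmult_plus_distr_r. replace (M / (ga * al) * (ga * al)) with M by (field; lra).
      nra. }
    assert (M * q <= C * b t * q) by (apply Rmult_le_compat_r; lra).
    assert (0 < C) by (unfold C; lra).
    assert (S3 : 0 <= C * (- eps * (- l * (- l * EL l t)) + mu * a t * (- l * EL l t) + b t * EL l t
      + (- eps * (3 / 4 * r * (3 / 4 * r * ER r t)) + mu * a t * (3 / 4 * r * ER r t)
       + b t * ER r t))) by (apply Rmult_le_pos; lra).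
    unfold W, W1, W2. unfold Rdiv at 1. fold q. lra. }
  assert (W0 : M <= W 0).
  { unfold W, EL. replace (- l * 0) with 0 by ring. rewrite exp_0.
    pose proof (ER_pos r 0). assert (M <= C) by (unfold C; lra). nra. }
  assert (W1' : M <= W 1).
  { unfold W, ER. replace (- (3 / 4) * r * (1 - 1)) with 0 by ring. rewrite exp_0.
    pose proof (EL_pos l 1). assert (M <= C) by (unfold C; lra). nra. }
  set (z2 := fun t => (mu * a t * z1 t + b t * z t - g t) / eps).
  assert (Lz : forall t, - eps * z2 t + mu * a t * z1 t + b t * z t = g t)
    by (intros t; unfold z2; field; lra).
  pose proof (Rabs_def2 (z 0) (M + 1)) as B0. pose proof (rem_0 Hz) as Z0.
  pose proof (rem_1 Hz) as Z1.
  apply Rabs_le_between in Z0. apply Rabs_le_between in Z1.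
  assert (Hb : forall t, 0 < t < 1 -> 0 < b t) by (intros t Ht; pose proof (b_pos t Ht); lra).
  assert (P1 : 0 <= W x - z x).
  { apply (maximum_principle eps (fun t => mu * a t) b (fun t => W t - z t)
             (fun t => W1 t - z1 t) (fun t => W2 t - z2 t)); auto; try lra.
    - intros t Ht. apply continuity_pt_minus.
      + apply derive_continuity_pt with (W1 t), dW.
      + apply (rem_cont Hz), Ht.
    - intros t Ht. apply @is_derive_minus; [apply dW|apply (rem_dz Hz), Ht].
    - intros t Ht. apply @is_derive_minus; [apply dW1|apply (rem_dz1 Hz), Ht].
    - intros t Ht. specialize (LW t Ht). specialize (Lz t).
      pose proof (rem_g Hz t Ht) as G. apply Rabs_le_between in G. lra. }
  assert (P2 : 0 <= W x + z x).
  { apply (maximum_principle eps (fun t => mu * a t) b (fun t => W t + z t)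
             (fun t => W1 t + z1 t) (fun t => W2 t + z2 t)); auto; try lra.
    - intros t Ht. apply continuity_pt_plus.
      + apply derive_continuity_pt with (W1 t), dW.
      + apply (rem_cont Hz), Ht.
    - intros t Ht. apply @is_derive_plus; [apply dW|apply (rem_dz Hz), Ht].
    - intros t Ht. apply @is_derive_plus; [apply dW1|apply (rem_dz1 Hz), Ht].
    - intros t Ht. specialize (LW t Ht). specialize (Lz t).
      pose proof (rem_g Hz t Ht) as G. apply Rabs_le_between in G. lra. }
  apply Rabs_le. replace (C * wt l r 0 x) with (W x) by (unfold W, wt, q; simpl; ring). lra.
Qed.

(** Without the term [eps * y1] the equation would be divided by mu a, which is of order 1/l; hence
    the factor [l] in front of the data. The term Y ER is a strict supersolution of the homogeneous
    equation and dominates the value at [t1], where ER >= 1/3 because [t1] lies within 1/r of the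
    boundary. *)
Lemma outflow_comparison :
  exists C, 0 < C /\ forall l r eps mu j c Y t1 (y y1 : R -> R),
    pars al ga l r eps mu -> mu = ga / (2 * l) ->
    0 < t1 < 1 -> 1 - / r <= t1 -> 0 <= c -> 0 < Y ->
    (forall x, 0 < x < 1 -> is_derive y x (y1 x)) ->
    (forall x, 0 < x < t1 -> Rabs (- eps * y1 x + mu * a x * y x) <= c * wt l r j x) ->
    Rabs (y t1) <= Y ->
    forall x, 0 < x <= t1 -> Rabs (y x) <= C * (c * (l * wt l r j x) + Y * ER r x).
Proof.
  pose proof gaal_pos as Hk.
  set (C := 8 / (ga * al) + 3).
  assert (HC : 0 < 8 / (ga * al)) by (apply Rdiv_lt_0_compat; lra).
  exists C; split; [unfold C; lra|].
  intros l r eps mu j c Y t1 y y1 Hp Hmu Ht1 Ht1r Hc HY Hd Hg Hend x Hx.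
  pose proof (pars_eps_pos _ _ _ _ Hp) as He.
  destruct Hp as [Hl Hr Heps _ _ _].
  assert (Hlj : 0 < l ^ j) by (apply pow_lt; lra).
  assert (Hrj : 0 < r ^ j) by (apply pow_lt; lra).
  set (q := / l ^ 3). assert (Hq : 0 < q) by (apply Rinv_0_lt_compat, pow_lt; lra).
  set (W := fun t => C * (c * (l * wt l r j t) + Y * ER r t)).
  set (W1 := fun t => C * (c * (l * (l ^ j * (0 + - l * EL l t) + r ^ j * (3 / 4 * r * ER r t)))
                           + Y * (3 / 4 * r * ER r t))).
  assert (dW : forall t, is_derive W t (W1 t)).
  { intros t. unfold W, W1, wt. apply is_derive_scal. apply @is_derive_plus.
    - apply is_derive_scal, is_derive_scal. apply @is_derive_plus.
      + apply is_derive_scal. apply @is_derive_plus; [apply @is_derive_const|apply is_derive_EL].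
      + apply is_derive_scal, is_derive_ER.
    - apply is_derive_scal, is_derive_ER. }
  assert (LW : forall t, 0 < t < 1 -> c * wt l r j t < - eps * W1 t + mu * a t * W t).
  { intros t Ht. pose proof (coefs_a_lower Hco t Ht) as Ha.
    pose proof (EL_pos l t) as HE. pose proof (ER_pos r t) as HF.
    set (K := ga * al / 2). assert (HK : 0 < K) by (unfold K; lra).
    assert (HCK : 1 <= C * (K / 4)).
    { unfold C, K. rewrite Rmult_plus_distr_r.
      replace (8 / (ga * al) * (ga * al / 2 / 4)) with 1 by (field; lra). lra. }
    assert (Hm : K / l <= mu * a t).
    { rewrite Hmu. unfold K. replace (ga * al / 2 / l) with (ga / (2 * l) * al) by (field; lra).
      apply Rmult_le_compat_l; [apply Rlt_le, Rdiv_lt_0_compat|]; lra. }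
    assert (Her : eps * r = K / l) by (rewrite Heps; unfold K; field; lra).
    assert (HKl : 0 < K / l) by (apply Rdiv_lt_0_compat; lra).
    assert (HD : K / l / 4 <= mu * a t - 3 / 4 * (eps * r)) by lra.
    assert (HlK : l * (K / l / 4) = K / 4) by (field; lra).
    assert (I1 : K / 4 * wt l r j t
       <= l * (mu * a t * (l ^ j * q) + (mu * a t + eps * l) * (l ^ j * EL l t)
               + (mu * a t - 3 / 4 * (eps * r)) * (r ^ j * ER r t))).
    { assert (B1 : 0 < l ^ j * q) by nra. assert (B2 : 0 < l ^ j * EL l t) by nra.
      assert (B3 : 0 < r ^ j * ER r t) by nra.
      rewrite <- HlK. unfold wt. fold q. rewrite Rmult_assoc. apply Rmult_le_compat_l; [lra|].
      assert (K / l / 4 * (l ^ j * q) <= mu * a t * (l ^ j * q)) by (apply Rmult_le_compat_r; lra).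
      assert (0 < eps * l) by nra.
      assert (K / l / 4 * (l ^ j * EL l t) <= (mu * a t + eps * l) * (l ^ j * EL l t))
        by (apply Rmult_le_compat_r; lra).
      assert (K / l / 4 * (r ^ j * ER r t) <= (mu * a t - 3 / 4 * (eps * r)) * (r ^ j * ER r t))
        by (apply Rmult_le_compat_r; lra).
      lra. }
    assert (I2 : 0 < (mu * a t - 3 / 4 * (eps * r)) * ER r t) by (apply Rmult_lt_0_compat; lra).
    assert (Ew : - eps * W1 t + mu * a t * W t =
      C * (c * (l * (mu * a t * (l ^ j * q) + (mu * a t + eps * l) * (l ^ j * EL l t)
               + (mu * a t - 3 / 4 * (eps * r)) * (r ^ j * ER r t)))
           + Y * ((mu * a t - 3 / 4 * (eps * r)) * ER r t))).
    { unfold W1, W, wt. fold q. field. }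
    rewrite Ew.
    pose proof (wt_pos l r Hl Hr j t) as Hw.
    assert (I3 : c * wt l r j t <= C * (c * (K / 4 * wt l r j t))).
    { replace (C * (c * (K / 4 * wt l r j t))) with (C * (K / 4) * (c * wt l r j t)) by ring.
      assert (0 <= c * wt l r j t) by nra. nra. }
    assert (I4 : c * (K / 4 * wt l r j t) <= c * (l * (mu * a t * (l ^ j * q) + (mu * a t + eps * l) * (l ^ j * EL l t)
               + (mu * a t - 3 / 4 * (eps * r)) * (r ^ j * ER r t)))) by (apply Rmult_le_compat_l; lra).
    assert (HC0 : 0 < C) by (unfold C; lra).
    assert (I5 : 0 < Y * ((mu * a t - 3 / 4 * (eps * r)) * ER r t)) by (apply Rmult_lt_0_compat; lra).
    eapply Rle_lt_trans; [exact I3|]. apply Rmult_lt_compat_l; lra. }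
  assert (Wend : Y <= W t1).
  { unfold W. assert (HE : 1 <= 3 * ER r t1).
    { replace 1 with (ER r 1) at 1.
      - apply ER_shift. assert (r * / r = 1) by (field; lra). nra.
      - unfold ER. replace (- (3 / 4) * r * (1 - 1)) with 0 by ring. apply exp_0. }
    pose proof (wt_pos l r Hl Hr j t1). pose proof (ER_pos r t1).
    assert (0 <= c * (l * wt l r j t1)) by (apply Rmult_le_pos; nra).
    assert (Y * 1 <= Y * (3 * ER r t1)) by (apply Rmult_le_compat_l; lra).
    assert (3 * (c * (l * wt l r j t1) + Y * ER r t1) <= C * (c * (l * wt l r j t1) + Y * ER r t1))
      by (apply Rmult_le_compat_r; [nra|unfold C; lra]).
    lra. }
  apply Rabs_le_between in Hend.
  assert (Hka : forall t, 0 < t < 1 -> 0 <= mu * a t).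
  { intros t Ht. pose proof (coefs_a_lower Hco t Ht).
    rewrite Hmu. apply Rmult_le_pos; [apply Rlt_le, Rdiv_lt_0_compat|]; lra. }
  apply Rabs_le.
  assert (P1 : 0 <= W x - y x).
  { apply (backward_comparison eps t1 (fun t => mu * a t) (fun t => W t - y t) (fun t => W1 t - y1 t));
      auto; try lra.
    - intros t Ht. apply @is_derive_minus; auto.
    - intros t Ht. assert (Ht' : 0 < t < 1) by lra. specialize (LW t Ht'). specialize (Hg t Ht).
      apply Rabs_le_between in Hg. lra. }
  assert (P2 : 0 <= W x + y x).
  { apply (backward_comparison eps t1 (fun t => mu * a t) (fun t => W t + y t) (fun t => W1 t + y1 t));
      auto; try lra.
    - intros t Ht. apply @is_derive_plus; auto.
    - intros t Ht. assert (Ht' : 0 < t < 1) by lra. specialize (LW t Ht'). specialize (Hg t Ht).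
      apply Rabs_le_between in Hg. lra. }
  fold (W x). lra.
Qed.

(** The inductive step for derivatives: a crude bound with one factor [r] on the whole weight is
    improved so that only the right layer keeps [r], while the rest grows by [l]. If r = 2 l the
    crude bound already is the claim; otherwise it serves only as the starting value of the
    comparison. *)
Lemma weight_gain c j :
  0 < c ->
  exists C, 0 < C /\ forall l r eps mu (y y1 : R -> R),
    pars al ga l r eps mu ->
    (forall x, 0 < x < 1 -> is_derive y x (y1 x)) ->
    (forall x, 0 < x < 1 -> Rabs (- eps * y1 x + mu * a x * y x) <= c * wt l r j x) ->
    (forall x, 0 < x < 1 -> Rabs (y x) <= c * (r * wt l r j x)) ->
    forall x, 0 < x < 1 -> Rabs (y x) <= C * wt l r (S j) x.
Proof.
  intros Hc. destruct outflow_comparison as [C [HC Hcmp]].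
  exists (2 * c + C * (c + 3 * c)). split; [nra|].
  intros l r eps mu y y1 Hp Hd Hg Hy x Hx.
  pose proof (pars_l Hp) as Hl. pose proof (pars_r Hp) as Hr.
  pose proof (wt_step l r Hl Hr j x) as Hs. pose proof (wt_pos l r Hl Hr j x) as Hw.
  pose proof (wt_pos l r Hl Hr (S j) x) as Hw'.
  destruct (pars_case Hp) as [H|H].
  - eapply Rle_trans; [apply Hy, Hx|]. rewrite H at 1.
    apply Rle_trans with (2 * c * wt l r (S j) x).
    + replace (c * (2 * l * wt l r j x)) with (2 * c * (l * wt l r j x)) by ring.
      apply Rmult_le_compat_l; lra.
    + apply Rmult_le_compat_r; nra.
  (* The starting point must lie at or beyond [x]; for [x] within 1/r of the boundary the comparison
     starts at [x] itself. *)
  - set (t1 := Rmax x (1 - / r)).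
    assert (Hri : 0 < / r < 1).
    { split; [apply Rinv_0_lt_compat; lra|]. rewrite <- Rinv_1. apply Rinv_lt_contravar; lra. }
    assert (Ht : 0 < t1 < 1).
    { unfold t1. split; [apply Rlt_le_trans with x; [lra|apply Rmax_l]|apply Rmax_lub_lt; lra]. }
    assert (HY : Rabs (y t1) <= 3 * c * r ^ S j).
    { eapply Rle_trans; [apply Hy, Ht|].
      assert (wt l r j t1 <= 3 * r ^ j) by (apply wt_le_pow; lra).
      simpl pow. replace (3 * c * (r * r ^ j)) with (c * (r * (3 * r ^ j))) by ring.
      apply Rmult_le_compat_l; [lra|]. apply Rmult_le_compat_l; lra. }
    assert (Hrp : 0 < r ^ S j) by (apply pow_lt; lra).
    eapply Rle_trans.
    + apply (Hcmp l r eps mu j c (3 * c * r ^ S j) t1 y y1 Hp H Ht); auto.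
      * apply Rmax_r.
      * lra.
      * nra.
      * intros t Ht'. apply Hg. lra.
      * split; [lra|apply Rmax_l].
    + pose proof (wt_R l r Hl (S j) x) as HR.
      apply Rle_trans with (C * (c + 3 * c) * wt l r (S j) x).
      * rewrite (Rmult_assoc C). apply Rmult_le_compat_l; [lra|].
        assert (c * (l * wt l r j x) <= c * wt l r (S j) x) by (apply Rmult_le_compat_l; lra).
        assert (3 * c * (r ^ S j * ER r x) <= 3 * c * wt l r (S j) x) by (apply Rmult_le_compat_l; lra).
        lra.
      * apply Rmult_le_compat_r; nra.
Qed.

End LayerBounds.

(** * Derivatives of the layer part *)

Lemma is_derive_Rmult (f g : R -> R) (x df dg : R) :
  is_derive f x df -> is_derive g x dg ->
  is_derive (fun t => f t * g t) x (df * g x + f x * dg).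
Proof.
  intros Hf Hg. apply (is_derive_mult (K := R_AbsRing) f g x df dg Hf Hg).
  intros u v. apply Rmult_comm.
Qed.

Section LayerDerivatives.

Context {al ga M : R} {a a1 a2 b b1 b2 : R -> R}.
Hypothesis Hco : coefs al ga M a a1 a2 b b1 b2.

Let Hal : 0 < al := coefs_al Hco.
Let Hga : 0 < ga := coefs_ga Hco.
Let HM : 1 <= M := coefs_M Hco.
Let Hk : 0 < ga * al := gaal_pos Hco.

Lemma mu_l l r eps mu : pars al ga l r eps mu -> mu * l <= ga / 2.
Proof.
  intros [H1 H2 H3 H4 H5 _].
  apply Rle_trans with (ga / (2 * l) * l); [apply Rmult_le_compat_r; lra|].
  right; field; lra.
Qed.

Lemma div_eps l r eps mu X :
  pars al ga l r eps mu -> X / eps = 2 / (ga * al) * (l * r * X).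
Proof. intros [H1 H2 -> H4 H5 _]. field. repeat split; lra. Qed.

(** The flux argument on an interval of length 1/r. The values contribute r z directly, and mu z /
    eps, which is again O(r z) because 1/eps is of order l r and mu l is bounded; the data
    contribute only the factor h / eps, of order l. *)
Lemma remainder_derivative_local :
  exists C, 0 < C /\ forall l r eps mu z z1 g g1 g2,
    pars al ga l r eps mu -> remainder_bvp M l eps mu a b z z1 g g1 g2 ->
    forall x, 0 < x < 1 -> Rabs (z1 x) <= C * (r * wt l r 0 x).
Proof.
  destruct (remainder_bound Hco) as [C0 [HC0 HZ0]].
  set (k := 2 / (ga * al)). assert (Hk2 : 0 < k) by (apply Rdiv_lt_0_compat; lra).
  exists (6 * C0 + k * (3 * ga * M * C0 + (M * (1 + 3 * C0) + 3 * ga * M * C0))).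
  split.
  { assert (0 < 3 * ga * M * C0) by (repeat apply Rmult_lt_0_compat; lra).
    assert (0 < M * (1 + 3 * C0)) by (apply Rmult_lt_0_compat; lra).
    apply Rplus_lt_0_compat; [lra|apply Rmult_lt_0_compat; lra]. }
  intros l r eps mu z z1 g g1 g2 Hp Hz x Hx.
  pose proof (pars_eps_pos Hco _ _ _ _ Hp) as He.
  pose proof (pars_l Hp) as Hl. pose proof (pars_r Hp) as Hr.
  pose proof (pars_mu0 Hp) as Hmu0. pose proof (mu_l _ _ _ _ Hp) as Hmul.
  set (h := / r). set (s := if Rle_dec x (1 / 2) then x else x - h).
  assert (Hh : 0 < h) by (apply Rinv_0_lt_compat; lra).
  assert (Hh2 : h < 1 / 2).
  { unfold h. replace (1 / 2) with (/ 2) by field. apply Rinv_lt_contravar; lra. }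
  assert (Hs : 0 < s /\ s <= x <= s + h /\ s + h < 1).
  { unfold s. destruct Rle_dec; lra. }
  pose proof (wt_pos l r Hl Hr 0 x) as Hw. set (w0 := wt l r 0 x) in *.
  assert (HZ : forall t, s <= t <= s + h -> Rabs (z t) <= 3 * C0 * w0).
  { intros t Ht. eapply Rle_trans; [apply (HZ0 _ _ _ _ _ _ _ _ _ Hp Hz); lra|].
    replace (3 * C0 * w0) with (C0 * (3 * w0)) by ring. apply Rmult_le_compat_l; [lra|].
    apply wt_shift; try lra. apply Rabs_le. fold h. lra. }
  assert (Hka : forall t, 0 < t < 1 -> Rabs (mu * a t) <= mu * M).
  { intros t Ht. apply Rabs_mult_le; [rewrite Rabs_pos_eq; lra|].
    apply (coefs_a Hco t Ht). }
  assert (Hka1 : forall t, 0 < t < 1 -> Rabs (mu * a1 t) <= mu * M).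
  { intros t Ht. apply Rabs_mult_le; [rewrite Rabs_pos_eq; lra|].
    apply (coefs_a1 Hco t Ht). }
  assert (HmM : 0 <= mu * M) by nra.
  assert (Hloc : Rabs (z1 x) <= 2 * (3 * C0 * w0) / h +
     (2 * (mu * M) * (3 * C0 * w0) + h * (M * (1 + 3 * C0) * w0 + (mu * M) * (3 * C0 * w0))) / eps).
  { apply (local_derivative_bound eps (mu * M) (mu * M) (3 * C0 * w0) (M * (1 + 3 * C0) * w0) s h
     (fun t => mu * a t) (fun t => mu * a1 t) z z1 (fun t => (mu * a t * z1 t + b t * z t - g t) / eps));
     auto; try lra.
    - intros t Ht. apply (rem_dz Hz). lra.
    - intros t Ht. apply (rem_dz1 Hz). lra.
    - intros t Ht. apply is_derive_scal. apply (coefs_da Hco). lra.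
    - intros t Ht. apply Hka. lra.
    - intros t Ht. apply Hka1. lra.
    - intros t Ht. replace (- eps * ((mu * a t * z1 t + b t * z t - g t) / eps) + mu * a t * z1 t)
        with (g t - b t * z t) by (field; lra).
      replace (M * (1 + 3 * C0) * w0) with (M * w0 + M * (3 * C0 * w0)) by ring.
      apply Rabs_minus_le.
      + eapply Rle_trans; [apply (rem_g Hz); lra|].
        apply Rmult_le_compat_l; [lra|]. apply wt_0.
      + apply Rabs_mult_le; [apply (coefs_b Hco); lra|apply HZ, Ht]. }
  eapply Rle_trans; [exact Hloc|]. clear Hloc.
  rewrite (div_eps l r eps mu _ Hp). fold k.
  replace (2 * (3 * C0 * w0) / h) with (6 * C0 * (r * w0)) by (unfold h; field; lra).
  set (B := M * (1 + 3 * C0) * w0 + mu * M * (3 * C0 * w0)).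
  assert (HB : B <= (M * (1 + 3 * C0) + 3 * ga * M * C0) * w0).
  { unfold B. assert (mu <= ga) by nra.
    assert (mu * (M * (3 * C0 * w0)) <= ga * (M * (3 * C0 * w0)))
      by (apply Rmult_le_compat_r; [apply Rmult_le_pos; nra|lra]). lra. }
  assert (HB0 : 0 <= B).
  { unfold B. assert (0 <= M * (1 + 3 * C0) * w0) by (repeat apply Rmult_le_pos; lra).
    assert (0 <= mu * M * (3 * C0 * w0)) by (repeat apply Rmult_le_pos; lra). lra. }
  assert (E : l * r * (2 * (mu * M) * (3 * C0 * w0) + h * B)
              = 6 * M * C0 * (mu * l) * (r * w0) + l * B) by (unfold h; field; lra).
  rewrite E.
  assert (F1 : 6 * M * C0 * (mu * l) * (r * w0) <= 6 * M * C0 * (ga / 2) * (r * w0)).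
  { apply Rmult_le_compat_r; [nra|]. apply Rmult_le_compat_l; [nra|lra]. }
  assert (F2 : l * B <= r * ((M * (1 + 3 * C0) + 3 * ga * M * C0) * w0)).
  { apply Rmult_le_compat; lra. }
  assert (F3 : k * (6 * M * C0 * (mu * l) * (r * w0) + l * B) <=
     k * (6 * M * C0 * (ga / 2) * (r * w0) + r * ((M * (1 + 3 * C0) + 3 * ga * M * C0) * w0)))
    by (apply Rmult_le_compat_l; lra).
  lra.
Qed.

(** Each derivative solves the first-order equation of [weight_gain], with data made of lower
    derivatives. The crude bound it asks for comes from the preceding equation divided by [eps]: the
    factor l r meets either mu l <= ga / 2 or a weight of lower index, which absorbs [l]. *)
Lemma remainder_derivatives :
  exists C, 0 < C /\ forall l r eps mu z z1 g g1 g2,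
    pars al ga l r eps mu -> remainder_bvp M l eps mu a b z z1 g g1 g2 ->
    exists z2 z3 : R -> R,
    (forall x, 0 < x < 1 -> is_derive z1 x (z2 x)) /\
    (forall x, 0 < x < 1 -> is_derive z2 x (z3 x)) /\
    (forall x, 0 < x < 1 -> - eps * z2 x + mu * a x * z1 x = g x - b x * z x) /\
    (forall x, 0 < x < 1 -> - eps * z3 x + mu * a x * z2 x
        = g1 x - (b1 x * z x + b x * z1 x) - mu * a1 x * z1 x) /\
    (forall x, 0 < x < 1 -> Rabs (z x) <= C * wt l r 0 x) /\
    (forall x, 0 < x < 1 -> Rabs (z1 x) <= C * wt l r 1 x) /\
    (forall x, 0 < x < 1 -> Rabs (z2 x) <= C * wt l r 2 x) /\
    (forall x, 0 < x < 1 -> Rabs (z3 x) <= C * wt l r 3 x).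
Proof.
  destruct (remainder_bound Hco) as [C0 [HC0 HZ0]].
  destruct remainder_derivative_local as [Cl [HCl HZl]].
  set (k := 2 / (ga * al)). assert (Hk2 : 0 < k) by (apply Rdiv_lt_0_compat; lra).
  assert (HMC0 : 0 < M * C0) by nra.
  set (c1 := Cl + (M + M * C0)). assert (Hc1 : 0 < c1) by (unfold c1; lra).
  destruct (weight_gain Hco c1 0 Hc1) as [C1 [HC1 G1]].
  set (D2 := M + (M * C0 + M * C1) + ga * M * C1).
  assert (HMC1 : 0 < M * C1) by nra.
  assert (HgMC1 : 0 < ga * M * C1) by nra.
  set (c2 := D2 + k * (ga / 2 * M * C1 + (M * C0 + M))).
  assert (Hc2 : 0 < c2) by (unfold c2, D2; nra).
  destruct (weight_gain Hco c2 1 Hc2) as [C2 [HC2 G2]].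
  assert (HMC2 : 0 < M * C2) by nra.
  assert (HgMC2 : 0 < ga * M * C2) by nra.
  set (D3 := M + (M * C0 + M * C1 + (M * C1 + M * C2)) + ga * M * C1 + ga * M * C2 + ga * M * C2).
  set (c3 := D3 + k * (ga / 2 * M * C2 + D2)).
  assert (Hc3 : 0 < c3) by (unfold c3, D3, D2; nra).
  destruct (weight_gain Hco c3 2 Hc3) as [C3 [HC3 G3]].
  exists (C0 + C1 + C2 + C3). split; [lra|].
  intros l r eps mu z z1 g g1 g2 Hp Hz.
  pose proof (pars_eps_pos Hco _ _ _ _ Hp) as He.
  pose proof (pars_l Hp) as Hl. pose proof (pars_r Hp) as Hr.
  pose proof (pars_mu0 Hp) as Hmu0. pose proof (mu_l _ _ _ _ Hp) as Hmul.
  assert (Hmga : mu <= ga) by nra.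
  (* The higher derivatives are defined by the equation solved for z'' and its formal derivatives;
     [z4] occurs only in the equation satisfied by [z3]. *)
  set (z2 := fun x => (mu * a x * z1 x + b x * z x - g x) / eps).
  set (z3 := fun x => (mu * a1 x * z1 x + mu * a x * z2 x + (b1 x * z x + b x * z1 x) - g1 x) / eps).
  set (z4 := fun x => (mu * a2 x * z1 x + mu * a1 x * z2 x + (mu * a1 x * z2 x + mu * a x * z3 x)
     + (b2 x * z x + b1 x * z1 x + (b1 x * z1 x + b x * z2 x)) - g2 x) / eps).
  assert (dz : forall x, 0 < x < 1 -> is_derive z x (z1 x)) by apply (rem_dz Hz).
  assert (dz1 : forall x, 0 < x < 1 -> is_derive z1 x (z2 x)) by apply (rem_dz1 Hz).
  assert (sc : forall (F : R -> R) x d, is_derive F x d -> is_derive (fun t => F t / eps) x (d / eps)).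
  { intros F x d HF. apply (is_derive_ext (fun t => / eps * F t)); [intros t; apply Rmult_comm|].
    replace (d / eps) with (/ eps * d) by apply Rmult_comm. now apply is_derive_scal. }
  pose proof (coefs_da Hco) as da. pose proof (coefs_da1 Hco) as da1.
  pose proof (coefs_db Hco) as db. pose proof (coefs_db1 Hco) as db1.
  pose proof (rem_dg Hz) as dg. pose proof (rem_dg1 Hz) as dg1.
  assert (dz2 : forall x, 0 < x < 1 -> is_derive z2 x (z3 x)).
  { intros x Hx. apply (sc (fun x => mu * a x * z1 x + b x * z x - g x)).
    apply @is_derive_minus; [apply @is_derive_plus|]; auto.
    - apply (is_derive_Rmult (fun x => mu * a x) z1); auto. apply is_derive_scal; auto.
    - apply (is_derive_Rmult b z); auto. }
  assert (dz3 : forall x, 0 < x < 1 -> is_derive z3 x (z4 x)).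
  { intros x Hx.
    apply (sc (fun x => mu * a1 x * z1 x + mu * a x * z2 x + (b1 x * z x + b x * z1 x) - g1 x)).
    apply @is_derive_minus; [apply @is_derive_plus; [apply @is_derive_plus|]|]; auto.
    - apply (is_derive_Rmult (fun x => mu * a1 x) z1); auto. apply is_derive_scal; auto.
    - apply (is_derive_Rmult (fun x => mu * a x) z2); auto. apply is_derive_scal; auto.
    - apply @is_derive_plus; [apply (is_derive_Rmult b1 z)|apply (is_derive_Rmult b z1)]; auto. }
  assert (w01 : forall x, wt l r 0 x <= wt l r 1 x) by (intros; apply wt_mono; lra).
  assert (w12 : forall x, wt l r 1 x <= wt l r 2 x) by (intros; apply wt_mono; lra).
  assert (w0 : forall x, / l ^ 3 <= wt l r 0 x) by (intros; apply wt_0).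
  assert (wp : forall j x, 0 < wt l r j x) by (intros; apply wt_pos; lra).
  assert (bM : forall h, (forall x, 0 < x < 1 -> Rabs (h x) <= M / l ^ 3) ->
            forall x, 0 < x < 1 -> Rabs (h x) <= M * wt l r 0 x).
  { intros h Hh x Hx. eapply Rle_trans; [apply Hh, Hx|]. apply Rmult_le_compat_l; [lra|apply w0]. }
  pose proof (bM g (rem_g Hz)) as Bg.
  pose proof (bM g1 (rem_g1 Hz)) as Bg1.
  pose proof (bM g2 (rem_g2 Hz)) as Bg2.
  pose proof (coefs_a Hco) as Ba. pose proof (coefs_a1 Hco) as Ba1.
  pose proof (coefs_a2 Hco) as Ba2. pose proof (coefs_b Hco) as Bb.
  pose proof (coefs_b1 Hco) as Bb1. pose proof (coefs_b2 Hco) as Bb2.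
  assert (Bmu : Rabs mu <= ga) by (rewrite Rabs_pos_eq; lra).
  assert (Bz : forall x, 0 < x < 1 -> Rabs (z x) <= C0 * wt l r 0 x).
  { intros x Hx. apply (HZ0 _ _ _ _ _ _ _ _ _ Hp Hz). lra. }
  assert (up : forall X c j x, 0 < c -> X <= c * wt l r j x -> X <= c * wt l r (S j) x).
  { intros X c j x Hc HX. eapply Rle_trans; [exact HX|]. apply Rmult_le_compat_l; [lra|apply wt_mono; lra]. }
  assert (Bz1 : forall x, 0 < x < 1 -> Rabs (z1 x) <= C1 * wt l r 1 x).
  { apply (G1 l r eps mu z1 z2 Hp dz1).
    - intros x Hx. replace (- eps * z2 x + mu * a x * z1 x) with (g x - b x * z x) by (unfold z2; field; lra).
      apply Rle_trans with (M * wt l r 0 x + M * (C0 * wt l r 0 x)).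
      + apply Rabs_minus_le; [apply Bg, Hx|apply Rabs_mult_le; auto].
      + unfold c1. pose proof (wp 0%nat x). nra.
    - intros x Hx. eapply Rle_trans; [apply (HZl _ _ _ _ _ _ _ _ _ Hp Hz x Hx)|].
      apply Rmult_le_compat_r; [|unfold c1; lra]. pose proof (wp 0%nat x). nra. }
  assert (K2 : forall x, 0 < x < 1 -> Rabs (g1 x - (b1 x * z x + b x * z1 x) - mu * a1 x * z1 x)
                <= D2 * wt l r 1 x).
  { intros x Hx. unfold D2. rewrite !Rmult_plus_distr_r, !Rmult_assoc.
    apply Rabs_minus_le; [apply Rabs_minus_le|].
    - apply up; [lra|]. auto.
    - apply Rabs_plus_le; apply Rabs_mult_le; auto.
    - apply Rabs_mult_le; auto. apply Rabs_mult_le; auto. }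
  assert (E2 : forall x, - eps * z3 x + mu * a x * z2 x =
     g1 x - (b1 x * z x + b x * z1 x) - mu * a1 x * z1 x) by (intros x; unfold z3; field; lra).
  assert (Bz2 : forall x, 0 < x < 1 -> Rabs (z2 x) <= C2 * wt l r 2 x).
  { apply (G2 l r eps mu z2 z3 Hp dz2).
    - intros x Hx. rewrite E2. eapply Rle_trans; [apply K2, Hx|].
      apply Rmult_le_compat_r; [left; apply wp|]. unfold c2. nra.
    - intros x Hx.
      assert (T : Rabs (mu * a x * z1 x + b x * z x - g x) <= mu * (M * (C1 * wt l r 1 x)) + (M * (C0 * wt l r 0 x) + M * wt l r 0 x)).
      { unfold Rminus. rewrite Rplus_assoc. apply Rabs_plus_le.
        - rewrite (Rmult_assoc mu). apply Rabs_mult_le; [rewrite Rabs_pos_eq; lra|apply Rabs_mult_le; auto].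
        - apply Rabs_minus_le; [apply Rabs_mult_le; auto|auto]. }
      unfold z2. eapply Rle_trans; [apply Rabs_div_le; [lra|exact T]|].
      rewrite (div_eps l r eps mu _ Hp). fold k.
      pose proof (wp 0%nat x) as Hw0. pose proof (wp 1%nat x) as Hw1.
      pose proof (wt_step l r Hl Hr 0 x) as Hw01.
      assert (F : l * r * (mu * (M * (C1 * wt l r 1 x)) + (M * (C0 * wt l r 0 x) + M * wt l r 0 x))
          = r * (M * C1 * (mu * l) * wt l r 1 x + (M * C0 + M) * (l * wt l r 0 x))) by ring.
      rewrite F.
      assert (F1 : M * C1 * (mu * l) * wt l r 1 x <= M * C1 * (ga / 2) * wt l r 1 x).
      { apply Rmult_le_compat_r; [lra|]. apply Rmult_le_compat_l; lra. }
      assert (F2 : (M * C0 + M) * (l * wt l r 0 x) <= (M * C0 + M) * wt l r 1 x)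
        by (apply Rmult_le_compat_l; lra).
      apply Rle_trans with (k * (r * ((ga / 2 * M * C1 + (M * C0 + M)) * wt l r 1 x))).
      + apply Rmult_le_compat_l; [lra|]. apply Rmult_le_compat_l; lra.
      + replace (k * (r * ((ga / 2 * M * C1 + (M * C0 + M)) * wt l r 1 x)))
          with (k * (ga / 2 * M * C1 + (M * C0 + M)) * (r * wt l r 1 x)) by ring.
        apply Rmult_le_compat_r; [nra|]. unfold c2, D2. lra. }
  assert (K3 : forall x, 0 < x < 1 -> Rabs (- eps * z4 x + mu * a x * z3 x) <= D3 * wt l r 2 x).
  { intros x Hx.
    replace (- eps * z4 x + mu * a x * z3 x)
      with (g2 x - (b2 x * z x + b1 x * z1 x + (b1 x * z1 x + b x * z2 x)) - mu * (a2 x * z1 x)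
            - mu * (a1 x * z2 x) - mu * (a1 x * z2 x)) by (unfold z4; field; lra).
    unfold D3. rewrite !Rmult_plus_distr_r, !Rmult_assoc.
    repeat apply Rabs_minus_le.
    - apply up; [lra|]. apply up; [lra|]. auto.
    - apply Rabs_plus_le; apply Rabs_plus_le; apply Rabs_mult_le; auto.
    - apply Rabs_mult_le; auto. apply Rabs_mult_le; auto.
    - apply Rabs_mult_le; auto. apply Rabs_mult_le; auto.
    - apply Rabs_mult_le; auto. apply Rabs_mult_le; auto. }
  assert (Bz3 : forall x, 0 < x < 1 -> Rabs (z3 x) <= C3 * wt l r 3 x).
  { apply (G3 l r eps mu z3 z4 Hp dz3).
    - intros x Hx. eapply Rle_trans; [apply K3, Hx|].
      apply Rmult_le_compat_r; [left; apply wp|]. unfold c3. assert (0 < D2) by (unfold D2; lra). nra.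
    - intros x Hx.
      assert (T : Rabs (mu * a x * z2 x - (g1 x - (b1 x * z x + b x * z1 x) - mu * a1 x * z1 x))
                 <= mu * (M * (C2 * wt l r 2 x)) + D2 * wt l r 1 x).
      { apply Rabs_minus_le; [|apply K2, Hx]. rewrite (Rmult_assoc mu).
        apply Rabs_mult_le; [rewrite Rabs_pos_eq; lra|apply Rabs_mult_le; auto]. }
      replace (z3 x) with ((mu * a x * z2 x - (g1 x - (b1 x * z x + b x * z1 x) - mu * a1 x * z1 x)) / eps)
        by (unfold z3; field; lra).
      eapply Rle_trans; [apply Rabs_div_le; [lra|exact T]|].
      rewrite (div_eps l r eps mu _ Hp). fold k.
      pose proof (wp 1%nat x) as Hw1. pose proof (wp 2%nat x) as Hw2.
      pose proof (wt_step l r Hl Hr 1 x) as Hw12.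
      assert (HD2 : 0 < D2) by (unfold D2; lra).
      assert (F : l * r * (mu * (M * (C2 * wt l r 2 x)) + D2 * wt l r 1 x)
          = r * (M * C2 * (mu * l) * wt l r 2 x + D2 * (l * wt l r 1 x))) by ring.
      rewrite F.
      assert (F1 : M * C2 * (mu * l) * wt l r 2 x <= M * C2 * (ga / 2) * wt l r 2 x).
      { apply Rmult_le_compat_r; [lra|]. apply Rmult_le_compat_l; lra. }
      assert (F2 : D2 * (l * wt l r 1 x) <= D2 * wt l r 2 x)
        by (apply Rmult_le_compat_l; lra).
      apply Rle_trans with (k * (r * ((ga / 2 * M * C2 + D2) * wt l r 2 x))).
      + apply Rmult_le_compat_l; [lra|]. apply Rmult_le_compat_l; lra.
      + replace (k * (r * ((ga / 2 * M * C2 + D2) * wt l r 2 x)))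
          with (k * (ga / 2 * M * C2 + D2) * (r * wt l r 2 x)) by ring.
        apply Rmult_le_compat_r; [nra|]. unfold c3, D3. lra. }
  assert (fin : forall X c j x, 0 <= c -> c <= C0 + C1 + C2 + C3 -> X <= c * wt l r j x ->
             X <= (C0 + C1 + C2 + C3) * wt l r j x).
  { intros X c j x Hc HcC HX. eapply Rle_trans; [exact HX|].
    apply Rmult_le_compat_r; [left; apply wp|lra]. }
  exists z2, z3. split; [exact dz1|]. split; [exact dz2|].
  split; [intros x Hx; unfold z2; field; lra|]. split; [intros x Hx; apply E2|].
  split; [intros x Hx; eapply fin; [| |apply Bz, Hx]; lra|].
  split; [intros x Hx; eapply fin; [| |apply Bz1, Hx]; lra|].
  split; intros x Hx; [eapply fin; [| |apply Bz2, Hx]|eapply fin; [| |apply Bz3, Hx]]; lra.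
Qed.

End LayerDerivatives.

(** * Splitting off the strong outflow layer *)

Section OutflowLayer.

Context {al ga M : R} {a a1 a2 b b1 b2 A : R -> R}.
Hypothesis Hco : coefs al ga M a a1 a2 b b1 b2.
Hypothesis HAc : forall x, continuity_pt A x.
Hypothesis HAd : forall x, 0 < x < 1 -> is_derive A x (a x).

Let Hal : 0 < al := coefs_al Hco.
Let Hga : 0 < ga := coefs_ga Hco.
Let HM : 1 <= M := coefs_M Hco.
Let Hk : 0 < ga * al := gaal_pos Hco.

(* When [mu = ga / (2 l)] the derivative [z1] splits into an exact solution [P] of
   [- eps P' + mu a P = 0], carrying the strong outflow layer, and a rest whose
   outflow layer is weaker by the factor [l / r]. *)
Lemma outflow_splitting :
  exists C, 0 < C /\ forall l r eps mu z z1 g g1 g2,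
    pars al ga l r eps mu -> mu = ga / (2 * l) ->
    remainder_bvp M l eps mu a b z z1 g g1 g2 ->
    exists s P Q1 : R -> R,
    (forall x, continuity_pt s x) /\
    (forall x, is_derive s x (P x)) /\
    (forall x, 0 < x < 1 -> is_derive P x (mu * a x / eps * P x)) /\
    (forall x, 0 < x < 1 -> is_derive (fun t => z1 t - P t) x (Q1 x)) /\
    (forall x, 0 <= x <= 1 -> Rabs (s x) <= C * ER r x) /\
    (forall x, 0 < x < 1 -> Rabs (P x) <= C * (r * ER r x)) /\
    (forall x, 0 < x < 1 -> Rabs (z1 x - P x) <= C * (l * wt l r 0 x)) /\
    (forall x, 0 < x < 1 -> Rabs (Q1 x) <= C * (l * wt l r 1 x)).
Proof.
  destruct (remainder_derivatives Hco) as [Cd [HCd HD]].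
  destruct (outflow_comparison Hco) as [Co [HCo HO]].
  destruct (remainder_derivative_local Hco) as [Cl [HCl HL]].
  set (k := 2 / (ga * al)). assert (Hk2 : 0 < k) by (apply Rdiv_lt_0_compat; lra).
  set (c0 := M + M * Cd). assert (Hc0 : 0 < c0) by (unfold c0; nra).
  set (CQ := Co * (c0 + 1)). assert (HCQ : 0 < CQ) by (unfold CQ; nra).
  set (c1 := M + (M * Cd + M * Cd) + ga * M * CQ).
  assert (HMCd : 0 < M * Cd) by nra.
  assert (HgMC : 0 < ga * M * CQ) by (repeat apply Rmult_lt_0_compat; lra).
  assert (Hc1 : 0 < c1) by (unfold c1; lra).
  set (CQ1 := Co * (c1 + k * (3 * c0))).
  assert (Hkc : 0 < k * (3 * c0)) by nra.
  assert (HCQ1 : 0 < CQ1) by (unfold CQ1; nra).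
  set (CP := 9 * Cl + 9 * Cl * exp (M / al)).
  assert (HeM : 0 < Cl * exp (M / al)) by (apply Rmult_lt_0_compat; [lra|apply exp_pos]).
  assert (HCP : 0 < CP) by (unfold CP; lra).
  set (CE := 3 * Cd + M / al * CP). assert (HMal : 0 < M / al) by (apply Rdiv_lt_0_compat; lra).
  assert (HCE : 0 < CE) by (unfold CE; nra).
  set (CE1 := k * (ga / 2 * M * CE + 3 * c0)). assert (HCE1 : 0 < CE1).
  { unfold CE1. apply Rmult_lt_0_compat; [lra|]. assert (0 < ga / 2 * M * CE) by (repeat apply Rmult_lt_0_compat; lra). lra. }
  exists (4 * CP + (CQ + 3 * CE) + (CQ1 + 3 * CE1)). split; [lra|].
  intros l r eps mu z z1 g g1 g2 Hp Hmu Hz.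
  pose proof (pars_eps_pos Hco _ _ _ _ Hp) as He.
  pose proof (pars_l Hp) as Hl. pose proof (pars_r Hp) as Hr.
  destruct (HD _ _ _ _ _ _ _ _ _ Hp Hz) as [z2 [z3 [dz1 [dz2 [E1 [E2 [Bz [Bz1 [Bz2 _]]]]]]]]].
  assert (wp : forall j x, 0 < wt l r j x) by (intros; apply wt_pos; lra).
  assert (Hrr : r * / r = 1) by (field; lra).
  assert (Hri : 0 < / r < / 2) by (split; [apply Rinv_0_lt_compat; lra|apply Rinv_lt_contravar; lra]).
  (* At the distance r^-2 from the boundary, the O(r^2) bound of the second derivative can be
     integrated over the remaining interval at the cost of a constant. *)
  set (t1 := 1 - / r * / r).
  assert (Ht1 : 0 < t1 < 1) by (unfold t1; nra).
  assert (Ht1r : 1 - / r <= t1) by (unfold t1; nra).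
  assert (Her : mu * al / eps = r).
  { rewrite Hmu, (pars_eps Hp). field. repeat split; lra. }
  assert (Hmu0 : 0 < mu) by (rewrite Hmu; apply Rdiv_lt_0_compat; lra).
  (* Normalised by P(t1) = z1(t1), so that z1 - P starts from 0 and brings no outflow data into the
     comparison. Since mu al / eps = r and a > al, P decays at least at the rate [r]. *)
  set (P := fun x => z1 t1 * exp (- (mu / eps) * (A t1 - A x))).
  assert (cA : forall x, continuous A x) by (intros; apply continuity_pt_filterlim, HAc).
  assert (cP : forall x, continuous P x).
  { intros x. unfold P. apply (continuous_mult (fun _ => z1 t1)); [apply continuous_const|].
    apply (continuous_comp (fun x => - (mu / eps) * (A t1 - A x)) exp).
    - apply (continuous_mult (fun _ => - (mu / eps))); [apply continuous_const|].
      apply (continuous_minus (fun _ => A t1)); [apply continuous_const|apply cA].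
    - apply continuity_pt_filterlim, derivable_continuous_pt, derivable_pt_exp. }
  (* The part of the solution whose slope is P. Normalised by s(0) = 0, it gains 1/r on P and is
     bounded by the layer function without a factor [r]. *)
  set (s := fun x => RInt P 0 x).
  assert (ds : forall x, is_derive s x (P x)).
  { intros x. apply is_derive_RInt with 0; [|apply cP].
    apply filter_forall. intros y. apply @RInt_correct, ex_RInt_continuous. intros; apply cP. }
  assert (dP : forall x, 0 < x < 1 -> is_derive P x (mu * a x / eps * P x)).
  { intros x Hx. unfold P.
    replace (mu * a x / eps * (z1 t1 * exp (- (mu / eps) * (A t1 - A x))))
      with (z1 t1 * ((- (mu / eps) * (0 - a x)) * exp (- (mu / eps) * (A t1 - A x)))) by (field; lra).
    apply is_derive_scal.
    apply (is_derive_comp exp (fun x => - (mu / eps) * (A t1 - A x))).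
    - apply is_derive_exp.
    - apply is_derive_scal. apply @is_derive_minus; [apply @is_derive_const|apply HAd, Hx]. }
  assert (BP : forall x, 0 < x <= t1 -> Rabs (P x) <= 9 * Cl * (r * ER r x)).
  { intros x Hx. unfold P. rewrite Rabs_mult.
    assert (B1 : Rabs (z1 t1) <= Cl * (r * 3)).
    { eapply Rle_trans; [apply (HL _ _ _ _ _ _ _ _ _ Hp Hz t1 Ht1)|].
      apply Rmult_le_compat_l; [lra|]. apply Rmult_le_compat_l; [lra|].
      assert (wt l r 0 t1 <= 3 * r ^ 0) by (apply wt_le_pow; lra). simpl in H. lra. }
    assert (B2 : al * (t1 - x) <= A t1 - A x).
    { assert (A x - al * x <= A t1 - al * t1); [|lra].
      apply (derive_nonneg_incr (fun t => A t - al * t) (fun t => a t - al * 1)); [lra| | |].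
      - intros t Ht. apply derive_continuity_pt with (a t - al * 1).
        apply @is_derive_minus; [apply HAd; lra|apply is_derive_scal, @is_derive_id].
      - intros t Ht. apply @is_derive_minus; [apply HAd; lra|apply is_derive_scal, @is_derive_id].
      - intros t Ht. pose proof (coefs_a_lower Hco t). lra. }
    assert (B3 : exp (- (mu / eps) * (A t1 - A x)) <= 3 * ER r x).
    { apply Rle_trans with (exp (- r * (t1 - x))).
      - apply exp_mono. assert (0 < mu / eps) by (apply Rdiv_lt_0_compat; lra).
        assert (r * (t1 - x) <= mu / eps * (A t1 - A x)); [|lra].
        rewrite <- Her. replace (mu * al / eps * (t1 - x)) with (mu / eps * (al * (t1 - x))) by (field; lra).
        apply Rmult_le_compat_l; lra.
      - replace (- r * (t1 - x)) with (r * (1 - t1) + - r * (1 - x)) by ring.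
        rewrite exp_plus. apply Rmult_le_compat; try (left; apply exp_pos).
        + eapply Rle_trans; [|apply exp_le_3]. apply exp_mono. nra.
        + unfold ER. apply exp_mono. nra. }
    rewrite (Rabs_pos_eq (exp _)) by (left; apply exp_pos).
    pose proof (ER_pos r x).
    replace (9 * Cl * (r * ER r x)) with (Cl * (r * 3) * (3 * ER r x)) by ring.
    apply Rmult_le_compat; [apply Rabs_pos|left; apply exp_pos|exact B1|exact B3]. }
  set (Q1 := fun x => z2 x - mu * a x / eps * P x).
  assert (dQ : forall x, 0 < x < 1 -> is_derive (fun t => z1 t - P t) x (Q1 x)).
  { intros x Hx. apply @is_derive_minus; [apply dz1, Hx|apply dP, Hx]. }
  set (Q2 := fun x => z3 x - (mu * a1 x / eps * P x + mu * a x / eps * (mu * a x / eps * P x))).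
  assert (dQ1 : forall x, 0 < x < 1 -> is_derive Q1 x (Q2 x)).
  { intros x Hx. apply @is_derive_minus; [apply dz2, Hx|].
    apply (is_derive_Rmult (fun x => mu * a x / eps) P); [|apply dP, Hx].
    apply (is_derive_ext (fun x => mu / eps * a x)).
    - intros t. apply Rmult_eq_reg_r with eps; [|lra]. field. lra.
    - replace (mu * a1 x / eps) with (mu / eps * a1 x) by (field; lra).
      apply is_derive_scal, (coefs_da Hco), Hx. }
  assert (Q0 : z1 t1 - P t1 = 0).
  { unfold P. rewrite Rminus_diag, Rmult_0_r, exp_0. ring. }
  assert (EQ : forall x, 0 < x < 1 -> - eps * Q1 x + mu * a x * (z1 x - P x) = g x - b x * z x).
  { intros x Hx. rewrite <- E1 by exact Hx. unfold Q1. field. lra. }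
  assert (EQ1 : forall x, 0 < x < 1 -> - eps * Q2 x + mu * a x * Q1 x
     = g1 x - (b1 x * z x + b x * z1 x) - mu * (a1 x * (z1 x - P x))).
  { intros x Hx. replace (- eps * Q2 x + mu * a x * Q1 x) with
     (- eps * z3 x + mu * a x * z2 x + mu * a1 x * P x) by (unfold Q2, Q1; field; lra).
    rewrite E2 by exact Hx. ring. }
  assert (w0 : forall x, / l ^ 3 <= wt l r 0 x) by (intros; apply wt_0).
  assert (w01 : forall x, wt l r 0 x <= wt l r 1 x) by (intros; apply wt_mono; lra).
  assert (bM : forall h, (forall x, 0 < x < 1 -> Rabs (h x) <= M / l ^ 3) ->
            forall x, 0 < x < 1 -> Rabs (h x) <= M * wt l r 0 x).
  { intros h Hh x Hx. eapply Rle_trans; [apply Hh, Hx|]. apply Rmult_le_compat_l; [lra|apply w0]. }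
  pose proof (bM g (rem_g Hz)) as Bg.
  pose proof (bM g1 (rem_g1 Hz)) as Bg1.
  assert (Bg0 : forall x, 0 < x < 1 -> Rabs (g x - b x * z x) <= c0 * wt l r 0 x).
  { intros x Hx. unfold c0. rewrite Rmult_plus_distr_r, Rmult_assoc. apply Rabs_minus_le; [auto|].
    apply Rabs_mult_le; [apply (coefs_b Hco x Hx)|auto]. }
  assert (BQ : forall x, 0 < x <= t1 -> Rabs (z1 x - P x) <= CQ * (l * wt l r 0 x)).
  { intros x Hx. eapply Rle_trans.
    - apply (HO l r eps mu 0%nat c0 l t1 (fun t => z1 t - P t) Q1 Hp Hmu Ht1 Ht1r); auto; try lra.
      + intros t Ht. rewrite EQ by lra. apply Bg0. lra.
      + rewrite Q0, Rabs_R0. lra.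
    - unfold CQ. rewrite Rmult_assoc. apply Rmult_le_compat_l; [lra|].
      pose proof (wt_R l r Hl 0 x) as HR. simpl pow in HR. nra. }
  assert (BQ1 : forall x, 0 < x <= t1 -> Rabs (Q1 x) <= CQ1 * (l * wt l r 1 x)).
  { intros x Hx.
    assert (HY : 0 < k * (3 * c0) * (l * r)) by (apply Rmult_lt_0_compat; nra).
    eapply Rle_trans.
    - apply (HO l r eps mu 1%nat c1 (k * (3 * c0) * (l * r)) t1 Q1 Q2 Hp Hmu Ht1 Ht1r); auto; try lra.
      + intros t Ht. rewrite EQ1 by lra. unfold c1. rewrite !Rmult_plus_distr_r, !Rmult_assoc.
        assert (Ht' : 0 < t < 1) by lra.
        assert (Hl0 : 0 < / l < 1).
        { split; [apply Rinv_0_lt_compat; lra|]. rewrite <- Rinv_1. apply Rinv_lt_contravar; lra. }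
        apply Rabs_minus_le; [apply Rabs_minus_le|].
        * eapply Rle_trans; [apply Bg1, Ht'|]. apply Rmult_le_compat_l; [lra|apply w01].
        * apply Rabs_plus_le; apply Rabs_mult_le; auto.
          -- apply (coefs_b1 Hco t Ht').
          -- eapply Rle_trans; [apply Bz, Ht'|]. apply Rmult_le_compat_l; [lra|apply w01].
          -- apply (coefs_b Hco t Ht').
        * assert (Hx1 : Rabs (mu * (a1 t * (z1 t - P t))) <= mu * (M * (CQ * (l * wt l r 0 t)))).
          { apply Rabs_mult_le; [rewrite Rabs_pos_eq; lra|]. apply Rabs_mult_le.
            - apply (coefs_a1 Hco t Ht').
            - apply BQ. lra. }
          eapply Rle_trans; [exact Hx1|].
          replace (mu * (M * (CQ * (l * wt l r 0 t)))) with ((mu * l) * (M * (CQ * wt l r 0 t))) by ring.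
          pose proof (wp 0%nat t). apply Rmult_le_compat; [nra| | |].
          -- apply Rmult_le_pos; nra.
          -- pose proof (mu_l _ _ _ _ Hp). lra.
          -- apply Rmult_le_compat_l; [lra|]. apply Rmult_le_compat_l; [lra|apply w01].
      (* This is the source of the gain. As z1 - P vanishes at [t1], its derivative there is the
         data divided by [eps], of size l r, whereas the second derivative of z itself may be of
         size r^2. *)
      + assert (Hx1 : Q1 t1 = - ((g t1 - b t1 * z t1) / eps)).
        { rewrite <- EQ by lra. rewrite Q0. field. lra. }
        rewrite Hx1, Rabs_Ropp. eapply Rle_trans; [apply Rabs_div_le; [lra|apply Bg0; lra]|].
        rewrite (div_eps Hco l r eps mu _ Hp). fold k.
        assert (W : wt l r 0 t1 <= 3 * r ^ 0) by (apply wt_le_pow; lra). simpl pow in W.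
        replace (k * (3 * c0) * (l * r)) with (k * (l * r * (c0 * 3))) by ring.
        apply Rmult_le_compat_l; [lra|]. apply Rmult_le_compat_l; [nra|].
        apply Rmult_le_compat_l; lra.
    - unfold CQ1. rewrite (Rmult_assoc Co). apply Rmult_le_compat_l; [lra|].
      pose proof (wt_R l r Hl 1 x) as HR. simpl pow in HR.
      assert (k * (3 * c0) * (l * (r * 1 * ER r x)) <= k * (3 * c0) * (l * wt l r 1 x)).
      { apply Rmult_le_compat_l; [lra|]. apply Rmult_le_compat_l; lra. }
      lra. }
  (* Within [/ r ^ 2] of the outflow boundary crude bounds suffice. *)
  assert (Hend : forall x, t1 < x < 1 -> 1 <= 3 * ER r x).
  { intros x Hx. replace 1 with (ER r 1) at 1.
    - apply ER_shift. assert (r * (/ r * / r) = / r) by (field; lra). unfold t1 in Hx. nra.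
    - unfold ER. replace (- (3 / 4) * r * (1 - 1)) with 0 by ring. apply exp_0. }
  assert (Hmr : mu / eps = r / al) by (rewrite <- Her; field; lra).
  assert (EP : forall x, t1 < x < 1 -> Rabs (P x) <= CP * r).
  { intros x Hx. unfold P. rewrite Rabs_mult.
    assert (B1 : Rabs (z1 t1) <= Cl * (r * 3)).
    { eapply Rle_trans; [apply (HL _ _ _ _ _ _ _ _ _ Hp Hz t1 Ht1)|].
      apply Rmult_le_compat_l; [lra|]. apply Rmult_le_compat_l; [lra|].
      assert (W : wt l r 0 t1 <= 3 * r ^ 0) by (apply wt_le_pow; lra). simpl in W. lra. }
    assert (B2 : A x - A t1 <= M * (x - t1)).
    { assert (M * t1 - A t1 <= M * x - A x); [|lra].
      apply (derive_nonneg_incr (fun t => M * t - A t) (fun t => M * 1 - a t)); [lra| | |].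
      - intros t Ht. apply derive_continuity_pt with (M * 1 - a t).
        apply @is_derive_minus; [apply is_derive_scal, @is_derive_id|apply HAd; lra].
      - intros t Ht. apply @is_derive_minus; [apply is_derive_scal, @is_derive_id|apply HAd; lra].
      - intros t Ht. pose proof (coefs_a Hco t ltac:(lra)) as Q.
        apply Rabs_le_between in Q. lra. }
    assert (B3 : exp (- (mu / eps) * (A t1 - A x)) <= exp (M / al)).
    { apply exp_mono. rewrite Hmr. replace (- (r / al) * (A t1 - A x)) with (r / al * (A x - A t1)) by ring.
      assert (Hra : 0 < r / al) by (apply Rdiv_lt_0_compat; lra).
      apply Rle_trans with (r / al * (M * (x - t1))); [apply Rmult_le_compat_l; lra|].
      replace (r / al * (M * (x - t1))) with (M / al * (r * (x - t1))) by (field; lra).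
      rewrite <- (Rmult_1_r (M / al)) at 2. apply Rmult_le_compat_l; [lra|].
      assert (r * (/ r * / r) = / r) by (field; lra). unfold t1 in *. nra. }
    rewrite (Rabs_pos_eq (exp _)) by (left; apply exp_pos).
    apply Rle_trans with (Cl * (r * 3) * exp (M / al)).
    - apply Rmult_le_compat; [apply Rabs_pos|left; apply exp_pos|exact B1|exact B3].
    - unfold CP. replace (Cl * (r * 3) * exp (M / al)) with (3 * (Cl * exp (M / al)) * r) by ring.
      apply Rmult_le_compat_r; lra. }
  assert (EQ1r : forall x, t1 < x < 1 -> Rabs (Q1 x) <= CE * r ^ 2).
  { intros x Hx. unfold Q1, CE.
    replace ((3 * Cd + M / al * CP) * r ^ 2) with (Cd * (3 * r ^ 2) + r / al * M * (CP * r)) by (field; lra).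
    apply Rabs_minus_le.
    - eapply Rle_trans; [apply Bz2; lra|]. apply Rmult_le_compat_l; [lra|apply wt_le_pow; lra].
    - apply Rabs_mult_le; [|apply EP, Hx].
      replace (mu * a x / eps) with (mu / eps * a x) by (field; lra). rewrite Hmr.
      apply Rabs_mult_le; [rewrite Rabs_pos_eq; [lra|apply Rlt_le, Rdiv_lt_0_compat; lra]|].
      apply (coefs_a Hco x). lra. }
  assert (EQb : forall x, t1 < x < 1 -> Rabs (z1 x - P x) <= CE).
  { intros x Hx. replace (z1 x - P x) with ((z1 x - P x) - (z1 t1 - P t1)) by lra.
    apply Rle_trans with (CE * r ^ 2 * x - CE * r ^ 2 * t1).
    - apply (increment_le (fun t => z1 t - P t) Q1 (fun t => CE * r ^ 2 * t) (fun _ => CE * r ^ 2 * 1)); try lra.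
      + intros t Ht. apply derive_continuity_pt with (Q1 t), dQ. lra.
      + intros t Ht. apply derive_continuity_pt with (CE * r ^ 2 * 1). apply is_derive_scal, @is_derive_id.
      + intros t Ht. apply dQ. lra.
      + intros t Ht. apply is_derive_scal, @is_derive_id.
      + intros t Ht. rewrite Rmult_1_r. apply EQ1r. lra.
    - assert (r ^ 2 * (x - t1) <= 1).
      { apply Rle_trans with (r ^ 2 * (/ r * / r)).
        - apply Rmult_le_compat_l; [apply pow_le; lra|unfold t1; lra].
        - right. field. lra. }
      nra. }
  (* With z1 - P bounded up to the boundary, its equation lowers the crude r^2 to l r, because mu /
     eps is of order [r] and 1 / eps of order l r. *)
  assert (EQ1b : forall x, t1 < x < 1 -> Rabs (Q1 x) <= CE1 * (l * r)).
  { intros x Hx.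
    replace (Q1 x) with ((mu * (a x * (z1 x - P x)) - (g x - b x * z x)) / eps)
      by (rewrite <- EQ by lra; field; lra).
    assert (T : Rabs (mu * (a x * (z1 x - P x)) - (g x - b x * z x)) <= mu * (M * CE) + c0 * 3).
    { apply Rabs_minus_le.
      - apply Rabs_mult_le; [rewrite Rabs_pos_eq; lra|].
        apply Rabs_mult_le; [apply (coefs_a Hco x); lra|apply EQb, Hx].
      - eapply Rle_trans; [apply Bg0; lra|]. apply Rmult_le_compat_l; [lra|].
        assert (W : wt l r 0 x <= 3 * r ^ 0) by (apply wt_le_pow; lra). simpl in W. lra. }
    eapply Rle_trans; [apply Rabs_div_le; [lra|exact T]|].
    rewrite (div_eps Hco l r eps mu _ Hp). fold k.
    unfold CE1. replace (k * (ga / 2 * M * CE + 3 * c0) * (l * r))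
      with (k * (l * r * (ga / 2 * (M * CE) + c0 * 3))) by ring.
    apply Rmult_le_compat_l; [lra|]. apply Rmult_le_compat_l; [nra|]. apply Rplus_le_compat_r.
    apply Rmult_le_compat_r; [nra|].
    pose proof (mu_l _ _ _ _ Hp). nra. }
  assert (sc : forall X c Y, 0 <= Y -> c <= 4 * CP + (CQ + 3 * CE) + (CQ1 + 3 * CE1) -> X <= c * Y ->
                 X <= (4 * CP + (CQ + 3 * CE) + (CQ1 + 3 * CE1)) * Y).
  { intros X c Y HY Hc HX. eapply Rle_trans; [exact HX|]. apply Rmult_le_compat_r; lra. }
  assert (Rp : forall x, 0 < ER r x) by (intros; apply ER_pos).
  assert (BPa : forall x, 0 < x < 1 -> Rabs (P x) <= 3 * CP * (r * ER r x)).
  { intros x Hx. specialize (Rp x). destruct (Rle_dec x t1) as [D|D].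
    - eapply Rle_trans; [apply BP; lra|]. apply Rmult_le_compat_r; [nra|unfold CP; lra].
    - eapply Rle_trans; [apply EP; lra|]. pose proof (Hend x ltac:(lra)).
      assert (CP * r * 1 <= CP * r * (3 * ER r x)) by (apply Rmult_le_compat_l; [nra|lra]). lra. }
  exists s, P, Q1.
  split; [intros x; apply derive_continuity_pt with (P x), ds|].
  split; [exact ds|]. split; [exact dP|]. split; [exact dQ|].
  split; [|split; [|split]]; intros x Hx.
  - apply sc with (4 * CP); [left; apply Rp|lra|].
    assert (S0 : s 0 = 0) by (unfold s; now rewrite RInt_point).
    replace (s x) with (s x - s 0) by (rewrite S0; ring).
    apply Rle_trans with (4 * CP * ER r x - 4 * CP * ER r 0).
    + apply (increment_le s P (fun t => 4 * CP * ER r t) (fun t => 4 * CP * (3 / 4 * r * ER r t))); try lra.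
      * intros t Ht. apply derive_continuity_pt with (P t), ds.
      * intros t Ht. apply derive_continuity_pt with (4 * CP * (3 / 4 * r * ER r t)).
        apply is_derive_scal, is_derive_ER.
      * intros t Ht. apply ds.
      * intros t Ht. apply is_derive_scal, is_derive_ER.
      * intros t Ht. eapply Rle_trans; [apply BPa; lra|]. lra.
    + pose proof (Rp 0). nra.
  - apply sc with (3 * CP); [pose proof (Rp x); nra|lra|apply BPa, Hx].
  - assert (Hlw : ER r x <= l * wt l r 0 x).
    { pose proof (wt_R l r Hl 0 x) as HR. simpl pow in HR. pose proof (wp 0%nat x). nra. }
    apply sc with (CQ + 3 * CE); [pose proof (Rp x); lra|lra|]. pose proof (Rp x).
    destruct (Rle_dec x t1) as [D|D].
    + eapply Rle_trans; [apply BQ; lra|]. apply Rmult_le_compat_r; lra.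
    + eapply Rle_trans; [apply EQb; lra|]. pose proof (Hend x ltac:(lra)).
      assert (CE * 1 <= CE * (3 * (l * wt l r 0 x))) by (apply Rmult_le_compat_l; lra).
      assert (0 <= CQ * (l * wt l r 0 x)) by (apply Rmult_le_pos; lra). lra.
  - assert (Hlw : l * r * ER r x <= l * wt l r 1 x).
    { pose proof (wt_R l r Hl 1 x) as HR. simpl pow in HR. rewrite Rmult_1_r in HR.
      rewrite Rmult_assoc. apply Rmult_le_compat_l; lra. }
    assert (Hlr : 0 < l * r) by nra. pose proof (Rp x).
    assert (0 < l * r * ER r x) by nra.
    apply sc with (CQ1 + 3 * CE1); [lra|lra|].
    destruct (Rle_dec x t1) as [D|D].
    + eapply Rle_trans; [apply BQ1; lra|]. apply Rmult_le_compat_r; lra.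
    + eapply Rle_trans; [apply EQ1b; lra|]. pose proof (Hend x ltac:(lra)).
      assert (CE1 * (l * r) * 1 <= CE1 * (l * r) * (3 * ER r x)) by (apply Rmult_le_compat_l; [nra|lra]).
      assert (CE1 * (l * r * ER r x) <= CE1 * (l * wt l r 1 x)) by (apply Rmult_le_compat_l; lra).
      assert (0 <= CQ1 * (l * wt l r 1 x)) by (apply Rmult_le_pos; lra). lra.
Qed.

End OutflowLayer.

(** * The regular part *)

(** One bound on [0,1] for [g] and its first [k] derivatives. The derivatives are witnesses
    continuous on the whole line and linked to each other only inside (0,1), so the endpoints need
    no one-sided derivatives. *)
Fixpoint Sm (k : nat) (B : R) (g : R -> R) : Prop :=
  (forall x, continuity_pt g x) /\ (forall x, 0 <= x <= 1 -> Rabs (g x) <= B) /\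
  match k with
  | O => True
  | S k' => exists g', (forall x, 0 < x < 1 -> is_derive g x (g' x)) /\ Sm k' B g'
  end.

Lemma Sm_cont k B g : Sm k B g -> forall x, continuity_pt g x.
Proof. destruct k; now intros [H _]. Qed.

Lemma Sm_bound k B g : Sm k B g -> forall x, 0 <= x <= 1 -> Rabs (g x) <= B.
Proof. destruct k; now intros [_ [H _]]. Qed.

Lemma Sm_mono k B B' g : B <= B' -> Sm k B g -> Sm k B' g.
Proof.
  intros HB. revert g. induction k as [|k IH]; intros g [H1 [H2 H3]].
  - repeat split; auto. intros x Hx. specialize (H2 x Hx). lra.
  - split; [exact H1|]. split; [intros x Hx; specialize (H2 x Hx); lra|].
    destruct H3 as [g' [H3 H4]]. exists g'. auto.
Qed.

Lemma Sm_pred k B g : Sm (S k) B g -> Sm k B g.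
Proof.
  revert g. induction k as [|k IH]; intros g [H1 [H2 [g' [H3 H4]]]].
  - repeat split; auto.
  - split; [exact H1|]. split; [exact H2|]. exists g'. split; auto.
Qed.

Lemma Sm_le j k B g : (j <= k)%nat -> Sm k B g -> Sm j B g.
Proof. induction 1; intros H'; [exact H'|]. apply IHle, Sm_pred, H'. Qed.

Lemma Sm_plus k B B' f g : Sm k B f -> Sm k B' g -> Sm k (B + B') (fun x => f x + g x).
Proof.
  revert f g. induction k as [|k IH]; intros f g [H1 [H2 H3]] [G1 [G2 G3]];
    (split; [intros x; apply continuity_pt_plus; auto|]);
    (split; [intros x Hx; apply Rabs_plus_le; auto|]).
  - exact I.
  - destruct H3 as [f' [H3 H4]]. destruct G3 as [g' [G3 G4]].
    exists (fun x => f' x + g' x). split; [|auto]. intros x Hx. apply @is_derive_plus; auto.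
Qed.

Lemma Sm_scal k B c g : Sm k B g -> Sm k (Rabs c * B) (fun x => c * g x).
Proof.
  revert g. induction k as [|k IH]; intros g [G1 [G2 G3]];
    (split; [intros x; apply (continuity_pt_scal g c x), G1|]);
    (split; [intros x Hx; apply Rabs_mult_le; auto; lra|]).
  - exact I.
  - destruct G3 as [g' [G3 G4]].
    exists (fun x => c * g' x). split; [|auto]. intros x Hx. apply is_derive_scal; auto.
Qed.

Lemma Sm_mult k B B' f g : Sm k B f -> Sm k B' g -> Sm k (2 ^ k * (B * B')) (fun x => f x * g x).
Proof.
  revert f g. induction k as [|k IH]; intros f g Hf Hg.
  - destruct Hf as [H1 [H2 _]], Hg as [G1 [G2 _]].
    split; [intros x; apply continuity_pt_mult; auto|]. split; [|exact I].
    intros x Hx. simpl. rewrite Rmult_1_l. apply Rabs_mult_le; auto.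
  - assert (Pf := Sm_pred _ _ _ Hf). assert (Pg := Sm_pred _ _ _ Hg).
    destruct Hf as [H1 [H2 [f' [H3 H4]]]], Hg as [G1 [G2 [g' [G3 G4]]]].
    split; [intros x; apply continuity_pt_mult; auto|].
    assert (HB : 0 <= B * B').
    { assert (0 <= B) by (eapply Rle_trans; [apply Rabs_pos|apply (H2 0); lra]).
      assert (0 <= B') by (eapply Rle_trans; [apply Rabs_pos|apply (G2 0); lra]). nra. }
    split.
    + intros x Hx. apply Rle_trans with (B * B'); [apply Rabs_mult_le; auto|].
      assert (1 <= 2 ^ S k) by (apply pow_R1_Rle; lra). nra.
    + exists (fun x => f' x * g x + f x * g' x). split.
      * intros x Hx. apply is_derive_Rmult; auto.
      * replace (2 ^ S k * (B * B')) with (2 ^ k * (B * B') + 2 ^ k * (B * B')) by (simpl; ring).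
        apply (Sm_plus k _ _ (fun x => f' x * g x) (fun x => f x * g' x)); auto.
Qed.

(** Induction through (1/g)' = - g' / g^2: the induction hypothesis controls 1/g, hence its square,
    one order below. The lower bound is required on the whole line because [Sm] asks for continuity
    everywhere. *)
Lemma Sm_inv k B be g :
  0 < be -> (forall x, be <= g x) -> Sm k B g -> exists B', Sm k B' (fun x => / g x).
Proof.
  intros Hbe Hg. revert g Hg. induction k as [|k IH]; intros g Hg Hs.
  - exists (/ be). pose proof (Sm_cont _ _ _ Hs) as Hc.
    split; [|split; [|exact I]].
    + intros x. apply continuity_pt_inv; [auto|]. specialize (Hg x). lra.
    + intros x Hx. specialize (Hg x). rewrite Rabs_pos_eq.
      * apply Rinv_le_contravar; lra.
      * left; apply Rinv_0_lt_compat; lra.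
  - destruct (IH g Hg (Sm_pred _ _ _ Hs)) as [B1 HB1].
    pose proof (Sm_cont _ _ _ Hs) as Hc.
    destruct Hs as [_ [_ [g' [Hd Hs']]]].
    pose proof (Sm_mult _ _ _ _ _ HB1 HB1) as Hsq.
    pose proof (Sm_scal _ _ (-1) _ (Sm_mult _ _ _ _ _ Hs' Hsq)) as Hp.
    set (B2 := Rabs (-1) * (2 ^ k * (B * (2 ^ k * (B1 * B1))))) in *.
    exists (Rmax B1 B2). split; [|split].
    + intros x. apply continuity_pt_inv; [auto|]. specialize (Hg x). lra.
    + intros x Hx. eapply Rle_trans; [apply (Sm_bound _ _ _ HB1 x Hx)|apply Rmax_l].
    + exists (fun x => -1 * (g' x * (/ g x * / g x))). split.
      * intros x Hx. specialize (Hg x).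
        replace (-1 * (g' x * (/ g x * / g x))) with (- g' x / (g x) ^ 2) by (field; lra).
        apply is_derive_inv; [auto|lra].
      * apply Sm_mono with B2; [apply Rmax_r|exact Hp].
Qed.

(** Composition with this 1-Lipschitz projection turns continuity relative to [0,1] into continuity
    at every real point. *)
Definition clamp (x : R) : R := Rmax 0 (Rmin 1 x).

Lemma clamp_in x : 0 <= clamp x <= 1.
Proof.
  unfold clamp. split; [apply Rmax_l|]. apply Rmax_lub; [lra|apply Rmin_l].
Qed.

Lemma clamp_id x : 0 <= x <= 1 -> clamp x = x.
Proof. intros H. unfold clamp. rewrite Rmin_right, Rmax_right; lra. Qed.

Lemma clamp_lip x y : Rabs (clamp x - clamp y) <= Rabs (x - y).
Proof.
  unfold clamp, Rmax, Rmin.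
  repeat destruct Rle_dec; unfold Rabs; repeat destruct Rcase_abs; lra.
Qed.

Lemma clamp_continuous (g : R -> R) :
  continuous_on in_clOmega g -> forall x, continuity_pt (fun t => g (clamp t)) x.
Proof.
  intros Hg x. apply continuity_pt_filterlim.
  specialize (Hg (clamp x) (clamp_in x)).
  intros P HP. specialize (Hg P HP). destruct Hg as [d Hd].
  exists d. intros y Hy. apply Hd; [|apply clamp_in].
  eapply Rle_lt_trans; [apply clamp_lip|exact Hy].
Qed.

Lemma is_derive_local_eq (f g : R -> R) x d :
  (forall t, 0 < t < 1 -> f t = g t) -> 0 < x < 1 -> is_derive f x d -> is_derive g x d.
Proof.
  intros He Hx Hd. apply (is_derive_ext_loc f); [|exact Hd].
  assert (Hm : 0 < Rmin x (1 - x)) by (apply Rmin_glb_lt; lra).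
  exists (mkposreal _ Hm). intros y Hy. apply He.
  change (Rabs (y - x) < Rmin x (1 - x)) in Hy.
  pose proof (Rmin_l x (1 - x)). pose proof (Rmin_r x (1 - x)).
  apply Rabs_def2 in Hy. lra.
Qed.

(** The witness for order [S j] serves as the derivative of the witness for order [j], since on
    (0,1) the two agree with consecutive derivatives of [g]. *)
Lemma smooth_Sm k g : smooth k g ->
  forall m j, (j + m <= k)%nat ->
  exists h B, Sm m B h /\ forall x, 0 < x < 1 -> h x = Derive_n g j x.
Proof.
  intros Hg m. induction m as [|m IH]; intros j Hj.
  - destruct (Hg j) as [_ [gj [Hc He]]]; [lia|].
    pose proof (clamp_continuous gj Hc) as Hcc.
    destruct (continuity_ab_maj (fun t => Rabs (gj (clamp t))) 0 1) as [m [Hm _]]; [lra| |].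
    { intros c _. apply (continuity_pt_comp (fun t => gj (clamp t)) Rabs); [apply Hcc|].
      apply Rcontinuity_abs. }
    exists (fun t => gj (clamp t)), (Rabs (gj (clamp m))).
    split; [split; [exact Hcc|split; [exact Hm|exact I]]|].
    intros x Hx. rewrite clamp_id by lra. apply He. exact Hx.
  - destruct (IH (S j)) as [h' [B' [HS HE]]]; [lia|].
    destruct (IH j) as [h [B [HS0 HE0]]]; [lia|].
    exists h, (Rmax B B'). split; [|exact HE0].
    split; [apply (Sm_cont _ _ _ HS0)|]. split.
    { intros x Hx. eapply Rle_trans; [apply (Sm_bound _ _ _ HS0 x Hx)|apply Rmax_l]. }
    exists h'. split; [|apply Sm_mono with B'; [apply Rmax_r|exact HS]].
    intros x Hx. destruct (Hg (S j)) as [Hex _]; [lia|].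
    apply (is_derive_local_eq (Derive_n g j)); [intros t Ht; symmetry; auto|exact Hx|].
    rewrite HE by exact Hx. simpl. apply Derive_correct. apply (Hex x Hx).
Qed.

Lemma smooth_extension k g : smooth k g ->
  exists h B, Sm k B h /\ forall x, 0 < x < 1 -> h x = g x.
Proof. intros H. apply (smooth_Sm k g H k 0). lia. Qed.

(** One step of the expansion. As [eps] and [mu] are O(1/l), the neglected part of the operator
    gains 1/l and loses two derivatives. Both the result and its product with [q] are returned: the
    product, for q = 1/b, is the next term, and the bare result is the residual of the last one. *)
Lemma reduced_operator (k : nat) (Ba Bq C0 : R) (a q : R -> R) :
  0 <= C0 -> Sm k Ba a -> Sm k Bq q ->
  exists C, 0 <= C /\ forall l eps mu B g,
    1 < l -> 0 <= eps <= C0 / l -> 0 <= mu <= C0 / l -> Sm (S (S k)) B g ->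
    exists g' g'',
      (forall x, 0 < x < 1 -> is_derive g x (g' x)) /\
      (forall x, 0 < x < 1 -> is_derive g' x (g'' x)) /\
      Sm k B g' /\ Sm k B g'' /\
      Sm k (C * B / l) (fun x => eps * g'' x + - mu * (a x * g' x)) /\
      Sm k (C * B / l) (fun x => q x * (eps * g'' x + - mu * (a x * g' x))).
Proof.
  intros HC0 Ha Hq.
  assert (HBa : 0 <= Ba) by (eapply Rle_trans; [apply Rabs_pos|apply (Sm_bound _ _ _ Ha 0); lra]).
  assert (HBq : 0 <= Bq) by (eapply Rle_trans; [apply Rabs_pos|apply (Sm_bound _ _ _ Hq 0); lra]).
  assert (H2 : 0 < 2 ^ k) by (apply pow_lt; lra).
  set (D := C0 * (1 + 2 ^ k * Ba)).
  assert (HD : 0 <= D) by (unfold D; apply Rmult_le_pos; nra).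
  exists (D + 2 ^ k * Bq * D). split; [assert (0 <= 2 ^ k * Bq) by nra; nra|].
  intros l eps mu B g Hl He Hm Hg.
  assert (HB : 0 <= B) by (eapply Rle_trans; [apply Rabs_pos|apply (Sm_bound _ _ _ Hg 0); lra]).
  destruct Hg as [_ [_ [g' [Hd Hg']]]].
  pose proof (Sm_le k (S k) B g' (Nat.le_succ_diag_r k) Hg') as Hg'k.
  destruct Hg' as [_ [_ [g'' [Hd' Hg'']]]].
  exists g', g''. split; [exact Hd|]. split; [exact Hd'|].
  split; [exact Hg'k|]. split; [exact Hg''|].
  assert (T : Sm k (D * B / l) (fun x => eps * g'' x + - mu * (a x * g' x))).
  { pose proof (Sm_scal k B eps g'' Hg'') as S1.
    pose proof (Sm_scal k _ (- mu) _ (Sm_mult k Ba B a g' Ha Hg'k)) as S2.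
    pose proof (Sm_plus k _ _ _ _ S1 S2) as S3.
    eapply Sm_mono; [|exact S3].
    rewrite Rabs_Ropp, !Rabs_pos_eq by lra.
    apply Rle_trans with (C0 / l * B + C0 / l * (2 ^ k * (Ba * B))).
    - apply Rplus_le_compat; apply Rmult_le_compat_r; try lra.
      apply Rmult_le_pos; [lra|]. apply Rmult_le_pos; lra.
    - unfold D. right. field. lra. }
  assert (HBl : 0 <= B / l) by (apply Rmult_le_pos; [lra|left; apply Rinv_0_lt_compat; lra]).
  split.
  - eapply Sm_mono; [|exact T].
    replace (D * B / l) with (D * (B / l)) by (unfold Rdiv; ring).
    replace ((D + 2 ^ k * Bq * D) * B / l) with ((D + 2 ^ k * Bq * D) * (B / l)) by (unfold Rdiv; ring).
    apply Rmult_le_compat_r; [lra|]. assert (0 <= 2 ^ k * Bq) by nra. nra.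
  - eapply Sm_mono; [|apply (Sm_mult _ _ _ _ _ Hq T)].
    replace (2 ^ k * (Bq * (D * B / l))) with ((2 ^ k * Bq * D) * (B / l)) by (unfold Rdiv; ring).
    replace ((D + 2 ^ k * Bq * D) * B / l) with ((D + 2 ^ k * Bq * D) * (B / l)) by (unfold Rdiv; ring).
    apply Rmult_le_compat_r; lra.
Qed.

Lemma Sm_eq k B g h :
  (forall x, continuity_pt h x) -> (forall x, 0 <= x <= 1 -> Rabs (h x) <= B) ->
  (forall x, 0 < x < 1 -> g x = h x) -> Sm k B g -> Sm k B h.
Proof.
  intros Hc Hb He Hg. destruct k as [|k].
  - repeat split; auto.
  - destruct Hg as [_ [_ [g' [Hd Hg']]]]. split; [exact Hc|]. split; [exact Hb|].
    exists g'. split; [|exact Hg']. intros x Hx. apply (is_derive_local_eq g); auto.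
Qed.

(** The extension is replaced by its maximum with [be], which changes nothing inside (0,1) and makes
    it bounded below everywhere, as its reciprocal requires. The maximum is written with an absolute
    value to obtain continuity. *)
Lemma smooth_positive_extension k g be : smooth k g -> 0 < be ->
  (forall x, 0 < x < 1 -> be <= g x) ->
  exists h B, Sm k B h /\ (forall x, be <= h x) /\ forall x, 0 < x < 1 -> h x = g x.
Proof.
  intros Hg Hbe Hlow. destruct (smooth_extension k g Hg) as [h0 [B [HS HE]]].
  assert (Hmax : forall x, (h0 x + be + Rabs (h0 x - be)) / 2 = Rmax (h0 x) be).
  { intros x. unfold Rmax, Rabs. destruct Rle_dec, Rcase_abs; lra. }
  assert (Hmax1 : forall x, 0 < x < 1 -> h0 x = (h0 x + be + Rabs (h0 x - be)) / 2).
  { intros x Hx. rewrite Hmax, Rmax_left; [auto|]. rewrite HE; auto. }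
  exists (fun x => (h0 x + be + Rabs (h0 x - be)) / 2), (Rmax B be).
  split; [|split].
  - apply (Sm_eq k _ h0).
    + intros x. apply (continuity_pt_mult (fun x => h0 x + be + Rabs (h0 x - be)) (fun _ => / 2)).
      * apply (continuity_pt_plus (fun x => h0 x + be) (fun x => Rabs (h0 x - be))).
        -- apply (continuity_pt_plus h0 (fun _ => be)); [apply (Sm_cont _ _ _ HS)|].
           apply continuity_pt_const. intros ? ?; reflexivity.
        -- apply (continuity_pt_comp (fun x => h0 x - be) Rabs); [|apply Rcontinuity_abs].
           apply (continuity_pt_minus h0 (fun _ => be)); [apply (Sm_cont _ _ _ HS)|].
           apply continuity_pt_const. intros ? ?; reflexivity.
      * apply continuity_pt_const. intros ? ?; reflexivity.
    + intros x Hx. rewrite Hmax. pose proof (Sm_bound _ _ _ HS x Hx) as Hb.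
      apply Rabs_le_between in Hb. pose proof (Rmax_l B be). pose proof (Rmax_r B be).
      apply Rabs_le. unfold Rmax at 2 3. destruct Rle_dec; lra.
    + exact Hmax1.
    + apply Sm_mono with B; [apply Rmax_l|exact HS].
  - intros x. rewrite Hmax. apply Rmax_r.
  - intros x Hx. rewrite <- Hmax1 by exact Hx. auto.
Qed.

(** [ut] is a continuous extension of [u] beyond [0,1]: the values of [u] outside are arbitrary,
    while [continuity_pt] is two-sided at 0 and 1. *)
Record regular_part {M l eps mu : R} {a b u ut v v1 v2 v3 g g1 g2 : R -> R} : Prop := {
  reg_u : forall x, 0 <= x <= 1 -> ut x = u x;
  reg_ut_cont : forall x, continuity_pt ut x;
  reg_dut : forall x, 0 < x < 1 -> is_derive ut x (Derive u x);
  reg_cont : forall x, continuity_pt v x;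
  reg_dv : forall x, 0 < x < 1 -> is_derive v x (v1 x);
  reg_dv1 : forall x, 0 < x < 1 -> is_derive v1 x (v2 x);
  reg_dv2 : forall x, 0 < x < 1 -> is_derive v2 x (v3 x);
  reg_v1 : forall x, 0 < x < 1 -> Rabs (v1 x) <= M;
  reg_v2 : forall x, 0 < x < 1 -> Rabs (v2 x) <= M;
  reg_v3 : forall x, 0 < x < 1 -> Rabs (v3 x) <= M;
  reg_rem : remainder_bvp M l eps mu a b (fun x => ut x - v x) (fun x => Derive u x - v1 x) g g1 g2 }.
Arguments regular_part : clear implicits.

(* The regular part is the truncated expansion [v0 + v1 + v2] with [b v0 = f] and
   [b v_(j+1) = eps v_j'' - mu a v_j']; each step gains a factor [1 / l]. *)
Lemma regular_decomposition (al ga : R) (a b f : R -> R) :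
  0 < al -> 0 < ga ->
  smooth 7 a -> smooth 9 b -> smooth 9 f ->
  (forall x, in_Omega x -> al < a x) ->
  (forall x, in_Omega x -> ga * a x < b x) ->
  exists M a1 a2 b1 b2 A,
    coefs al ga M a a1 a2 b b1 b2 /\
    (forall x, continuity_pt A x) /\ (forall x, 0 < x < 1 -> is_derive A x (a x)) /\
    forall l r eps mu u,
      pars al ga l r eps mu -> bvp_solution eps mu a b f u ->
      exists ut v v1 v2 v3 g g1 g2,
        regular_part M l eps mu a b u ut v v1 v2 v3 g g1 g2.
Proof.
  intros Hal Hga Sa Sb Sf Ha Hb.
  assert (Hk : 0 < ga * al) by nra.
  destruct (smooth_extension 7 a Sa) as [ah [Ba [HSa HEa]]].
  destruct (smooth_positive_extension 9 b (ga * al) Sb Hk) as [bh [Bb [HSb [Hbl HEb]]]].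
  { intros x Hx. specialize (Ha x Hx). specialize (Hb x Hx). nra. }
  destruct (smooth_extension 9 f Sf) as [fh [Bf [HSf HEf]]].
  destruct (Sm_inv 9 Bb (ga * al) bh Hk Hbl HSb) as [Bq HSq].
  set (q := fun x => / bh x) in *.
  pose proof (Sm_mult 9 _ _ _ _ HSf HSq) as HSv0.
  set (v0 := fun x => fh x * q x) in *. set (B0 := 2 ^ 9 * (Bf * Bq)) in *.
  set (C0 := ga * al + ga). assert (HC0 : 0 <= C0) by (unfold C0; lra).
  (* Bookkeeping of orders: [v0] has 9 derivatives, [v1] has 7, [v2] has 5 and the residual [g] has
     3. The first product with [a] takes place at order 7. *)
  destruct (reduced_operator 7 Ba Bq C0 ah q HC0 HSa (Sm_le 7 9 _ _ ltac:(lia) HSq)) as [C7 [HC7 O7]].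
  destruct (reduced_operator 5 Ba Bq C0 ah q HC0 (Sm_le 5 7 _ _ ltac:(lia) HSa)
              (Sm_le 5 9 _ _ ltac:(lia) HSq)) as [C5 [HC5 O5]].
  destruct (reduced_operator 3 Ba Bq C0 ah q HC0 (Sm_le 3 7 _ _ ltac:(lia) HSa)
              (Sm_le 3 9 _ _ ltac:(lia) HSq)) as [C3 [HC3 O3]].
  assert (HB0 : 0 <= B0) by (eapply Rle_trans; [apply Rabs_pos|apply (Sm_bound _ _ _ HSv0 0); lra]).
  assert (HBa : 0 <= Ba) by (eapply Rle_trans; [apply Rabs_pos|apply (Sm_bound _ _ _ HSa 0); lra]).
  assert (HBb : 0 <= Bb) by (eapply Rle_trans; [apply Rabs_pos|apply (Sm_bound _ _ _ HSb 0); lra]).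
  set (D1 := C7 * B0). assert (HD1 : 0 <= D1) by (unfold D1; nra).
  set (D2 := C5 * D1). assert (HD2 : 0 <= D2) by (unfold D2; nra).
  set (D3 := C3 * D2). assert (HD3 : 0 <= D3) by (unfold D3; nra).
  set (M := 1 + Ba + Bb + (B0 + (D1 + D2)) + D3).
  pose proof HSa as HSa'. destruct HSa' as [_ [_ [a1 [da HSa1]]]].
  pose proof HSa1 as HSa1'. destruct HSa1' as [_ [_ [a2 [da1 HSa2]]]].
  pose proof HSb as HSb'. destruct HSb' as [_ [_ [b1 [db HSb1]]]].
  pose proof HSb1 as HSb1'. destruct HSb1' as [_ [_ [b2 [db1 HSb2]]]].
  exists M, a1, a2, b1, b2, (fun x => RInt ah 0 x).
  assert (Hint : forall x, is_derive (fun x => RInt ah 0 x) x (ah x)).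
  { intros x. assert (cc : forall y, continuous ah y)
      by (intros y; apply continuity_pt_filterlim, (Sm_cont _ _ _ HSa)).
    apply is_derive_RInt with 0; [|apply cc].
    apply filter_forall. intros y. apply @RInt_correct, ex_RInt_continuous. intros; apply cc. }
  split; [|split; [|split]].
  - assert (bd : forall k B h x, Sm k B h -> B <= M -> 0 < x < 1 -> Rabs (h x) <= M).
    { intros k B h x HS HB Hx. eapply Rle_trans; [apply (Sm_bound _ _ _ HS x); lra|exact HB]. }
    constructor; auto.
    + unfold M; lra.
    + intros x Hx. apply (is_derive_local_eq ah); auto.
    + intros x Hx. apply (is_derive_local_eq bh); auto.
    + intros x Hx. rewrite <- HEa by exact Hx. apply (bd _ _ _ _ HSa); [unfold M; lra|exact Hx].
    + intros x Hx. apply (bd _ _ _ _ HSa1); [unfold M; lra|exact Hx].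
    + intros x Hx. apply (bd _ _ _ _ HSa2); [unfold M; lra|exact Hx].
    + intros x Hx. rewrite <- HEb by exact Hx. apply (bd _ _ _ _ HSb); [unfold M; lra|exact Hx].
    + intros x Hx. apply (bd _ _ _ _ HSb1); [unfold M; lra|exact Hx].
    + intros x Hx. apply (bd _ _ _ _ HSb2); [unfold M; lra|exact Hx].
  - intros x. apply derive_continuity_pt with (ah x), Hint.
  - intros x Hx. rewrite <- HEa by exact Hx. apply Hint.
  - intros l r eps mu u [Hl Hr Heps Hmu0 Hmu _] [Hu1 [Hu2 [Hu3 Hu4]]].
    assert (He0 : 0 < eps) by (rewrite Heps; apply Rdiv_lt_0_compat; nra).
    assert (He : 0 <= eps <= C0 / l).
    { split; [lra|]. apply Rle_trans with (ga * al / l).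
      - rewrite Heps. apply Rmult_le_compat_l; [lra|]. apply Rinv_le_contravar; nra.
      - apply Rmult_le_compat_r; [left; apply Rinv_0_lt_compat; lra|unfold C0; lra]. }
    assert (Hm : 0 <= mu <= C0 / l).
    { split; [lra|]. apply Rle_trans with (ga / l).
      - eapply Rle_trans; [exact Hmu|]. apply Rmult_le_compat_l; [lra|]. apply Rinv_le_contravar; lra.
      - apply Rmult_le_compat_r; [left; apply Rinv_0_lt_compat; lra|unfold C0; lra]. }
    assert (Hil : 0 < / l < 1).
    { split; [apply Rinv_0_lt_compat; lra|]. rewrite <- Rinv_1. apply Rinv_lt_contravar; lra. }
    destruct (O7 l eps mu B0 v0 Hl He Hm HSv0) as [p0 [q0 [dv0 [dp0 [Sp0 [Sq0 [_ Sv1]]]]]]].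
    fold D1 in Sv1. set (v1 := fun x => q x * (eps * q0 x + - mu * (ah x * p0 x))) in *.
    destruct (O5 l eps mu _ v1 Hl He Hm Sv1) as [p1 [q1 [dv1 [dp1 [Sp1 [Sq1 [_ Sv2]]]]]]].
    set (v2 := fun x => q x * (eps * q1 x + - mu * (ah x * p1 x))) in *.
    destruct (O3 l eps mu _ v2 Hl He Hm Sv2) as [p2 [q2 [dv2 [dp2 [Sp2 [Sq2 [Sg _]]]]]]].
    set (g := fun x => eps * q2 x + - mu * (ah x * p2 x)) in *.
    replace (C3 * (C5 * (D1 / l) / l) / l) with (D3 / l ^ 3) in Sg by (unfold D3, D2; field; lra).
    replace (C5 * (D1 / l) / l) with (D2 / l ^ 2) in * by (unfold D2; field; lra).
    assert (L1 : D1 / l <= D1) by (unfold Rdiv; nra).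
    assert (L2 : D2 / l ^ 2 <= D2).
    { replace (D2 / l ^ 2) with (D2 * / l * / l) by (field; lra).
      assert (D2 * / l <= D2) by nra. assert (0 <= D2 * / l) by nra. nra. }
    apply (Sm_mono _ _ D1) in Sv1; [|exact L1]. apply (Sm_mono _ _ D1) in Sp1; [|exact L1].
    apply (Sm_mono _ _ D1) in Sq1; [|exact L1].
    apply (Sm_mono _ _ D2) in Sv2; [|exact L2]. apply (Sm_mono _ _ D2) in Sp2; [|exact L2].
    apply (Sm_mono _ _ D2) in Sq2; [|exact L2].
    assert (sum : forall j k0 k1 k2 h0 h1 h2, (j <= k0)%nat -> (j <= k1)%nat -> (j <= k2)%nat ->
       Sm k0 B0 h0 -> Sm k1 D1 h1 -> Sm k2 D2 h2 ->
       Sm j (B0 + (D1 + D2)) (fun x => h0 x + (h1 x + h2 x))).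
    { intros j k0 k1 k2 h0 h1 h2 J0 J1 J2 S0 S1 S2. apply (Sm_plus j _ _ h0 (fun x => h1 x + h2 x)).
      - apply (Sm_le j k0); auto.
      - apply Sm_plus; [apply (Sm_le j k1)|apply (Sm_le j k2)]; auto. }
    pose proof (sum 1 9 7 5 _ _ _ ltac:(lia) ltac:(lia) ltac:(lia) HSv0 Sv1 Sv2)%nat as SV.
    pose proof (sum 1 7 5 3 _ _ _ ltac:(lia) ltac:(lia) ltac:(lia) Sp0 Sp1 Sp2)%nat as SP.
    pose proof (sum 1 7 5 3 _ _ _ ltac:(lia) ltac:(lia) ltac:(lia) Sq0 Sq1 Sq2)%nat as SQ.
    pose proof SQ as SQ'. destruct SQ' as [_ [_ [V3 [dQ SV3]]]].
    destruct Sg as [Cg [Bg [g1 [dg Sg1]]]]. destruct Sg1 as [_ [Bg1 [g2 [dg1 Sg2]]]].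
    exists (fun x => u (clamp x)), (fun x => v0 x + (v1 x + v2 x)), (fun x => p0 x + (p1 x + p2 x)),
      (fun x => q0 x + (q1 x + q2 x)), V3, g, g1, g2.
    assert (bd : forall k B h x, Sm k B h -> B <= M -> 0 <= x <= 1 -> Rabs (h x) <= M).
    { intros k B h x HS HB Hx. eapply Rle_trans; [apply (Sm_bound _ _ _ HS x); lra|exact HB]. }
    assert (HBM : B0 + (D1 + D2) <= M) by (unfold M; lra).
    assert (du : forall x, 0 < x < 1 -> is_derive u x (Derive u x)).
    { intros x Hx. apply Derive_correct. apply (Hu4 x Hx). }
    assert (dut : forall x, 0 < x < 1 -> is_derive (fun x => u (clamp x)) x (Derive u x)).
    { intros x Hx. apply (is_derive_local_eq u); auto. intros t Ht. rewrite clamp_id; [auto|lra]. }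
    assert (dv : forall x, 0 < x < 1 -> is_derive (fun x => v0 x + (v1 x + v2 x)) x (p0 x + (p1 x + p2 x))).
    { intros x Hx. apply @is_derive_plus; [auto|]. apply @is_derive_plus; auto. }
    assert (dp : forall x, 0 < x < 1 -> is_derive (fun x => p0 x + (p1 x + p2 x)) x (q0 x + (q1 x + q2 x))).
    { intros x Hx. apply @is_derive_plus; [auto|]. apply @is_derive_plus; auto. }
    assert (cu : forall x, continuity_pt (fun x => u (clamp x)) x) by (apply clamp_continuous, Hu1).
    assert (HDl : D3 / l ^ 3 <= M / l ^ 3).
    { apply Rmult_le_compat_r; [left; apply Rinv_0_lt_compat, pow_lt; lra|unfold M; lra]. }
    constructor; auto.
    + intros x Hx. now rewrite clamp_id.
    + apply (Sm_cont _ _ _ SV).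
    + intros x Hx. apply (bd _ _ _ x SP); auto; lra.
    + intros x Hx. apply (bd _ _ _ x SQ); auto; lra.
    + intros x Hx. apply (bd _ _ _ x SV3); auto; lra.
    + constructor; auto.
      * intros x _. apply continuity_pt_minus; [apply cu|apply (Sm_cont _ _ _ SV)].
      * rewrite clamp_id, Hu2 by lra. rewrite Rminus_0_l, Rabs_Ropp. apply (bd _ _ _ 0 SV); auto; lra.
      * rewrite clamp_id, Hu3 by lra. rewrite Rminus_0_l, Rabs_Ropp. apply (bd _ _ _ 1 SV); auto; lra.
      * intros x Hx. apply @is_derive_minus; auto.
      * intros x Hx. destruct (Hu4 x Hx) as [_ [He2 Hode]].
        (* The sum telescopes: b v0 = f cancels the right-hand side, b v1 and b v2 cancel the
           remainders of the terms before them, and only the remainder [g] of [v2] is left. *)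
        assert (E : (mu * a x * (Derive u x - (p0 x + (p1 x + p2 x))) +
           b x * (u (clamp x) - (v0 x + (v1 x + v2 x))) - g x) / eps
           = Derive_n u 2 x - (q0 x + (q1 x + q2 x))).
        { rewrite clamp_id by lra. unfold g, v2, v1, v0, q. rewrite <- HEb by exact Hx.
          rewrite HEa, HEf by exact Hx. rewrite <- Hode, HEb by exact Hx.
          assert (b x <> 0) by (rewrite <- HEb by exact Hx; specialize (Hbl x); lra).
          field. lra. }
        rewrite E. apply @is_derive_minus; [|auto].
        apply (Derive_correct (Derive_n u 1)). exact He2.
      * intros x Hx. eapply Rle_trans; [apply Bg; lra|exact HDl].
      * intros x Hx. eapply Rle_trans; [apply Bg1; lra|exact HDl].
      * intros x Hx. eapply Rle_trans; [apply (Sm_bound _ _ _ Sg2); lra|exact HDl].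
Qed.

(** * Difference operators and slopes of mesh functions *)

Ltac mul_nonneg := first [lra | apply Rmult_le_pos; mul_nonneg].
Ltac mul_pos := first [lra | apply Rmult_lt_0_compat; mul_pos].

Definition slp (x e : nat -> R) (j : nat) : R := (e (S j) - e j) / (x (S j) - x j).

(* The upwind operator at the node [S j]. *)
Definition op (eps mu : R) (av bv x e : nat -> R) (j : nat) : R :=
  - eps * ((slp x e (S j) - slp x e j) / ((x (S (S j)) - x j) / 2))
  + mu * av (S j) * slp x e j + bv (S j) * e (S j).

(** The discrete counterpart of exp(lam x_i): its slope on a cell is [lam] times its value at the
    left end of the cell. *)
Fixpoint gr (lam : R) (x : nat -> R) (i : nat) : R :=
  match i with
  | O => 1
  | S j => gr lam x j * (1 + lam * (x (S j) - x j))
  end.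

(** The rates l/2 and r/2 are below those of [EL] and [ER]. This pays for the factor up to 2 by
    which the step in the second difference may differ from a cell width, and leaves room in the
    supersolution inequalities. *)
Definition BL (l : R) (x : nat -> R) (i : nat) : R := / gr (l / 2) x i.
Definition BR (r : R) (N : nat) (x : nat -> R) (i : nat) : R := gr (r / 2) x i / gr (r / 2) x N.

(* The mesh has 4 n cells, of the widths [hL], [H] and [hR]. *)
Record dmesh {n : nat} {l r eta hL H hR : R} {x : nat -> R} : Prop := {
  dm_n : (1 <= n)%nat;
  dm_0 : x 0%nat = 0;
  dm_1 : x (4 * n)%nat = 1;
  dm_hL : 0 < hL;
  dm_H : 0 < H;
  dm_hR : 0 < hR;
  dm_left : forall i, (i < n)%nat -> x (S i) - x i = hL;
  dm_mid : forall i, (n <= i < 3 * n)%nat -> x (S i) - x i = H;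
  dm_right : forall i, (3 * n <= i < 4 * n)%nat -> x (S i) - x i = hR;
  dm_eta : 0 < eta <= 1;
  dm_hL_le : hL <= 8 * eta / l;
  dm_hR_le : hR <= 16 * eta / r;
  dm_H_ge : 1 / INR (4 * n) <= H;
  dm_H_le : H <= 2 / INR (4 * n);
  dm_sL : 1 / (4 * l) <= INR n * hL;
  dm_sR : 1 / (4 * r) <= INR n * hR }.
Arguments dmesh : clear implicits.

Record dcoef {al ga M : R} {n : nat} {x av bv : nat -> R} : Prop := {
  dc_al : 0 < al;
  dc_ga : 0 < ga;
  dc_M : 1 <= M;
  dc_a_lower : forall i, (0 < i < 4 * n)%nat -> al < av i;
  dc_b_lower : forall i, (0 < i < 4 * n)%nat -> ga * av i < bv i;
  dc_a : forall i, (i <= 4 * n)%nat -> Rabs (av i) <= M;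
  dc_b : forall i, (0 < i < 4 * n)%nat -> Rabs (bv i) <= M;
  dc_da : forall i, (i < 4 * n)%nat -> Rabs (av (S i) - av i) <= M * (x (S i) - x i) }.
Arguments dcoef : clear implicits.

Lemma op_minus eps mu av bv x e e' j :
  op eps mu av bv x (fun i => e i - e' i) j = op eps mu av bv x e j - op eps mu av bv x e' j.
Proof. unfold op, slp, Rdiv. ring. Qed.

Lemma op_plus eps mu av bv x e e' j :
  op eps mu av bv x (fun i => e i + e' i) j = op eps mu av bv x e j + op eps mu av bv x e' j.
Proof. unfold op, slp, Rdiv. ring. Qed.

Lemma op_scal eps mu av bv x c e j :
  op eps mu av bv x (fun i => c * e i) j = c * op eps mu av bv x e j.
Proof. unfold op, slp, Rdiv. ring. Qed.

Lemma op_const eps mu av bv x c j : op eps mu av bv x (fun _ => c) j = bv (S j) * c.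
Proof. unfold op, slp, Rdiv. ring. Qed.

Lemma nat_argmin (Z : nat -> R) (N : nat) :
  exists m, (m <= N)%nat /\ forall i, (i <= N)%nat -> Z m <= Z i.
Proof.
  induction N as [|N [m [Hm Hmin]]].
  - exists 0%nat. split; [lia|]. intros i Hi. replace i with 0%nat by lia. lra.
  - destruct (Rle_dec (Z m) (Z (S N))) as [H|H].
    + exists m. split; [lia|]. intros i Hi.
      destruct (Nat.eq_dec i (S N)) as [->|]; [exact H|apply Hmin; lia].
    + exists (S N). split; [lia|]. intros i Hi.
      destruct (Nat.eq_dec i (S N)) as [->|]; [lra|].
      apply Rle_trans with (Z m); [lra|apply Hmin; lia].
Qed.

(** At a negative minimum the backward slope is nonpositive and the forward slope nonnegative.
    Because the convection term is upwinded, it has the favourable sign there for arbitrary mesh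
    widths. *)
Lemma discrete_maximum_principle eps mu av bv (x Z : nat -> R) (N : nat) :
  0 < eps -> 0 <= mu ->
  (forall i, (i < N)%nat -> x i < x (S i)) ->
  (forall i, (0 < i < N)%nat -> 0 <= av i) ->
  (forall i, (0 < i < N)%nat -> 0 < bv i) ->
  (forall j, (S j < N)%nat -> 0 <= op eps mu av bv x Z j) ->
  0 <= Z 0%nat -> 0 <= Z N ->
  forall i, (i <= N)%nat -> 0 <= Z i.
Proof.
  intros He Hmu Hx Ha Hb Hop H0 HN i Hi.
  destruct (nat_argmin Z N) as [m [Hm Hmin]].
  apply Rle_trans with (Z m); [|apply Hmin, Hi].
  destruct (Rle_lt_dec 0 (Z m)) as [H|H]; [exact H|exfalso].
  destruct m as [|j]; [lra|].
  assert (HjN : (S j < N)%nat) by (destruct (Nat.eq_dec (S j) N) as [E|]; [rewrite E in H; lra|lia]).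
  specialize (Hop j HjN).
  assert (X1 : x j < x (S j)) by (apply Hx; lia).
  assert (X2 : x (S j) < x (S (S j))) by (apply Hx; lia).
  assert (Z1 : Z (S j) <= Z j) by (apply Hmin; lia).
  assert (Z2 : Z (S j) <= Z (S (S j))) by (apply Hmin; lia).
  assert (P1 : 0 <= slp x Z (S j)).
  { unfold slp. apply Rmult_le_pos; [lra|left; apply Rinv_0_lt_compat; lra]. }
  assert (P2 : slp x Z j <= 0).
  { unfold slp, Rdiv. assert (0 < / (x (S j) - x j)) by (apply Rinv_0_lt_compat; lra). nra. }
  assert (P3 : 0 <= (slp x Z (S j) - slp x Z j) / ((x (S (S j)) - x j) / 2)).
  { apply Rmult_le_pos; [lra|left; apply Rinv_0_lt_compat; lra]. }
  assert (A1 : 0 <= mu * av (S j)) by (apply Rmult_le_pos; [lra|apply Ha; lia]).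
  assert (B1 : 0 < bv (S j)) by (apply Hb; lia).
  unfold op in Hop. assert (mu * av (S j) * slp x Z j <= 0) by nra.
  assert (bv (S j) * Z (S j) < 0) by nra. nra.
Qed.

Section Growth.

Variables (lam : R) (x : nat -> R) (N : nat).
Hypothesis Hlam : 0 < lam.
Hypothesis Hx : forall i, (i < N)%nat -> x i < x (S i).

Lemma gr_pos i : (i <= N)%nat -> 0 < gr lam x i.
Proof.
  induction i as [|i IH]; intros Hi; simpl; [lra|].
  assert (x i < x (S i)) by (apply Hx; lia). assert (0 < gr lam x i) by (apply IH; lia).
  apply Rmult_lt_0_compat; nra.
Qed.

Lemma gr_mono i j : (i <= j <= N)%nat -> gr lam x i <= gr lam x j.
Proof.
  intros [Hij HjN]. induction j as [|j IH]; [replace i with 0%nat by lia; lra|].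
  destruct (Nat.eq_dec i (S j)) as [->|]; [lra|].
  assert (x j < x (S j)) by (apply Hx; lia).
  assert (gr lam x i <= gr lam x j) by (apply IH; lia).
  assert (0 < gr lam x j) by (apply gr_pos; lia).
  assert (0 < lam * (x (S j) - x j)) by (apply Rmult_lt_0_compat; lra).
  simpl. nra.
Qed.

Lemma gr_le_exp i j : (i <= j <= N)%nat -> gr lam x j <= gr lam x i * exp (lam * (x j - x i)).
Proof.
  intros [Hij HjN]. induction j as [|j IH].
  - replace i with 0%nat by lia. rewrite Rminus_diag, Rmult_0_r, exp_0. lra.
  - destruct (Nat.eq_dec i (S j)) as [->|].
    + rewrite Rminus_diag, Rmult_0_r, exp_0. lra.
    + assert (Hj : x j < x (S j)) by (apply Hx; lia).
      assert (IH' := IH ltac:(lia) ltac:(lia)).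
      replace (lam * (x (S j) - x i)) with (lam * (x j - x i) + lam * (x (S j) - x j)) by ring.
      rewrite exp_plus, <- Rmult_assoc. simpl.
      assert (0 < gr lam x j) by (apply gr_pos; lia).
      assert (0 < lam * (x (S j) - x j)) by (apply Rmult_lt_0_compat; lra).
      apply Rmult_le_compat; try lra. apply exp_ineq1_le.
Qed.

(** From 1 - t + t^2 <= exp(-(t - t^2)) and (1 - t + t^2)(1 + t) = 1 + t^3 >= 1. *)
Lemma exp_sub_sq_le t : 0 <= t -> exp (t - t ^ 2) <= 1 + t.
Proof.
  intros Ht. pose proof (exp_ineq1_le (- (t - t ^ 2))) as H.
  rewrite exp_Ropp in H. pose proof (exp_pos (t - t ^ 2)) as Hp.
  assert (H1 : 0 < 1 - t + t ^ 2) by nra.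
  assert (H2 : (1 - t + t ^ 2) * exp (t - t ^ 2) <= 1).
  { apply Rle_trans with (/ exp (t - t ^ 2) * exp (t - t ^ 2)).
    - apply Rmult_le_compat_r; lra.
    - right. field. lra. }
  assert (H3 : 1 <= (1 - t + t ^ 2) * (1 + t)).
  { assert (0 <= t ^ 3) by (apply pow_le; lra).
    replace ((1 - t + t ^ 2) * (1 + t)) with (1 + t ^ 3) by ring. lra. }
  apply Rmult_le_reg_l with (1 - t + t ^ 2); lra.
Qed.

(** The discrete exponential falls short of the true one by the exponent lam^2 h (x_j - x_i) at
    most. On the fine parts of the mesh this is of order eta ln N, hence bounded. *)
Lemma gr_ge_exp h i j : (i <= j <= N)%nat ->
  (forall k, (i <= k < j)%nat -> x (S k) - x k = h) ->
  gr lam x i * exp (lam * (x j - x i) - lam ^ 2 * h * (x j - x i)) <= gr lam x j.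
Proof.
  intros [Hij HjN] Hu. induction j as [|j IH].
  - replace i with 0%nat by lia. rewrite !Rminus_diag, !Rmult_0_r, Rminus_diag, exp_0. lra.
  - destruct (Nat.eq_dec i (S j)) as [->|].
    + rewrite !Rminus_diag, !Rmult_0_r, Rminus_diag, exp_0. lra.
    + assert (Hj : x j < x (S j)) by (apply Hx; lia).
      assert (Hh : x (S j) - x j = h) by (apply Hu; lia).
      assert (IH' := IH ltac:(lia) ltac:(lia) ltac:(intros; apply Hu; lia)).
      replace (lam * (x (S j) - x i) - lam ^ 2 * h * (x (S j) - x i))
        with (lam * (x j - x i) - lam ^ 2 * h * (x j - x i) + (lam * h - (lam * h) ^ 2))
        by (rewrite <- Hh; ring).
      rewrite exp_plus, <- Rmult_assoc. simpl gr. rewrite Hh.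
      assert (0 < gr lam x i) by (apply gr_pos; lia).
      apply Rmult_le_compat.
      * apply Rmult_le_pos; [lra|left; apply exp_pos].
      * left; apply exp_pos.
      * exact IH'.
      * apply exp_sub_sq_le. nra.
Qed.

End Growth.

(** Cells may be much narrower than the layer, so the flux argument runs on a block of cells with
    the prescribed total length, up to one cell. *)
Lemma block_size (n0 : nat) (h ell : R) :
  0 < h -> 0 < ell -> ell <= INR n0 * h ->
  exists m, (1 <= m <= n0)%nat /\ ell <= INR m * h /\ INR m * h <= ell + h.
Proof.
  intros Hh Hel. induction n0 as [|n0 IH]; intros Hn.
  - simpl in Hn. lra.
  - destruct (Rle_dec ell (INR n0 * h)) as [C|C].
    + destruct (IH C) as [m [Hm1 Hm2]]. exists m. split; [lia|exact Hm2].
    + exists (S n0). split; [lia|]. split; [exact Hn|]. rewrite S_INR. lra.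
Qed.

Lemma uniform_nodes (x : nat -> R) (s k : nat) (h : R) :
  (forall i, (s <= i < s + k)%nat -> x (S i) - x i = h) -> x (s + k)%nat - x s = INR k * h.
Proof.
  induction k as [|k IH]; intros Hu.
  - rewrite Nat.add_0_r. simpl. ring.
  - rewrite S_INR. replace (s + S k)%nat with (S (s + k)) by lia.
    assert (E := Hu (s + k)%nat ltac:(lia)). assert (E' := IH ltac:(intros; apply Hu; lia)). lra.
Qed.

(* Discrete counterpart of [local_derivative_bound]: on uniform cells the flux
   [eps p_j - ka_j e_j] varies slowly, hence so does the slope [p_j]. *)
Lemma block_flux (eps mu K K1 Mb E T h : R) (av bv x e : nat -> R) (s m : nat) :
  0 < eps -> 0 < h -> (1 <= m)%nat -> 0 <= K1 -> 0 <= Mb -> 0 <= T ->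
  (forall i, (s <= i < s + m)%nat -> x (S i) - x i = h) ->
  (forall i, (s <= i <= s + m)%nat -> Rabs (mu * av i) <= K) ->
  (forall i, (s <= i < s + m)%nat -> Rabs (mu * av (S i) - mu * av i) <= K1 * h) ->
  (forall i, (s < i < s + m)%nat -> Rabs (bv i) <= Mb) ->
  (forall i, (s <= i <= s + m)%nat -> Rabs (e i) <= E) ->
  (forall i, (s <= i)%nat -> (S i < s + m)%nat -> Rabs (op eps mu av bv x e i) <= T) ->
  forall j, (s <= j < s + m)%nat ->
    Rabs (slp x e j) <= 2 * E / (INR m * h)
      + (2 * K * E + INR m * h * ((K1 + Mb) * E + T)) / eps.
Proof.
  intros He Hh Hm1 HK1 HMb HT0 Hx HK HdK HB HE HT j Hj.
  set (D := (K1 + Mb) * E + T).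
  assert (HE0 : 0 <= E) by (eapply Rle_trans; [apply Rabs_pos|apply (HE s); lia]).
  assert (HK0 : 0 <= K) by (eapply Rle_trans; [apply Rabs_pos|apply (HK s); lia]).
  set (F := fun i => eps * slp x e i - mu * av i * e i).
  assert (HF1 : forall i, (s <= i)%nat -> (S i < s + m)%nat -> Rabs (F (S i) - F i) <= h * D).
  { intros i Hi1 Hi2.
    pose proof (Hx i ltac:(lia)) as X1. pose proof (Hx (S i) ltac:(lia)) as X2.
    (* On two equal cells the increment of the flux is [h] times the operator, up to the reaction
       term and the variation of the convection coefficient. *)
    assert (Ei : F (S i) - F i = - ((mu * av (S i) - mu * av i) * e i)
                  + h * (bv (S i) * e (S i) - op eps mu av bv x e i)).
    { assert (Es : h * slp x e i = e (S i) - e i) by (unfold slp; rewrite X1; field; lra).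
      unfold F, op. replace (x (S (S i)) - x i) with (2 * h) by lra.
      replace (h * (bv (S i) * e (S i) - (- eps * ((slp x e (S i) - slp x e i) / (2 * h / 2))
          + mu * av (S i) * slp x e i + bv (S i) * e (S i))))
        with (eps * (slp x e (S i) - slp x e i) - mu * av (S i) * (h * slp x e i)) by (field; lra).
      rewrite Es. ring. }
    rewrite Ei.
    replace (h * D) with (K1 * h * E + h * (Mb * E + T)) by (unfold D; ring).
    apply Rabs_plus_le.
    - rewrite Rabs_Ropp. apply Rabs_mult_le; [apply HdK; lia|apply HE; lia].
    - apply Rabs_mult_le; [rewrite Rabs_pos_eq; lra|].
      apply Rabs_minus_le; [|apply HT; lia].
      apply Rabs_mult_le; [apply HB; lia|apply HE; lia]. }
  assert (HD0 : 0 <= D) by (unfold D; nra).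
  assert (HhD : 0 <= h * D) by nra.
  assert (HFk : forall k i, (s <= i)%nat -> (i + k < s + m)%nat -> Rabs (F (i + k)%nat - F i) <= INR k * (h * D)).
  { induction k as [|k IH]; intros i Hi1 Hi2.
    - rewrite Nat.add_0_r, Rminus_diag, Rabs_R0. simpl. lra.
    - replace (i + S k)%nat with (S (i + k)) by lia. rewrite S_INR.
      replace (F (S (i + k)) - F i) with ((F (i + k)%nat - F i) + (F (S (i + k)) - F (i + k)%nat)) by ring.
      replace ((INR k + 1) * (h * D)) with (INR k * (h * D) + h * D) by ring.
      apply Rabs_plus_le; [apply IH; lia|apply HF1; lia]. }
  assert (HFF : forall i i', (s <= i <= i')%nat -> (i' < s + m)%nat -> Rabs (F i' - F i) <= INR m * h * D).
  { intros i i' Hi Hi'. replace i' with (i + (i' - i))%nat by lia.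
    eapply Rle_trans; [apply HFk; lia|]. rewrite (Rmult_assoc (INR m)). apply Rmult_le_compat_r; [lra|].
    apply le_INR. lia. }
  set (D' := (2 * K * E + INR m * h * D) / eps).
  assert (HP : forall i, (s <= i < s + m)%nat -> Rabs (slp x e i - slp x e j) <= D').
  { intros i Hi.
    replace (slp x e i - slp x e j) with ((F i - F j + (mu * av i * e i - mu * av j * e j)) / eps)
      by (unfold F; field; lra).
    apply Rabs_div_le; [lra|].
    replace (2 * K * E + INR m * h * D) with (INR m * h * D + (K * E + K * E)) by ring.
    apply Rabs_plus_le.
    - destruct (le_lt_dec j i) as [C|C]; [apply HFF; lia|]. rewrite Rabs_minus_sym. apply HFF; lia.
    - apply Rabs_minus_le; (apply Rabs_mult_le; [apply HK; lia|apply HE; lia]). }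
  (* Summation over the block compares the slope on cell [j] with the mean slope, which the end
     values of the block control. *)
  assert (HS : forall k, (k <= m)%nat -> Rabs (e (s + k)%nat - e s - INR k * h * slp x e j) <= INR k * h * D').
  { induction k as [|k IH]; intros Hk.
    - rewrite Nat.add_0_r. simpl. rewrite !Rmult_0_l, Rminus_diag, Rminus_0_r, Rabs_R0. lra.
    - replace (s + S k)%nat with (S (s + k)) by lia. rewrite S_INR.
      pose proof (Hx (s + k)%nat ltac:(lia)) as X1.
      assert (Es : h * slp x e (s + k)%nat = e (S (s + k)) - e (s + k)%nat)
        by (unfold slp; rewrite X1; field; lra).
      replace (e (S (s + k)) - e s - (INR k + 1) * h * slp x e j)
        with ((e (s + k)%nat - e s - INR k * h * slp x e j) + h * (slp x e (s + k)%nat - slp x e j)) by lra.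
      replace ((INR k + 1) * h * D') with (INR k * h * D' + h * D') by ring.
      apply Rabs_plus_le; [apply IH; lia|].
      apply Rabs_mult_le; [rewrite Rabs_pos_eq; lra|apply HP; lia]. }
  specialize (HS m ltac:(lia)). fold D'.
  assert (Hmp : 0 < INR m * h) by (apply Rmult_lt_0_compat; [apply lt_0_INR; lia|lra]).
  replace (slp x e j) with ((e (s + m)%nat - e s) / (INR m * h)
      - (e (s + m)%nat - e s - INR m * h * slp x e j) / (INR m * h))
    by (field; split; [lra|apply not_0_INR; lia]).
  replace D' with (INR m * h * D' / (INR m * h)) by (field; split; [lra|apply not_0_INR; lia]).
  apply Rabs_minus_le; apply Rabs_div_le; try lra.
  replace (2 * E) with (E + E) by ring. apply Rabs_minus_le; apply HE; lia.
Qed.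

(** * Stability of the upwind scheme in the maximum norm *)

Section Discrete.

Context {al ga M l r eps mu eta hL H hR : R} {n : nat} {x av bv : nat -> R}.
Hypothesis Hp : pars al ga l r eps mu.
Hypothesis Hm : dmesh n l r eta hL H hR x.
Hypothesis Hc : dcoef al ga M n x av bv.

Let Hal : 0 < al := dc_al Hc.
Let Hga : 0 < ga := dc_ga Hc.
Let HM : 1 <= M := dc_M Hc.
Let Hl : 1 < l := pars_l Hp.
Let Hr : 2 * l <= r := pars_r Hp.
Let Hmu0 : 0 <= mu := pars_mu0 Hp.

Lemma mesh_incr i : (i < 4 * n)%nat -> x i < x (S i).
Proof.
  intros Hi. pose proof (dm_hL Hm). pose proof (dm_H Hm).
  pose proof (dm_hR Hm).
  destruct (le_lt_dec n i) as [C1|C1].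
  - destruct (le_lt_dec (3 * n) i) as [C2|C2].
    + pose proof (dm_right Hm i ltac:(lia)). lra.
    + pose proof (dm_mid Hm i ltac:(lia)). lra.
  - pose proof (dm_left Hm i C1). lra.
Qed.

Lemma d_eps_pos : 0 < eps.
Proof. rewrite (pars_eps Hp). apply Rdiv_lt_0_compat; nra. Qed.

Lemma d_b_pos i : (0 < i < 4 * n)%nat -> ga * al < bv i.
Proof.
  intros Hi. pose proof (dc_a_lower Hc i Hi).
  pose proof (dc_b_lower Hc i Hi). nra.
Qed.

Lemma BL_pos i : (i <= 4 * n)%nat -> 0 < BL l x i.
Proof.
  intros Hi. apply Rinv_0_lt_compat, (gr_pos _ _ (4 * n)); [lra|apply mesh_incr|exact Hi].
Qed.

Lemma BR_pos i : (i <= 4 * n)%nat -> 0 < BR r (4 * n) x i.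
Proof.
  intros Hi. apply Rdiv_lt_0_compat; (apply (gr_pos _ _ (4 * n)); [lra|apply mesh_incr|lia]).
Qed.

Lemma BL_step j : (j < 4 * n)%nat -> BL l x j = BL l x (S j) * (1 + l / 2 * (x (S j) - x j)).
Proof.
  intros Hj. unfold BL. simpl. pose proof (mesh_incr j Hj).
  assert (0 < gr (l / 2) x j) by (apply (gr_pos _ _ (4 * n)); [lra|apply mesh_incr|lia]).
  assert (0 < l / 2 * (x (S j) - x j)) by (apply Rmult_lt_0_compat; lra).
  field. split; [nra|lra].
Qed.

Lemma BR_step j : BR r (4 * n) x (S j) = BR r (4 * n) x j * (1 + r / 2 * (x (S j) - x j)).
Proof. unfold BR. simpl. unfold Rdiv. ring. Qed.

Lemma slp_BL j : (j < 4 * n)%nat -> slp x (BL l x) j = - (l / 2) * BL l x (S j).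
Proof.
  intros Hj. unfold slp. rewrite (BL_step j Hj). pose proof (mesh_incr j Hj). field. lra.
Qed.

Lemma slp_BR j : (j < 4 * n)%nat -> slp x (BR r (4 * n) x) j = r / 2 * BR r (4 * n) x j.
Proof.
  intros Hj. unfold slp. rewrite (BR_step j). pose proof (mesh_incr j Hj). field. lra.
Qed.

(** The ratio of the right cell to the step of the second difference is at most 2, which turns the
    rate l/2 into the diffusion term eps l^2 / 2 <= ga al / 8. Convection costs at most ga a / 4, so
    more than half of the reaction is left. *)
Lemma op_BL j : (S j < 4 * n)%nat ->
  ga * al / 2 * BL l x (S j) <= op eps mu av bv x (BL l x) j.
Proof.
  intros Hj. unfold op. rewrite !slp_BL by lia.
  pose proof (mesh_incr j ltac:(lia)) as X1. pose proof (mesh_incr (S j) Hj) as X2.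
  pose proof (BL_pos (S j) ltac:(lia)) as P1. pose proof (BL_pos (S (S j)) ltac:(lia)) as P2.
  pose proof (BL_step (S j) Hj) as E.
  set (h' := x (S (S j)) - x (S j)) in *. set (B := BL l x (S j)) in *. set (B' := BL l x (S (S j))) in *.
  pose proof d_eps_pos as He.
  assert (Hk : 0 < ga * al) by nra.
  assert (T : (- (l / 2) * B' - - (l / 2) * B) / ((x (S (S j)) - x j) / 2) <= l ^ 2 / 2 * B).
  { apply Rmult_le_reg_r with ((x (S (S j)) - x j) / 2); [lra|].
    unfold Rdiv at 1. rewrite Rmult_assoc, Rinv_l, Rmult_1_r by lra.
    assert (B - B' = l / 2 * h' * B') by (rewrite E; ring).
    assert (B' <= B).
    { assert (0 < l / 2 * h' * B') by (unfold h'; mul_pos). lra. }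
    replace (- (l / 2) * B' - - (l / 2) * B) with (l / 2 * (B - B')) by ring. rewrite H0.
    assert (l ^ 2 * h' * B' <= l ^ 2 * h' * B).
    { apply Rmult_le_compat_l; [|lra]. unfold h'. apply Rmult_le_pos; [apply pow_le|]; lra. }
    assert (l ^ 2 * h' * B <= l ^ 2 * (x (S (S j)) - x j) * B).
    { apply Rmult_le_compat_r; [lra|]. apply Rmult_le_compat_l; [apply pow_le; lra|]. unfold h'; lra. }
    lra. }
  assert (T2 : - eps * (l ^ 2 / 2 * B) <= - eps * ((- (l / 2) * B' - - (l / 2) * B) / ((x (S (S j)) - x j) / 2))).
  { rewrite !Ropp_mult_distr_l_reverse. apply Ropp_le_contravar. apply Rmult_le_compat_l; lra. }
  assert (El : eps * l ^ 2 <= ga * al / 4).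
  { rewrite (pars_eps Hp).
    replace (ga * al / (2 * l * r) * l ^ 2) with (ga * al * (l / (2 * r))) by (field; lra).
    unfold Rdiv at 2. apply Rmult_le_compat_l; [lra|].
    apply Rmult_le_reg_r with (2 * r); [lra|]. field_simplify; lra. }
  pose proof (mu_l _ _ _ _ Hp) as Hmul.
  pose proof (dc_a_lower Hc (S j) ltac:(lia)) as Ha.
  pose proof (dc_b_lower Hc (S j) ltac:(lia)) as Hb.
  assert (mu * l * av (S j) <= ga / 2 * av (S j)) by (apply Rmult_le_compat_r; lra).
  assert (Q : ga * al / 2 * B <= (bv (S j) - eps * l ^ 2 / 2 - mu * l * av (S j) / 2) * B).
  { apply Rmult_le_compat_r; [lra|]. nra. }
  lra.
Qed.

Lemma eps_r2 : eps * r ^ 2 = ga * al / 2 * (r / l).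
Proof. rewrite (pars_eps Hp). field. lra. Qed.

(** [q] isolates the effect of unequal cells: the left cell over the step of the second difference
    is below 2 in general and equals 1 on equal cells. The diffusion term is q eps r^2 / 4 = q (ga
    al / 8) (r / l). *)
Lemma op_BR_gen j q : (S j < 4 * n)%nat ->
  (x (S j) - x j) / ((x (S (S j)) - x j) / 2) <= q ->
  BR r (4 * n) x j * (- (q * (ga * al / 8 * (r / l))) + mu * av (S j) * r / 2 + ga * al)
   <= op eps mu av bv x (BR r (4 * n) x) j.
Proof.
  intros Hj Hq. unfold op. rewrite !slp_BR, !BR_step by lia.
  pose proof (mesh_incr j ltac:(lia)) as X1. pose proof (mesh_incr (S j) Hj) as X2.
  pose proof (BR_pos j ltac:(lia)) as P1. set (B := BR r (4 * n) x j) in *.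
  pose proof (d_b_pos (S j) ltac:(lia)) as Hb. pose proof eps_r2 as E2. pose proof d_eps_pos as He.
  set (h := x (S j) - x j) in *. set (hh := (x (S (S j)) - x j) / 2) in *.
  assert (Hh : 0 < h) by (unfold h; lra). assert (Hhh : 0 < hh) by (unfold hh; lra).
  replace (- eps * ((r / 2 * (B * (1 + r / 2 * h)) - r / 2 * B) / hh))
    with (- (h / hh * (eps * r ^ 2 / 4)) * B) by (field; lra).
  rewrite E2.
  assert (Hk : 0 < ga * al) by nra.
  assert (Hrl : 0 < r / l) by (apply Rdiv_lt_0_compat; lra).
  assert (T : h / hh * (ga * al / 2 * (r / l) / 4) <= q * (ga * al / 2 * (r / l) / 4)).
  { apply Rmult_le_compat_r; [nra|exact Hq]. }
  assert (T1 : bv (S j) * B <= bv (S j) * (B * (1 + r / 2 * h))).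
  { apply Rmult_le_compat_l; [lra|]. assert (0 < r / 2 * h) by nra. nra. }
  assert (T2 : ga * al * B <= bv (S j) * B) by (apply Rmult_le_compat_r; lra).
  assert (T3 : - (q * (ga * al / 2 * (r / l) / 4)) * B <= - (h / hh * (ga * al / 2 * (r / l) / 4)) * B)
    by (apply Rmult_le_compat_r; lra).
  lra.
Qed.

Lemma mu_av_r j : (S j < 4 * n)%nat -> r <> 2 * l -> ga * al / 2 * (r / l) <= mu * av (S j) * r.
Proof.
  intros Hj Hne. destruct (pars_case Hp) as [E|E]; [now elim Hne|].
  pose proof (dc_a_lower Hc (S j) ltac:(lia)) as Ha. rewrite E.
  replace (ga / (2 * l) * av (S j) * r) with (ga / 2 * (r / l) * av (S j)) by (field; lra).
  assert (Hrl : 0 < r / l) by (apply Rdiv_lt_0_compat; lra).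
  assert (0 < ga / 2 * (r / l)) by nra. nra.
Qed.

(** With q = 2, diffusion costs (ga al / 4) (r / l). If convection dominates, mu a r / 2 is at least
    exactly that; if r = 2 l, the cost is ga al / 2, which the reaction covers. *)
Lemma op_BR_nonneg j : (S j < 4 * n)%nat -> 0 <= op eps mu av bv x (BR r (4 * n) x) j.
Proof.
  intros Hj. eapply Rle_trans; [|apply (op_BR_gen j 2 Hj)].
  - pose proof (BR_pos j ltac:(lia)) as P1. apply Rmult_le_pos; [lra|].
    assert (Hk : 0 < ga * al) by nra.
    pose proof (dc_a_lower Hc (S j) ltac:(lia)) as Ha.
    destruct (Req_dec r (2 * l)) as [E|E].
    + replace (r / l) with 2 by (rewrite E; field; lra).
      assert (0 <= mu * av (S j) * r) by (mul_nonneg). lra.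
    + pose proof (mu_av_r j Hj E). lra.
  - pose proof (mesh_incr j ltac:(lia)) as X1. pose proof (mesh_incr (S j) Hj) as X2.
    apply Rmult_le_reg_r with ((x (S (S j)) - x j) / 2); [lra|].
    unfold Rdiv at 1. rewrite Rmult_assoc, Rinv_l, Rmult_1_r by lra. lra.
Qed.

(** With q = 1 half of the convection term survives. This surplus of order r/l absorbs consistency
    errors that are larger than the error itself by the factor r/l. *)
Lemma op_BR_uniform j : (3 * n <= j)%nat -> (S j < 4 * n)%nat ->
  ga * al / 8 * (r / l) * BR r (4 * n) x j <= op eps mu av bv x (BR r (4 * n) x) j.
Proof.
  intros Hj1 Hj. eapply Rle_trans; [|apply (op_BR_gen j 1 Hj)].
  - pose proof (BR_pos j ltac:(lia)) as P1. rewrite Rmult_comm. apply Rmult_le_compat_l; [lra|].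
    assert (Hk : 0 < ga * al) by nra.
    pose proof (dc_a_lower Hc (S j) ltac:(lia)) as Ha.
    destruct (Req_dec r (2 * l)) as [E|E].
    + replace (r / l) with 2 by (rewrite E; field; lra).
      assert (0 <= mu * av (S j) * r) by (mul_nonneg). lra.
    + pose proof (mu_av_r j Hj E). lra.
  - pose proof (dm_right Hm j ltac:(lia)) as X1.
    pose proof (dm_right Hm (S j) ltac:(lia)) as X2.
    pose proof (dm_hR Hm).
    replace (x (S (S j)) - x j) with (2 * hR) by lra. rewrite X1. right. field. lra.
Qed.

Lemma BR_step_le j : (3 * n <= j < 4 * n)%nat -> BR r (4 * n) x (S j) <= 9 * BR r (4 * n) x j.
Proof.
  intros Hj. rewrite BR_step. pose proof (dm_right Hm j Hj) as X1. rewrite X1.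
  pose proof (dm_hR_le Hm) as Hh. pose proof (dm_eta Hm) as Het.
  pose proof (BR_pos j ltac:(lia)) as P1.
  assert (r / 2 * hR <= 8).
  { apply Rle_trans with (r / 2 * (16 * eta / r)); [apply Rmult_le_compat_l; lra|].
    replace (r / 2 * (16 * eta / r)) with (8 * eta) by (field; lra). lra. }
  nra.
Qed.

(** The barrier is a multiple of A + eta BL + eta BR: the reaction handles A, [op_BL] the left layer
    and [op_BR_uniform] the factor r/l on the right. *)
Lemma nodal_error_bound (A c : R) (e : nat -> R) :
  0 <= A -> 0 <= c ->
  e 0%nat = 0 -> e (4 * n)%nat = 0 ->
  (forall j, (S j <= 3 * n)%nat ->
     Rabs (op eps mu av bv x e j) <= c * (A + eta * BL l x (S j))) ->
  (forall j, (3 * n < S j < 4 * n)%nat ->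
     Rabs (op eps mu av bv x e j) <= c * (A + eta * (r / l * BR r (4 * n) x (S j)))) ->
  forall i, (i <= 4 * n)%nat ->
    Rabs (e i) <= 72 / (ga * al) * c * (A + eta * BL l x i + eta * BR r (4 * n) x i).
Proof.
  intros HA Hc0 He0 HeN Hl1 Hr1 i Hi.
  assert (Hk : 0 < ga * al) by nra.
  (* 72 = 8 * 9: the constant ga al / 8 of [op_BR_uniform], and the factor 9 for moving [BR] from
     node [S j], where the data are measured, to node [j]. *)
  set (K := 72 / (ga * al)). assert (HK : 0 < K) by (apply Rdiv_lt_0_compat; lra).
  assert (HKk : K * (ga * al) = 72) by (unfold K; field; lra).
  pose proof (dm_eta Hm) as Het. pose proof (dm_n Hm) as Hn.
  assert (Hrl : 2 <= r / l).
  { apply Rmult_le_reg_r with l; [lra|]. unfold Rdiv. rewrite Rmult_assoc, Rinv_l; lra. }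
  set (W := fun i => K * c * (A + eta * BL l x i + eta * BR r (4 * n) x i)).
  assert (EW : forall j, op eps mu av bv x W j = K * c * (bv (S j) * A + eta * op eps mu av bv x (BL l x) j
        + eta * op eps mu av bv x (BR r (4 * n) x) j)).
  { intros j. unfold W. rewrite op_scal, op_plus, op_plus, !op_scal, op_const. reflexivity. }
  assert (HKc : 0 <= K * c) by nra.
  assert (LW : forall j, (S j < 4 * n)%nat -> Rabs (op eps mu av bv x e j) <= op eps mu av bv x W j).
  { intros j Hj. rewrite EW.
    pose proof (op_BL j Hj) as OL. pose proof (op_BR_nonneg j Hj) as OR.
    pose proof (d_b_pos (S j) ltac:(lia)) as Hb.
    pose proof (BL_pos (S j) ltac:(lia)) as P1. pose proof (BR_pos (S j) ltac:(lia)) as P2.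
    pose proof (BR_pos j ltac:(lia)) as P3.
    assert (HbA : ga * al * A <= bv (S j) * A) by (apply Rmult_le_compat_r; lra).
    assert (HOL : eta * (ga * al / 2 * BL l x (S j)) <= eta * op eps mu av bv x (BL l x) j)
      by (apply Rmult_le_compat_l; lra).
    destruct (le_lt_dec (S j) (3 * n)) as [Hj3|Hj3].
    - eapply Rle_trans; [apply Hl1, Hj3|].
      apply Rle_trans with (K * c * (ga * al * A + eta * (ga * al / 2 * BL l x (S j)) + 0)).
      + replace (K * c * (ga * al * A + eta * (ga * al / 2 * BL l x (S j)) + 0))
          with (K * (ga * al) * (c * (A + eta * BL l x (S j) / 2))) by field.
        rewrite HKk. assert (0 <= c * A) by nra.
        assert (0 <= c * (eta * BL l x (S j))) by (apply Rmult_le_pos; nra). nra.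
      + apply Rmult_le_compat_l; [lra|].
        assert (0 <= eta * op eps mu av bv x (BR r (4 * n) x) j) by (apply Rmult_le_pos; lra). lra.
    - eapply Rle_trans; [apply Hr1; lia|].
      pose proof (op_BR_uniform j ltac:(lia) Hj) as OU.
      pose proof (BR_step_le j ltac:(lia)) as S9.
      assert (HOU : eta * (ga * al / 8 * (r / l) * BR r (4 * n) x j)
                  <= eta * op eps mu av bv x (BR r (4 * n) x) j) by (apply Rmult_le_compat_l; lra).
      apply Rle_trans with (K * c * (ga * al * A + 0 + eta * (ga * al / 8 * (r / l) * BR r (4 * n) x j))).
      + replace (K * c * (ga * al * A + 0 + eta * (ga * al / 8 * (r / l) * BR r (4 * n) x j)))
          with (K * (ga * al) * (c * (A + eta * (r / l * BR r (4 * n) x j) / 8))) by (field; lra).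
        rewrite HKk. assert (0 <= c * A) by nra.
        assert (Hq : r / l * BR r (4 * n) x (S j) <= 9 * (r / l * BR r (4 * n) x j)) by nra.
        assert (Hq2 : eta * (r / l * BR r (4 * n) x (S j)) <= eta * (9 * (r / l * BR r (4 * n) x j)))
          by (apply Rmult_le_compat_l; lra).
        assert (Hq3 : c * (A + eta * (r / l * BR r (4 * n) x (S j)))
             <= c * (A + eta * (9 * (r / l * BR r (4 * n) x j)))) by (apply Rmult_le_compat_l; lra).
        lra.
      + apply Rmult_le_compat_l; [lra|].
        assert (0 <= eta * op eps mu av bv x (BL l x) j) by (assert (0 <= eta * (ga * al / 2 * BL l x (S j))) by (apply Rmult_le_pos; nra); lra). lra. }
  assert (HWpos : forall k, (k <= 4 * n)%nat -> 0 <= W k).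
  { intros k Hk'. unfold W. pose proof (BL_pos k Hk'). pose proof (BR_pos k Hk').
    apply Rmult_le_pos; [lra|]. nra. }
  assert (Ha0 : forall k, (0 < k < 4 * n)%nat -> 0 <= av k).
  { intros k Hk'. pose proof (dc_a_lower Hc k Hk'). lra. }
  assert (Hb0 : forall k, (0 < k < 4 * n)%nat -> 0 < bv k).
  { intros k Hk'. pose proof (d_b_pos k Hk'). lra. }
  fold (W i). apply Rabs_le.
  assert (P1 : 0 <= W i - e i).
  { apply (discrete_maximum_principle eps mu av bv x (fun k => W k - e k) (4 * n)); auto.
    - apply d_eps_pos.
    - apply mesh_incr.
    - intros j Hj. rewrite op_minus. specialize (LW j Hj). apply Rabs_le_between in LW. lra.
    - rewrite He0. pose proof (HWpos 0%nat ltac:(lia)). lra.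
    - rewrite HeN. pose proof (HWpos (4 * n)%nat ltac:(lia)). lra. }
  assert (P2 : 0 <= W i + e i).
  { apply (discrete_maximum_principle eps mu av bv x (fun k => W k + e k) (4 * n)); auto.
    - apply d_eps_pos.
    - apply mesh_incr.
    - intros j Hj. rewrite op_plus. specialize (LW j Hj). apply Rabs_le_between in LW. lra.
    - rewrite He0. pose proof (HWpos 0%nat ltac:(lia)). lra.
    - rewrite HeN. pose proof (HWpos (4 * n)%nat ltac:(lia)). lra. }
  lra.
Qed.

Lemma x_le i j : (i <= j <= 4 * n)%nat -> x i <= x j.
Proof.
  intros [Hij HjN]. induction j as [|j IH]; [replace i with 0%nat by lia; lra|].
  destruct (Nat.eq_dec i (S j)) as [->|]; [lra|].
  pose proof (mesh_incr j ltac:(lia)). assert (x i <= x j) by (apply IH; lia). lra.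
Qed.

(** The blocks of the flux argument are at most 17/r long, so the layer barriers vary over them by a
    bounded factor; exp 9 comes from the rate l/2 over the length 18/l. *)
Lemma BL_near i j : (i <= 4 * n)%nat -> (j <= 4 * n)%nat -> x j - x i <= 18 / l ->
  BL l x i <= exp 9 * BL l x j.
Proof.
  intros Hi Hj Hd. unfold BL.
  assert (Gi : 0 < gr (l / 2) x i) by (apply (gr_pos _ _ (4 * n)); [lra|apply mesh_incr|lia]).
  assert (Gj : 0 < gr (l / 2) x j) by (apply (gr_pos _ _ (4 * n)); [lra|apply mesh_incr|lia]).
  assert (G : gr (l / 2) x j <= exp 9 * gr (l / 2) x i).
  { destruct (le_lt_dec i j) as [C|C].
    - eapply Rle_trans; [apply (gr_le_exp _ _ (4 * n)); [lra|apply mesh_incr|split; [exact C|exact Hj]]|].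
      rewrite Rmult_comm. apply Rmult_le_compat_r; [lra|]. apply exp_mono.
      apply Rle_trans with (l / 2 * (18 / l)); [apply Rmult_le_compat_l; lra|]. right; field; lra.
    - apply Rle_trans with (1 * gr (l / 2) x i).
      + rewrite Rmult_1_l. apply (gr_mono _ _ (4 * n)); [lra|apply mesh_incr|lia].
      + apply Rmult_le_compat_r; [lra|]. rewrite <- exp_0. apply exp_mono. lra. }
  apply Rmult_le_reg_r with (gr (l / 2) x i * gr (l / 2) x j); [nra|].
  replace (/ gr (l / 2) x i * (gr (l / 2) x i * gr (l / 2) x j)) with (gr (l / 2) x j) by (field; lra).
  replace (exp 9 * / gr (l / 2) x j * (gr (l / 2) x i * gr (l / 2) x j))
    with (exp 9 * gr (l / 2) x i) by (field; lra). exact G.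
Qed.

Lemma BR_near i j : (i <= 4 * n)%nat -> (j <= 4 * n)%nat -> x i - x j <= 18 / r ->
  BR r (4 * n) x i <= exp 9 * BR r (4 * n) x j.
Proof.
  intros Hi Hj Hd. unfold BR.
  assert (GN : 0 < gr (r / 2) x (4 * n)) by (apply (gr_pos _ _ (4 * n)); [lra|apply mesh_incr|lia]).
  assert (Gj : 0 < gr (r / 2) x j) by (apply (gr_pos _ _ (4 * n)); [lra|apply mesh_incr|lia]).
  unfold Rdiv. rewrite <- Rmult_assoc. apply Rmult_le_compat_r; [left; apply Rinv_0_lt_compat, GN|].
  destruct (le_lt_dec j i) as [C|C].
  - eapply Rle_trans; [apply (gr_le_exp _ _ (4 * n)); [lra|apply mesh_incr|split; [exact C|exact Hi]]|].
    rewrite Rmult_comm. apply Rmult_le_compat_r; [lra|]. apply exp_mono.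
    apply Rle_trans with (r / 2 * (18 / r)); [apply Rmult_le_compat_l; lra|]. right; field; lra.
  - apply Rle_trans with (1 * gr (r / 2) x j).
    + rewrite Rmult_1_l. apply (gr_mono _ _ (4 * n)); [lra|apply mesh_incr|lia].
    + apply Rmult_le_compat_r; [lra|]. rewrite <- exp_0. apply exp_mono. lra.
Qed.

Definition Cblk : R := 8 + 2 / (ga * al) * (18 * (ga + 1) * M + 18).

(** [block_flux] on a block of length between 1/(4 r) and 17/r that contains cell [j]. After
    multiplication by 1/eps, of order l r, the values enter with the factor [r] and the residual
    with [l]. The bounds are needed only near the cell, so they may be layer functions frozen
    there. *)
Lemma block_slope (E T h : R) (e : nat -> R) (s0 n0 j : nat) :
  0 < h -> h <= 16 / r -> 1 / (4 * r) <= INR n0 * h -> 0 <= T ->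
  (s0 + n0 <= 4 * n)%nat ->
  (forall i, (s0 <= i < s0 + n0)%nat -> x (S i) - x i = h) ->
  (s0 <= j < s0 + n0)%nat ->
  (forall i, (s0 <= i <= s0 + n0)%nat -> Rabs (x i - x j) <= 17 / r -> Rabs (e i) <= E) ->
  (forall i, (s0 <= i)%nat -> (S i < s0 + n0)%nat -> Rabs (x (S i) - x j) <= 17 / r ->
     Rabs (op eps mu av bv x e i) <= T) ->
  Rabs (slp x e j) <= Cblk * (r * E + l * T).
Proof.
  intros Hh Hhr Hn0 HT Hs Hx Hj HE HTau.
  assert (Hk : 0 < ga * al) by nra.
  assert (Her : 0 < 1 / (4 * r)) by (apply Rdiv_lt_0_compat; lra).
  destruct (block_size n0 h (1 / (4 * r)) Hh Her Hn0) as [m [Hm1 [Hm2 Hm3]]].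
  (* The block starts at [j], or ends with the uniform region if it would overrun it. *)
  assert (Hsub : exists s, (s0 <= s /\ s + m <= s0 + n0 /\ s <= j < s + m)%nat).
  { destruct (le_lt_dec (j + m) (s0 + n0)); [exists j; lia|exists (s0 + n0 - m)%nat; lia]. }
  destruct Hsub as [s [S1 [S2 S3]]].
  assert (Hmh : INR m * h <= 17 / r).
  { eapply Rle_trans; [exact Hm3|]. apply Rle_trans with (1 / (4 * r) + 16 / r); [lra|].
    apply Rmult_le_reg_r with r; [lra|]. field_simplify; lra. }
  assert (Hnear : forall i, (s <= i <= s + m)%nat -> Rabs (x i - x j) <= 17 / r).
  { intros i Hi.
    assert (Xm : x (s + m)%nat - x s = INR m * h) by (apply uniform_nodes; intros; apply Hx; lia).
    assert (x s <= x i) by (apply x_le; lia). assert (x i <= x (s + m)%nat) by (apply x_le; lia).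
    assert (x s <= x j) by (apply x_le; lia). assert (x j <= x (s + m)%nat) by (apply x_le; lia).
    apply Rabs_le. lra. }
  pose proof (mu_l _ _ _ _ Hp) as Hmul.
  assert (Hmuga : mu <= ga) by nra.
  assert (HE0 : 0 <= E).
  { eapply Rle_trans; [apply Rabs_pos|apply (HE j); [lia|]]. rewrite Rminus_diag, Rabs_R0.
    apply Rlt_le, Rdiv_lt_0_compat; lra. }
  assert (HmM : 0 <= mu * M) by nra.
  pose proof d_eps_pos as He.
  assert (B := block_flux eps mu (mu * M) (mu * M) M E T h av bv x e s m He Hh ltac:(lia) HmM ltac:(lra) HT).
  assert (B1 : Rabs (slp x e j) <= 2 * E / (INR m * h)
      + (2 * (mu * M) * E + INR m * h * ((mu * M + M) * E + T)) / eps).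
  { apply B; clear B; try lia.
    - intros i Hi. apply Hx; lia.
    - intros i Hi. apply Rabs_mult_le; [rewrite Rabs_pos_eq; lra|apply (dc_a Hc); lia].
    - intros i Hi. rewrite <- Rmult_minus_distr_l, Rmult_assoc.
      apply Rabs_mult_le; [rewrite Rabs_pos_eq; lra|].
      eapply Rle_trans; [apply (dc_da Hc); lia|]. rewrite Hx by lia. lra.
    - intros i Hi. apply (dc_b Hc); lia.
    - intros i Hi. apply HE; [lia|apply Hnear, Hi].
    - intros i Hi1 Hi2. apply HTau; [lia|lia|apply Hnear; lia]. }
  clear B. eapply Rle_trans; [exact B1|].
  assert (P1 : 2 * E / (INR m * h) <= 8 * (r * E)).
  { apply Rmult_le_reg_r with (INR m * h); [lra|]. unfold Rdiv at 1.
    rewrite Rmult_assoc, Rinv_l, Rmult_1_r by lra.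
    apply Rle_trans with (8 * (r * E) * (1 / (4 * r))); [right; field; lra|].
    apply Rmult_le_compat_l; [|lra]. apply Rmult_le_pos; nra. }
  set (D := (mu * M + M) * E + T).
  assert (HD : D <= (ga + 1) * M * E + T).
  { unfold D. assert (mu * (M * E) <= ga * (M * E)) by (apply Rmult_le_compat_r; nra). lra. }
  assert (HD0 : 0 <= D) by (unfold D; nra).
  assert (P2 : (2 * (mu * M) * E + INR m * h * D) / eps
      <= 2 / (ga * al) * (ga * M * (r * E) + 17 * l * D)).
  { assert (Ediv : forall X, X / eps = 2 / (ga * al) * (l * r * X)).
    { intros X. rewrite (pars_eps Hp). field. lra. }
    rewrite Ediv. apply Rmult_le_compat_l; [apply Rlt_le, Rdiv_lt_0_compat; lra|].
    rewrite Rmult_plus_distr_l. apply Rplus_le_compat.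
    - replace (l * r * (2 * (mu * M) * E)) with (2 * (mu * l) * (M * (r * E))) by ring.
      replace (ga * M * (r * E)) with (2 * (ga / 2) * (M * (r * E))) by field.
      apply Rmult_le_compat_r; [|lra]. mul_nonneg.
    - replace (17 * l * D) with (l * r * (17 / r * D)) by (field; lra).
      apply Rmult_le_compat_l; [nra|]. apply Rmult_le_compat_r; lra. }
  assert (P3 : ga * M * (r * E) + 17 * l * D <= (18 * (ga + 1) * M + 18) * (r * E + l * T)).
  { assert (l * D <= l * ((ga + 1) * M * E + T)) by (apply Rmult_le_compat_l; lra).
    assert (0 <= M * (r * E)) by (mul_nonneg).
    assert (0 <= l * T) by nra. assert (0 <= r * E) by nra.
    assert ((ga + 1) * M * (l * E) <= (ga + 1) * M * (r * E)).
    { apply Rmult_le_compat_l; [apply Rmult_le_pos; lra|]. apply Rmult_le_compat_r; lra. }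
    assert (0 <= (ga + 1) * M * (l * T)) by (mul_nonneg). nra. }
  assert (P4 : 2 / (ga * al) * (ga * M * (r * E) + 17 * l * D)
     <= 2 / (ga * al) * ((18 * (ga + 1) * M + 18) * (r * E + l * T))).
  { apply Rmult_le_compat_l; [apply Rlt_le, Rdiv_lt_0_compat; lra|exact P3]. }
  assert (0 <= l * T) by nra.
  unfold Cblk. lra.
Qed.

Lemma Cblk_pos : 0 < Cblk.
Proof.
  unfold Cblk. assert (0 < 2 / (ga * al)) by (apply Rdiv_lt_0_compat; nra).
  assert (0 < 18 * (ga + 1) * M + 18) by (assert (0 < (ga + 1) * M) by nra; lra). nra.
Qed.

(** * Slopes of the nodal error, region by region *)

Section Slopes.

Context {A c : R} {e : nat -> R}.

(** All that the slope estimates use about the error: [A] is its size outside the layers. In the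
    right layer the consistency error carries an extra factor r/l. [nb_BR] keeps the steep slopes of
    that layer from leaking into the coarse mesh, and [nb_BL] controls the value at the left
    transition point when a coarse cell may be as short as a layer width. *)
Record nodal_bounds : Prop := {
  nb_A : 0 <= A <= 2 * eta;
  nb_c : 0 < c;
  nb_e_left : forall i, (i <= n)%nat -> Rabs (e i) <= c * (A + eta * BL l x i);
  nb_e_mid : forall i, (n < i <= 3 * n)%nat -> Rabs (e i) <= c * A;
  nb_e_right : forall i, (3 * n <= i <= 4 * n)%nat ->
    Rabs (e i) <= c * (A + eta * BR r (4 * n) x i);
  nb_op_left : forall j, (S j <= n)%nat ->
    Rabs (op eps mu av bv x e j) <= c * (A + eta * BL l x (S j));
  nb_op_mid : forall j, (n < S j <= 3 * n)%nat -> Rabs (op eps mu av bv x e j) <= c * A;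
  nb_op_right : forall j, (3 * n < S j < 4 * n)%nat ->
    Rabs (op eps mu av bv x e j) <= c * (A + eta * (r / l * BR r (4 * n) x (S j)));
  nb_BR : INR (4 * n) * BR r (4 * n) x (3 * n) <= c;
  nb_BL : l <= 4 * INR (4 * n) -> l * (eta * BL l x n) <= c * (eta + l * A) }.

Hypothesis Hnb : nodal_bounds.

Let HA : 0 <= A <= 2 * eta := nb_A Hnb.
Let Hc0 : 0 < c := nb_c Hnb.
Let Het : 0 < eta <= 1 := dm_eta Hm.
Let Hn1 : (1 <= n)%nat := dm_n Hm.

(** The scheme read as an implicit step for the slopes, running from the outflow boundary to the
    left; the convection coefficient adds to the left-hand side only and damps. *)
Lemma backward_step j : (S j < 4 * n)%nat ->
  Rabs (slp x e j) * (eps / ((x (S (S j)) - x j) / 2) + mu * av (S j))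
  <= eps / ((x (S (S j)) - x j) / 2) * Rabs (slp x e (S j))
     + (Rabs (op eps mu av bv x e j) + M * Rabs (e (S j))).
Proof.
  intros Hj. pose proof (mesh_incr j ltac:(lia)) as X1. pose proof (mesh_incr (S j) Hj) as X2.
  set (hh := (x (S (S j)) - x j) / 2). assert (Hhh : 0 < hh) by (unfold hh; lra).
  pose proof d_eps_pos as He.
  pose proof (dc_a_lower Hc (S j) ltac:(lia)) as Ha.
  assert (Hq : 0 < eps / hh) by (apply Rdiv_lt_0_compat; lra).
  assert (Hma : 0 <= mu * av (S j)) by (apply Rmult_le_pos; lra).
  rewrite <- (Rabs_pos_eq (eps / hh + mu * av (S j))) by lra. rewrite <- Rabs_mult.
  replace (slp x e j * (eps / hh + mu * av (S j)))
    with (eps / hh * slp x e (S j) + (op eps mu av bv x e j - bv (S j) * e (S j)))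
    by (unfold op; fold hh; field; lra).
  apply Rabs_plus_le.
  - rewrite Rabs_mult, (Rabs_pos_eq (eps / hh)) by lra. lra.
  - apply Rabs_minus_le; [lra|]. apply Rabs_mult_le; [|lra].
    apply (dc_b Hc); lia.
Qed.

Lemma mu_av_lower j : (S j < 4 * n)%nat -> r <> 2 * l -> ga * al / (2 * l) <= mu * av (S j).
Proof.
  intros Hj Hne. destruct (pars_case Hp) as [E|E]; [now elim Hne|].
  pose proof (dc_a_lower Hc (S j) ltac:(lia)) as Ha. rewrite E.
  replace (ga * al / (2 * l)) with (ga / (2 * l) * al) by (field; lra).
  apply Rmult_le_compat_l; [apply Rlt_le, Rdiv_lt_0_compat|]; lra.
Qed.

(** A level [Y] is passed on to the left as long as the damping, at least ga al / (2 l) times [Y],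
    covers the residual; dividing by this damping is the discrete source of the factor [l]. *)
Lemma backward_step_const j Y G : (S j < 4 * n)%nat -> r <> 2 * l ->
  Rabs (slp x e (S j)) <= Y -> Rabs (op eps mu av bv x e j) + M * Rabs (e (S j)) <= G ->
  G <= ga * al / (2 * l) * Y -> Rabs (slp x e j) <= Y.
Proof.
  intros Hj Hne HY HG HGY. pose proof (backward_step j Hj) as B.
  pose proof (mu_av_lower j Hj Hne) as Hma.
  pose proof (mesh_incr j ltac:(lia)) as X1. pose proof (mesh_incr (S j) Hj) as X2.
  set (hh := (x (S (S j)) - x j) / 2) in *. assert (Hhh : 0 < hh) by (unfold hh; lra).
  pose proof d_eps_pos as He.
  assert (Hq : 0 < eps / hh) by (apply Rdiv_lt_0_compat; lra).
  assert (HY0 : 0 <= Y) by (eapply Rle_trans; [apply Rabs_pos|exact HY]).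
  assert (Hk : 0 < ga * al / (2 * l)) by (apply Rdiv_lt_0_compat; nra).
  apply Rmult_le_reg_r with (eps / hh + mu * av (S j)); [lra|].
  eapply Rle_trans; [exact B|].
  assert (eps / hh * Rabs (slp x e (S j)) <= eps / hh * Y) by (apply Rmult_le_compat_l; lra).
  assert (ga * al / (2 * l) * Y <= mu * av (S j) * Y) by (apply Rmult_le_compat_r; lra). lra.
Qed.

Lemma right_local j : (3 * n <= j < 4 * n)%nat ->
  Rabs (slp x e j) <= 2 * c * exp 9 * Cblk * (r * (A + eta * BR r (4 * n) x j)).
Proof.
  intros Hj. pose proof (BR_pos j ltac:(lia)) as Pj. pose proof (exp_pos 9) as P9.
  assert (E9 : 1 <= exp 9) by (rewrite <- exp_0; apply exp_mono; lra).
  set (B := BR r (4 * n) x j) in *.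
  assert (Hrl : 0 < r / l) by (apply Rdiv_lt_0_compat; lra).
  assert (PB : 0 < eta * B) by nra. assert (PB9 : eta * B <= eta * (exp 9 * B)) by nra.
  eapply Rle_trans.
  - apply (block_slope (c * (A + eta * (exp 9 * B))) (c * (A + eta * (r / l * (exp 9 * B)))) hR e (3 * n) n j).
    + apply (dm_hR Hm).
    + eapply Rle_trans; [apply (dm_hR_le Hm)|].
      apply Rmult_le_compat_r; [left; apply Rinv_0_lt_compat; lra|lra].
    + apply (dm_sR Hm).
    + apply Rmult_le_pos; [lra|]. assert (0 < exp 9 * B) by nra.
      assert (0 < r / l * (exp 9 * B)) by (apply Rmult_lt_0_compat; lra). nra.
    + lia.
    + intros i Hi. apply (dm_right Hm). lia.
    + lia.
    + intros i Hi Hd. eapply Rle_trans; [apply (nb_e_right Hnb); lia|].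
      apply Rmult_le_compat_l; [lra|]. apply Rplus_le_compat_l. apply Rmult_le_compat_l; [lra|].
      apply BR_near; try lia. apply Rabs_le_between in Hd.
      apply Rle_trans with (17 / r); [lra|]. apply Rmult_le_compat_r; [left; apply Rinv_0_lt_compat; lra|lra].
    + intros i Hi1 Hi2 Hd. eapply Rle_trans; [apply (nb_op_right Hnb); lia|].
      apply Rmult_le_compat_l; [lra|]. apply Rplus_le_compat_l. apply Rmult_le_compat_l; [lra|].
      apply Rmult_le_compat_l; [lra|].
      apply BR_near; try lia. apply Rabs_le_between in Hd.
      apply Rle_trans with (17 / r); [lra|]. apply Rmult_le_compat_r; [left; apply Rinv_0_lt_compat; lra|lra].
  - pose proof Cblk_pos as PC.
    replace (2 * c * exp 9 * Cblk * (r * (A + eta * B))) with (Cblk * (2 * c * exp 9 * (r * (A + eta * B)))) by ring.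
    apply Rmult_le_compat_l; [lra|].
    replace (l * (c * (A + eta * (r / l * (exp 9 * B))))) with (c * (l * A + exp 9 * (r * (eta * B)))) by (field; lra).
    assert (l * A <= r * A) by (apply Rmult_le_compat_r; lra).
    assert (HrA : 0 <= r * A) by (apply Rmult_le_pos; lra). assert (r * A <= exp 9 * (r * A)) by nra.
    replace (r * (c * (A + eta * (exp 9 * B))) + c * (l * A + exp 9 * (r * (eta * B))))
      with (c * (r * A + l * A + 2 * (exp 9 * (r * (eta * B))))) by ring.
    replace (2 * c * exp 9 * (r * (A + eta * B))) with (c * (2 * (exp 9 * (r * A)) + 2 * (exp 9 * (r * (eta * B))))) by ring.
    apply Rmult_le_compat_l; lra.
Qed.

Definition CR : R := 38 * c * exp 9 * Cblk + 36 * c * (1 + M) / (ga * al).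

Lemma CR_pos : 0 < CR.
Proof.
  unfold CR. pose proof Cblk_pos. pose proof (exp_pos 9).
  assert (0 < 38 * c * exp 9 * Cblk) by (mul_pos).
  assert (0 < 36 * c * (1 + M) / (ga * al)) by (apply Rdiv_lt_0_compat; nra). lra.
Qed.

Lemma BR_N : BR r (4 * n) x (4 * n) = 1.
Proof.
  unfold BR. assert (0 < gr (r / 2) x (4 * n)) by (apply (gr_pos _ _ (4 * n)); [lra|apply mesh_incr|lia]).
  field. lra.
Qed.

(** The block argument alone yields r A. When convection dominates, the recursion replaces it by l
    A, the block argument being used only on the last cell; when r = 2 l the two agree up to a
    factor. *)
Lemma right_slopes j : (3 * n <= j < 4 * n)%nat ->
  Rabs (slp x e j) <= CR * (l * A + eta * (r * BR r (4 * n) x j)).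
Proof.
  intros Hj.
  assert (Hk : 0 < ga * al) by nra. pose proof Cblk_pos as PC. pose proof (exp_pos 9) as P9.
  set (K1 := 2 * c * exp 9 * Cblk). assert (HK1 : 0 < K1) by (unfold K1; mul_pos).
  set (K2 := 36 * c * (1 + M) / (ga * al)).
  assert (HK2 : 0 < K2) by (apply Rdiv_lt_0_compat; nra).
  assert (EC : CR = 19 * K1 + K2) by (unfold CR, K1, K2; ring).
  destruct (Req_dec r (2 * l)) as [Er|Er].
  - eapply Rle_trans; [apply right_local, Hj|]. fold K1. pose proof (BR_pos j ltac:(lia)) as Pj.
    set (B := BR r (4 * n) x j) in *. assert (0 <= eta * (r * B)) by (mul_nonneg).
    assert (0 <= l * A) by (apply Rmult_le_pos; lra).
    apply Rle_trans with (K1 * (2 * (l * A + eta * (r * B)))).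
    + apply Rmult_le_compat_l; [lra|].
      replace (r * (A + eta * B)) with (r * A + eta * (r * B)) by ring. rewrite Er at 1. lra.
    + rewrite EC. nra.
  - destruct Hj as [Hj1 Hj2].
    assert (Hind : forall k j, (4 * n - 1 = j + k)%nat -> (3 * n <= j)%nat ->
       Rabs (slp x e j) <= CR * (l * A + eta * (r * BR r (4 * n) x j))).
    { clear j Hj1 Hj2. induction k as [|k IH]; intros j Ek Hj1.
      - assert (Ej : S j = (4 * n)%nat) by lia.
        eapply Rle_trans; [apply right_local; lia|]. fold K1.
        pose proof (BR_step_le j ltac:(lia)) as S9. rewrite Ej, BR_N in S9.
        pose proof (BR_pos j ltac:(lia)) as Pj. set (B := BR r (4 * n) x j) in *.
        (* On the last cell [BR] is at least 1/9, so A <= 2 eta <= 18 eta B; in particular the term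
           r A can be hidden in the layer term. *)
        assert (HAB : A + eta * B <= 19 * (eta * B)) by nra.
        assert (r * (A + eta * B) <= r * (19 * (eta * B))) by (apply Rmult_le_compat_l; lra).
        assert (0 <= l * A) by (apply Rmult_le_pos; lra).
        assert (HrB : 0 <= eta * (r * B)) by (mul_nonneg).
        apply Rle_trans with (K1 * (19 * (eta * (r * B)))).
        + apply Rmult_le_compat_l; lra.
        + rewrite EC. assert (0 <= K2 * (l * A + eta * (r * B))) by nra.
          assert (0 <= 19 * K1 * (l * A)) by nra. lra.
      - assert (Hj2 : (S j < 4 * n)%nat) by lia.
        assert (IH' := IH (S j) ltac:(lia) ltac:(lia)). rewrite BR_step in IH'.
        pose proof (backward_step j Hj2) as B.
        pose proof (mu_av_lower j Hj2 Er) as Hma.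
        pose proof (dm_right Hm j ltac:(lia)) as X1.
        pose proof (dm_right Hm (S j) ltac:(lia)) as X2.
        pose proof (dm_hR Hm) as HhR.
        replace ((x (S (S j)) - x j) / 2) with hR in B by lra. rewrite X1 in IH'.
        assert (He : eps = ga * al / (2 * l * r)) by apply (pars_eps Hp).
        pose proof d_eps_pos as He0.
        pose proof (BR_step_le j ltac:(lia)) as S9.
        pose proof (BR_pos j ltac:(lia)) as Pj. pose proof (BR_pos (S j) ltac:(lia)) as Pj'.
        set (Bj := BR r (4 * n) x j) in *.
        assert (Hrl : 2 <= r / l).
        { apply Rmult_le_reg_r with l; [lra|]. unfold Rdiv. rewrite Rmult_assoc, Rinv_l; lra. }
        assert (HG : Rabs (op eps mu av bv x e j) + M * Rabs (e (S j))
            <= c * (1 + M) * (A + eta * (r / l * (9 * Bj)))).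
        { pose proof (nb_op_right Hnb j ltac:(lia)) as G1. pose proof (nb_e_right Hnb (S j) ltac:(lia)) as G2.
          set (B' := BR r (4 * n) x (S j)) in *.
          assert (Q1 : r / l * B' <= r / l * (9 * Bj)) by (apply Rmult_le_compat_l; lra).
          assert (Q2 : eta * (r / l * B') <= eta * (r / l * (9 * Bj))) by (apply Rmult_le_compat_l; lra).
          assert (Q3 : B' <= r / l * B') by nra.
          assert (Q4 : eta * B' <= eta * (r / l * B')) by (apply Rmult_le_compat_l; lra).
          apply Rle_trans with (c * (A + eta * (r / l * (9 * Bj))) + M * (c * (A + eta * (r / l * (9 * Bj))))).
          - apply Rplus_le_compat.
            + eapply Rle_trans; [exact G1|]. apply Rmult_le_compat_l; lra.
            + apply Rmult_le_compat_l; [lra|]. eapply Rle_trans; [exact G2|]. apply Rmult_le_compat_l; lra.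
          - lra. }
        set (kl := ga * al / (2 * l)) in *. assert (Hkl : 0 < kl) by (apply Rdiv_lt_0_compat; lra).
        assert (Hkr : kl * r = ga * al / 2 * (r / l)) by (unfold kl; field; lra).
        assert (HCR : 36 * c * (1 + M) <= CR * (ga * al)).
        { rewrite EC. assert (K2 * (ga * al) = 36 * c * (1 + M)) by (unfold K2; field; lra). nra. }
        apply Rmult_le_reg_r with (eps / hR + mu * av (S j)).
        { assert (0 < eps / hR) by (apply Rdiv_lt_0_compat; lra). lra. }
        eapply Rle_trans; [exact B|].
        assert (Hq : 0 < eps / hR) by (apply Rdiv_lt_0_compat; lra).
        set (P := l * A + eta * (r * Bj)).
        assert (HP : 0 <= P). { unfold P. assert (0 <= l * A) by (apply Rmult_le_pos; lra).
          assert (0 <= eta * (r * Bj)) by (mul_nonneg). lra. }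
        (* Since eps r = kl and the barrier grows with the rate r/2, its increment over one cell
           costs half of the damping [kl]; the other half pays for the residual. *)
        assert (U1 : eps / hR * Rabs (slp x e (S j))
           <= eps / hR * (CR * P) + CR * (kl / 2 * (eta * (r * Bj)))).
        { eapply Rle_trans; [apply Rmult_le_compat_l; [lra|exact IH']|]. right. unfold P, kl. rewrite He. field. lra. }
        assert (U2 : c * (1 + M) * (A + eta * (r / l * (9 * Bj))) <= CR * (kl / 2 * (eta * (r * Bj)) + kl * (l * A))).
        { assert (EE : CR * (kl / 2 * (eta * (r * Bj)) + kl * (l * A))
             = CR * (ga * al) * (A / 2 + eta * (r / l * Bj) / 4)) by (unfold kl; field; lra).
          rewrite EE.
          assert (V : 0 <= eta * (r / l * Bj)) by (apply Rmult_le_pos; [lra|apply Rmult_le_pos; lra]).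
          apply Rle_trans with (36 * c * (1 + M) * (A / 2 + eta * (r / l * Bj) / 4)).
          - assert (0 < c * (1 + M)) by nra. nra.
          - apply Rmult_le_compat_r; lra. }
        assert (U3 : kl * (CR * P) <= mu * av (S j) * (CR * P)).
        { apply Rmult_le_compat_r; [|exact Hma]. apply Rmult_le_pos; [pose proof CR_pos|]; lra. }
        unfold P in *. lra. }
    apply (Hind (4 * n - 1 - j)%nat j); lia.
Qed.

Definition CM : R := 3 * c * (1 + c) * Cblk + CR + 2 * CR * c + 2 * c * (1 + M) / (ga * al).

Lemma CM_pos : 0 < CM.
Proof.
  unfold CM. pose proof Cblk_pos. pose proof CR_pos.
  assert (0 < 3 * c * (1 + c) * Cblk) by (mul_pos).
  assert (0 < 2 * CR * c) by (mul_pos).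
  assert (0 < 2 * c * (1 + M) / (ga * al)) by (apply Rdiv_lt_0_compat; nra). lra.
Qed.

(** If r = 2 l, the bound on [l] makes the coarse cells short enough for the block argument.
    Otherwise the recursion enters the coarse mesh from the right layer, where the small factor eps
    / H and the smallness of [BR] at the transition point cancel the large slope, and then continues
    with a constant level. *)
Lemma mid_slopes j : l <= 4 * INR (4 * n) -> (n <= j < 3 * n)%nat ->
  Rabs (slp x e j) <= CM * (l * A + eta).
Proof.
  intros HlN Hj.
  assert (Hk : 0 < ga * al) by nra. pose proof Cblk_pos as PC. pose proof CR_pos as PR.
  assert (HlA : 0 <= l * A) by (apply Rmult_le_pos; lra).
  assert (HN : 0 < INR (4 * n)) by (apply lt_0_INR; lia).
  set (K2 := 2 * c * (1 + M) / (ga * al)). assert (HK2 : 0 < K2) by (apply Rdiv_lt_0_compat; nra).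
  assert (EC : CM = 3 * c * (1 + c) * Cblk + CR + 2 * CR * c + K2) by reflexivity.
  assert (HCRc : 0 < CR * c) by nra. assert (Hcc : 0 < 3 * c * (1 + c) * Cblk) by (mul_pos).
  destruct (Req_dec r (2 * l)) as [Er|Er].
  - pose proof (BL_pos n ltac:(lia)) as Pn.
    assert (PB : 0 < eta * BL l x n) by nra.
    eapply Rle_trans.
    + apply (block_slope (c * (A + eta * BL l x n)) (c * A) H e n (2 * n) j).
      * apply (dm_H Hm).
      * eapply Rle_trans; [apply (dm_H_le Hm)|]. rewrite Er.
        replace (16 / (2 * l)) with (2 * / (l / 4)) by (field; lra).
        apply Rmult_le_compat_l; [lra|apply Rinv_le_contravar; lra].
      * pose proof (dm_H_ge Hm) as HH.
        apply Rle_trans with (1 / 2).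
        -- apply Rmult_le_compat_l; [lra|]. apply Rinv_le_contravar; lra.
        -- apply Rle_trans with (INR (2 * n) * (1 / INR (4 * n))); [|apply Rmult_le_compat_l; [apply pos_INR|exact HH]].
           right. rewrite !mult_INR. simpl (INR 2). simpl (INR 4). field. apply not_0_INR. lia.
      * apply Rmult_le_pos; lra.
      * lia.
      * intros i Hi. apply (dm_mid Hm). lia.
      * lia.
      * intros i Hi _. destruct (Nat.eq_dec i n) as [->|].
        -- apply (nb_e_left Hnb); lia.
        -- eapply Rle_trans; [apply (nb_e_mid Hnb); lia|]. apply Rmult_le_compat_l; lra.
      * intros i Hi1 Hi2 _. apply (nb_op_mid Hnb). lia.
    + apply Rle_trans with (Cblk * (3 * c * (1 + c) * (l * A + eta))).
      * apply Rmult_le_compat_l; [lra|]. pose proof (nb_BL Hnb HlN) as HB. rewrite Er.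
        replace (2 * l * (c * (A + eta * BL l x n)) + l * (c * A)) with (c * (3 * (l * A) + 2 * (l * (eta * BL l x n)))) by ring.
        replace (3 * c * (1 + c) * (l * A + eta)) with (c * (3 * (l * A + eta) + 3 * (c * (eta + l * A)))) by ring.
        apply Rmult_le_compat_l; [lra|]. assert (0 <= c * (eta + l * A)) by nra. lra.
      * rewrite EC. nra.
  - assert (Hind : forall k j, (3 * n - 1 = j + k)%nat -> (n <= j)%nat ->
       Rabs (slp x e j) <= CM * (l * A + eta)).
    { clear j Hj. induction k as [|k IH]; intros j Ek Hj1.
      - assert (Ej : S j = (3 * n)%nat) by lia.
        assert (Hj2 : (S j < 4 * n)%nat) by lia.
        pose proof (backward_step j Hj2) as B. pose proof (mu_av_lower j Hj2 Er) as Hma.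
        pose proof (dm_mid Hm j ltac:(lia)) as X1.
        pose proof (mesh_incr (S j) Hj2) as X2.
        pose proof (dm_H_ge Hm) as HH. pose proof (dm_H Hm) as HH0.
        set (hh := (x (S (S j)) - x j) / 2) in *. assert (Hhh : 0 < hh) by (unfold hh; lra).
        pose proof d_eps_pos as He0.
        pose proof (right_slopes (S j) ltac:(lia)) as R.
        pose proof (BR_pos (S j) ltac:(lia)) as PB. pose proof (nb_BR Hnb) as NB. rewrite <- Ej in NB.
        set (B' := BR r (4 * n) x (S j)) in *.
        assert (HG : Rabs (op eps mu av bv x e j) + M * Rabs (e (S j)) <= c * (1 + M) * A).
        { pose proof (nb_op_mid Hnb j ltac:(lia)) as G1. pose proof (nb_e_mid Hnb (S j) ltac:(lia)) as G2.
          assert (M * Rabs (e (S j)) <= M * (c * A)) by (apply Rmult_le_compat_l; lra). lra. }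
        set (kl := ga * al / (2 * l)) in *. assert (Hkl : 0 < kl) by (apply Rdiv_lt_0_compat; lra).
        assert (Hq : 0 < eps / hh) by (apply Rdiv_lt_0_compat; lra).
        apply Rmult_le_reg_r with (eps / hh + mu * av (S j)); [lra|].
        eapply Rle_trans; [exact B|].
        assert (U1 : eps / hh * Rabs (slp x e (S j)) <= eps / hh * (CR * (l * A)) + eps / hh * (CR * (eta * (r * B')))).
        { rewrite <- Rmult_plus_distr_l. apply Rmult_le_compat_l; lra. }
        assert (U2 : eps / hh <= eps * (2 * INR (4 * n))).
        { apply Rmult_le_compat_l; [lra|]. replace (2 * INR (4 * n)) with (/ (1 / INR (4 * n) / 2)) by (field; lra).
          apply Rinv_le_contravar; [|unfold hh; lra].
          apply Rdiv_lt_0_compat; [apply Rdiv_lt_0_compat|]; lra. }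
        (* With 1 / hh <= 2 N and eps r = kl, the outflow slope becomes kl times N BR at the
           transition point, which [nb_BR] bounds. *)
        assert (U3 : eps / hh * (CR * (eta * (r * B'))) <= kl * (2 * CR * c * eta)).
        { apply Rle_trans with (eps * (2 * INR (4 * n)) * (CR * (eta * (r * B')))).
          - apply Rmult_le_compat_r; [mul_nonneg|exact U2].
          - replace (eps * (2 * INR (4 * n)) * (CR * (eta * (r * B'))))
              with (kl * (2 * CR * eta * (INR (4 * n) * B'))).
            + apply Rmult_le_compat_l; [lra|].
              replace (2 * CR * c * eta) with (2 * CR * eta * c) by ring.
              apply Rmult_le_compat_l; [|exact NB]. mul_nonneg.
            + unfold kl. rewrite (pars_eps Hp). field. lra. }
        assert (U4 : c * (1 + M) * A <= kl * (K2 * (l * A))) by (right; unfold kl, K2; field; lra).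
        assert (HCM : 0 < CM) by apply CM_pos.
        assert (U5 : eps / hh * (CR * (l * A)) <= eps / hh * (CM * (l * A + eta))).
        { apply Rmult_le_compat_l; [lra|]. apply Rmult_le_compat; lra. }
        assert (U6 : kl * (2 * CR * c * eta) + kl * (K2 * (l * A)) <= kl * (CM * (l * A + eta))).
        { rewrite <- Rmult_plus_distr_l. apply Rmult_le_compat_l; [lra|]. rewrite EC.
          assert (0 <= CR * c * (l * A)) by nra. assert (0 <= K2 * eta) by nra.
          assert (0 <= (3 * c * (1 + c) * Cblk + CR) * (l * A + eta)) by (apply Rmult_le_pos; lra). lra. }
        assert (U7 : kl * (CM * (l * A + eta)) <= mu * av (S j) * (CM * (l * A + eta))).
        { apply Rmult_le_compat_r; [|exact Hma]. apply Rmult_le_pos; lra. }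
        lra.
      - apply (backward_step_const j _ (c * (1 + M) * A)); [lia|exact Er|apply IH; lia| |].
        + pose proof (nb_op_mid Hnb j ltac:(lia)) as G1. pose proof (nb_e_mid Hnb (S j) ltac:(lia)) as G2.
          assert (M * Rabs (e (S j)) <= M * (c * A)) by (apply Rmult_le_compat_l; lra). lra.
        + apply Rle_trans with (ga * al / (2 * l) * (K2 * (l * A))); [right; unfold K2; field; lra|].
          apply Rmult_le_compat_l; [apply Rlt_le, Rdiv_lt_0_compat; lra|]. rewrite EC.
          assert (0 <= K2 * eta) by nra.
          assert (0 <= (3 * c * (1 + c) * Cblk + CR + 2 * CR * c) * (l * A + eta)) by (apply Rmult_le_pos; lra). lra. }
    apply (Hind (3 * n - 1 - j)%nat j); lia.
Qed.

(** The slope on the first coarse cell is an assumption, because it is obtained differently for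
    moderate and for very large [l]. The recursion runs with the level [BL] at the right end of the
    cell, which only increases to the left. *)
Lemma left_slopes K0 j : 0 < K0 -> Rabs (slp x e n) <= K0 * (l * A + eta) -> (j < n)%nat ->
  Rabs (slp x e j) <= (3 * c * exp 9 * Cblk + K0 + 2 * c * (1 + M) / (ga * al))
     * (eta + l * A + l * (eta * BL l x j)).
Proof.
  intros HK0 Hn Hj.
  assert (Hk : 0 < ga * al) by nra. pose proof Cblk_pos as PC. pose proof (exp_pos 9) as P9.
  assert (E9 : 1 <= exp 9) by (rewrite <- exp_0; apply exp_mono; lra).
  assert (HlA : 0 <= l * A) by (apply Rmult_le_pos; lra).
  set (K2 := 2 * c * (1 + M) / (ga * al)). assert (HK2 : 0 < K2) by (apply Rdiv_lt_0_compat; nra).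
  set (K3 := 3 * c * exp 9 * Cblk). assert (HK3 : 0 < K3) by (unfold K3; mul_pos).
  destruct (Req_dec r (2 * l)) as [Er|Er].
  - pose proof (BL_pos j ltac:(lia)) as Pj. set (B := BL l x j) in *.
    assert (PB : 0 < eta * B) by nra. assert (PB9 : eta * B <= eta * (exp 9 * B)) by nra.
    assert (HnearL : forall i, (i <= n)%nat -> Rabs (x i - x j) <= 17 / r -> eta * BL l x i <= eta * (exp 9 * B)).
    { intros i Hi Hd. apply Rmult_le_compat_l; [lra|]. apply BL_near; try lia.
      apply Rabs_le_between in Hd. apply Rle_trans with (17 / r); [lra|].
      apply Rle_trans with (17 / l).
      - apply Rmult_le_compat_l; [lra|]. apply Rinv_le_contravar; lra.
      - apply Rmult_le_compat_r; [left; apply Rinv_0_lt_compat; lra|lra]. }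
    eapply Rle_trans.
    + apply (block_slope (c * (A + eta * (exp 9 * B))) (c * (A + eta * (exp 9 * B))) hL e 0 n j).
      * apply (dm_hL Hm).
      * eapply Rle_trans; [apply (dm_hL_le Hm)|]. rewrite Er.
        apply Rmult_le_reg_r with l; [lra|]. field_simplify; lra.
      * eapply Rle_trans; [|apply (dm_sL Hm)].
        apply Rmult_le_compat_l; [lra|]. apply Rinv_le_contravar; lra.
      * apply Rmult_le_pos; lra.
      * lia.
      * intros i Hi. apply (dm_left Hm). lia.
      * lia.
      * intros i Hi Hd. eapply Rle_trans; [apply (nb_e_left Hnb); lia|].
        apply Rmult_le_compat_l; [lra|]. apply Rplus_le_compat_l. apply HnearL; [lia|exact Hd].
      * intros i Hi1 Hi2 Hd. eapply Rle_trans; [apply (nb_op_left Hnb); lia|].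
        apply Rmult_le_compat_l; [lra|]. apply Rplus_le_compat_l. apply HnearL; [lia|exact Hd].
    + apply Rle_trans with (K3 * (eta + l * A + l * (eta * B))).
      * unfold K3. rewrite Er.
        replace (2 * l * (c * (A + eta * (exp 9 * B))) + l * (c * (A + eta * (exp 9 * B))))
          with (3 * c * (l * A + exp 9 * (l * (eta * B)))) by ring.
        replace (3 * c * exp 9 * Cblk * (eta + l * A + l * (eta * B)))
          with (Cblk * (3 * c * (exp 9 * eta + exp 9 * (l * A) + exp 9 * (l * (eta * B))))) by ring.
        apply Rmult_le_compat_l; [lra|]. apply Rmult_le_compat_l; [lra|].
        assert (l * A <= exp 9 * (l * A)) by nra. assert (0 < exp 9 * eta) by nra. lra.
      * apply Rmult_le_compat_r; [|lra]. assert (0 < l * (eta * B)) by nra. lra.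
  - assert (Hind : forall k j, (n = S j + k)%nat ->
       Rabs (slp x e j) <= (K3 + K0 + K2) * (eta + l * A + l * (eta * BL l x (S j)))).
    { clear j Hj. induction k as [|k IH]; intros j Ek.
      - apply (backward_step_const j _ (c * (1 + M) * (A + eta * BL l x (S j)))); [lia|exact Er| | |].
        + replace (S j) with n by lia. eapply Rle_trans; [exact Hn|].
          pose proof (BL_pos n ltac:(lia)). assert (0 < l * (eta * BL l x n)) by (mul_pos).
          apply Rmult_le_compat; lra.
        + pose proof (nb_op_left Hnb j ltac:(lia)) as G1. pose proof (nb_e_left Hnb (S j) ltac:(lia)) as G2.
          assert (M * Rabs (e (S j)) <= M * (c * (A + eta * BL l x (S j)))) by (apply Rmult_le_compat_l; lra). lra.
        + pose proof (BL_pos (S j) ltac:(lia)). assert (0 < l * (eta * BL l x (S j))) by (mul_pos).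
          apply Rle_trans with (ga * al / (2 * l) * (K2 * (l * A + l * (eta * BL l x (S j))))); [right; unfold K2; field; lra|].
          apply Rmult_le_compat_l; [apply Rlt_le, Rdiv_lt_0_compat; lra|].
          apply Rmult_le_compat; lra.
      - assert (IH' := IH (S j) ltac:(lia)).
        pose proof (BL_pos (S j) ltac:(lia)) as P1. pose proof (BL_pos (S (S j)) ltac:(lia)) as P2.
        assert (0 < l * (eta * BL l x (S j))) by (mul_pos).
        apply (backward_step_const j _ (c * (1 + M) * (A + eta * BL l x (S j)))); [lia|exact Er| | |].
        + eapply Rle_trans; [exact IH'|]. apply Rmult_le_compat_l; [lra|]. apply Rplus_le_compat_l.
          apply Rmult_le_compat_l; [lra|]. apply Rmult_le_compat_l; [lra|].
          rewrite (BL_step (S j)) by lia. pose proof (mesh_incr (S j) ltac:(lia)).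
          assert (0 < l / 2 * (x (S (S j)) - x (S j))) by (apply Rmult_lt_0_compat; lra). nra.
        + pose proof (nb_op_left Hnb j ltac:(lia)) as G1. pose proof (nb_e_left Hnb (S j) ltac:(lia)) as G2.
          assert (M * Rabs (e (S j)) <= M * (c * (A + eta * BL l x (S j)))) by (apply Rmult_le_compat_l; lra). lra.
        + apply Rle_trans with (ga * al / (2 * l) * (K2 * (l * A + l * (eta * BL l x (S j))))); [right; unfold K2; field; lra|].
          apply Rmult_le_compat_l; [apply Rlt_le, Rdiv_lt_0_compat; lra|].
          apply Rmult_le_compat; lra. }
    eapply Rle_trans; [apply (Hind (n - S j)%nat j); lia|].
    apply Rmult_le_compat_l; [lra|]. apply Rplus_le_compat_l. apply Rmult_le_compat_l; [lra|].
    apply Rmult_le_compat_l; [lra|]. pose proof (BL_pos (S j) ltac:(lia)) as P1.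
    rewrite (BL_step j) by lia. pose proof (mesh_incr j ltac:(lia)).
    assert (0 < l / 2 * (x (S j) - x j)) by (apply Rmult_lt_0_compat; lra). nra.
Qed.

End Slopes.

End Discrete.
Arguments Cblk : clear implicits.
Arguments nodal_bounds : clear implicits.
Arguments CR : clear implicits.
Arguments CM : clear implicits.

(** * Consistency and interpolation errors *)

Lemma EL_mono l s t : 0 <= l -> s <= t -> EL l t <= EL l s.
Proof. intros. apply exp_mono. nra. Qed.

Lemma ER_mono r s t : 0 <= r -> s <= t -> ER r s <= ER r t.
Proof. intros. apply exp_mono. nra. Qed.

Lemma one_minus_exp_le t : 0 <= t -> 1 - exp (- t) <= Rmin t 1.
Proof.
  intros Ht. pose proof (exp_ineq1_le (- t)). pose proof (exp_pos (- t)).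
  apply Rmin_glb; lra.
Qed.

(* Layer terms are integrated exactly, so the increment sees the better of the
   mesh width and the layer width. *)
Lemma layer_variation (l r c0 cL cR s t : R) (y y1 : R -> R) :
  0 < l -> 0 < r -> 0 <= c0 -> 0 <= cL -> 0 <= cR -> s <= t ->
  (forall x, s <= x <= t -> continuity_pt y x) ->
  (forall x, s < x < t -> is_derive y x (y1 x)) ->
  (forall x, s < x < t -> Rabs (y1 x) <= c0 + cL * EL l x + cR * ER r x) ->
  Rabs (y t - y s) <= c0 * (t - s) + cL / l * (EL l s * Rmin (l * (t - s)) 1)
     + 2 * cR / r * (ER r t * Rmin (r * (t - s)) 1).
Proof.
  intros Hl Hr Hc0 HcL HcR Hst Hc Hd Hb.
  set (g := fun x => c0 * x + - (cL / l) * EL l x + 4 * cR / (3 * r) * ER r x).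
  set (dg := fun x => c0 * 1 + - (cL / l) * (- l * EL l x) + 4 * cR / (3 * r) * (3 / 4 * r * ER r x)).
  assert (Hg : forall x, is_derive g x (dg x)).
  { intros x. unfold g, dg. apply @is_derive_plus; [apply @is_derive_plus|].
    - apply is_derive_scal, @is_derive_id.
    - apply is_derive_scal, is_derive_EL.
    - apply is_derive_scal, is_derive_ER. }
  apply Rle_trans with (g t - g s).
  - apply (increment_le y y1 g dg); auto.
    + intros x _. apply derive_continuity_pt with (dg x), Hg.
    + intros x Hx. eapply Rle_trans; [apply Hb, Hx|]. right. unfold dg. field. lra.
  - assert (A1 : EL l s - EL l t <= EL l s * Rmin (l * (t - s)) 1).
    { assert (E : EL l t = EL l s * exp (- (l * (t - s)))).
      { unfold EL. rewrite <- exp_plus. f_equal. ring. }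
      rewrite E. pose proof (EL_pos l s).
      pose proof (one_minus_exp_le (l * (t - s)) ltac:(nra)). nra. }
    assert (A2 : ER r t - ER r s <= ER r t * Rmin (r * (t - s)) 1).
    { assert (E : ER r s = ER r t * exp (- (3 / 4 * r * (t - s)))).
      { unfold ER. rewrite <- exp_plus. f_equal. field. }
      rewrite E. pose proof (ER_pos r t).
      pose proof (one_minus_exp_le (3 / 4 * r * (t - s)) ltac:(nra)) as B.
      assert (Rmin (3 / 4 * r * (t - s)) 1 <= Rmin (r * (t - s)) 1).
      { apply Rmin_glb; [eapply Rle_trans; [apply Rmin_l|]; nra|apply Rmin_r]. }
      nra. }
    assert (0 <= ER r t * Rmin (r * (t - s)) 1).
    { apply Rmult_le_pos; [left; apply ER_pos|]. apply Rmin_glb; nra. }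
    assert (B1 : cL / l * (EL l s - EL l t) <= cL / l * (EL l s * Rmin (l * (t - s)) 1)).
    { apply Rmult_le_compat_l; [apply Rmult_le_pos; [lra|left; apply Rinv_0_lt_compat; lra]|exact A1]. }
    assert (Hq : 0 <= cR / r) by (apply Rmult_le_pos; [lra|left; apply Rinv_0_lt_compat; lra]).
    assert (B2 : 4 * cR / (3 * r) * (ER r t - ER r s) <= 2 * cR / r * (ER r t * Rmin (r * (t - s)) 1)).
    { replace (4 * cR / (3 * r) * (ER r t - ER r s)) with (4 / 3 * (cR / r * (ER r t - ER r s))) by (field; lra).
      replace (2 * cR / r * (ER r t * Rmin (r * (t - s)) 1))
        with (2 * (cR / r * (ER r t * Rmin (r * (t - s)) 1))) by (field; lra).
      assert (cR / r * (ER r t - ER r s) <= cR / r * (ER r t * Rmin (r * (t - s)) 1))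
        by (apply Rmult_le_compat_l; lra).
      assert (0 <= cR / r * (ER r t * Rmin (r * (t - s)) 1)) by (apply Rmult_le_pos; lra). lra. }
    unfold g. lra.
Qed.

Lemma slope_mvt (x : nat -> R) (y y1 : R -> R) (j : nat) :
  x j < x (S j) ->
  (forall t, x j <= t <= x (S j) -> continuity_pt y t) ->
  (forall t, x j < t < x (S j) -> is_derive y t (y1 t)) ->
  exists xi, x j < xi < x (S j) /\ slp x (fun i => y (x i)) j = y1 xi.
Proof.
  intros Hx Hc Hd. destruct (mvt_open y y1 _ _ Hx Hc Hd) as [xi [H1 H2]].
  exists xi. split; [exact H1|]. unfold slp. rewrite H2. field. lra.
Qed.

(** The second difference is exact for quadratics on unequal cells, so the Taylor polynomial at the
    node can be subtracted. The error is expressed by variations of y' and y'' over the stencil,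
    which accommodates both smooth and layer estimates. *)
Lemma truncation_error (eps mu K V1 V2 : R) (av bv x : nat -> R) (y y1 y2 : R -> R) (j : nat) :
  0 < eps -> 0 <= mu -> Rabs (av (S j)) <= K ->
  x j < x (S j) -> x (S j) < x (S (S j)) ->
  (forall t, x j <= t <= x (S (S j)) -> continuity_pt y t) ->
  (forall t, x j < t < x (S (S j)) -> is_derive y t (y1 t)) ->
  (forall t, x j < t < x (S (S j)) -> is_derive y1 t (y2 t)) ->
  (forall t, x j < t < x (S j) -> Rabs (y1 t - y1 (x (S j))) <= V1) ->
  (forall t, x j < t < x (S (S j)) -> Rabs (y2 t - y2 (x (S j))) <= V2) ->
  Rabs (op eps mu av bv x (fun i => y (x i)) j
    - (- eps * y2 (x (S j)) + mu * av (S j) * y1 (x (S j)) + bv (S j) * y (x (S j))))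
  <= 2 * eps * V2 + mu * (K * V1).
Proof.
  intros He Hmu HK X1 X2 Hc Hd1 Hd2 HV1 HV2.
  set (m := x (S j)) in *. set (d := (x (S (S j)) - x j) / 2).
  assert (Hd : 0 < d) by (unfold d; lra).
  (* The derivative of [phi] vanishes at the node and is bounded by V2 times the distance to it; the
     slopes of [phi] on the two cells are values of this derivative. *)
  set (phi := fun t => y t - (y1 m * t + y2 m / 2 * ((t - m) * (t - m)))).
  set (phi1 := fun t => y1 t - (y1 m * 1 + y2 m / 2 * (2 * (t - m)))).
  assert (Hphi : forall t, x j < t < x (S (S j)) -> is_derive phi t (phi1 t)).
  { intros t Ht. unfold phi, phi1. apply @is_derive_minus; [apply Hd1, Ht|].
    apply @is_derive_plus; [apply is_derive_scal, @is_derive_id|].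
    apply is_derive_scal. auto_derive; [auto|ring]. }
  assert (Hphic : forall t, x j <= t <= x (S (S j)) -> continuity_pt phi t).
  { intros t Ht. unfold phi. apply continuity_pt_minus; [apply Hc, Ht|].
    apply derive_continuity_pt with (y1 m * 1 + y2 m / 2 * (2 * (t - m))).
    apply @is_derive_plus; [apply is_derive_scal, @is_derive_id|].
    apply is_derive_scal. auto_derive; [auto|ring]. }
  assert (HV2' : 0 <= V2).
  { assert (Q : x j < m < x (S (S j))) by (split; assumption). eapply Rle_trans; [apply Rabs_pos|apply (HV2 m Q)]. }
  assert (Hb1 : forall t, x j < t < x (S (S j)) -> Rabs (phi1 t) <= V2 * Rabs (t - m)).
  { intros t Ht.
    assert (E : exists xi, x j < xi < x (S (S j)) /\ y1 t - y1 m = y2 xi * (t - m)).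
    { destruct (Rtotal_order t m) as [C|[C|C]].
      - destruct (mvt_open y1 y2 t m C) as [xi [H1 H2]].
        + intros u Hu. apply derive_continuity_pt with (y2 u), Hd2. lra.
        + intros u Hu. apply Hd2. lra.
        + exists xi. split; [lra|lra].
      - exists m. split; [lra|]. rewrite C. ring.
      - destruct (mvt_open y1 y2 m t C) as [xi [H1 H2]].
        + intros u Hu. apply derive_continuity_pt with (y2 u), Hd2. lra.
        + intros u Hu. apply Hd2. lra.
        + exists xi. split; [lra|lra]. }
    destruct E as [xi [Hxi Exi]].
    replace (phi1 t) with ((y2 xi - y2 m) * (t - m)) by (unfold phi1; lra).
    rewrite Rabs_mult. apply Rmult_le_compat_r; [apply Rabs_pos|apply HV2, Hxi]. }
  destruct (slope_mvt x phi phi1 j) as [xl [Hxl El]]; [exact X1| | |].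
  { intros t Ht. apply Hphic. fold m in Ht. lra. }
  { intros t Ht. apply Hphi. fold m in Ht. lra. }
  destruct (slope_mvt x phi phi1 (S j)) as [xr [Hxr Er]]; [exact X2| | |].
  { intros t Ht. apply Hphic. lra. }
  { intros t Ht. apply Hphi. lra. }
  assert (Bl : Rabs (phi1 xl) <= V2 * (m - x j)).
  { eapply Rle_trans; [apply Hb1; lra|]. apply Rmult_le_compat_l; [lra|].
    fold m in Hxl. rewrite Rabs_left1; lra. }
  assert (Br : Rabs (phi1 xr) <= V2 * (x (S (S j)) - m)).
  { eapply Rle_trans; [apply Hb1; lra|]. apply Rmult_le_compat_l; [lra|].
    fold m in Hxr. rewrite Rabs_pos_eq; lra. }
  destruct (slope_mvt x y y1 j) as [xi [Hxi Exi]]; [exact X1| | |].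
  { intros t Ht. apply Hc. fold m in Ht. lra. }
  { intros t Ht. apply Hd1. fold m in Ht. lra. }
  assert (E2 : (slp x (fun i => y (x i)) (S j) - slp x (fun i => y (x i)) j) / d - y2 m
      = (phi1 xr - phi1 xl) / d).
  { rewrite <- Er, <- El. unfold slp, phi, d. fold m. field. repeat split; lra. }
  unfold op. fold m. fold d.
  replace (- eps * ((slp x (fun i => y (x i)) (S j) - slp x (fun i => y (x i)) j) / d) +
     mu * av (S j) * slp x (fun i => y (x i)) j + bv (S j) * y m -
     (- eps * y2 m + mu * av (S j) * y1 m + bv (S j) * y m))
    with (- eps * ((slp x (fun i => y (x i)) (S j) - slp x (fun i => y (x i)) j) / d - y2 m)
          + mu * (av (S j) * (y1 xi - y1 m))) by (rewrite Exi; ring).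
  rewrite E2. apply Rabs_plus_le.
  - rewrite Rabs_mult, Rabs_Ropp, (Rabs_pos_eq eps) by lra.
    replace (2 * eps * V2) with (eps * (V2 * (2 * d) / d)) by (field; lra).
    apply Rmult_le_compat_l; [lra|]. apply Rabs_div_le; [exact Hd|].
    replace (V2 * (2 * d)) with (V2 * (x (S (S j)) - m) + V2 * (m - x j)) by (unfold d; field).
    apply Rabs_minus_le; assumption.
  - apply Rabs_mult_le; [rewrite Rabs_pos_eq; lra|]. apply Rabs_mult_le; [exact HK|]. apply HV1, Hxi.
Qed.

Lemma Rmin_mono x x' y : x <= x' -> Rmin x y <= Rmin x' y.
Proof. intros. apply Rmin_glb; [eapply Rle_trans; [apply Rmin_l|lra]|apply Rmin_r]. Qed.

(** A version for two arbitrary points of a stencil, with the layers evaluated at the ends of the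
    stencil, where they are largest. *)
Lemma layer_variation_within (l r c0 cL cR p q : R) (y y1 : R -> R) :
  0 < l -> 0 < r -> 0 <= c0 -> 0 <= cL -> 0 <= cR ->
  (forall x, 0 < x < 1 -> is_derive y x (y1 x)) ->
  (forall x, 0 < x < 1 -> p <= x <= q -> Rabs (y1 x) <= c0 + cL * EL l x + cR * ER r x) ->
  forall s t, 0 < s < 1 -> p <= s <= q -> 0 < t < 1 -> p <= t <= q ->
  Rabs (y t - y s) <= c0 * (q - p) + cL / l * (EL l p * Rmin (l * (q - p)) 1)
     + 2 * cR / r * (ER r q * Rmin (r * (q - p)) 1).
Proof.
  intros Hl Hr Hc0 HcL HcR Hd Hb.
  assert (W : forall s t, 0 < s < 1 -> p <= s <= q -> 0 < t < 1 -> p <= t <= q -> s <= t ->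
    Rabs (y t - y s) <= c0 * (q - p) + cL / l * (EL l p * Rmin (l * (q - p)) 1)
     + 2 * cR / r * (ER r q * Rmin (r * (q - p)) 1)).
  { intros s t Hs0 Hs Ht0 Ht Hst.
    eapply Rle_trans; [apply (layer_variation l r c0 cL cR s t y y1); auto|].
    - intros x Hx. apply derive_continuity_pt with (y1 x), Hd. lra.
    - intros x Hx. apply Hd. lra.
    - intros x Hx. apply Hb; lra.
    - assert (H1 : 0 <= cL / l) by (apply Rmult_le_pos; [lra|left; apply Rinv_0_lt_compat; lra]).
      assert (H2 : 0 <= 2 * cR / r) by (apply Rmult_le_pos; [lra|left; apply Rinv_0_lt_compat; lra]).
      assert (M1 : 0 <= Rmin (l * (t - s)) 1) by (apply Rmin_glb; nra).
      assert (M2 : 0 <= Rmin (r * (t - s)) 1) by (apply Rmin_glb; nra).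
      apply Rplus_le_compat; [apply Rplus_le_compat|].
      + apply Rmult_le_compat_l; lra.
      + apply Rmult_le_compat_l; [exact H1|]. apply Rmult_le_compat; [left; apply EL_pos|exact M1| |].
        * apply EL_mono; lra.
        * apply Rmin_mono. nra.
      + apply Rmult_le_compat_l; [exact H2|]. apply Rmult_le_compat; [left; apply ER_pos|exact M2| |].
        * apply ER_mono; lra.
        * apply Rmin_mono. nra. }
  intros s t Hs0 Hs Ht0 Ht. destruct (Rle_dec s t) as [C|C]; [apply W; assumption|].
  rewrite Rabs_minus_sym. apply W; try assumption. lra.
Qed.

Section Consistency.

Context {al ga l r eps mu : R}.
Hypothesis Hp : pars al ga l r eps mu.
Hypothesis Hal : 0 < al.
Hypothesis Hga : 0 < ga.

Let Hl : 1 < l := pars_l Hp.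
Let Hr : 2 * l <= r := pars_r Hp.
Let Hmu0 : 0 <= mu := pars_mu0 Hp.
Let Hk : 0 < ga * al.
Proof. apply Rmult_lt_0_compat; [exact Hga|exact Hal]. Qed.

Lemma c_eps_pos : 0 < eps.
Proof. rewrite (pars_eps Hp). apply Rdiv_lt_0_compat; nra. Qed.

Lemma c_eps_lr : eps * (l * r) <= ga * al.
Proof.
  rewrite (pars_eps Hp).
  replace (ga * al / (2 * l * r) * (l * r)) with (ga * al / 2) by (field; lra). lra.
Qed.

Lemma c_mu_l : mu * l <= ga.
Proof. pose proof (mu_l _ _ _ _ Hp). lra. Qed.

Lemma c_div_l X Y : X * l <= Y -> X <= Y / l.
Proof.
  intros H. apply Rmult_le_reg_r with l; [lra|].
  unfold Rdiv. rewrite Rmult_assoc, Rinv_l, Rmult_1_r; lra.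
Qed.

(* [D] is the width of the stencil, [EE] and [FF] are the sizes of the left layer
   at its left end and of the right layer at its right end. *)
Definition cons (D EE FF : R) : R :=
  D / l + EE * Rmin (l * D) 1 + r / l * (FF * Rmin (r * D) 1).

Lemma cons_nonneg D EE FF : 0 <= D -> 0 <= EE -> 0 <= FF -> 0 <= cons D EE FF.
Proof.
  intros. unfold cons.
  assert (0 <= Rmin (l * D) 1) by (apply Rmin_glb; nra).
  assert (0 <= Rmin (r * D) 1) by (apply Rmin_glb; nra).
  assert (0 < / l) by (apply Rinv_0_lt_compat; lra).
  assert (0 <= D / l) by (apply Rmult_le_pos; lra).
  assert (0 <= r / l) by (apply Rmult_le_pos; lra).
  assert (0 <= EE * Rmin (l * D) 1) by (apply Rmult_le_pos; lra).
  assert (0 <= r / l * (FF * Rmin (r * D) 1)) by (apply Rmult_le_pos; [|apply Rmult_le_pos]; lra).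
  lra.
Qed.

(** The classical estimate through third derivatives. The relations eps l r <= ga al and mu l <= ga
    turn all powers of [l] and [r] into the factors 1/l, 1 and r/l of [cons]. *)
Lemma truncation_layer (K c : R) (av bv x : nat -> R) (y y1 y2 y3 : R -> R) (j : nat) :
  0 <= c -> Rabs (av (S j)) <= K ->
  0 <= x j -> x j < x (S j) -> x (S j) < x (S (S j)) -> x (S (S j)) <= 1 ->
  (forall t, 0 <= t <= 1 -> continuity_pt y t) ->
  (forall t, 0 < t < 1 -> is_derive y t (y1 t)) ->
  (forall t, 0 < t < 1 -> is_derive y1 t (y2 t)) ->
  (forall t, 0 < t < 1 -> is_derive y2 t (y3 t)) ->
  (forall t, 0 < t < 1 -> Rabs (y2 t) <= c * (1 + l ^ 2 * EL l t + r ^ 2 * ER r t)) ->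
  (forall t, 0 < t < 1 -> Rabs (y3 t) <= c * (1 + l ^ 3 * EL l t + r ^ 3 * ER r t)) ->
  Rabs (op eps mu av bv x (fun i => y (x i)) j
    - (- eps * y2 (x (S j)) + mu * av (S j) * y1 (x (S j)) + bv (S j) * y (x (S j))))
  <= c * (4 * (ga * al) + 2 * K * ga) * cons (x (S (S j)) - x j) (EL l (x j)) (ER r (x (S (S j)))).
Proof.
  intros Hc HK X0 X1 X2 X3 Cy D1 D2 D3 B2 B3.
  set (D := x (S (S j)) - x j). set (EE := EL l (x j)). set (FF := ER r (x (S (S j)))).
  set (m1 := Rmin (l * D) 1). set (m2 := Rmin (r * D) 1).
  assert (HD : 0 < D) by (unfold D; lra).
  assert (M1 : 0 <= m1) by (apply Rmin_glb; nra). assert (M2 : 0 <= m2) by (apply Rmin_glb; nra).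
  assert (HE : 0 < EE) by apply EL_pos. assert (HF : 0 < FF) by apply ER_pos.
  set (V1 := c * D + c * l ^ 2 / l * (EE * m1) + 2 * (c * r ^ 2) / r * (FF * m2)).
  set (V2 := c * D + c * l ^ 3 / l * (EE * m1) + 2 * (c * r ^ 3) / r * (FF * m2)).
  assert (pl : forall k, 0 <= c * l ^ k) by (intros; apply Rmult_le_pos; [lra|apply pow_le; lra]).
  assert (pr : forall k, 0 <= c * r ^ k) by (intros; apply Rmult_le_pos; [lra|apply pow_le; lra]).
  eapply Rle_trans; [apply (truncation_error eps mu K V1 V2 av bv x y y1 y2 j); auto|].
  - apply c_eps_pos.
  - intros t Ht. apply Cy; lra.
  - intros t Ht. apply D1; lra.
  - intros t Ht. apply D2; lra.
  - intros t Ht. apply (layer_variation_within l r c (c * l ^ 2) (c * r ^ 2) (x j) (x (S (S j))) y1 y2);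
      auto; try lra.
    + intros u Hu0 Hu. eapply Rle_trans; [apply B2; lra|]. right; ring.
  - intros t Ht. apply (layer_variation_within l r c (c * l ^ 3) (c * r ^ 3) (x j) (x (S (S j))) y2 y3);
      auto; try lra.
    + intros u Hu0 Hu. eapply Rle_trans; [apply B3; lra|]. right; ring.
  - pose proof c_eps_lr as He. pose proof c_mu_l as Hmu. pose proof c_eps_pos as He0.
    assert (HK0 : 0 <= K) by (eapply Rle_trans; [apply Rabs_pos|exact HK]).
    set (P := EE * m1). set (Q := FF * m2).
    assert (HP : 0 <= P) by (apply Rmult_le_pos; lra). assert (HQ : 0 <= Q) by (apply Rmult_le_pos; lra).
    replace V1 with (c * (D + l * P + 2 * (r * Q))) by (unfold V1, P, Q; field; lra).
    replace V2 with (c * (D + l ^ 2 * P + 2 * (r ^ 2 * Q))) by (unfold V2, P, Q; field; lra).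
    unfold cons. fold m1 m2. fold P Q.
    assert (Hll : l * l <= l * r) by (apply Rmult_le_compat_l; lra).
    assert (E1 : eps * D <= ga * al * (D / l)).
    { replace (ga * al * (D / l)) with (ga * al * D / l) by (field; lra). apply c_div_l.
      replace (eps * D * l) with (eps * l * D) by ring. apply Rmult_le_compat_r; [lra|].
      apply Rle_trans with (eps * (l * r)); [apply Rmult_le_compat_l; [lra|nra]|exact He]. }
    assert (E2 : eps * (l ^ 2 * P) <= ga * al * P).
    { rewrite <- Rmult_assoc. apply Rmult_le_compat_r; [lra|].
      apply Rle_trans with (eps * (l * r)); [apply Rmult_le_compat_l; [lra|simpl; lra]|exact He]. }
    assert (E3 : eps * (r ^ 2 * Q) <= ga * al * (r / l * Q)).
    { replace (eps * (r ^ 2 * Q)) with (eps * (l * r) * (r / l * Q)) by (field; lra).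
      apply Rmult_le_compat_r; [|exact He]. apply Rmult_le_pos; [|lra].
      apply Rmult_le_pos; [lra|left; apply Rinv_0_lt_compat; lra]. }
    assert (F1 : mu * D <= ga * (D / l)).
    { replace (ga * (D / l)) with (ga * D / l) by (field; lra). apply c_div_l.
      replace (mu * D * l) with (mu * l * D) by ring. apply Rmult_le_compat_r; lra. }
    assert (F2 : mu * (l * P) <= ga * P).
    { rewrite <- Rmult_assoc. apply Rmult_le_compat_r; lra. }
    assert (F3 : mu * (r * Q) <= ga * (r / l * Q)).
    { replace (mu * (r * Q)) with (mu * l * (r / l * Q)) by (field; lra).
      apply Rmult_le_compat_r; [|exact Hmu]. apply Rmult_le_pos; [|lra].
      apply Rmult_le_pos; [lra|left; apply Rinv_0_lt_compat; lra]. }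
    set (d := D / l) in *. set (q := r / l * Q) in *.
    assert (Hd : 0 <= d) by (unfold d; apply Rmult_le_pos; [lra|left; apply Rinv_0_lt_compat; lra]).
    assert (Hq : 0 <= q) by (unfold q; apply Rmult_le_pos; [apply Rmult_le_pos; [lra|left; apply Rinv_0_lt_compat; lra]|lra]).
    apply Rle_trans with (c * (2 * (ga * al * d + ga * al * P + 2 * (ga * al * q)) + K * (ga * d + ga * P + 2 * (ga * q)))).
    + replace (2 * eps * (c * (D + l ^ 2 * P + 2 * (r ^ 2 * Q))) + mu * (K * (c * (D + l * P + 2 * (r * Q)))))
        with (c * (2 * (eps * D + eps * (l ^ 2 * P) + 2 * (eps * (r ^ 2 * Q)))
              + K * (mu * D + mu * (l * P) + 2 * (mu * (r * Q))))) by ring.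
      apply Rmult_le_compat_l; [lra|]. apply Rplus_le_compat; [lra|].
      apply Rmult_le_compat_l; lra.
    + replace (c * (4 * (ga * al) + 2 * K * ga) * (d + P + q))
        with (c * ((4 * (ga * al) + 2 * K * ga) * (d + P + q))) by ring.
      apply Rmult_le_compat_l; [lra|].
      assert (0 <= ga * al * d) by nra. assert (0 <= ga * al * P) by nra. assert (0 <= ga * al * q) by nra.
      assert (0 <= K * (ga * d)) by (apply Rmult_le_pos; nra). assert (0 <= K * (ga * P)) by (apply Rmult_le_pos; nra).
      assert (0 <= K * (ga * q)) by (apply Rmult_le_pos; nra). lra.
Qed.

(** For the solution minus its strong outflow layer. Only second derivatives are used, so the
    variation of y'' is replaced by twice its size; the weaker layer amplitude l r times [eps] is
    bounded, and no factor r/l appears. *)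
Lemma truncation_weak_outflow (K c : R) (av bv x : nat -> R) (y y1 y2 : R -> R) (j : nat) :
  0 <= c -> Rabs (av (S j)) <= K ->
  0 <= x j -> x j < x (S j) -> x (S j) < x (S (S j)) -> x (S (S j)) <= 1 ->
  (forall t, 0 <= t <= 1 -> continuity_pt y t) ->
  (forall t, 0 < t < 1 -> is_derive y t (y1 t)) ->
  (forall t, 0 < t < 1 -> is_derive y1 t (y2 t)) ->
  (forall t, 0 < t < 1 -> Rabs (y2 t) <= c * (1 + l ^ 2 * EL l t + l * r * ER r t)) ->
  Rabs (op eps mu av bv x (fun i => y (x i)) j
    - (- eps * y2 (x (S j)) + mu * av (S j) * y1 (x (S j)) + bv (S j) * y (x (S j))))
  <= c * (4 * (ga * al) + 2 * K * ga) *
     (/ (l * r) + l / r * EL l (x j) + ER r (x (S (S j)))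
      + (x (S (S j)) - x j) / l + EL l (x j) * Rmin (l * (x (S (S j)) - x j)) 1).
Proof.
  intros Hc HK X0 X1 X2 X3 Cy D1 D2 B2.
  set (D := x (S (S j)) - x j). set (EE := EL l (x j)). set (FF := ER r (x (S (S j)))).
  set (m1 := Rmin (l * D) 1).
  assert (HD : 0 < D) by (unfold D; lra).
  assert (M1 : 0 <= m1) by (apply Rmin_glb; nra).
  assert (HE : 0 < EE) by apply EL_pos. assert (HF : 0 < FF) by apply ER_pos.
  set (V1 := c * D + c * l ^ 2 / l * (EE * m1) + 2 * (c * (l * r)) / r * FF).
  set (V2 := 2 * (c * (1 + l ^ 2 * EE + l * r * FF))).
  assert (pl : 0 <= c * l ^ 2) by (apply Rmult_le_pos; [lra|apply pow_le; lra]).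
  assert (Hlr : 0 < l * r) by nra.
  assert (pr : 0 <= c * (l * r)) by nra.
  assert (Bs : forall t, x j < t < x (S (S j)) -> Rabs (y2 t) <= c * (1 + l ^ 2 * EE + l * r * FF)).
  { intros t Ht. eapply Rle_trans; [apply B2; lra|]. apply Rmult_le_compat_l; [lra|].
    assert (EL l t <= EE) by (apply EL_mono; lra). assert (ER r t <= FF) by (apply ER_mono; lra).
    assert (l ^ 2 * EL l t <= l ^ 2 * EE) by (apply Rmult_le_compat_l; [apply pow_le; lra|lra]).
    assert (l * r * ER r t <= l * r * FF) by (apply Rmult_le_compat_l; lra). lra. }
  eapply Rle_trans; [apply (truncation_error eps mu K V1 V2 av bv x y y1 y2 j); auto|].
  - apply c_eps_pos.
  - intros t Ht. apply Cy; lra.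
  - intros t Ht. apply D1; lra.
  - intros t Ht. apply D2; lra.
  - intros t Ht. eapply Rle_trans; [apply (layer_variation_within l r c (c * l ^ 2) (c * (l * r)) (x j) (x (S (S j))) y1 y2);
      auto; try lra|].
    + intros u Hu0 Hu. eapply Rle_trans; [apply B2; lra|]. right; ring.
    + fold D EE FF m1. unfold V1. apply Rplus_le_compat_l. apply Rmult_le_compat_l.
      * apply Rmult_le_pos; [lra|left; apply Rinv_0_lt_compat; lra].
      * rewrite <- (Rmult_1_r FF) at 2. apply Rmult_le_compat_l; [lra|apply Rmin_r].
  - intros t Ht. unfold V2. replace (2 * (c * (1 + l ^ 2 * EE + l * r * FF)))
      with (c * (1 + l ^ 2 * EE + l * r * FF) + c * (1 + l ^ 2 * EE + l * r * FF)) by ring.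
    apply Rabs_minus_le; apply Bs; [exact Ht|lra].
  - pose proof c_eps_lr as He. pose proof c_mu_l as Hmu. pose proof c_eps_pos as He0.
    assert (HK0 : 0 <= K) by (eapply Rle_trans; [apply Rabs_pos|exact HK]).
    set (P := EE * m1).
    assert (HP : 0 <= P) by (apply Rmult_le_pos; lra).
    replace V1 with (c * (D + l * P + 2 * (l * FF))) by (unfold V1, P; field; lra).
    unfold V2.
    assert (E1 : eps <= ga * al * / (l * r)).
    { apply Rmult_le_reg_r with (l * r); [lra|]. rewrite Rmult_assoc, Rinv_l; lra. }
    assert (E2 : eps * (l ^ 2 * EE) <= ga * al * (l / r * EE)).
    { replace (eps * (l ^ 2 * EE)) with (eps * (l * r) * (l / r * EE)) by (field; lra).
      apply Rmult_le_compat_r; [|exact He]. apply Rmult_le_pos; [|lra].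
      apply Rmult_le_pos; [lra|left; apply Rinv_0_lt_compat; lra]. }
    assert (E3 : eps * (l * r * FF) <= ga * al * FF).
    { rewrite <- Rmult_assoc. apply Rmult_le_compat_r; lra. }
    assert (F1 : mu * D <= ga * (D / l)).
    { replace (ga * (D / l)) with (ga * D / l) by (field; lra). apply c_div_l.
      replace (mu * D * l) with (mu * l * D) by ring. apply Rmult_le_compat_r; lra. }
    assert (F2 : mu * (l * P) <= ga * P).
    { rewrite <- Rmult_assoc. apply Rmult_le_compat_r; lra. }
    assert (F3 : mu * (l * FF) <= ga * FF).
    { rewrite <- Rmult_assoc. apply Rmult_le_compat_r; lra. }
    set (d := D / l) in *. set (i0 := / (l * r)) in *. set (q := l / r * EE) in *.
    assert (Hd : 0 <= d) by (unfold d; apply Rmult_le_pos; [lra|left; apply Rinv_0_lt_compat; lra]).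
    assert (Hi0 : 0 <= i0) by (left; apply Rinv_0_lt_compat; lra).
    assert (Hq : 0 <= q) by (unfold q; apply Rmult_le_pos; [apply Rmult_le_pos; [lra|left; apply Rinv_0_lt_compat; lra]|lra]).
    apply Rle_trans with (c * (4 * (ga * al * i0 + ga * al * q + ga * al * FF) + K * (ga * d + ga * P + 2 * (ga * FF)))).
    + replace (2 * eps * (2 * (c * (1 + l ^ 2 * EE + l * r * FF))) + mu * (K * (c * (D + l * P + 2 * (l * FF)))))
        with (c * (4 * (eps + eps * (l ^ 2 * EE) + eps * (l * r * FF))
              + K * (mu * D + mu * (l * P) + 2 * (mu * (l * FF))))) by ring.
      apply Rmult_le_compat_l; [lra|]. apply Rplus_le_compat; [lra|].
      apply Rmult_le_compat_l; lra.
    + fold P. replace (c * (4 * (ga * al) + 2 * K * ga) * (i0 + q + FF + d + P))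
        with (c * ((4 * (ga * al) + 2 * K * ga) * (i0 + q + FF + d + P))) by ring.
      apply Rmult_le_compat_l; [lra|].
      assert (0 <= ga * al * d) by nra. assert (0 <= ga * al * P) by nra.
      assert (0 <= K * ga) by nra.
      assert (0 <= K * ga * d) by nra. assert (0 <= K * ga * P) by nra.
      assert (0 <= K * ga * i0) by nra. assert (0 <= K * ga * q) by nra. assert (0 <= K * ga * FF) by nra. nra.
Qed.

(** For components with a layer too steep for the mesh, Taylor expansion is useless; their slopes
    and values are estimated separately. *)
Lemma op_by_slopes (K : R) (av bv x s : nat -> R) (j : nat) :
  Rabs (av (S j)) <= K -> x j < x (S (S j)) ->
  Rabs (op eps mu av bv x s j - bv (S j) * s (S j))
  <= eps / ((x (S (S j)) - x j) / 2) * (Rabs (slp x s (S j)) + Rabs (slp x s j))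
     + mu * K * Rabs (slp x s j).
Proof.
  intros HK X. pose proof c_eps_pos as He. set (h := (x (S (S j)) - x j) / 2).
  assert (Hh : 0 < h) by (unfold h; lra).
  assert (Hq : 0 < eps / h) by (apply Rdiv_lt_0_compat; lra).
  unfold op. fold h.
  replace (- eps * ((slp x s (S j) - slp x s j) / h) + mu * av (S j) * slp x s j
      + bv (S j) * s (S j) - bv (S j) * s (S j))
    with (- (eps / h * (slp x s (S j) - slp x s j)) + mu * (av (S j) * slp x s j)) by (field; lra).
  rewrite (Rmult_assoc mu). apply Rabs_plus_le.
  - rewrite Rabs_Ropp, Rabs_mult, (Rabs_pos_eq (eps / h)) by lra.
    apply Rmult_le_compat_l; [lra|]. apply Rabs_minus_le; lra.
  - apply Rabs_mult_le; [rewrite Rabs_pos_eq; lra|]. apply Rabs_mult_le; [exact HK|lra].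
Qed.

End Consistency.
Arguments cons : clear implicits.

(** * The layer structure of the solution *)

Record outflow_split {C l r eps mu : R} {a u s P y2 : R -> R} : Prop := {
  os_cont : forall x, continuity_pt s x;
  os_ds : forall x, is_derive s x (P x);
  os_dP : forall x, 0 < x < 1 -> is_derive P x (mu * a x / eps * P x);
  os_dy : forall x, 0 < x < 1 -> is_derive (fun t => Derive u t - P t) x (y2 x);
  os_s : forall x, 0 <= x <= 1 -> Rabs (s x) <= C * ER r x;
  os_P : forall x, 0 < x < 1 -> Rabs (P x) <= C * (r * ER r x);
  os_y2 : forall x, 0 < x < 1 -> Rabs (y2 x) <= C * (1 + l ^ 2 * EL l x + l * r * ER r x) }.
Arguments outflow_split : clear implicits.

(** The interface to the error analysis, offering three descriptions of one solution: derivative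
    bounds for the whole, the decomposition into the regular part and the layers, and, when
    convection dominates, the splitting of the outflow layer. Which one is sharp depends on how [l]
    and [r] compare with N. *)
Record layered_solution {C ga l r eps mu : R} {a b f u ut u2 u3 v v1 v2 v3 g : R -> R} : Prop := {
  ls_ut : forall x, 0 <= x <= 1 -> ut x = u x;
  ls_cont : forall x, continuity_pt ut x;
  ls_d1 : forall x, 0 < x < 1 -> is_derive ut x (Derive u x);
  ls_d2 : forall x, 0 < x < 1 -> is_derive (Derive u) x (u2 x);
  ls_d3 : forall x, 0 < x < 1 -> is_derive u2 x (u3 x);
  ls_ode : forall x, 0 < x < 1 -> - eps * u2 x + mu * a x * Derive u x + b x * ut x = f x;
  ls_b1 : forall x, 0 < x < 1 -> Rabs (Derive u x) <= C * (1 + l * EL l x + r * ER r x);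
  ls_b2 : forall x, 0 < x < 1 -> Rabs (u2 x) <= C * (1 + l ^ 2 * EL l x + r ^ 2 * ER r x);
  ls_b3 : forall x, 0 < x < 1 -> Rabs (u3 x) <= C * (1 + l ^ 3 * EL l x + r ^ 3 * ER r x);
  ls_vcont : forall x, continuity_pt v x;
  ls_dv : forall x, 0 < x < 1 -> is_derive v x (v1 x);
  ls_dv1 : forall x, 0 < x < 1 -> is_derive v1 x (v2 x);
  ls_dv2 : forall x, 0 < x < 1 -> is_derive v2 x (v3 x);
  ls_v2 : forall x, 0 < x < 1 -> Rabs (v2 x) <= C;
  ls_v3 : forall x, 0 < x < 1 -> Rabs (v3 x) <= C;
  ls_v_ode : forall x, 0 < x < 1 -> - eps * v2 x + mu * a x * v1 x + b x * v x = f x - g x;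
  ls_g : forall x, 0 < x < 1 -> Rabs (g x) <= C / l ^ 3;
  ls_z : forall x, 0 <= x <= 1 -> Rabs (ut x - v x) <= C * (/ l ^ 3 + EL l x + ER r x);
  ls_z1 : forall x, 0 < x < 1 -> Rabs (Derive u x - v1 x) <= C * (/ l ^ 2 + l * EL l x + r * ER r x);
  ls_split : mu = ga / (2 * l) -> exists s P y2, outflow_split C l r eps mu a u s P y2 }.
Arguments layered_solution : clear implicits.

Lemma solution_layers (al ga : R) (a b f : R -> R) :
  0 < al -> 0 < ga ->
  smooth 7 a -> smooth 9 b -> smooth 9 f ->
  (forall x, in_Omega x -> al < a x) ->
  (forall x, in_Omega x -> ga * a x < b x) ->
  exists M C a1 a2 b1 b2,
    coefs al ga M a a1 a2 b b1 b2 /\ 0 < C /\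
    forall l r eps mu u,
      pars al ga l r eps mu -> bvp_solution eps mu a b f u ->
      exists ut u2 u3 v v1 v2 v3 g, layered_solution C ga l r eps mu a b f u ut u2 u3 v v1 v2 v3 g.
Proof.
  intros Hal Hga Sa Sb Sf Ha Hb.
  destruct (regular_decomposition al ga a b f Hal Hga Sa Sb Sf Ha Hb)
    as [M [a1 [a2 [b1 [b2 [A [Hco [HAc [HAd Hreg]]]]]]]]].
  destruct (remainder_bound Hco) as [Cz [HCz HZ]].
  destruct (remainder_derivatives Hco) as [Cd [HCd HD]].
  destruct (outflow_splitting Hco HAc HAd) as [Cs [HCs HS]].
  pose proof (coefs_M Hco) as HM.
  set (C := M + Cz + Cd + Cs).
  exists M, C, a1, a2, b1, b2. split; [exact Hco|]. split; [unfold C; lra|].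
  intros l r eps mu u Hp Hu.
  destruct (Hreg l r eps mu u Hp Hu) as [ut [v [v1 [v2 [v3 [g [g1 [g2 Hr]]]]]]]].
  pose proof (reg_rem Hr) as Hz.
  destruct (HD _ _ _ _ _ _ _ _ _ Hp Hz) as [z2 [z3 [dz1 [dz2 [E1 [_ [_ [B1 [B2 B3]]]]]]]]].
  pose proof (pars_eps_pos Hco _ _ _ _ Hp) as He.
  pose proof (pars_l Hp) as Hl. pose proof (pars_r Hp) as Hrr.
  assert (du : forall x, 0 < x < 1 -> is_derive (Derive u) x (v2 x + z2 x)).
  { intros x Hx. apply (is_derive_ext (fun t => v1 t + (Derive u t - v1 t))).
    - intros t. apply Rplus_minus.
    - apply @is_derive_plus; [apply (reg_dv1 Hr x Hx)|apply dz1, Hx]. }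
  assert (wl : forall k, 0 < l ^ k) by (intros; apply pow_lt; lra).
  assert (wr : forall k, 0 < r ^ k) by (intros; apply pow_lt; lra).
  assert (Hil : 0 < / l < 1).
  { split; [apply Rinv_0_lt_compat; lra|]. rewrite <- Rinv_1. apply Rinv_lt_contravar; lra. }
  assert (w1 : forall x, wt l r 1 x = / l ^ 2 + l * EL l x + r * ER r x) by (intros; unfold wt; field; lra).
  assert (w2 : forall x, wt l r 2 x = / l + l ^ 2 * EL l x + r ^ 2 * ER r x) by (intros; unfold wt; field; lra).
  assert (w3 : forall x, wt l r 3 x = 1 + l ^ 3 * EL l x + r ^ 3 * ER r x) by (intros; unfold wt; field; lra).
  assert (L2 : / l ^ 2 <= 1) by (rewrite <- Rinv_1; apply Rinv_le_contravar; [lra|apply pow_R1_Rle; lra]).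
  assert (sumb : forall j p q x, 0 < x < 1 -> Rabs p <= M -> Rabs q <= Cd * wt l r j x ->
     wt l r j x <= 1 + l ^ j * EL l x + r ^ j * ER r x ->
     Rabs (p + q) <= C * (1 + l ^ j * EL l x + r ^ j * ER r x)).
  { intros j p q x Hx P Q W. eapply Rle_trans; [apply Rabs_plus_le; [exact P|exact Q]|].
    pose proof (EL_pos l x). pose proof (ER_pos r x).
    assert (0 < l ^ j * EL l x) by (apply Rmult_lt_0_compat; auto).
    assert (0 < r ^ j * ER r x) by (apply Rmult_lt_0_compat; auto).
    set (S := 1 + l ^ j * EL l x + r ^ j * ER r x) in *.
    assert (1 <= S) by (unfold S; lra).
    assert (Cd * wt l r j x <= Cd * S) by (apply Rmult_le_compat_l; lra).
    assert (M * 1 <= M * S) by (apply Rmult_le_compat_l; lra).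
    apply Rle_trans with ((M + Cd) * S); [lra|]. apply Rmult_le_compat_r; [lra|unfold C; lra]. }
  exists ut, (fun x => v2 x + z2 x), (fun x => v3 x + z3 x), v, v1, v2, v3, g.
  constructor.
  - apply (reg_u Hr).
  - apply (reg_ut_cont Hr).
  - apply (reg_dut Hr).
  - exact du.
  - intros x Hx. apply @is_derive_plus; [apply (reg_dv2 Hr x Hx)|apply dz2, Hx].
  - intros x Hx. destruct Hu as [_ [_ [_ Hu]]]. destruct (Hu x Hx) as [_ [Hu2 Hode]].
    rewrite <- (is_derive_unique _ _ _ (du x Hx)), (reg_u Hr) by lra.
    exact Hode.
  - intros x Hx. replace (Derive u x) with (v1 x + (Derive u x - v1 x)) by ring.
    pose proof (sumb 1%nat (v1 x) (Derive u x - v1 x) x Hx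
       (reg_v1 Hr x Hx) (B1 x Hx)) as S. rewrite w1 in S.
    simpl pow in S. rewrite !Rmult_1_r in S. apply S. simpl pow in L2. rewrite Rmult_1_r in L2. lra.
  - intros x Hx. apply (sumb 2%nat (v2 x) (z2 x) x Hx (reg_v2 Hr x Hx) (B2 x Hx)).
    rewrite w2. lra.
  - intros x Hx. apply (sumb 3%nat (v3 x) (z3 x) x Hx (reg_v3 Hr x Hx) (B3 x Hx)).
    rewrite w3. lra.
  - apply (reg_cont Hr).
  - apply (reg_dv Hr).
  - apply (reg_dv1 Hr).
  - apply (reg_dv2 Hr).
  - intros x Hx. eapply Rle_trans; [apply (reg_v2 Hr x Hx)|unfold C; lra].
  - intros x Hx. eapply Rle_trans; [apply (reg_v3 Hr x Hx)|unfold C; lra].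
  - intros x Hx. destruct Hu as [_ [_ [_ Hu]]]. destruct (Hu x Hx) as [_ [Hu2 Hode]].
    specialize (E1 x Hx). simpl in E1.
    rewrite (reg_u Hr) in E1 by lra.
    assert (E2 : Derive_n u 2 x = v2 x + z2 x) by (apply (is_derive_unique _ _ _ (du x Hx))).
    rewrite E2 in Hode. lra.
  - intros x Hx. eapply Rle_trans; [apply (rem_g Hz x Hx)|].
    apply Rmult_le_compat_r; [left; apply Rinv_0_lt_compat, wl|unfold C; lra].
  - intros x Hx. eapply Rle_trans; [apply (HZ _ _ _ _ _ _ _ _ _ Hp Hz x Hx)|].
    replace (/ l ^ 3 + EL l x + ER r x) with (wt l r 0 x) by (unfold wt; simpl; ring).
    apply Rmult_le_compat_r; [left; apply wt_pos; lra|unfold C; lra].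
  - intros x Hx. eapply Rle_trans; [apply (B1 x Hx)|]. rewrite <- w1.
    apply Rmult_le_compat_r; [left; apply wt_pos; lra|unfold C; lra].
  - intros Hmu.
    destruct (HS _ _ _ _ _ _ _ _ _ Hp Hmu Hz) as [s [P [Q1 [S1 [S2 [S3 [S4 [S5 [S6 [_ S8]]]]]]]]]].
    exists s, P, (fun x => v2 x + Q1 x). constructor; auto.
    + intros x Hx. apply (is_derive_ext (fun t => v1 t + (Derive u t - v1 t - P t))).
      * intros t. change (@eq R (v1 t + (Derive u t - v1 t - P t)) (Derive u t - P t)). ring.
      * apply @is_derive_plus; [apply (reg_dv1 Hr x Hx)|apply S4, Hx].
    + intros x Hx. eapply Rle_trans; [apply S5, Hx|]. apply Rmult_le_compat_r; [left; apply ER_pos|unfold C; lra].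
    + intros x Hx. eapply Rle_trans; [apply S6, Hx|]. pose proof (ER_pos r x).
      apply Rmult_le_compat_r; [apply Rmult_le_pos; lra|unfold C; lra].
    + intros x Hx'.
      eapply Rle_trans; [apply Rabs_plus_le; [apply (reg_v2 Hr x Hx')|apply S8, Hx']|].
      rewrite w1. pose proof (EL_pos l x). pose proof (ER_pos r x). pose proof (wl 2%nat).
      replace (l * (/ l ^ 2 + l * EL l x + r * ER r x)) with (/ l + l ^ 2 * EL l x + l * r * ER r x) by (field; lra).
      assert (0 < l ^ 2 * EL l x) by nra. assert (0 < l * r) by nra. assert (0 < l * r * ER r x) by nra.
      set (S := 1 + l ^ 2 * EL l x + l * r * ER r x).
      assert (M * 1 <= M * S) by (apply Rmult_le_compat_l; unfold S; lra).
      assert (Cs * (/ l + l ^ 2 * EL l x + l * r * ER r x) <= Cs * S) by (apply Rmult_le_compat_l; unfold S; lra).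
      apply Rle_trans with ((M + Cs) * S); [lra|]. apply Rmult_le_compat_r; [unfold S; lra|unfold C; lra].
Qed.

(** * Consistency and interpolation errors on one stencil or one cell *)

Section LocalErrors.

Context {al ga M C l r eps mu : R} {a b f u ut u2 u3 v v1 v2 v3 g : R -> R}.
Hypotheses (Hal : 0 < al) (Hga : 0 < ga) (HM : 1 <= M) (HC : 0 < C).
Hypothesis Hp : pars al ga l r eps mu.
Hypothesis HaM : forall x, 0 < x < 1 -> Rabs (a x) <= M.
Hypothesis HbM : forall x, 0 < x < 1 -> Rabs (b x) <= M.
Hypothesis Hs : layered_solution C ga l r eps mu a b f u ut u2 u3 v v1 v2 v3 g.

Let Hl : 1 < l := pars_l Hp.
Let Hr : 2 * l <= r := pars_r Hp.
Let Hmu0 : 0 <= mu := pars_mu0 Hp.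
Let Hk : 0 < ga * al.
Proof. apply Rmult_lt_0_compat; [exact Hga|exact Hal]. Qed.

Section Stencil.

Context {N : R} {x av bv : nat -> R} {j : nat}.
Hypothesis Hav : av (S j) = a (x (S j)).
Hypothesis Hbv : bv (S j) = b (x (S j)).
Hypotheses (X0 : 0 <= x j) (X1 : x j < x (S j)) (X2 : x (S j) < x (S (S j))) (X3 : x (S (S j)) <= 1).

Let Hm : 0 < x (S j) < 1.
Proof. lra. Qed.

Lemma consistency_layer :
  Rabs (op eps mu av bv x (fun i => ut (x i)) j - f (x (S j)))
  <= C * (4 * (ga * al) + 2 * M * ga) * cons l r (x (S (S j)) - x j) (EL l (x j)) (ER r (x (S (S j)))).
Proof.
  rewrite <- (ls_ode Hs) by exact Hm. rewrite <- Hav, <- Hbv.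
  apply (truncation_layer Hp Hal Hga M C av bv x ut (Derive u) u2 u3 j); auto; try lra.
  - rewrite Hav. apply HaM, Hm.
  - intros t _. apply (ls_cont Hs).
  - apply (ls_d1 Hs).
  - apply (ls_d2 Hs).
  - apply (ls_d3 Hs).
  - apply (ls_b2 Hs).
  - apply (ls_b3 Hs).
Qed.

Hypotheses (HN : 0 < N) (HhN : 1 / N <= x (S j) - x j).

Lemma eps_over_step : eps / ((x (S (S j)) - x j) / 2) <= 2 * (ga * al) * (N / (l * r)).
Proof.
  assert (He : 0 < eps) by (apply (c_eps_pos Hp Hal Hga)).
  assert (Hlr : 0 < l * r) by nra.
  assert (HiN : 0 < 1 / N) by (apply Rdiv_lt_0_compat; lra).
  apply Rle_trans with (eps * (2 * N)).
  - apply Rmult_le_compat_l; [lra|]. replace (2 * N) with (/ (1 / N / 2)) by (field; lra).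
    apply Rinv_le_contravar; lra.
  - assert (E : eps <= ga * al * / (l * r)).
    { apply Rmult_le_reg_r with (l * r); [lra|]. rewrite Rmult_assoc, Rinv_l, Rmult_1_r by lra.
      apply (c_eps_lr Hp Hal Hga). }
    apply Rle_trans with (ga * al * / (l * r) * (2 * N)); [apply Rmult_le_compat_r; lra|].
    right. unfold Rdiv. ring.
Qed.

Lemma mu_le_div : mu <= ga / l.
Proof.
  apply Rle_trans with (ga / (2 * l)); [apply (pars_mu Hp)|].
  apply Rmult_le_compat_l; [lra|]. apply Rinv_le_contravar; lra.
Qed.

Lemma slope_bound_size (s : R -> R) (S0 : R) :
  (forall t, x j <= t <= x (S j) -> Rabs (s t) <= S0) ->
  Rabs (slp x (fun i => s (x i)) j) <= 2 * N * S0.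
Proof.
  intros HS. unfold slp. assert (HiN : 0 < 1 / N) by (apply Rdiv_lt_0_compat; lra).
  assert (HS0 : 0 <= S0) by (eapply Rle_trans; [apply Rabs_pos|apply (HS (x j)); lra]).
  apply Rle_trans with (2 * S0 / (x (S j) - x j)).
  - apply Rabs_div_le; [lra|]. replace (2 * S0) with (S0 + S0) by ring.
    apply Rabs_minus_le; apply HS; lra.
  - replace (2 * N * S0) with (2 * S0 * / (1 / N)) by (field; lra).
    apply Rmult_le_compat_l; [lra|]. apply Rinv_le_contravar; lra.
Qed.

(** No positive power of [r] survives: the rest u - s has the weak layer, and for [s] the slopes O(r
    ER) meet eps / h, of order N / (l r), while in the convection term the slope is bounded by the
    values, 2 N ER, and meets mu <= ga / l. *)
Lemma consistency_split :
  mu = ga / (2 * l) ->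
  Rabs (op eps mu av bv x (fun i => ut (x i)) j - f (x (S j)))
  <= C * (8 * (ga * al) + 4 * M * ga) *
     (/ (l * r) + l / r * EL l (x j) + ER r (x (S (S j)))
      + (x (S (S j)) - x j) / l + EL l (x j) * Rmin (l * (x (S (S j)) - x j)) 1
      + N / l * ER r (x (S (S j)))).
Proof.
  intros Hmu.
  destruct (ls_split Hs Hmu)
    as [s [P [y2 [S1 S2 S3 S4 S5 S6 S7]]]].
  assert (He : 0 < eps) by (apply (c_eps_pos Hp Hal Hga)).
  set (FF := ER r (x (S (S j)))). assert (HF : 0 < FF) by apply ER_pos.
  set (y := fun t => ut t - s t).
  assert (T1 := truncation_weak_outflow Hp Hal Hga M C av bv x y
     (fun t => Derive u t - P t) y2 j).
  assert (Ey : - eps * y2 (x (S j)) + mu * av (S j) * (Derive u (x (S j)) - P (x (S j))) + bv (S j) * y (x (S j))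
      = f (x (S j)) - bv (S j) * s (x (S j))).
  { rewrite <- (ls_ode Hs) by exact Hm.
    assert (E : y2 (x (S j)) = u2 (x (S j)) - mu * a (x (S j)) / eps * P (x (S j))).
    { rewrite <- (is_derive_unique _ _ _ (S4 _ Hm)). apply is_derive_unique.
      apply @is_derive_minus; [apply (ls_d2 Hs), Hm|apply S3, Hm]. }
    rewrite E, Hav, Hbv. unfold y. field. lra. }
  assert (B1 : Rabs (op eps mu av bv x (fun i => y (x i)) j - (f (x (S j)) - bv (S j) * s (x (S j))))
     <= C * (4 * (ga * al) + 2 * M * ga) *
     (/ (l * r) + l / r * EL l (x j) + FF
      + (x (S (S j)) - x j) / l + EL l (x j) * Rmin (l * (x (S (S j)) - x j)) 1)).
  { rewrite <- Ey. apply T1; clear T1; try lra.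
    - rewrite Hav. apply HaM, Hm.
    - intros t Ht. apply continuity_pt_minus; [apply (ls_cont Hs)|apply S1].
    - intros t Ht. apply @is_derive_minus; [apply (ls_d1 Hs), Ht|apply S2].
    - exact S4.
    - intros t Ht. apply S7, Ht. }
  clear T1.
  assert (B2 := op_by_slopes Hp Hal Hga M av bv x (fun i => s (x i)) j).
  assert (B3 : Rabs (op eps mu av bv x (fun i => s (x i)) j - bv (S j) * s (x (S j)))
    <= eps / ((x (S (S j)) - x j) / 2) * (Rabs (slp x (fun i => s (x i)) (S j)) + Rabs (slp x (fun i => s (x i)) j))
     + mu * M * Rabs (slp x (fun i => s (x i)) j)).
  { apply B2; [rewrite Hav; apply HaM, Hm|lra]. }
  clear B2.
  assert (SP : forall i t, (i = j \/ i = S j) -> x i < t < x (S i) -> Rabs (P t) <= C * (r * FF)).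
  { intros i t Hi Ht. assert (Hx : 0 < t < x (S (S j))) by (destruct Hi; subst i; lra).
    eapply Rle_trans; [apply S6; lra|]. apply Rmult_le_compat_l; [lra|]. apply Rmult_le_compat_l; [lra|].
    apply ER_mono; lra. }
  assert (L1 : Rabs (slp x (fun i => s (x i)) (S j)) <= C * (r * FF)).
  { destruct (slope_mvt x s P (S j) X2) as [xi [H1 H2]]; [intros; apply S1|intros; apply S2|].
    rewrite H2. apply (SP (S j)); auto. }
  assert (L2 : Rabs (slp x (fun i => s (x i)) j) <= C * (r * FF)).
  { destruct (slope_mvt x s P j X1) as [xi [H1 H2]]; [intros; apply S1|intros; apply S2|].
    rewrite H2. apply (SP j); auto. }
  assert (L3 : Rabs (slp x (fun i => s (x i)) j) <= 2 * N * (C * FF)).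
  { apply slope_bound_size. intros t Ht. eapply Rle_trans; [apply S5; lra|].
    apply Rmult_le_compat_l; [lra|]. apply ER_mono; lra. }
  replace (op eps mu av bv x (fun i => ut (x i)) j - f (x (S j)))
    with ((op eps mu av bv x (fun i => y (x i)) j - (f (x (S j)) - bv (S j) * s (x (S j))))
          + (op eps mu av bv x (fun i => s (x i)) j - bv (S j) * s (x (S j)))).
  2:{ unfold y. rewrite (op_minus eps mu av bv x (fun i => ut (x i)) (fun i => s (x i))). ring. }
  eapply Rle_trans; [apply Rabs_plus_le; [exact B1|exact B3]|].
  pose proof eps_over_step as Q. pose proof mu_le_div as Qm.
  set (q := eps / ((x (S (S j)) - x j) / 2)) in *.
  assert (Hq0 : 0 <= q) by (apply Rmult_le_pos; [lra|left; apply Rinv_0_lt_compat; lra]).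
  assert (HNlr : 0 <= N / (l * r)) by (apply Rmult_le_pos; [lra|left; apply Rinv_0_lt_compat; nra]).
  assert (HNl : 0 <= N / l) by (apply Rmult_le_pos; [lra|left; apply Rinv_0_lt_compat; lra]).
  assert (K1 : q * (Rabs (slp x (fun i => s (x i)) (S j)) + Rabs (slp x (fun i => s (x i)) j))
      <= 4 * (ga * al) * C * (N / l * FF)).
  { apply Rle_trans with (2 * (ga * al) * (N / (l * r)) * (2 * (C * (r * FF)))).
    - apply Rmult_le_compat; [exact Hq0| |exact Q|lra].
      apply Rplus_le_le_0_compat; apply Rabs_pos.
    - right. field. lra. }
  assert (K2 : mu * M * Rabs (slp x (fun i => s (x i)) j) <= 2 * M * ga * C * (N / l * FF)).
  { apply Rle_trans with (ga / l * M * (2 * N * (C * FF))).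
    - apply Rmult_le_compat; [apply Rmult_le_pos; lra|apply Rabs_pos| |exact L3].
      apply Rmult_le_compat_r; lra.
    - right. field. lra. }
  set (Z := / (l * r) + l / r * EL l (x j) + FF + (x (S (S j)) - x j) / l
       + EL l (x j) * Rmin (l * (x (S (S j)) - x j)) 1) in *.
  assert (HZ : 0 <= Z).
  { unfold Z. pose proof (EL_pos l (x j)).
    assert (0 <= / (l * r)) by (left; apply Rinv_0_lt_compat; nra).
    assert (0 <= l / r) by (apply Rmult_le_pos; [lra|left; apply Rinv_0_lt_compat; lra]).
    assert (0 <= l / r * EL l (x j)) by (apply Rmult_le_pos; lra).
    assert (0 <= (x (S (S j)) - x j) / l) by (apply Rmult_le_pos; [lra|left; apply Rinv_0_lt_compat; lra]).
    assert (0 <= EL l (x j) * Rmin (l * (x (S (S j)) - x j)) 1).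
    { apply Rmult_le_pos; [lra|]. apply Rmin_glb; nra. }
    lra. }
  assert (HCk : 0 <= C * (4 * (ga * al) + 2 * M * ga)) by (apply Rmult_le_pos; nra).
  set (W := N / l * FF) in *. assert (HW : 0 <= W) by (apply Rmult_le_pos; lra).
  replace (C * (8 * (ga * al) + 4 * M * ga)) with (2 * (C * (4 * (ga * al) + 2 * M * ga))) by ring.
  replace (4 * (ga * al) * C * W) with (C * (4 * (ga * al)) * W) in K1 by ring.
  assert (0 <= C * (4 * (ga * al) + 2 * M * ga) * Z) by nra.
  assert (0 <= C * (4 * (ga * al) + 2 * M * ga) * W) by nra. lra.
Qed.

(** Meant for [l] larger than N, when the left layer is narrower than a coarse cell. The layer part
    is not expanded: on the left cell its slope is bounded by N times its values, and only on the
    right cell, where the left layer has decayed further, by its derivative. *)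
Lemma consistency_direct :
  Rabs (op eps mu av bv x (fun i => ut (x i)) j - f (x (S j)))
  <= C * (2 * M + 4 * (ga * al) + 2 * M * ga) *
     ((x (S (S j)) - x j) / l
      + N / (l * r) * (/ l ^ 2 + l * EL l (x (S j)) + r * ER r (x (S (S j))))
      + N / l * (1 + N / r) * (/ l ^ 3 + EL l (x j) + ER r (x (S j)))
      + (/ l ^ 3 + EL l (x (S j)) + ER r (x (S j)))).
Proof.
  assert (He : 0 < eps) by (apply (c_eps_pos Hp Hal Hga)).
  set (D := x (S (S j)) - x j). assert (HD : 0 < D) by (unfold D; lra).
  set (z := fun t => ut t - v t).
  assert (Bv : Rabs (op eps mu av bv x (fun i => v (x i)) j - (f (x (S j)) - g (x (S j))))
     <= 2 * eps * (C * D) + mu * (M * (C * D))).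
  { rewrite <- (ls_v_ode Hs) by exact Hm. rewrite <- Hav, <- Hbv.
    assert (Lip : forall (h h1 : R -> R), (forall t, 0 < t < 1 -> is_derive h t (h1 t)) ->
       (forall t, 0 < t < 1 -> Rabs (h1 t) <= C) ->
       forall t, x j < t < x (S (S j)) -> Rabs (h t - h (x (S j))) <= C * D).
    { intros h h1 Dh Bh t Ht.
      eapply Rle_trans; [apply (layer_variation_within 1 1 C 0 0 (x j) (x (S (S j))) h h1); try lra; auto|].
      - intros w Hw _. eapply Rle_trans; [apply Bh, Hw|]. lra.
      - fold D. unfold Rdiv. lra. }
    apply truncation_error with (y1 := v1) (y2 := v2); auto.
    - rewrite Hav. apply HaM, Hm.
    - intros t _. apply (ls_vcont Hs).
    - intros t Ht. apply (ls_dv Hs). lra.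
    - intros t Ht. apply (ls_dv1 Hs). lra.
    - intros t Ht. apply (Lip v1 v2); [apply (ls_dv1 Hs)
        |apply (ls_v2 Hs)|lra].
    - intros t Ht. apply (Lip v2 v3); [apply (ls_dv2 Hs)
        |apply (ls_v3 Hs)|lra]. }
  assert (B2 := op_by_slopes Hp Hal Hga M av bv x (fun i => z (x i)) j).
  assert (B3 : Rabs (op eps mu av bv x (fun i => z (x i)) j - bv (S j) * z (x (S j)))
    <= eps / ((x (S (S j)) - x j) / 2) * (Rabs (slp x (fun i => z (x i)) (S j)) + Rabs (slp x (fun i => z (x i)) j))
     + mu * M * Rabs (slp x (fun i => z (x i)) j)).
  { apply B2; [rewrite Hav; apply HaM, Hm|lra]. }
  clear B2.
  set (w1 := / l ^ 2 + l * EL l (x (S j)) + r * ER r (x (S (S j)))).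
  set (w0 := / l ^ 3 + EL l (x j) + ER r (x (S j))).
  set (wm := / l ^ 3 + EL l (x (S j)) + ER r (x (S j))).
  assert (L1 : Rabs (slp x (fun i => z (x i)) (S j)) <= C * w1).
  { destruct (slope_mvt x z (fun t => Derive u t - v1 t) (S j) X2) as [xi [H1 H2]].
    - intros t _. apply continuity_pt_minus; [apply (ls_cont Hs)
        |apply (ls_vcont Hs)].
    - intros t Ht. apply @is_derive_minus; [apply (ls_d1 Hs); lra
        |apply (ls_dv Hs); lra].
    - rewrite H2. eapply Rle_trans; [apply (ls_z1 Hs); lra|].
      apply Rmult_le_compat_l; [lra|]. unfold w1.
      assert (EL l xi <= EL l (x (S j))) by (apply EL_mono; lra).
      assert (ER r xi <= ER r (x (S (S j)))) by (apply ER_mono; lra).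
      assert (l * EL l xi <= l * EL l (x (S j))) by (apply Rmult_le_compat_l; lra).
      assert (r * ER r xi <= r * ER r (x (S (S j)))) by (apply Rmult_le_compat_l; lra). lra. }
  assert (L2 : Rabs (slp x (fun i => z (x i)) j) <= 2 * N * (C * w0)).
  { apply slope_bound_size. intros t Ht.
    eapply Rle_trans; [apply (ls_z Hs); lra|].
    apply Rmult_le_compat_l; [lra|]. unfold w0.
    assert (EL l t <= EL l (x j)) by (apply EL_mono; lra).
    assert (ER r t <= ER r (x (S j))) by (apply ER_mono; lra). lra. }
  assert (Bz : Rabs (bv (S j) * z (x (S j)) - g (x (S j))) <= M * (C * wm) + C * wm).
  { apply Rabs_minus_le.
    - apply Rabs_mult_le; [rewrite Hbv; apply HbM, Hm|].
      apply (ls_z Hs). lra.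
    - eapply Rle_trans; [apply (ls_g Hs), Hm|].
      apply Rmult_le_compat_l; [lra|]. unfold wm.
      pose proof (EL_pos l (x (S j))). pose proof (ER_pos r (x (S j))). lra. }
  replace (op eps mu av bv x (fun i => ut (x i)) j - f (x (S j)))
    with ((op eps mu av bv x (fun i => v (x i)) j - (f (x (S j)) - g (x (S j))))
          + ((op eps mu av bv x (fun i => z (x i)) j - bv (S j) * z (x (S j)))
          + (bv (S j) * z (x (S j)) - g (x (S j))))).
  2:{ unfold z. rewrite (op_minus eps mu av bv x (fun i => ut (x i)) (fun i => v (x i))). ring. }
  eapply Rle_trans; [apply Rabs_plus_le; [exact Bv|apply Rabs_plus_le; [exact B3|exact Bz]]|].
  pose proof eps_over_step as Q. pose proof mu_le_div as Qm.
  set (q := eps / ((x (S (S j)) - x j) / 2)) in *.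
  assert (Hq0 : 0 <= q) by (apply Rmult_le_pos; [lra|left; apply Rinv_0_lt_compat; lra]).
  assert (Hil : 0 < / l) by (apply Rinv_0_lt_compat; lra).
  assert (Hir : 0 < / r) by (apply Rinv_0_lt_compat; lra).
  assert (HNlr : 0 <= N / (l * r)) by (apply Rmult_le_pos; [lra|left; apply Rinv_0_lt_compat; nra]).
  assert (HNl : 0 <= N / l) by (apply Rmult_le_pos; lra).
  assert (H3 : 0 < / l ^ 3) by (apply Rinv_0_lt_compat, pow_lt; lra).
  assert (H2 : 0 < / l ^ 2) by (apply Rinv_0_lt_compat, pow_lt; lra).
  assert (W0 : 0 < w0) by (unfold w0; pose proof (EL_pos l (x j)); pose proof (ER_pos r (x (S j))); lra).
  assert (Wm : 0 < wm) by (unfold wm; pose proof (EL_pos l (x (S j))); pose proof (ER_pos r (x (S j))); lra).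
  assert (W1 : 0 < w1).
  { unfold w1. pose proof (EL_pos l (x (S j))). pose proof (ER_pos r (x (S (S j)))). nra. }
  assert (K0 : eps <= ga * al / l).
  { apply (c_div_l Hp). pose proof (c_eps_lr Hp Hal Hga).
    assert (eps * l <= eps * (l * r)) by (apply Rmult_le_compat_l; [lra|nra]). lra. }
  assert (K1 : 2 * eps * (C * D) + mu * (M * (C * D)) <= C * (2 * (ga * al) + M * ga) * (D / l)).
  { assert (eps * (C * D) <= ga * al / l * (C * D)) by (apply Rmult_le_compat_r; nra).
    assert (mu * (M * (C * D)) <= ga / l * (M * (C * D))).
    { apply Rmult_le_compat_r; [|exact Qm]. apply Rmult_le_pos; nra. }
    replace (C * (2 * (ga * al) + M * ga) * (D / l)) with (2 * (ga * al / l * (C * D)) + ga / l * (M * (C * D))) by (field; lra).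
    lra. }
  assert (K2 : q * (Rabs (slp x (fun i => z (x i)) (S j)) + Rabs (slp x (fun i => z (x i)) j))
      <= 2 * (ga * al) * C * (N / (l * r) * w1) + 4 * (ga * al) * C * (N / l * (N / r) * w0)).
  { apply Rle_trans with (2 * (ga * al) * (N / (l * r)) * (C * w1 + 2 * N * (C * w0))).
    - apply Rmult_le_compat; [exact Hq0| |exact Q|lra].
      apply Rplus_le_le_0_compat; apply Rabs_pos.
    - right. field. lra. }
  assert (K3 : mu * M * Rabs (slp x (fun i => z (x i)) j) <= 2 * M * ga * C * (N / l * w0)).
  { apply Rle_trans with (ga / l * M * (2 * N * (C * w0))).
    - apply Rmult_le_compat; [apply Rmult_le_pos; lra|apply Rabs_pos| |exact L2].
      apply Rmult_le_compat_r; lra.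
    - right. field. lra. }
  set (T1 := D / l) in *. set (T2 := N / (l * r) * w1) in *.
  assert (HT1 : 0 <= T1) by (apply Rmult_le_pos; lra).
  assert (HT2 : 0 <= T2) by (apply Rmult_le_pos; lra).
  replace (N / l * (1 + N / r) * w0) with (N / l * w0 + N / l * (N / r) * w0) by ring.
  set (T3 := N / l * w0) in *. set (T4 := N / l * (N / r) * w0) in *.
  assert (HT3 : 0 <= T3) by (apply Rmult_le_pos; lra).
  assert (HT4 : 0 <= T4).
  { apply Rmult_le_pos; [apply Rmult_le_pos; [lra|apply Rmult_le_pos; lra]|lra]. }
  set (Ca := C * (ga * al)) in *. assert (HCa : 0 < Ca) by (unfold Ca; apply Rmult_lt_0_compat; lra).
  set (Cb := C * (M * ga)) in *. assert (HCb : 0 < Cb) by (unfold Cb; repeat apply Rmult_lt_0_compat; lra).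
  assert (HCM : 0 < C * M) by (apply Rmult_lt_0_compat; lra).
  assert (HCM1 : C * 1 <= C * M) by (apply Rmult_le_compat_l; lra).
  replace (C * (2 * M + 4 * (ga * al) + 2 * M * ga)) with (2 * (C * M) + 4 * Ca + 2 * Cb) by (unfold Ca, Cb; ring).
  replace (C * (2 * (ga * al) + M * ga) * T1) with (2 * (Ca * T1) + Cb * T1) in K1 by (unfold Ca, Cb; ring).
  replace (2 * (ga * al) * C * T2 + 4 * (ga * al) * C * T4) with (2 * (Ca * T2) + 4 * (Ca * T4)) in K2 by (unfold Ca; ring).
  replace (2 * M * ga * C * T3) with (2 * (Cb * T3)) in K3 by (unfold Cb; ring).
  assert (P1 : forall t, 0 <= t -> 0 <= Ca * t) by (intros; apply Rmult_le_pos; lra).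
  assert (P2 : forall t, 0 <= t -> 0 <= Cb * t) by (intros; apply Rmult_le_pos; lra).
  assert (P3 : forall t, 0 <= t -> 0 <= C * M * t) by (intros; apply Rmult_le_pos; lra).
  assert (C * wm <= C * M * wm) by (apply Rmult_le_compat_r; lra).
  pose proof (P1 T1 HT1). pose proof (P1 T2 HT2). pose proof (P1 T3 HT3). pose proof (P1 T4 HT4). pose proof (P1 wm ltac:(lra)).
  pose proof (P2 T1 HT1). pose proof (P2 T2 HT2). pose proof (P2 T3 HT3). pose proof (P2 T4 HT4). pose proof (P2 wm ltac:(lra)).
  pose proof (P3 T1 HT1). pose proof (P3 T2 HT2). pose proof (P3 T3 HT3). pose proof (P3 T4 HT4). pose proof (P3 wm ltac:(lra)).
  lra.
Qed.

End Stencil.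

Section Cell.

Context {N : R} {x : nat -> R} {j : nat} {t : R}.
Hypotheses (X0 : 0 <= x j) (X1 : x j < x (S j)) (X3 : x (S j) <= 1) (Ht : x j <= t <= x (S j)).

Let h := x (S j) - x j.

Lemma interpolation_value :
  Rabs (ut t - ut (x j)) <= 2 * C * (h + EL l (x j) * Rmin (l * h) 1 + ER r (x (S j)) * Rmin (r * h) 1).
Proof.
  assert (P1 : 0 <= Rmin (l * h) 1) by (apply Rmin_glb; unfold h; nra).
  assert (P2 : 0 <= Rmin (r * h) 1) by (apply Rmin_glb; unfold h; nra).
  pose proof (EL_pos l (x j)). pose proof (ER_pos r (x (S j))).
  eapply Rle_trans; [apply (layer_variation l r C (C * l) (C * r) (x j) t ut (Derive u)); try lra; try nra|].
  - intros y _. apply (ls_cont Hs).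
  - intros y Hy. apply (ls_d1 Hs). lra.
  - intros y Hy. eapply Rle_trans; [apply (ls_b1 Hs); lra|]. right; ring.
  - replace (C * l / l) with C by (field; lra). replace (2 * (C * r) / r) with (2 * C) by (field; lra).
    assert (Q1 : t - x j <= h) by (unfold h; lra).
    assert (Q2 : EL l (x j) * Rmin (l * (t - x j)) 1 <= EL l (x j) * Rmin (l * h) 1).
    { apply Rmult_le_compat_l; [lra|]. apply Rmin_mono. nra. }
    assert (Q3 : ER r t * Rmin (r * (t - x j)) 1 <= ER r (x (S j)) * Rmin (r * h) 1).
    { apply Rmult_le_compat; [left; apply ER_pos|apply Rmin_glb; nra|apply ER_mono; lra|apply Rmin_mono; nra]. }
    assert (0 <= EL l (x j) * Rmin (l * h) 1) by (apply Rmult_le_pos; lra). nra.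
Qed.

Hypothesis Ht01 : 0 < t < 1.

Lemma derivative_variation (c cL cR : R) (y y1 y2 : R -> R) :
  0 <= c -> 0 <= cL -> 0 <= cR ->
  (forall s, continuity_pt y s) ->
  (forall s, 0 < s < 1 -> is_derive y s (y1 s)) ->
  (forall s, 0 < s < 1 -> is_derive y1 s (y2 s)) ->
  (forall s, 0 < s < 1 -> x j <= s <= x (S j) -> Rabs (y2 s) <= c + cL * EL l s + cR * ER r s) ->
  Rabs (y1 t - slp x (fun i => y (x i)) j) <= c * h + cL / l * (EL l (x j) * Rmin (l * h) 1)
    + 2 * cR / r * (ER r (x (S j)) * Rmin (r * h) 1).
Proof.
  intros Hc HcL HcR Cy D1 D2 B.
  destruct (slope_mvt x y y1 j X1) as [xi [H1 H2]].
  { intros; apply Cy. } { intros s Hs'. apply D1. lra. }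
  rewrite H2. apply (layer_variation_within l r c cL cR (x j) (x (S j)) y1 y2); auto; lra.
Qed.

Lemma interpolation_layer :
  Rabs (Derive u t - slp x (fun i => ut (x i)) j)
  <= 2 * C * (h + l * EL l (x j) * Rmin (l * h) 1 + r * ER r (x (S j)) * Rmin (r * h) 1).
Proof.
  assert (P1 : 0 <= Rmin (l * h) 1) by (apply Rmin_glb; unfold h; nra).
  assert (P2 : 0 <= Rmin (r * h) 1) by (apply Rmin_glb; unfold h; nra).
  pose proof (EL_pos l (x j)). pose proof (ER_pos r (x (S j))).
  eapply Rle_trans; [apply (derivative_variation C (C * l ^ 2) (C * r ^ 2) ut (Derive u) u2); try lra|].
  - apply Rmult_le_pos; [lra|apply pow_le; lra].
  - apply Rmult_le_pos; [lra|apply pow_le; lra].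
  - apply (ls_cont Hs).
  - apply (ls_d1 Hs).
  - apply (ls_d2 Hs).
  - intros s Hs1 _. eapply Rle_trans; [apply (ls_b2 Hs), Hs1|]. right; ring.
  - replace (C * l ^ 2 / l * (EL l (x j) * Rmin (l * h) 1)) with (C * (l * EL l (x j) * Rmin (l * h) 1)) by (field; lra).
    replace (2 * (C * r ^ 2) / r * (ER r (x (S j)) * Rmin (r * h) 1))
      with (2 * (C * (r * ER r (x (S j)) * Rmin (r * h) 1))) by (field; lra).
    assert (0 <= C * (l * EL l (x j) * Rmin (l * h) 1)) by (apply Rmult_le_pos; [lra|apply Rmult_le_pos; [nra|lra]]).
    assert (0 <= C * h) by (unfold h; nra). lra.
Qed.

Hypotheses (HN : 0 < N) (HhN : 1 / N <= h).

(** The slope P of the strong layer is kept at the point [t] itself, where the weight of the norm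
    will absorb its factor [r]; the discrete slope of [s] costs only N times its values. *)
Lemma interpolation_split :
  mu = ga / (2 * l) ->
  Rabs (Derive u t - slp x (fun i => ut (x i)) j)
  <= 2 * C * (h + l * EL l (x j) * Rmin (l * h) 1 + l * ER r (x (S j))
       + r * ER r t + N * ER r (x (S j))).
Proof.
  intros Hmu.
  destruct (ls_split Hs Hmu)
    as [s [P [y2 [S1 S2 S3 S4 S5 S6 S7]]]].
  pose proof (EL_pos l (x j)). pose proof (ER_pos r (x (S j))) as HF. pose proof (ER_pos r t) as HFt.
  assert (P1 : 0 <= Rmin (l * h) 1) by (apply Rmin_glb; unfold h; nra).
  assert (P2 : 0 <= Rmin (r * h) 1 <= 1) by (split; [apply Rmin_glb; unfold h; nra|apply Rmin_r]).
  assert (B1 : Rabs (Derive u t - P t - slp x (fun i => ut (x i) - s (x i)) j)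
     <= C * h + C * l ^ 2 / l * (EL l (x j) * Rmin (l * h) 1) + 2 * (C * (l * r)) / r * (ER r (x (S j)) * Rmin (r * h) 1)).
  { apply (derivative_variation C (C * l ^ 2) (C * (l * r)) (fun w => ut w - s w) (fun w => Derive u w - P w) y2); try lra.
    - apply Rmult_le_pos; [lra|apply pow_le; lra].
    - apply Rmult_le_pos; nra.
    - intros w. apply continuity_pt_minus; [apply (ls_cont Hs)|apply S1].
    - intros w Hw. apply @is_derive_minus; [apply (ls_d1 Hs), Hw|apply S2].
    - exact S4.
    - intros w Hw0 Hw. eapply Rle_trans; [apply S7; lra|]. right; ring. }
  assert (B2 : Rabs (slp x (fun i => s (x i)) j) <= 2 * N * (C * ER r (x (S j)))).
  { apply (slope_bound_size X1 HN); [fold h; lra|].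
    intros w Hw. eapply Rle_trans; [apply S5; lra|]. apply Rmult_le_compat_l; [lra|]. apply ER_mono; lra. }
  assert (B3 : Rabs (P t) <= C * (r * ER r t)) by (apply S6; lra).
  replace (Derive u t - slp x (fun i => ut (x i)) j)
    with ((Derive u t - P t - slp x (fun i => ut (x i) - s (x i)) j) + (P t - slp x (fun i => s (x i)) j))
    by (unfold slp, Rdiv; ring).
  eapply Rle_trans; [apply Rabs_plus_le; [exact B1|apply Rabs_minus_le; [exact B3|exact B2]]|].
  replace (C * l ^ 2 / l * (EL l (x j) * Rmin (l * h) 1)) with (C * (l * EL l (x j) * Rmin (l * h) 1)) by (field; lra).
  replace (2 * (C * (l * r)) / r * (ER r (x (S j)) * Rmin (r * h) 1))
    with (2 * (C * (l * ER r (x (S j))) * Rmin (r * h) 1)) by (field; lra).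
  assert (0 <= C * (l * EL l (x j) * Rmin (l * h) 1)) by (apply Rmult_le_pos; [lra|apply Rmult_le_pos; [nra|lra]]).
  assert (0 <= C * h) by (unfold h; nra).
  assert (0 <= C * (r * ER r t)) by (apply Rmult_le_pos; nra).
  assert (Q : 0 <= C * (l * ER r (x (S j)))) by (apply Rmult_le_pos; nra).
  assert (C * (l * ER r (x (S j))) * Rmin (r * h) 1 <= C * (l * ER r (x (S j)))) by nra.
  lra.
Qed.

(** As in [consistency_direct], the layer part is not interpolated: its derivative at [t] and its
    discrete slope are bounded separately. *)
Lemma interpolation_direct :
  Rabs (Derive u t - slp x (fun i => ut (x i)) j)
  <= 2 * C * (h + / l ^ 2 + l * EL l t + r * ER r t + N * (/ l ^ 3 + EL l (x j) + ER r (x (S j)))).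
Proof.
  pose proof (EL_pos l t). pose proof (ER_pos r t).
  assert (B1 : Rabs (v1 t - slp x (fun i => v (x i)) j)
     <= C * h + 0 / l * (EL l (x j) * Rmin (l * h) 1) + 2 * 0 / r * (ER r (x (S j)) * Rmin (r * h) 1)).
  { apply (derivative_variation C 0 0 v v1 v2); try lra.
    - apply (ls_vcont Hs).
    - apply (ls_dv Hs).
    - apply (ls_dv1 Hs).
    - intros w Hw _. eapply Rle_trans; [apply (ls_v2 Hs), Hw|]. lra. }
  assert (B2 : Rabs (slp x (fun i => ut (x i) - v (x i)) j) <= 2 * N * (C * (/ l ^ 3 + EL l (x j) + ER r (x (S j))))).
  { apply (slope_bound_size X1 HN HhN (fun w => ut w - v w)). intros w Hw.
    eapply Rle_trans; [apply (ls_z Hs); lra|].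
    apply Rmult_le_compat_l; [lra|].
    assert (EL l w <= EL l (x j)) by (apply EL_mono; lra).
    assert (ER r w <= ER r (x (S j))) by (apply ER_mono; lra). lra. }
  assert (B3 : Rabs (Derive u t - v1 t) <= C * (/ l ^ 2 + l * EL l t + r * ER r t))
    by (apply (ls_z1 Hs), Ht01).
  replace (Derive u t - slp x (fun i => ut (x i)) j)
    with ((v1 t - slp x (fun i => v (x i)) j) + ((Derive u t - v1 t) - slp x (fun i => ut (x i) - v (x i)) j))
    by (unfold slp, Rdiv; ring).
  eapply Rle_trans; [apply Rabs_plus_le; [exact B1|apply Rabs_minus_le; [exact B3|exact B2]]|].
  replace (0 / l) with 0 by (field; lra). replace (2 * 0 / r) with 0 by (field; lra).
  assert (0 <= C * h) by (unfold h; nra).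
  assert (0 < / l ^ 2) by (apply Rinv_0_lt_compat, pow_lt; lra).
  assert (0 <= C * (/ l ^ 2 + l * EL l t + r * ER r t)) by (apply Rmult_le_pos; [lra|nra]). lra.
Qed.

End Cell.

End LocalErrors.

(** * The Shishkin mesh *)

(** exp t is the fourth power of exp(t/4) >= 1 + t/4, and (1 + t/4)^2 >= t. Applied to ln N it shows
    that eta ln N is at most 1. *)
Lemma exp_ge_sq t : 0 <= t -> t * t <= exp t.
Proof.
  intros Ht. pose proof (exp_ineq1_le (t / 4)) as H.
  assert (E : exp t = (exp (t / 4) * exp (t / 4)) * (exp (t / 4) * exp (t / 4))).
  { rewrite <- !exp_plus. f_equal. field. }
  assert (H1 : t <= (1 + t / 4) * (1 + t / 4)).
  { pose proof (Rle_0_sqr (1 - t / 4)) as Q. unfold Rsqr in Q. lra. }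
  assert (H2 : (1 + t / 4) * (1 + t / 4) <= exp (t / 4) * exp (t / 4)) by (apply Rmult_le_compat; lra).
  rewrite E. apply Rmult_le_compat; lra.
Qed.

Lemma exp_neg_le_inv t : 0 < t -> exp (- t) <= / t.
Proof.
  intros Ht. rewrite exp_Ropp. apply Rinv_le_contravar; [exact Ht|].
  pose proof (exp_ineq1_le t). lra.
Qed.

(** [Lg] is ln N, characterised by [sm_exp]. The inequalities hold for both alternatives in the
    minima defining the transition points; the equalities for uncapped points are assumed later
    where they are used. *)
Record smesh {n : nat} {l r Lg hL H hR : R} {x : nat -> R} : Prop := {
  sm_d : dmesh n l r (Lg / INR (4 * n)) hL H hR x;
  sm_L1 : 1 <= Lg;
  sm_exp : exp Lg = INR (4 * n);
  sm_sL : INR n * hL <= 2 / l * Lg;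
  sm_sR : INR n * hR <= 4 / r * Lg;
  sm_sL4 : INR n * hL <= 1 / 4;
  sm_sR4 : INR n * hR <= 1 / 4 }.
Arguments smesh : clear implicits.

Section MeshFacts.

Context {al ga l r eps mu Lg hL H hR : R} {n : nat} {x : nat -> R}.
Hypothesis Hp : pars al ga l r eps mu.
Hypothesis Hs : smesh n l r Lg hL H hR x.

Let N := INR (4 * n).
Let eta := Lg / N.
Let Hm : dmesh n l r eta hL H hR x := sm_d Hs.
Let Hl : 1 < l := pars_l Hp.
Let Hr : 2 * l <= r := pars_r Hp.
Let HL1 : 1 <= Lg := sm_L1 Hs.
Let Hn : (1 <= n)%nat := dm_n Hm.

Lemma N_eq : N = 4 * INR n.
Proof. unfold N. rewrite mult_INR. simpl. ring. Qed.

Lemma N_ge : 4 <= N.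
Proof. rewrite N_eq. assert (1 <= INR n) by (apply (le_INR 1), Hn). lra. Qed.

Lemma Lg_sq : Lg * Lg <= N.
Proof. unfold N. rewrite <- (sm_exp Hs). apply exp_ge_sq. lra. Qed.

Lemma Lg_half : 2 * Lg <= N.
Proof. pose proof Lg_sq. pose proof N_ge. destruct (Rle_dec Lg 2); [lra|nra]. Qed.

Lemma eta_N : eta * N = Lg.
Proof. unfold eta. field. pose proof N_ge. lra. Qed.

Lemma inv_N_le_eta : / N <= eta.
Proof.
  unfold eta, Rdiv. assert (0 < / N) by (apply Rinv_0_lt_compat; pose proof N_ge; lra). nra.
Qed.

Lemma eta_bounds : 0 < eta <= 1.
Proof. apply (dm_eta Hm). Qed.

Lemma eta_Lg : eta * Lg <= 1.
Proof.
  pose proof Lg_sq. pose proof N_ge. unfold eta.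
  apply Rmult_le_reg_r with N; [lra|]. field_simplify; lra.
Qed.

Lemma hL_le : hL <= / N.
Proof.
  pose proof (sm_sL4 Hs). rewrite N_eq. assert (1 <= INR n) by (apply (le_INR 1), Hn).
  apply Rmult_le_reg_l with (INR n); [lra|]. replace (INR n * / (4 * INR n)) with (1 / 4) by (field; lra). lra.
Qed.

Lemma hR_le : hR <= / N.
Proof.
  pose proof (sm_sR4 Hs). rewrite N_eq. assert (1 <= INR n) by (apply (le_INR 1), Hn).
  apply Rmult_le_reg_l with (INR n); [lra|]. replace (INR n * / (4 * INR n)) with (1 / 4) by (field; lra). lra.
Qed.

Lemma cell_incr i : (i < 4 * n)%nat -> x i < x (S i).
Proof. apply (mesh_incr Hm). Qed.

Lemma node_le i j : (i <= j <= 4 * n)%nat -> x i <= x j.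
Proof. apply (x_le Hm). Qed.

Lemma node_in i : (i <= 4 * n)%nat -> 0 <= x i <= 1.
Proof.
  intros Hi. pose proof (node_le 0 i ltac:(lia)) as A. pose proof (node_le i (4 * n) ltac:(lia)) as B.
  rewrite (dm_0 Hm) in A. rewrite (dm_1 Hm) in B. lra.
Qed.

Lemma cell_le i : (i < 4 * n)%nat -> x (S i) - x i <= 2 * / N.
Proof.
  intros Hi. pose proof hL_le. pose proof hR_le. pose proof (dm_H_le Hm) as A. fold N in A.
  assert (0 < / N) by (apply Rinv_0_lt_compat; pose proof N_ge; lra).
  destruct (le_lt_dec n i) as [C1|C1].
  - destruct (le_lt_dec (3 * n) i) as [C2|C2].
    + rewrite (dm_right Hm) by lia. lra.
    + rewrite (dm_mid Hm) by lia. lra.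
  - rewrite (dm_left Hm) by lia. lra.
Qed.

Lemma cell_ge_mid i : (n <= i < 3 * n)%nat -> 1 / N <= x (S i) - x i.
Proof. intros Hi. rewrite (dm_mid Hm) by exact Hi. apply (dm_H_ge Hm). Qed.

Lemma x_left i : (i <= n)%nat -> x i = INR i * hL.
Proof.
  intros Hi. pose proof (uniform_nodes x 0 i hL) as U. rewrite (dm_0 Hm) in U.
  rewrite Nat.add_0_l in U. rewrite <- U; [ring|]. intros k Hk. apply (dm_left Hm). lia.
Qed.

Lemma x_right i : (i <= n)%nat -> x (4 * n - i)%nat = 1 - INR i * hR.
Proof.
  intros Hi. pose proof (uniform_nodes x (4 * n - i) i hR) as U.
  replace (4 * n - i + i)%nat with (4 * n)%nat in U by lia. rewrite (dm_1 Hm) in U.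
  rewrite <- U; [ring|]. intros k Hk. apply (dm_right Hm). lia.
Qed.

Lemma x_3n : x (3 * n)%nat = 1 - INR n * hR.
Proof. rewrite <- x_right by lia. f_equal. lia. Qed.

Lemma x_right_ge i : (3 * n <= i <= 4 * n)%nat -> 3 / 4 <= x i.
Proof.
  intros Hi. pose proof (node_le (3 * n) i ltac:(lia)) as A. rewrite x_3n in A.
  pose proof (sm_sR4 Hs). lra.
Qed.

(** The middle part has at least two equal cells, so x_(n+1) is not beyond the midpoint of x_n <=
    1/4 and 1. Stencils at nodes of the left part thus stay away from the outflow boundary. *)
Lemma x_n1_le : x (S n) <= 5 / 8.
Proof.
  pose proof (uniform_nodes x n (2 * n) H) as U.
  assert (Hk : forall i, (n <= i < n + 2 * n)%nat -> x (S i) - x i = H).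
  { intros i Hi. apply (dm_mid Hm). lia. }
  specialize (U Hk). pose proof (node_in (n + 2 * n) ltac:(lia)) as A.
  pose proof (Hk n ltac:(lia)) as B. pose proof (x_left n ltac:(lia)) as E.
  pose proof (sm_sL4 Hs) as F. pose proof (dm_H Hm).
  rewrite mult_INR in U. simpl (INR 2) in U. assert (1 <= INR n) by (apply (le_INR 1), Hn). nra.
Qed.

Lemma exp_Lg_neg k : exp (- (INR k * Lg)) = / N ^ k.
Proof.
  rewrite exp_Ropp. f_equal. unfold N. rewrite <- (sm_exp Hs).
  induction k as [|k IH]; [simpl; rewrite Rmult_0_l; apply exp_0|].
  rewrite S_INR, Rmult_plus_distr_r, Rmult_1_l, exp_plus, IH. simpl. ring.
Qed.

(** The loss exponent (l/2)^2 hL x_i is at most 4 eta ln N <= 4, from hL <= 8 eta / l and x_i <=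
    (2/l) ln N. *)
Lemma BL_upper i : (i <= n)%nat -> BL l x i <= exp 4 * exp (- (l / 2 * x i)).
Proof.
  intros Hi. unfold BL.
  assert (G : gr (l / 2) x 0 * exp (l / 2 * (x i - x 0%nat) - (l / 2) ^ 2 * hL * (x i - x 0%nat)) <= gr (l / 2) x i).
  { apply (gr_ge_exp (l / 2) x (4 * n)); [lra|apply cell_incr|lia|].
    intros k Hk. apply (dm_left Hm). lia. }
  rewrite (dm_0 Hm), !Rminus_0_r in G. simpl gr in G at 1. rewrite Rmult_1_l in G.
  assert (Q : (l / 2) ^ 2 * hL * x i <= 4).
  { pose proof (dm_hL_le Hm) as A. pose proof (dm_hL Hm) as A0.
    pose proof (node_le i n ltac:(lia)) as B. rewrite (x_left n) in B by lia.
    pose proof (sm_sL Hs) as B1. pose proof (node_in i ltac:(lia)) as B2.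
    pose proof eta_Lg. pose proof eta_bounds.
    apply Rle_trans with ((l / 2) ^ 2 * (8 * eta / l) * (2 / l * Lg)).
    - apply Rmult_le_compat; try lra.
      + apply Rmult_le_pos; [apply pow_le; lra|lra].
      + apply Rmult_le_compat_l; [apply pow_le; lra|lra].
    - replace ((l / 2) ^ 2 * (8 * eta / l) * (2 / l * Lg)) with (4 * (eta * Lg)) by (field; lra). lra. }
  rewrite <- exp_plus. pose proof (exp_pos (l / 2 * x i - (l / 2) ^ 2 * hL * x i)) as P.
  apply Rle_trans with (/ exp (l / 2 * x i - (l / 2) ^ 2 * hL * x i)).
  - apply Rinv_le_contravar; assumption.
  - rewrite <- exp_Ropp. apply exp_mono. lra.
Qed.

Lemma BL_lower i : (i <= 4 * n)%nat -> exp (- (l / 2 * x i)) <= BL l x i.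
Proof.
  intros Hi. unfold BL. rewrite exp_Ropp.
  apply Rinv_le_contravar; [apply (gr_pos _ _ (4 * n)); [lra|apply cell_incr|exact Hi]|].
  pose proof (gr_le_exp (l / 2) x (4 * n) ltac:(lra) cell_incr 0 i ltac:(lia)) as G.
  rewrite (dm_0 Hm), Rminus_0_r in G. simpl gr in G at 2. lra.
Qed.

Lemma EL_le_BL i : (i <= 4 * n)%nat -> EL l (x i) <= BL l x i.
Proof.
  intros Hi. eapply Rle_trans; [|apply BL_lower, Hi]. apply exp_mono.
  pose proof (node_in i Hi). nra.
Qed.

Lemma BR_upper i : (3 * n <= i <= 4 * n)%nat -> BR r (4 * n) x i <= exp 16 * exp (- (r / 2 * (1 - x i))).
Proof.
  intros Hi. unfold BR.
  assert (G : gr (r / 2) x i * exp (r / 2 * (x (4 * n)%nat - x i) - (r / 2) ^ 2 * hR * (x (4 * n)%nat - x i)) <= gr (r / 2) x (4 * n)).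
  { apply (gr_ge_exp (r / 2) x (4 * n)); [lra|apply cell_incr|lia|].
    intros k Hk. apply (dm_right Hm). lia. }
  rewrite (dm_1 Hm) in G.
  assert (Gp : 0 < gr (r / 2) x i) by (apply (gr_pos _ _ (4 * n)); [lra|apply cell_incr|lia]).
  assert (Q : (r / 2) ^ 2 * hR * (1 - x i) <= 16).
  { pose proof (dm_hR_le Hm) as A. pose proof (dm_hR Hm) as A0.
    pose proof (node_le (3 * n) i ltac:(lia)) as B. rewrite x_3n in B.
    pose proof (sm_sR Hs) as B1. pose proof (node_in i ltac:(lia)) as B2.
    pose proof eta_Lg. pose proof eta_bounds.
    apply Rle_trans with ((r / 2) ^ 2 * (16 * eta / r) * (4 / r * Lg)).
    - apply Rmult_le_compat; try lra.
      + apply Rmult_le_pos; [apply pow_le; lra|lra].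
      + apply Rmult_le_compat_l; [apply pow_le; lra|lra].
    - replace ((r / 2) ^ 2 * (16 * eta / r) * (4 / r * Lg)) with (16 * (eta * Lg)) by (field; lra). lra. }
  set (w := r / 2 * (1 - x i) - (r / 2) ^ 2 * hR * (1 - x i)) in *. pose proof (exp_pos w) as P.
  apply Rle_trans with (/ exp w).
  - apply Rmult_le_reg_r with (gr (r / 2) x (4 * n)); [nra|].
    assert (GN : 0 < gr (r / 2) x (4 * n)) by (apply (gr_pos _ _ (4 * n)); [lra|apply cell_incr|lia]).
    replace (gr (r / 2) x i / gr (r / 2) x (4 * n) * gr (r / 2) x (4 * n)) with (gr (r / 2) x i) by (field; lra).
    apply Rmult_le_reg_l with (exp w); [exact P|]. rewrite <- Rmult_assoc, Rinv_r by lra. lra.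
  - rewrite <- exp_Ropp, <- exp_plus. apply exp_mono. unfold w. lra.
Qed.

Lemma BR_lower i : (i <= 4 * n)%nat -> exp (- (r / 2 * (1 - x i))) <= BR r (4 * n) x i.
Proof.
  intros Hi. unfold BR.
  pose proof (gr_le_exp (r / 2) x (4 * n) ltac:(lra) cell_incr i (4 * n) ltac:(lia)) as G.
  rewrite (dm_1 Hm) in G.
  assert (Gp : 0 < gr (r / 2) x i) by (apply (gr_pos _ _ (4 * n)); [lra|apply cell_incr|lia]).
  assert (GN : 0 < gr (r / 2) x (4 * n)) by (apply (gr_pos _ _ (4 * n)); [lra|apply cell_incr|lia]).
  rewrite exp_Ropp. pose proof (exp_pos (r / 2 * (1 - x i))) as P.
  apply Rmult_le_reg_r with (gr (r / 2) x (4 * n)); [exact GN|].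
  replace (gr (r / 2) x i / gr (r / 2) x (4 * n) * gr (r / 2) x (4 * n)) with (gr (r / 2) x i) by (field; lra).
  apply Rmult_le_reg_l with (exp (r / 2 * (1 - x i))); [exact P|].
  rewrite <- Rmult_assoc, Rinv_r by lra. lra.
Qed.

Lemma ER_le_BR i : (i <= 4 * n)%nat -> ER r (x i) <= BR r (4 * n) x i.
Proof.
  intros Hi. eapply Rle_trans; [|apply BR_lower, Hi]. apply exp_mono.
  pose proof (node_in i Hi). nra.
Qed.

Lemma l_hL : l * hL <= 8 * eta.
Proof.
  pose proof (dm_hL_le Hm) as A. apply Rle_trans with (l * (8 * eta / l)).
  - apply Rmult_le_compat_l; lra.
  - right; field; lra.
Qed.

Lemma r_hR : r * hR <= 16 * eta.
Proof.
  pose proof (dm_hR_le Hm) as A. apply Rle_trans with (r * (16 * eta / r)).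
  - apply Rmult_le_compat_l; lra.
  - right; field; lra.
Qed.

Lemma EL_prev j t : (S j <= n)%nat -> x j <= t <= x (S j) -> EL l (x j) <= exp 8 * EL l t.
Proof.
  intros Hj Ht. pose proof (dm_left Hm j ltac:(lia)) as E. pose proof l_hL. pose proof eta_bounds.
  unfold EL. rewrite <- exp_plus. apply exp_mono. nra.
Qed.

Lemma ER_next j t : (3 * n <= j < 4 * n)%nat -> x j <= t <= x (S j) -> ER r (x (S j)) <= exp 12 * ER r t.
Proof.
  intros Hj Ht. pose proof (dm_right Hm j ltac:(lia)) as E. pose proof r_hR. pose proof eta_bounds.
  unfold ER. rewrite <- exp_plus. apply exp_mono. nra.
Qed.

Lemma EL_tail i : (3 * n <= i <= 4 * n)%nat -> l * EL l (x i) <= 2.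
Proof.
  intros Hi. pose proof (x_right_ge i Hi) as A.
  apply Rle_trans with (l * / (3 / 4 * l)).
  - apply Rmult_le_compat_l; [lra|]. eapply Rle_trans; [|apply exp_neg_le_inv; lra]. apply exp_mono. nra.
  - replace (l * / (3 / 4 * l)) with (4 / 3) by (field; lra). lra.
Qed.

Section LeftTransition.

Hypothesis HsL : INR n * hL = 2 / l * Lg.

Lemma EL_xn : EL l (x n) = / N ^ 2.
Proof.
  rewrite <- exp_Lg_neg. unfold EL. f_equal. rewrite x_left, HsL by lia. simpl. field. lra.
Qed.

Lemma BL_xn : BL l x n <= exp 4 * / N.
Proof.
  eapply Rle_trans; [apply BL_upper; lia|]. right. f_equal.
  replace (/ N) with (/ N ^ 1) by (f_equal; ring). rewrite <- exp_Lg_neg. f_equal.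
  rewrite x_left, HsL by lia. simpl. field. lra.
Qed.

Lemma BL_xn_lower : / N <= BL l x n.
Proof.
  eapply Rle_trans; [|apply BL_lower; lia]. right.
  replace (/ N) with (/ N ^ 1) by (f_equal; ring). rewrite <- exp_Lg_neg. f_equal.
  rewrite x_left, HsL by lia. simpl. field. lra.
Qed.

Lemma EL_after i : (n <= i <= 4 * n)%nat -> EL l (x i) <= / N ^ 2.
Proof. intros Hi. rewrite <- EL_xn. apply EL_mono; [lra|apply node_le; lia]. Qed.

(** One coarse cell beyond the transition point contributes exp(-l H) <= N / l on top of N^-2. This
    1/l is what remains useful when [l] is far larger than N. *)
Lemma EL_after_step i : (n < i <= 4 * n)%nat -> EL l (x i) <= / N * / l.
Proof.
  intros Hi. pose proof N_ge as HN.
  apply Rle_trans with (EL l (x (S n))); [apply EL_mono; [lra|apply node_le; lia]|].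
  pose proof (dm_mid Hm n ltac:(lia)) as E. pose proof (dm_H_ge Hm) as HH. fold N in HH.
  assert (E2 : EL l (x (S n)) = EL l (x n) * exp (- (l * H))).
  { unfold EL. rewrite <- exp_plus. f_equal. replace (x (S n)) with (x n + H) by lra. ring. }
  rewrite E2, EL_xn. assert (HiN : 0 < 1 / N) by (apply Rdiv_lt_0_compat; lra).
  apply Rle_trans with (/ N ^ 2 * (N / l)).
  - apply Rmult_le_compat_l; [left; apply Rinv_0_lt_compat, pow_lt; lra|].
    eapply Rle_trans; [apply exp_neg_le_inv; nra|].
    replace (N / l) with (/ (l * (1 / N))) by (field; lra).
    apply Rinv_le_contravar; [nra|]. apply Rmult_le_compat_l; lra.
  - right. field. lra.
Qed.

Lemma BL_after_step i : (n < i <= 4 * n)%nat -> BL l x i <= 2 * exp 4 * / l.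
Proof.
  intros Hi. pose proof N_ge as HN.
  assert (Gp : 0 < gr (l / 2) x (S n)) by (apply (gr_pos _ _ (4 * n)); [lra|apply cell_incr|lia]).
  apply Rle_trans with (BL l x (S n)).
  { apply Rinv_le_contravar; [exact Gp|]. apply (gr_mono _ _ (4 * n)); [lra|apply cell_incr|lia]. }
  pose proof (BL_step Hp Hm n ltac:(lia)) as B.
  rewrite (dm_mid Hm n ltac:(lia)) in B.
  pose proof (dm_H_ge Hm) as HH. fold N in HH. pose proof BL_xn as B1.
  assert (HiN : 0 < / N) by (apply Rinv_0_lt_compat; lra).
  assert (P : 0 < BL l x (S n)) by (apply Rinv_0_lt_compat, Gp).
  assert (Q : l / 2 * / N * BL l x (S n) <= exp 4 * / N).
  { eapply Rle_trans; [|exact B1]. rewrite B.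
    assert (l / 2 * / N <= l / 2 * H) by (apply Rmult_le_compat_l; lra).
    assert (l / 2 * / N * BL l x (S n) <= l / 2 * H * BL l x (S n)) by (apply Rmult_le_compat_r; lra). lra. }
  apply Rmult_le_reg_l with (l / 2 * / N); [apply Rmult_lt_0_compat; lra|].
  eapply Rle_trans; [exact Q|]. right. field. lra.
Qed.

End LeftTransition.

Section RightTransition.

Hypothesis HsR : INR n * hR = 4 / r * Lg.

Lemma r_ge : 16 * Lg <= r.
Proof.
  pose proof (sm_sR4 Hs) as A. rewrite HsR in A.
  apply Rmult_le_reg_r with (4 / r); [apply Rdiv_lt_0_compat; lra|].
  replace (r * (4 / r)) with 4 by (field; lra). lra.
Qed.

Lemma ER_before i : (i <= 3 * n)%nat -> ER r (x i) <= / N ^ 3.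
Proof.
  intros Hi. apply Rle_trans with (ER r (x (3 * n)%nat)).
  - apply ER_mono; [lra|apply node_le; lia].
  - rewrite <- exp_Lg_neg. unfold ER. apply exp_mono. rewrite x_3n, HsR. right. simpl. field. lra.
Qed.

Lemma ER_before_next i : (i <= S (3 * n))%nat -> ER r (x i) <= exp 12 * / N ^ 3.
Proof.
  intros Hi. pose proof N_ge as HN. apply Rle_trans with (ER r (x (S (3 * n)))).
  - apply ER_mono; [lra|apply node_le; lia].
  - pose proof (cell_incr (3 * n) ltac:(lia)).
    eapply Rle_trans; [apply (ER_next (3 * n) (x (3 * n)%nat)); [lia|lra]|].
    apply Rmult_le_compat_l; [left; apply exp_pos|apply ER_before; lia].
Qed.

Lemma BR_before i : (i <= 3 * n)%nat -> BR r (4 * n) x i <= exp 16 * / N ^ 2.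
Proof.
  intros Hi. apply Rle_trans with (BR r (4 * n) x (3 * n)).
  - unfold BR. apply Rmult_le_compat_r.
    + left. apply Rinv_0_lt_compat, (gr_pos _ _ (4 * n)); [lra|apply cell_incr|lia].
    + apply (gr_mono _ _ (4 * n)); [lra|apply cell_incr|lia].
  - eapply Rle_trans; [apply BR_upper; lia|]. apply Rmult_le_compat_l; [left; apply exp_pos|].
    rewrite <- exp_Lg_neg. apply exp_mono. rewrite x_3n, HsR. right. simpl. field. lra.
Qed.

(** The exponent is at least (9/32) r. Of it, r/8 >= 2 ln N yields N^-2, because sigma_R <= 1/4
    forces r >= 16 ln N; the remaining (5/32) r consumes the factor [r]. *)
Lemma r_ER_left t : t <= 5 / 8 -> r * ER r t <= 7 * / N ^ 2.
Proof.
  intros Ht. pose proof r_ge as A. pose proof N_ge as HN.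
  assert (B : ER r t <= exp (- (INR 2 * Lg)) * exp (- (5 / 32 * r))).
  { unfold ER. rewrite <- exp_plus. apply exp_mono. simpl. nra. }
  rewrite exp_Lg_neg in B.
  assert (D : exp (- (5 / 32 * r)) <= / (5 / 32 * r)) by (apply exp_neg_le_inv; lra).
  assert (P : 0 < / N ^ 2) by (apply Rinv_0_lt_compat, pow_lt; lra).
  apply Rle_trans with (r * (/ N ^ 2 * / (5 / 32 * r))).
  - apply Rmult_le_compat_l; [lra|]. eapply Rle_trans; [exact B|]. apply Rmult_le_compat_l; lra.
  - replace (r * (/ N ^ 2 * / (5 / 32 * r))) with (32 / 5 * / N ^ 2) by (field; lra).
    apply Rmult_le_compat_r; lra.
Qed.

End RightTransition.

End MeshFacts.

(** * Errors in the three mesh regimes *)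

(** exp 12 and exp 8 bound the change of [ER] and [EL] over one fine cell, of width at most 16 eta /
    r and 8 eta / l. *)
Definition Ctau (al ga M C : R) : R :=
  C * (8 * (ga * al) + 4 * M * ga + 2 * M) * (60 + 40 * exp 12 + 20 * exp 8).

Definition Cnod (al ga M C : R) : R :=
  Ctau al ga M C + 72 / (ga * al) * Ctau al ga M C * (1 + 2 * exp 4 + exp 16) + exp 16 + 4 * exp 4.

(** What the estimates use about the weight chi of the norm: it absorbs one derivative of each
    layer, already against the halved exponentials, and within the distances tau_L and tau_R of the
    boundaries it absorbs a bare factor [l]. *)
Record layer_weight {K l r : R} {w : R -> R} : Prop := {
  lw_K : 1 <= K;
  lw_bound : forall t, 0 < t < 1 -> 0 <= w t <= K;
  lw_left : forall t, 0 < t < 1 -> w t * (l * exp (- (l / 2 * t))) <= K;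
  lw_right : forall t, 0 < t < 1 -> w t * (r * exp (- (r / 2 * (1 - t)))) <= K;
  lw_near0 : forall t, 0 < t < 1 -> t <= 2 / l * ln l -> w t * l <= K;
  lw_near1 : forall t, 0 < t < 1 -> 1 - 2 / r * ln r <= t -> w t * l <= K }.
Arguments layer_weight : clear implicits.

Definition Cmid (al ga M c : R) : R := 3 * CM al ga M c + 2 * c * (3 + exp 4).

Definition Cleft (al ga M c : R) : R :=
  3 * c * exp 9 * Cblk al ga M + Cmid al ga M c + 2 * c * (1 + M) / (ga * al).

Definition Cslope (al ga M c : R) : R :=
  9 * Cmid al ga M c + (9 + exp 8) * Cleft al ga M c + (8 + exp 16) * CR al ga M c.

Definition Cint : R := 400 + 30 * exp 12 + 10 * exp 8.

Section Regimes.

Context {al ga M C l r eps mu Lg hL H hR : R} {n : nat} {x av bv U : nat -> R}.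
Context {a b f u ut u2 u3 v v1 v2 v3 g : R -> R}.
Hypotheses (Hal : 0 < al) (Hga : 0 < ga) (HM : 1 <= M) (HC : 0 < C).
Hypothesis Hp : pars al ga l r eps mu.
Hypothesis HaM : forall y, 0 < y < 1 -> Rabs (a y) <= M.
Hypothesis HbM : forall y, 0 < y < 1 -> Rabs (b y) <= M.
Hypothesis Hls : layered_solution C ga l r eps mu a b f u ut u2 u3 v v1 v2 v3 g.
Hypothesis Hs : smesh n l r Lg hL H hR x.
Hypothesis Hdc : dcoef al ga M n x av bv.
Hypothesis Hav : forall i, (0 < i < 4 * n)%nat -> av i = a (x i).
Hypothesis Hbv : forall i, (0 < i < 4 * n)%nat -> bv i = b (x i).
Hypotheses (Hu0 : ut 0 = 0) (Hu1 : ut 1 = 0) (HU0 : U 0%nat = 0) (HU1 : U (4 * n)%nat = 0).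
Hypothesis HU : forall j, (S j < 4 * n)%nat -> op eps mu av bv x U j = f (x (S j)).

Let N := INR (4 * n).
Let eta := Lg / N.
Let e := fun i => ut (x i) - U i.
Let Hm : dmesh n l r eta hL H hR x := sm_d Hs.
Let Hl : 1 < l := pars_l Hp.
Let Hr : 2 * l <= r := pars_r Hp.
Let Hn : (1 <= n)%nat := dm_n Hm.
Let HL1 : 1 <= Lg := sm_L1 Hs.
Let N4 : 4 <= N := N_ge Hs.
Let N0 : 0 < N.
Proof. lra. Qed.
Let N_sq : 4 * N <= N ^ 2.
Proof. replace (N ^ 2) with (N * N) by ring. apply Rmult_le_compat_r; lra. Qed.
Let Heta : 0 < eta <= 1 := eta_bounds Hs.
Let HiN : / N <= eta := inv_N_le_eta Hs.
Let Cc := C * (8 * (ga * al) + 4 * M * ga + 2 * M).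
Let KK := 60 + 40 * exp 12 + 20 * exp 8.

Lemma Cc_pos : 0 < Cc.
Proof. unfold Cc. apply Rmult_lt_0_compat; [lra|]. assert (0 < ga * al) by nra. nra. Qed.

Lemma KK_pos : 0 < KK.
Proof. unfold KK. pose proof (exp_pos 12). pose proof (exp_pos 8). lra. Qed.

Lemma Ctau_eq : Ctau al ga M C = Cc * KK.
Proof. reflexivity. Qed.

Lemma Ctau_pos : 0 < Ctau al ga M C.
Proof. rewrite Ctau_eq. apply Rmult_lt_0_compat; [apply Cc_pos|apply KK_pos]. Qed.

Lemma error_op j : (S j < 4 * n)%nat ->
  op eps mu av bv x e j = op eps mu av bv x (fun i => ut (x i)) j - f (x (S j)).
Proof. intros Hj. unfold e. rewrite op_minus, HU by exact Hj. reflexivity. Qed.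

Lemma stencil j : (S j < 4 * n)%nat ->
  0 <= x j /\ x j < x (S j) /\ x (S j) < x (S (S j)) /\ x (S (S j)) <= 1 /\ x (S (S j)) - x j <= 4 * / N.
Proof.
  intros Hj. pose proof (node_in Hs j ltac:(lia)).
  pose proof (node_in Hs (S (S j)) ltac:(lia)).
  pose proof (cell_incr Hs j ltac:(lia)).
  pose proof (cell_incr Hs (S j) ltac:(lia)).
  pose proof (cell_le Hs j ltac:(lia)) as A1.
  pose proof (cell_le Hs (S j) ltac:(lia)) as A2. fold N in A1, A2. lra.
Qed.

(** This and the next two lemmas bring the three consistency estimates to one form with one
    constant, so that each regime only has to compare their right-hand sides with the target [Y]. *)
Lemma tau_layer j Y : (S j < 4 * n)%nat ->
  cons l r (x (S (S j)) - x j) (EL l (x j)) (ER r (x (S (S j)))) <= KK * Y ->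
  Rabs (op eps mu av bv x e j) <= Ctau al ga M C * Y.
Proof.
  intros Hj HY. destruct (stencil j Hj) as [X0 [X1 [X2 [X3 X4]]]]. rewrite error_op by exact Hj.
  eapply Rle_trans.
  - apply (consistency_layer Hal Hga HC Hp HaM Hls
             (Hav (S j) ltac:(lia)) (Hbv (S j) ltac:(lia))); auto.
  - rewrite Ctau_eq, (Rmult_assoc Cc). apply Rmult_le_compat.
    + assert (0 < ga * al) by nra. apply Rmult_le_pos; nra.
    + apply (cons_nonneg Hp); [lra|left; apply EL_pos|left; apply ER_pos].
    + unfold Cc. apply Rmult_le_compat_l; [lra|]. assert (0 < ga * al) by nra. nra.
    + exact HY.
Qed.

Lemma tau_split j Y : (S j < 4 * n)%nat -> 1 / N <= x (S j) - x j -> r <> 2 * l ->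
  / (l * r) + l / r * EL l (x j) + ER r (x (S (S j))) + (x (S (S j)) - x j) / l
    + EL l (x j) * Rmin (l * (x (S (S j)) - x j)) 1 + N / l * ER r (x (S (S j))) <= KK * Y ->
  Rabs (op eps mu av bv x e j) <= Ctau al ga M C * Y.
Proof.
  intros Hj Hh Hne HY. destruct (stencil j Hj) as [X0 [X1 [X2 [X3 X4]]]]. rewrite error_op by exact Hj.
  destruct (pars_case Hp) as [E|Hmu]; [now elim Hne|].
  assert (T := consistency_split Hal Hga HM HC Hp HaM Hls (Hav (S j) ltac:(lia)) (Hbv (S j) ltac:(lia)) X0 X1 X2 X3 N0 Hh Hmu).
  eapply Rle_trans; [exact T|].
  rewrite Ctau_eq, (Rmult_assoc Cc). apply Rle_trans with (Cc * (/ (l * r) + l / r * EL l (x j) + ER r (x (S (S j))) + (x (S (S j)) - x j) / l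
    + EL l (x j) * Rmin (l * (x (S (S j)) - x j)) 1 + N / l * ER r (x (S (S j))))).
  - apply Rmult_le_compat_r.
    + pose proof (EL_pos l (x j)). pose proof (ER_pos r (x (S (S j)))).
      assert (0 < / (l * r)) by (apply Rinv_0_lt_compat; nra).
      assert (0 < l / r) by (apply Rdiv_lt_0_compat; lra). assert (0 < N / l) by (apply Rdiv_lt_0_compat; lra).
      assert (0 < (x (S (S j)) - x j) / l) by (apply Rdiv_lt_0_compat; lra).
      assert (0 <= Rmin (l * (x (S (S j)) - x j)) 1) by (apply Rmin_glb; nra).
      assert (0 <= EL l (x j) * Rmin (l * (x (S (S j)) - x j)) 1) by (apply Rmult_le_pos; lra). nra.
    + unfold Cc. apply Rmult_le_compat_l; lra.
  - apply Rmult_le_compat_l; [left; apply Cc_pos|exact HY].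
Qed.

Lemma tau_direct j Y : (S j < 4 * n)%nat -> 1 / N <= x (S j) - x j ->
  (x (S (S j)) - x j) / l
      + N / (l * r) * (/ l ^ 2 + l * EL l (x (S j)) + r * ER r (x (S (S j))))
      + N / l * (1 + N / r) * (/ l ^ 3 + EL l (x j) + ER r (x (S j)))
      + (/ l ^ 3 + EL l (x (S j)) + ER r (x (S j))) <= KK * Y ->
  Rabs (op eps mu av bv x e j) <= Ctau al ga M C * Y.
Proof.
  intros Hj Hh HY. destruct (stencil j Hj) as [X0 [X1 [X2 [X3 X4]]]]. rewrite error_op by exact Hj.
  assert (T := consistency_direct Hal Hga HM HC Hp HaM HbM Hls (Hav (S j) ltac:(lia)) (Hbv (S j) ltac:(lia)) X0 X1 X2 X3 N0 Hh).
  eapply Rle_trans; [exact T|].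
  rewrite Ctau_eq, (Rmult_assoc Cc). apply Rle_trans with (Cc * ((x (S (S j)) - x j) / l
      + N / (l * r) * (/ l ^ 2 + l * EL l (x (S j)) + r * ER r (x (S (S j))))
      + N / l * (1 + N / r) * (/ l ^ 3 + EL l (x j) + ER r (x (S j)))
      + (/ l ^ 3 + EL l (x (S j)) + ER r (x (S j))))).
  - apply Rmult_le_compat_r.
    + pose proof (EL_pos l (x j)). pose proof (ER_pos r (x (S (S j)))).
      pose proof (EL_pos l (x (S j))). pose proof (ER_pos r (x (S j))).
      assert (0 < / l ^ 2) by (apply Rinv_0_lt_compat, pow_lt; lra).
      assert (0 < / l ^ 3) by (apply Rinv_0_lt_compat, pow_lt; lra).
      assert (0 < N / (l * r)) by (apply Rdiv_lt_0_compat; [lra|apply Rmult_lt_0_compat; lra]).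
      assert (0 < N / l) by (apply Rdiv_lt_0_compat; lra). assert (0 < N / r) by (apply Rdiv_lt_0_compat; lra).
      assert (0 < (x (S (S j)) - x j) / l) by (apply Rdiv_lt_0_compat; lra).
      assert (0 < / l ^ 2 + l * EL l (x (S j)) + r * ER r (x (S (S j)))).
      { repeat apply Rplus_lt_0_compat; [lra|apply Rmult_lt_0_compat; lra|apply Rmult_lt_0_compat; lra]. }
      assert (0 < N / (l * r) * (/ l ^ 2 + l * EL l (x (S j)) + r * ER r (x (S (S j))))) by (apply Rmult_lt_0_compat; assumption).
      assert (0 < N / l * (1 + N / r) * (/ l ^ 3 + EL l (x j) + ER r (x (S j)))).
      { apply Rmult_lt_0_compat; [apply Rmult_lt_0_compat|]; lra. }
      lra.
    + unfold Cc. apply Rmult_le_compat_l; [lra|]. assert (0 < ga * al) by nra. nra.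
  - apply Rmult_le_compat_l; [left; apply Cc_pos|exact HY].
Qed.

Let il : 0 < / l < 1.
Proof. split; [apply Rinv_0_lt_compat; lra|]. rewrite <- Rinv_1. apply Rinv_lt_contravar; lra. Qed.

Let iN : 0 < / N <= / 4.
Proof. split; [apply Rinv_0_lt_compat; lra|apply Rinv_le_contravar; lra]. Qed.

(** On the fine right cells r D is O(eta), so D is O(eta / l) as well. The left layer has decayed to
    l EL <= 2 there, and the right layer keeps its factor r/l, which the barrier tolerates on these
    nodes. *)
Lemma tau_right j : (3 * n <= j)%nat -> (S j < 4 * n)%nat ->
  Rabs (op eps mu av bv x e j)
  <= Ctau al ga M C * (eta * / l + eta * (r / l * BR r (4 * n) x (S j))).
Proof.
  intros Hj1 Hj. apply tau_layer; [exact Hj|]. destruct (stencil j Hj) as [X0 [X1 [X2 [X3 _]]]].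
  pose proof (dm_right Hm j ltac:(lia)) as E1.
  pose proof (dm_right Hm (S j) ltac:(lia)) as E2.
  pose proof (r_hR Hp Hs) as Rh. fold N eta in Rh.
  set (D := x (S (S j)) - x j) in *. assert (HD : 0 < D) by (unfold D; lra).
  assert (RD : r * D <= 32 * eta) by (unfold D; nra).
  assert (LD : D <= 16 * eta * / l).
  { apply Rmult_le_reg_l with l; [lra|]. replace (l * (16 * eta * / l)) with (16 * eta) by (field; lra). nra. }
  pose proof (EL_tail Hp Hs j ltac:(lia)) as TL.
  pose proof (ER_next Hp Hs (S j) (x (S j)) ltac:(lia) ltac:(lra)) as NR.
  pose proof (ER_le_BR Hp Hs (S j) ltac:(lia)) as NB.
  set (B := BR r (4 * n) x (S j)) in *. set (E := EL l (x j)) in *. set (F := ER r (x (S (S j)))) in *.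
  assert (HE : 0 < E) by apply EL_pos. assert (HF : 0 < F) by apply ER_pos.
  pose proof (exp_pos 12) as P12. pose proof (exp_pos 8) as P8.
  assert (HB : 0 < B) by (pose proof (ER_pos r (x (S j))); lra).
  assert (Hrl : 0 < r / l) by (apply Rdiv_lt_0_compat; lra).
  assert (T1 : D / l <= 16 * (eta * / l)) by (unfold Rdiv; nra).
  assert (T2 : E * Rmin (l * D) 1 <= 32 * (eta * / l)).
  { apply Rle_trans with (E * (l * D)); [apply Rmult_le_compat_l; [lra|apply Rmin_l]|].
    replace (E * (l * D)) with (l * E * D) by ring.
    apply Rle_trans with (2 * (16 * eta * / l)); [apply Rmult_le_compat; nra|lra]. }
  assert (T3 : r / l * (F * Rmin (r * D) 1) <= 32 * exp 12 * (eta * (r / l * B))).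
  { apply Rle_trans with (r / l * (exp 12 * B * (32 * eta))).
    - apply Rmult_le_compat_l; [lra|]. apply Rmult_le_compat; [lra|apply Rmin_glb; nra|nra|].
      eapply Rle_trans; [apply Rmin_l|exact RD].
    - right. ring. }
  assert (V : 0 <= eta * (r / l * B)) by (apply Rmult_le_pos; [lra|nra]).
  assert (V0 : 0 <= eta * / l) by nra.
  unfold cons. unfold KK.
  assert (0 <= exp 12 * (eta * / l)) by nra. assert (0 <= exp 8 * (eta * / l)) by nra.
  assert (0 <= exp 12 * (eta * (r / l * B))) by nra. assert (0 <= exp 8 * (eta * (r / l * B))) by nra. lra.
Qed.

Context {K : R} {w : R -> R}.
Hypothesis Hw : layer_weight K l r w.

Let K1 : 1 <= K := lw_K Hw.

(** Half of the exponential is spent on the factor [l]; the other half remains and becomes 1/N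
    beyond an uncapped transition point. *)
Lemma weight_EL t : 0 < t < 1 -> w t * (l * EL l t) <= K * exp (- (l / 2 * t)).
Proof.
  intros Ht. pose proof (lw_left Hw t Ht) as Q.
  replace (EL l t) with (exp (- (l / 2 * t)) * exp (- (l / 2 * t))).
  - rewrite <- (Rmult_assoc l), <- (Rmult_assoc (w t)). apply Rmult_le_compat_r; [left; apply exp_pos|exact Q].
  - unfold EL. rewrite <- exp_plus. f_equal. field.
Qed.

Lemma weight_ER t : 0 < t < 1 -> w t * (r * ER r t) <= K * exp (- (r / 4 * (1 - t))).
Proof.
  intros Ht. pose proof (lw_right Hw t Ht) as Q.
  replace (ER r t) with (exp (- (r / 2 * (1 - t))) * exp (- (r / 4 * (1 - t)))).
  - rewrite <- (Rmult_assoc r), <- (Rmult_assoc (w t)). apply Rmult_le_compat_r; [left; apply exp_pos|exact Q].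
  - unfold ER. rewrite <- exp_plus. f_equal. field.
Qed.

Lemma weight_EL_le t : 0 < t < 1 -> w t * (l * EL l t) <= K.
Proof.
  intros Ht. eapply Rle_trans; [apply weight_EL, Ht|].
  assert (exp (- (l / 2 * t)) <= 1) by (rewrite <- exp_0; apply exp_mono; nra).
  pose proof (exp_pos (- (l / 2 * t))). nra.
Qed.

Lemma weight_ER_le t : 0 < t < 1 -> w t * (r * ER r t) <= K.
Proof.
  intros Ht. eapply Rle_trans; [apply weight_ER, Ht|].
  assert (0 <= r / 4 * (1 - t)) by (apply Rmult_le_pos; lra).
  assert (Q : exp (- (r / 4 * (1 - t))) <= exp 0) by (apply exp_mono; lra). rewrite exp_0 in Q.
  pose proof (exp_pos (- (r / 4 * (1 - t)))). nra.
Qed.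

Lemma weight_le t X Y : 0 < t < 1 -> X <= Y -> 0 <= Y -> w t * X <= K * Y.
Proof.
  intros Ht H1 H2. pose proof (lw_bound Hw t Ht). apply Rle_trans with (w t * Y).
  - apply Rmult_le_compat_l; lra.
  - apply Rmult_le_compat_r; lra.
Qed.

Lemma weight_scale t X S Y : 0 < t < 1 -> X <= 2 * C * S -> w t * S <= Y -> w t * X <= 2 * C * Y.
Proof.
  intros Ht H1 H2. pose proof (lw_bound Hw t Ht). apply Rle_trans with (2 * C * (w t * S)).
  - replace (2 * C * (w t * S)) with (w t * (2 * C * S)) by ring. apply Rmult_le_compat_l; lra.
  - apply Rmult_le_compat_l; lra.
Qed.

(** The error of the interpolant is the interpolation error of the solution plus a convex
    combination of the two nodal errors, with the barycentric coordinate [la]. *)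
Lemma value_error j t E : (j < 4 * n)%nat -> x j <= t <= x (S j) ->
  EL l (x j) * Rmin (l * (x (S j) - x j)) 1 <= 16 * eta ->
  ER r (x (S j)) * Rmin (r * (x (S j) - x j)) 1 <= 16 * eta ->
  Rabs (e j) <= E -> Rabs (e (S j)) <= E ->
  Rabs (ut t - (U j + slp x U j * (t - x j))) <= 136 * C * eta + E.
Proof.
  intros Hj Ht HE HF H1 H2.
  pose proof (node_in Hs j ltac:(lia)) as I1.
  pose proof (node_in Hs (S j) ltac:(lia)) as I2.
  pose proof (cell_incr Hs j Hj) as I3.
  pose proof (cell_le Hs j Hj) as I4. fold N in I4.
  assert (V : forall s, x j <= s <= x (S j) -> Rabs (ut s - ut (x j)) <= 68 * C * eta).
  { intros s Hs'. eapply Rle_trans.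
    - apply (interpolation_value HC Hp Hls); lra.
    - replace (68 * C * eta) with (2 * C * (34 * eta)) by ring. apply Rmult_le_compat_l; lra. }
  set (la := (t - x j) / (x (S j) - x j)).
  assert (Hla : 0 <= la <= 1).
  { unfold la. split; [apply Rmult_le_pos; [lra|left; apply Rinv_0_lt_compat; lra]|].
    apply Rmult_le_reg_r with (x (S j) - x j); [lra|]. unfold Rdiv. rewrite Rmult_assoc, Rinv_l; lra. }
  replace (ut t - (U j + slp x U j * (t - x j)))
    with ((ut t - ut (x j)) - la * (ut (x (S j)) - ut (x j)) + (1 - la) * e j + la * e (S j)).
  - pose proof (V t Ht) as A1. pose proof (V (x (S j)) ltac:(lra)) as A2.
    apply Rabs_le_between in A1. apply Rabs_le_between in A2.
    apply Rabs_le_between in H1. apply Rabs_le_between in H2. apply Rabs_le_between.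
    assert (- (68 * C * eta) <= la * (ut (x (S j)) - ut (x j)) <= 68 * C * eta) by nra.
    assert (- E <= (1 - la) * e j + la * e (S j) <= E) by nra. lra.
  - unfold e, slp, la. field. lra.
Qed.

Lemma derivative_error j t X Y : 0 < t < 1 -> (j < 4 * n)%nat ->
  w t * Rabs (Derive u t - slp x (fun i => ut (x i)) j) <= X -> w t * Rabs (slp x e j) <= Y ->
  Rabs (w t * (Derive u t - slp x U j)) <= X + Y.
Proof.
  intros Ht Hj H1 H2. pose proof (lw_bound Hw t Ht) as B.
  pose proof (cell_incr Hs j Hj) as I3.
  replace (Derive u t - slp x U j)
    with ((Derive u t - slp x (fun i => ut (x i)) j) + slp x e j) by (unfold slp, e; field; lra).
  rewrite Rabs_mult, (Rabs_pos_eq (w t)) by lra.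
  eapply Rle_trans; [apply Rmult_le_compat_l; [lra|apply Rabs_triang]|]. lra.
Qed.

Lemma weight_cell j t : 0 < t < 1 -> (j < 4 * n)%nat -> w t * (x (S j) - x j) <= K * (2 * eta).
Proof.
  intros Ht Hj. apply weight_le; [exact Ht| |lra].
  pose proof (cell_le Hs j Hj) as I4. fold N in I4. lra.
Qed.

Lemma weight_BL j t : 0 < t < 1 -> (j < n)%nat -> x j <= t <= x (S j) ->
  w t * (l * BL l x j) <= K * exp 8.
Proof.
  intros Ht Hj Htc. pose proof (lw_bound Hw t Ht) as B.
  pose proof (dm_left Hm j Hj) as E.
  pose proof (l_hL Hp Hs) as Q. fold N eta in Q.
  assert (A1 : BL l x j <= exp 8 * exp (- (l / 2 * t))).
  { eapply Rle_trans; [apply (BL_upper Hp Hs); lia|].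
    rewrite <- !exp_plus. apply exp_mono. assert (l * (t - x j) <= l * hL) by (apply Rmult_le_compat_l; lra). lra. }
  apply Rle_trans with (w t * (l * (exp 8 * exp (- (l / 2 * t))))).
  - apply Rmult_le_compat_l; [lra|]. apply Rmult_le_compat_l; lra.
  - replace (w t * (l * (exp 8 * exp (- (l / 2 * t))))) with (w t * (l * exp (- (l / 2 * t))) * exp 8) by ring.
    apply Rmult_le_compat_r; [left; apply exp_pos|apply (lw_left Hw t Ht)].
Qed.

Lemma weight_BR j t : 0 < t < 1 -> (3 * n <= j < 4 * n)%nat -> x j <= t <= x (S j) ->
  w t * (r * BR r (4 * n) x j) <= K * exp 16.
Proof.
  intros Ht Hj Htc. pose proof (lw_bound Hw t Ht) as B.
  assert (A1 : BR r (4 * n) x j <= exp 16 * exp (- (r / 2 * (1 - t)))).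
  { eapply Rle_trans; [apply (BR_upper Hp Hs); lia|].
    apply Rmult_le_compat_l; [left; apply exp_pos|]. apply exp_mono. nra. }
  apply Rle_trans with (w t * (r * (exp 16 * exp (- (r / 2 * (1 - t)))))).
  - apply Rmult_le_compat_l; [lra|]. apply Rmult_le_compat_l; lra.
  - replace (w t * (r * (exp 16 * exp (- (r / 2 * (1 - t)))))) with (w t * (r * exp (- (r / 2 * (1 - t)))) * exp 16) by ring.
    apply Rmult_le_compat_r; [left; apply exp_pos|apply (lw_right Hw t Ht)].
Qed.

Lemma weight_ER_right j t : 0 < t < 1 -> (3 * n <= j < 4 * n)%nat -> x j <= t <= x (S j) ->
  w t * (r * ER r (x (S j)) * Rmin (r * (x (S j) - x j)) 1) <= K * (16 * exp 12 * eta).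
Proof.
  intros Ht Hj Htc. pose proof (lw_bound Hw t Ht) as B.
  pose proof (dm_right Hm j ltac:(lia)) as E.
  pose proof (dm_hR Hm) as Eh.
  pose proof (r_hR Hp Hs) as Q. fold N eta in Q. rewrite E.
  pose proof (ER_next Hp Hs j t Hj Htc) as Q2.
  pose proof (weight_ER_le t Ht) as Q3. pose proof (exp_pos 12) as P12.
  pose proof (ER_pos r (x (S j))) as P1. pose proof (ER_pos r t) as P2.
  apply Rle_trans with (w t * (r * (exp 12 * ER r t) * (16 * eta))).
  - apply Rmult_le_compat_l; [lra|]. apply Rmult_le_compat.
    + apply Rmult_le_pos; lra.
    + apply Rmin_glb; [apply Rmult_le_pos; lra|lra].
    + apply Rmult_le_compat_l; lra.
    + eapply Rle_trans; [apply Rmin_l|exact Q].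
  - replace (w t * (r * (exp 12 * ER r t) * (16 * eta))) with (w t * (r * ER r t) * (16 * exp 12 * eta)) by ring.
    apply Rmult_le_compat_r; [|exact Q3]. apply Rmult_le_pos; lra.
Qed.

Lemma cell_bounds j t : (j < 4 * n)%nat -> x j <= t <= x (S j) ->
  0 <= x j /\ x j < x (S j) /\ x (S j) <= 1.
Proof.
  intros Hj Ht. pose proof (node_in Hs j ltac:(lia)).
  pose proof (node_in Hs (S j) ltac:(lia)).
  pose proof (cell_incr Hs j Hj). lra.
Qed.

Lemma BL_le_1 i : (i <= 4 * n)%nat -> BL l x i <= 1.
Proof.
  intros Hi. unfold BL. rewrite <- Rinv_1. apply Rinv_le_contravar; [lra|].
  pose proof (gr_mono (l / 2) x (4 * n) ltac:(lra) (cell_incr Hs) 0 i ltac:(lia)) as G.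
  simpl gr in G at 1. exact G.
Qed.

Lemma BR_le_1 i : (i <= 4 * n)%nat -> BR r (4 * n) x i <= 1.
Proof.
  intros Hi. pose proof (gr_mono (r / 2) x (4 * n) ltac:(lra) (cell_incr Hs) i (4 * n) ltac:(lia)) as G.
  assert (Gp : 0 < gr (r / 2) x (4 * n)) by (apply (gr_pos _ _ (4 * n)); [lra|apply (cell_incr Hs)|lia]).
  unfold BR. apply Rmult_le_reg_r with (gr (r / 2) x (4 * n)); [exact Gp|].
  replace (gr (r / 2) x i / gr (r / 2) x (4 * n) * gr (r / 2) x (4 * n)) with (gr (r / 2) x i) by (field; lra). lra.
Qed.

Lemma nodal_bounds_uniform A c : nodal_bounds l r eps mu eta n x av bv A c e ->
  forall i, (i <= 4 * n)%nat -> Rabs (e i) <= 3 * c * eta.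
Proof.
  intros NB i Hi. pose proof (nb_A NB). pose proof (nb_c NB).
  pose proof (BL_le_1 i Hi).
  pose proof (BR_le_1 i Hi).
  assert (F : forall X, X <= 3 * eta -> c * X <= 3 * c * eta) by (intros; nra).
  destruct (le_lt_dec i n) as [C1|C1]; [|destruct (le_lt_dec i (3 * n)) as [C2|C2]].
  - eapply Rle_trans; [apply (nb_e_left NB), C1|]. apply F. nra.
  - eapply Rle_trans; [apply (nb_e_mid NB); lia|]. apply F. lra.
  - eapply Rle_trans; [apply (nb_e_right NB); lia|]. apply F. nra.
Qed.

Section FromConsistency.

Variable A : R.
Hypothesis HA : 0 < A <= 2 * eta.
Hypothesis HsR : INR n * hR = 4 / r * Lg.
Hypothesis BR_A : eta * / N ^ 2 <= A.
Hypothesis BL_A : forall i, (n < i <= 4 * n)%nat -> eta * BL l x i <= 2 * exp 4 * A.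
Hypothesis BL_n : l <= 4 * N -> l * (eta * BL l x n) <= 4 * exp 4 * (eta + l * A).
Hypothesis tau_l : forall j, (S j <= n)%nat ->
  Rabs (op eps mu av bv x e j) <= Ctau al ga M C * (A + eta * BL l x (S j)).
Hypothesis tau_m : forall j, (n < S j <= 3 * n)%nat -> Rabs (op eps mu av bv x e j) <= Ctau al ga M C * A.
Hypothesis tau_r : forall j, (3 * n < S j < 4 * n)%nat ->
  Rabs (op eps mu av bv x e j) <= Ctau al ga M C * (A + eta * (r / l * BR r (4 * n) x (S j))).

(** The nodal bound contains both layer barriers everywhere. [BL_A] and [BR_A] say that outside its
    own layer each barrier is already O(A), so that only one of them survives in each region and
    none in the middle. *)
Lemma consistency_nodal_bounds : nodal_bounds l r eps mu eta n x av bv A (Cnod al ga M C) e.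
Proof.
  pose proof Ctau_pos as Ct. set (ct := Ctau al ga M C) in *.
  assert (Hk : 0 < ga * al) by nra.
  set (cn := 72 / (ga * al) * ct). assert (Hcn : 0 < cn) by (unfold cn; apply Rmult_lt_0_compat; [apply Rdiv_lt_0_compat|]; lra).
  pose proof (exp_pos 4) as P4. pose proof (exp_pos 16) as P16.
  destruct HA as [HA0 HA2].
  assert (Ec : Cnod al ga M C = ct + cn * (1 + 2 * exp 4 + exp 16) + exp 16 + 4 * exp 4) by reflexivity.
  assert (He0 : e 0%nat = 0) by (unfold e; rewrite (dm_0 Hm), Hu0, HU0; ring).
  assert (He1 : e (4 * n)%nat = 0) by (unfold e; rewrite (dm_1 Hm), Hu1, HU1; ring).
  assert (BLp : forall i, (i <= 4 * n)%nat -> 0 < BL l x i) by (apply (BL_pos Hp Hm)).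
  assert (BRp : forall i, (i <= 4 * n)%nat -> 0 < BR r (4 * n) x i) by (apply (BR_pos Hp Hm)).
  assert (E : forall i, (i <= 4 * n)%nat -> Rabs (e i) <= cn * (A + eta * BL l x i + eta * BR r (4 * n) x i)).
  { apply (nodal_error_bound Hp Hm Hdc A ct e); auto; try lra.
    intros j Hj. destruct (le_lt_dec (S j) n) as [C1|C1]; [apply tau_l, C1|].
    eapply Rle_trans; [apply tau_m; lia|]. apply Rmult_le_compat_l; [lra|].
    pose proof (BLp (S j) ltac:(lia)). nra. }
  assert (N2 : 0 < / N ^ 2) by (apply Rinv_0_lt_compat, pow_lt; lra).
  assert (RB : forall i, (i <= 3 * n)%nat -> eta * BR r (4 * n) x i <= exp 16 * A).
  { intros i Hi. pose proof (BR_before Hp Hs HsR i Hi) as Q. fold N in Q.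
    apply Rle_trans with (eta * (exp 16 * / N ^ 2)); [apply Rmult_le_compat_l; lra|].
    replace (eta * (exp 16 * / N ^ 2)) with (exp 16 * (eta * / N ^ 2)) by ring. apply Rmult_le_compat_l; lra. }
  assert (up : forall k Y, 0 <= Y -> k <= Cnod al ga M C -> k * Y <= Cnod al ga M C * Y)
    by (intros; apply Rmult_le_compat_r; lra).
  assert (Hcn4 : 0 < cn * exp 4) by nra. assert (Hcn16 : 0 < cn * exp 16) by nra.
  constructor.
  - lra.
  - rewrite Ec. nra.
  - intros i Hi. eapply Rle_trans; [apply E; lia|].
    pose proof (RB i ltac:(lia)). pose proof (BLp i ltac:(lia)). assert (0 < eta * BL l x i) by nra.
    apply Rle_trans with (cn * (1 + exp 16) * (A + eta * BL l x i)).
    + rewrite Rmult_assoc. apply Rmult_le_compat_l; [lra|]. nra.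
    + apply up; [lra|]. rewrite Ec. lra.
  - intros i Hi. eapply Rle_trans; [apply E; lia|].
    pose proof (RB i ltac:(lia)). pose proof (BL_A i ltac:(lia)).
    apply Rle_trans with (cn * (1 + 2 * exp 4 + exp 16) * A).
    + rewrite (Rmult_assoc cn). apply Rmult_le_compat_l; [lra|]. lra.
    + apply up; [lra|]. rewrite Ec. lra.
  - intros i Hi. eapply Rle_trans; [apply E; lia|].
    pose proof (BL_A i ltac:(lia)). pose proof (BRp i ltac:(lia)). assert (0 < eta * BR r (4 * n) x i) by nra.
    apply Rle_trans with (cn * (1 + 2 * exp 4) * (A + eta * BR r (4 * n) x i)).
    + rewrite (Rmult_assoc cn). apply Rmult_le_compat_l; [lra|]. nra.
    + apply up; [lra|]. rewrite Ec. lra.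
  - intros j Hj. eapply Rle_trans; [apply tau_l, Hj|].
    pose proof (BLp (S j) ltac:(lia)). apply up; [nra|]. fold ct. rewrite Ec. lra.
  - intros j Hj. eapply Rle_trans; [apply tau_m, Hj|]. apply up; [lra|]. fold ct. rewrite Ec. lra.
  - intros j Hj. eapply Rle_trans; [apply tau_r, Hj|].
    pose proof (BRp (S j) ltac:(lia)). assert (0 < r / l) by (apply Rdiv_lt_0_compat; lra).
    apply up; [|fold ct; rewrite Ec; lra].
    assert (0 < eta * (r / l * BR r (4 * n) x (S j))) by (apply Rmult_lt_0_compat; nra). lra.
  - pose proof (BR_before Hp Hs HsR (3 * n) ltac:(lia)) as Q. fold N in Q. fold N.
    apply Rle_trans with (N * (exp 16 * / N ^ 2)); [apply Rmult_le_compat_l; lra|].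
    replace (N * (exp 16 * / N ^ 2)) with (exp 16 * / N) by (field; lra). rewrite Ec. nra.
  - intros HlN. fold N in HlN. eapply Rle_trans; [apply BL_n, HlN|].
    assert (0 < l * A) by nra. apply up; [lra|]. rewrite Ec. lra.
Qed.

End FromConsistency.

Lemma slope_constants_pos c : 0 < c ->
  0 < CR al ga M c /\ 0 < Cmid al ga M c /\ 0 < Cleft al ga M c /\ 0 < Cslope al ga M c.
Proof.
  intros Hc. pose proof (Cblk_pos Hdc) as Cb. assert (Hk : 0 < ga * al) by nra.
  pose proof (exp_pos 4) as P4. pose proof (exp_pos 8) as P8. pose proof (exp_pos 9) as P9. pose proof (exp_pos 16) as P16.
  assert (q0 : 0 < c * (1 + M) / (ga * al)) by (apply Rdiv_lt_0_compat; nra).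
  assert (pr : 0 < CR al ga M c).
  { unfold CR. assert (0 < 38 * c * exp 9 * Cblk al ga M) by (repeat apply Rmult_lt_0_compat; lra).
    assert (36 * c * (1 + M) / (ga * al) = 36 * (c * (1 + M) / (ga * al))) by (unfold Rdiv; ring). lra. }
  assert (e2 : 2 * c * (1 + M) / (ga * al) = 2 * (c * (1 + M) / (ga * al))) by (unfold Rdiv; ring).
  assert (pm : 0 < Cmid al ga M c).
  { unfold Cmid, CM. rewrite e2. assert (0 < 3 * c * (1 + c) * Cblk al ga M) by (repeat apply Rmult_lt_0_compat; lra).
    assert (0 < 2 * CR al ga M c * c) by (repeat apply Rmult_lt_0_compat; lra).
    assert (0 < 2 * c * (3 + exp 4)) by (repeat apply Rmult_lt_0_compat; lra). lra. }
  assert (pl : 0 < Cleft al ga M c).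
  { unfold Cleft. rewrite e2. assert (0 < 3 * c * exp 9 * Cblk al ga M) by (repeat apply Rmult_lt_0_compat; lra). lra. }
  repeat split; auto.
  unfold Cslope. assert (0 < (9 + exp 8) * Cleft al ga M c) by (apply Rmult_lt_0_compat; lra).
  assert (0 < (8 + exp 16) * CR al ga M c) by (apply Rmult_lt_0_compat; lra). lra.
Qed.

(** The regional slope bounds, weighted. On the fine cells the term l A may exceed [Y] for very
    large [l]; there the weight has to compensate, which is why [HlA] is asked only outside the
    coarse part. *)
Lemma weighted_slope A c Y j t :
  nodal_bounds l r eps mu eta n x av bv A c e -> 0 < A -> eta <= Y ->
  (forall i, (n <= i < 3 * n)%nat -> Rabs (slp x e i) <= Cmid al ga M c * (9 * Y)) ->
  Rabs (slp x e n) <= Cmid al ga M c * (l * A + eta) ->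
  (forall s, 0 < s < 1 -> s <= x n \/ x (3 * n)%nat <= s -> w s * (l * A) <= K * (8 * Y)) ->
  0 < t < 1 -> (j < 4 * n)%nat -> x j <= t <= x (S j) ->
  w t * Rabs (slp x e j) <= Cslope al ga M c * K * Y.
Proof.
  intros NB HA HY Hmid Hsn HlA Ht Hj Htc. pose proof (lw_bound Hw t Ht) as B.
  pose proof (exp_pos 8) as P8. pose proof (exp_pos 9) as P9. pose proof (exp_pos 16) as P16.
  pose proof (nb_c NB) as Hc.
  destruct (slope_constants_pos c Hc) as [PR [PMd [PL _]]].
  assert (Ke : 0 < K * Y) by nra.
  assert (q1 : 0 < Cmid al ga M c * (K * Y)) by (apply Rmult_lt_0_compat; lra).
  assert (q2 : 0 < (9 + exp 8) * Cleft al ga M c * (K * Y)) by (repeat apply Rmult_lt_0_compat; lra).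
  assert (q3 : 0 < (8 + exp 16) * CR al ga M c * (K * Y)) by (repeat apply Rmult_lt_0_compat; lra).
  assert (fin : forall X k, w t * X <= K * (k * Y) ->
    forall q, Rabs (slp x e j) <= q * X -> 0 < q -> q * k * (K * Y) <= Cslope al ga M c * K * Y ->
    w t * Rabs (slp x e j) <= Cslope al ga M c * K * Y).
  { intros X k H1 q H2 Hq H3. apply Rle_trans with (w t * (q * X)); [apply Rmult_le_compat_l; lra|].
    eapply Rle_trans; [|exact H3]. replace (w t * (q * X)) with (q * (w t * X)) by ring.
    replace (q * k * (K * Y)) with (q * (K * (k * Y))) by ring. apply Rmult_le_compat_l; lra. }
  assert (up : forall X E, X <= K * E -> 0 < E -> eta * X <= Y * (K * E)).
  { intros X E HX HE. apply Rle_trans with (eta * (K * E)); [apply Rmult_le_compat_l; lra|].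
    apply Rmult_le_compat_r; [nra|exact HY]. }
  destruct (le_lt_dec n j) as [C1|C1]; [destruct (le_lt_dec (3 * n) j) as [C2|C2]|].
  - apply (fin (l * A + eta * (r * BR r (4 * n) x j)) (8 + exp 16)) with (q := CR al ga M c); try lra.
    + pose proof (up _ _ (weight_BR j t Ht ltac:(lia) Htc) P16) as Q1.
      pose proof (node_le Hs (3 * n) j ltac:(lia)) as Q2.
      pose proof (HlA t Ht ltac:(right; lra)) as Q3. lra.
    + apply (right_slopes Hp Hm Hdc NB). lia.
    + unfold Cslope. lra.
  - apply (fin (9 * Y) 9) with (q := Cmid al ga M c); try lra.
    + apply Rmult_le_compat_r; lra.
    + apply Hmid. lia.
    + unfold Cslope. lra.
  - apply (fin (eta + l * A + l * (eta * BL l x j)) (9 + exp 8)) with (q := Cleft al ga M c); try lra.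
    + pose proof (up _ _ (weight_BL j t Ht ltac:(lia) Htc) P8) as Q1.
      pose proof (node_le Hs (S j) n ltac:(lia)) as Q2.
      pose proof (HlA t Ht ltac:(left; lra)) as Q3.
      assert (w t * eta <= K * Y) by (apply weight_le; lra). lra.
    + apply (left_slopes Hp Hm Hdc NB (Cmid al ga M c) j PMd Hsn). lia.
    + unfold Cslope. lra.
Qed.

(* sigma_L < 1/4, hence also sigma_R < 1/4. *)
Section Main.

Hypothesis HsL : INR n * hL = 2 / l * Lg.
Hypothesis HsR : INR n * hR = 4 / r * Lg.

(** eta / l is the consistency error of the smooth part. eta / N^2 accounts for what is left of the
    outflow layer at the right transition point: the barrier O(N^-2), and the layer itself, N^-3. *)
Let A := eta * (/ l + / N ^ 2).

Let A_ge : / N * / l <= A.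
Proof.
  unfold A. assert (0 < / N ^ 2) by (apply Rinv_0_lt_compat, pow_lt; lra).
  assert (/ N * / l <= eta * / l) by (apply Rmult_le_compat_r; lra). nra.
Qed.

Let A_ge3 : / N ^ 3 <= A.
Proof.
  unfold A. assert (0 < / N ^ 2) by (apply Rinv_0_lt_compat, pow_lt; lra).
  replace (/ N ^ 3) with (/ N * / N ^ 2) by (field; lra).
  assert (/ N * / N ^ 2 <= eta * / N ^ 2) by (apply Rmult_le_compat_r; lra). nra.
Qed.

Let A_ge_l : eta * / l <= A.
Proof. unfold A. assert (0 < / N ^ 2) by (apply Rinv_0_lt_compat, pow_lt; lra). nra. Qed.

Let A_bounds : 0 < A <= 2 * eta.
Proof.
  assert (Q : 0 < / N ^ 2) by (apply Rinv_0_lt_compat, pow_lt; lra).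
  assert (/ N ^ 2 <= 1) by (rewrite <- Rinv_1; apply Rinv_le_contravar; [lra|apply pow_R1_Rle; lra]).
  unfold A. split; nra.
Qed.

Lemma tau_main_left j : (S j <= n)%nat ->
  Rabs (op eps mu av bv x e j) <= Ctau al ga M C * (A + eta * BL l x (S j)).
Proof.
  intros Hj. assert (Hj4 : (S j < 4 * n)%nat) by lia.
  apply tau_layer; [exact Hj4|]. destruct (stencil j Hj4) as [X0 [X1 [X2 [X3 X4]]]].
  set (D := x (S (S j)) - x j) in *. assert (HD : 0 < D) by (unfold D; lra).
  pose proof (EL_prev Hp Hs j (x (S j)) Hj ltac:(lra)) as EP.
  pose proof (EL_le_BL Hp Hs (S j) ltac:(lia)) as EB.
  assert (X5 : x (S (S j)) <= 5 / 8).
  { eapply Rle_trans; [apply (node_le Hs _ (S n)); lia|].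
    apply (x_n1_le Hs). }
  pose proof (r_ER_left Hp Hs HsR _ X5) as RR. fold N in RR.
  set (B := BL l x (S j)) in *. set (E := EL l (x j)) in *. set (F := ER r (x (S (S j)))) in *.
  assert (HE : 0 < E) by apply EL_pos. assert (HF : 0 < F) by apply ER_pos.
  pose proof (exp_pos 12) as P12. pose proof (exp_pos 8) as P8.
  assert (HB : 0 < B) by (pose proof (EL_pos l (x (S j))); lra).
  assert (T1 : D / l <= 4 * A) by (unfold Rdiv; nra).
  assert (T2 : E * Rmin (l * D) 1 <= 16 * exp 8 * (eta * B)).
  (* At the transition node the stencil reaches into the coarse mesh and its width is useless; the
     layer is already N^-2 there, which eta [BL] covers since [BL] is at least 1/N at that node. *)
  { destruct (Nat.eq_dec (S j) n) as [Ej|Ej].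
    - apply Rle_trans with (E * 1); [apply Rmult_le_compat_l; [lra|apply Rmin_r]|]. rewrite Rmult_1_r.
      eapply Rle_trans; [exact EP|]. rewrite Ej, (EL_xn Hp Hs HsL). fold N.
      pose proof (BL_xn_lower Hp Hs HsL) as BLn. fold N in BLn.
      unfold B. rewrite Ej.
      assert (/ N ^ 2 <= eta * BL l x n).
      { replace (/ N ^ 2) with (/ N * / N) by (field; lra). apply Rmult_le_compat; lra. }
      assert (exp 8 * / N ^ 2 <= exp 8 * (eta * BL l x n)) by (apply Rmult_le_compat_l; lra).
      assert (0 < eta * BL l x n) by nra. nra.
    - pose proof (dm_left Hm j ltac:(lia)) as E1.
      pose proof (dm_left Hm (S j) ltac:(lia)) as E2.
      pose proof (l_hL Hp Hs) as Lh. fold N eta in Lh.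
      apply Rle_trans with (E * (16 * eta)).
      + apply Rmult_le_compat_l; [lra|]. eapply Rle_trans; [apply Rmin_l|]. unfold D. nra.
      + assert (E * (16 * eta) <= exp 8 * B * (16 * eta)) by (apply Rmult_le_compat_r; nra). lra. }
  assert (T3 : r / l * (F * Rmin (r * D) 1) <= 7 * A).
  { apply Rle_trans with (r / l * (F * 1)).
    - apply Rmult_le_compat_l; [apply Rlt_le, Rdiv_lt_0_compat; lra|]. apply Rmult_le_compat_l; [lra|apply Rmin_r].
    - replace (r / l * (F * 1)) with (r * F * / l) by (field; lra).
      apply Rle_trans with (7 * / N ^ 2 * / l); [apply Rmult_le_compat_r; lra|].
      replace (7 * / N ^ 2 * / l) with (7 * (/ N * (/ N * / l))) by (field; lra).
      assert (0 < / N * / l) by nra. nra. }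
  assert (V : 0 < eta * B) by nra. destruct A_bounds as [HA _].
  unfold cons, KK.
  assert (0 <= exp 12 * (eta * B)) by nra. assert (0 <= exp 8 * A) by nra. assert (0 <= exp 12 * A) by nra.
  assert (0 <= exp 8 * (eta * B)) by nra. lra.
Qed.

(** The choice among the three estimates. For l <= N and r <= 4 N^2 the classical bound suffices,
    since (r / l) N^-3 is O(1 / (N l)). For l <= N and r > 4 N^2 the splitting removes [r]; it is
    available because r = 2 l is then impossible. For l > N the layer part is not expanded at
    all. *)
Lemma tau_main_mid j : (n < S j <= 3 * n)%nat ->
  Rabs (op eps mu av bv x e j) <= Ctau al ga M C * A.
Proof.
  intros Hj. assert (Hj4 : (S j < 4 * n)%nat) by lia.
  destruct (stencil j Hj4) as [X0 [X1 [X2 [X3 X4]]]].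
  set (D := x (S (S j)) - x j) in *. assert (HD : 0 < D) by (unfold D; lra).
  pose proof (EL_after Hp Hs HsL j ltac:(lia)) as E1. fold N in E1.
  pose proof (EL_after_step Hp Hs HsL (S j) ltac:(lia)) as E2. fold N in E2.
  pose proof (ER_before Hp Hs HsR (S j) ltac:(lia)) as F1. fold N in F1.
  pose proof (ER_before_next Hp Hs HsR (S (S j)) ltac:(lia)) as F2. fold N in F2.
  pose proof (cell_ge_mid Hs j ltac:(lia)) as Hh. fold N in Hh.
  pose proof (exp_pos 12) as P12. pose proof (exp_pos 8) as P8.
  destruct A_bounds as [HA _].
  pose proof (EL_pos l (x j)) as PE. pose proof (ER_pos r (x (S (S j)))) as PF.
  pose proof (EL_pos l (x (S j))) as PE'. pose proof (ER_pos r (x (S j))) as PF'.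
  assert (N2 : 0 < / N ^ 2) by (apply Rinv_0_lt_compat, pow_lt; lra).
  assert (N3 : / N ^ 3 = / N * / N ^ 2) by (field; lra).
  assert (N2' : / N ^ 2 = / N * / N) by (field; lra).
  assert (T1 : D / l <= 4 * A) by (unfold Rdiv; nra).
  assert (m1 : 0 <= Rmin (l * D) 1 <= 1) by (apply Rmin_1_bounds, Rmult_le_pos; lra).
  assert (m2 : 0 <= Rmin (r * D) 1 <= 1) by (apply Rmin_1_bounds, Rmult_le_pos; lra).
  assert (Hrl : 0 < r / l) by (apply Rdiv_lt_0_compat; lra).
  assert (q1 : 0 <= exp 12 * A) by nra. assert (q2 : 0 <= exp 8 * A) by nra.
  assert (a0 : 0 < / N * / l) by nra.
  destruct (Rle_dec l N) as [HlN|HlN].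
  - assert (iNl : / N <= / l) by (apply Rinv_le_contravar; lra).
    assert (E3 : EL l (x j) <= A) by (rewrite N2' in E1; assert (/ N * / N <= / N * / l) by (apply Rmult_le_compat_l; lra); lra).
    destruct (Rle_dec r (4 * N ^ 2)) as [HrN|HrN].
    + apply tau_layer; [exact Hj4|]. fold D. unfold cons, KK.
      assert (T2 : EL l (x j) * Rmin (l * D) 1 <= A) by (apply mult_le_1; lra).
      assert (T3 : r / l * (ER r (x (S (S j))) * Rmin (r * D) 1) <= 4 * exp 12 * A).
      { apply Rle_trans with (4 * N ^ 2 * / l * (exp 12 * / N ^ 3 * 1)).
        - apply Rmult_le_compat; [lra|apply Rmult_le_pos; lra| |].
          + unfold Rdiv. apply Rmult_le_compat_r; lra.
          + apply Rmult_le_compat; lra.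
        - replace (4 * N ^ 2 * / l * (exp 12 * / N ^ 3 * 1)) with (4 * exp 12 * (/ N * / l)) by (field; lra).
          apply Rmult_le_compat_l; lra. }
      lra.
    + assert (ir : / r <= / N ^ 2) by (apply Rinv_le_contravar; [apply pow_lt; lra|lra]).
      assert (Hne : r <> 2 * l) by (intros Er; lra).
      apply tau_split; [exact Hj4|exact Hh|exact Hne|]. fold D. unfold KK.
      assert (T0 : / (l * r) <= A).
      { rewrite Rinv_mult. assert (/ l * / r <= / l * / N ^ 2) by (apply Rmult_le_compat_l; lra).
        rewrite N2' in H0.
        assert (/ l * (/ N * / N) <= / l * (/ N * 1)) by (apply Rmult_le_compat_l; [lra|apply Rmult_le_compat_l; lra]). lra. }
      assert (T2 : l / r * EL l (x j) <= A).
      { assert (l / r <= 1) by (apply Rmult_le_reg_r with r; [lra|]; unfold Rdiv; rewrite Rmult_assoc, Rinv_l; lra).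
        assert (0 < l / r) by (apply Rdiv_lt_0_compat; lra). rewrite Rmult_comm. apply mult_le_1; lra. }
      assert (T3 : ER r (x (S (S j))) <= exp 12 * A).
      { eapply Rle_trans; [exact F2|]. apply Rmult_le_compat_l; lra. }
      assert (T4 : EL l (x j) * Rmin (l * D) 1 <= A) by (apply mult_le_1; lra).
      assert (T5 : N / l * ER r (x (S (S j))) <= exp 12 * A).
      { apply Rle_trans with (N / l * (exp 12 * / N ^ 3)).
        - apply Rmult_le_compat_l; [apply Rlt_le, Rdiv_lt_0_compat; lra|exact F2].
        - replace (N / l * (exp 12 * / N ^ 3)) with (exp 12 * (/ N * (/ N * / l))) by (field; lra).
          apply Rmult_le_compat_l; [lra|]. rewrite Rmult_comm. apply mult_le_1; lra. }
      lra.
  - assert (iNl : / l <= / N) by (apply Rinv_le_contravar; lra).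
    assert (irl : / r <= / l) by (apply Rinv_le_contravar; lra). assert (ir0 : 0 < / r) by (apply Rinv_0_lt_compat; lra).
    apply tau_direct; [exact Hj4|exact Hh|]. fold D. unfold KK.
    assert (L2 : / l ^ 2 = / l * / l) by (field; lra). assert (L3 : / l ^ 3 = / l * / l * / l) by (field; lra).
    assert (Nl : N / l <= 1) by (apply Rmult_le_reg_r with l; [lra|]; unfold Rdiv; rewrite Rmult_assoc, Rinv_l; lra).
    assert (Nl0 : 0 < N / l) by (apply Rdiv_lt_0_compat; lra).
    assert (Nr : N / r <= 1) by (apply Rmult_le_reg_r with r; [lra|]; unfold Rdiv; rewrite Rmult_assoc, Rinv_l; lra).
    assert (Nr0 : 0 < N / r) by (apply Rdiv_lt_0_compat; lra).
    assert (S2 : N / (l * r) * (/ l ^ 2 + l * EL l (x (S j)) + r * ER r (x (S (S j)))) <= 2 * A + exp 12 * A).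
    { replace (N / (l * r) * (/ l ^ 2 + l * EL l (x (S j)) + r * ER r (x (S (S j)))))
        with (N / l * (/ r * (/ l * / l)) + N / r * EL l (x (S j)) + N / l * ER r (x (S (S j)))) by (field; lra).
      assert (U1 : N / l * (/ r * (/ l * / l)) <= A).
      { assert (/ r * (/ l * / l) <= / N * / l).
        { assert (/ r * (/ l * / l) <= / N * (/ l * / l)) by (apply Rmult_le_compat_r; [apply Rmult_le_pos; lra|lra]).
          assert (/ N * (/ l * / l) <= / N * (/ l * 1)) by (apply Rmult_le_compat_l; [lra|apply Rmult_le_compat_l; lra]). lra. }
        assert (0 < / r * (/ l * / l)) by (repeat apply Rmult_lt_0_compat; lra).
        rewrite Rmult_comm. apply mult_le_1; lra. }
      assert (U2 : N / r * EL l (x (S j)) <= A) by (rewrite Rmult_comm; apply mult_le_1; lra).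
      assert (U3 : N / l * ER r (x (S (S j))) <= exp 12 * A).
      { apply Rle_trans with (ER r (x (S (S j)))); [rewrite Rmult_comm; apply mult_le_1; lra|]. eapply Rle_trans; [exact F2|].
        apply Rmult_le_compat_l; lra. }
      lra. }
    assert (W0 : / l ^ 3 + EL l (x j) + ER r (x (S j)) <= 3 * (/ N * / N)).
    { rewrite L3. rewrite N3 in F1. rewrite N2' in E1, F1.
      assert (/ l * / l * / l <= / N * / N).
      { assert (/ l * / l <= / N * / N) by (apply Rmult_le_compat; lra).
        apply mult_le_1; [split; [apply Rmult_le_pos; lra|lra]|lra]. }
      assert (/ N * (/ N * / N) <= / N * / N) by (apply Rmult_le_compat_l; [lra|apply mult_le_1; lra]). lra. }
    assert (S3 : N / l * (1 + N / r) * (/ l ^ 3 + EL l (x j) + ER r (x (S j))) <= 6 * A).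
    { apply Rle_trans with (N / l * 2 * (3 * (/ N * / N))).
      - apply Rmult_le_compat; [apply Rmult_le_pos; lra| | |exact W0].
        + assert (0 < / l ^ 3) by (apply Rinv_0_lt_compat, pow_lt; lra). lra.
        + apply Rmult_le_compat_l; lra.
      - replace (N / l * 2 * (3 * (/ N * / N))) with (6 * (/ N * / l)) by (field; lra). lra. }
    assert (S4 : / l ^ 3 + EL l (x (S j)) + ER r (x (S j)) <= 3 * A).
    { rewrite L3. assert (/ l * / l * / l <= / N * / l).
      { assert (/ l * / l <= / N * / l) by (apply Rmult_le_compat_r; lra).
        apply mult_le_1; [split; [apply Rmult_le_pos; lra|lra]|lra]. }
      lra. }
    lra.
Qed.

Lemma tau_main_right j : (3 * n < S j < 4 * n)%nat ->
  Rabs (op eps mu av bv x e j) <= Ctau al ga M C * (A + eta * (r / l * BR r (4 * n) x (S j))).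
Proof.
  intros Hj. eapply Rle_trans; [apply tau_right; lia|].
  apply Rmult_le_compat_l; [left; apply Ctau_pos|]. lra.
Qed.

Lemma main_nodal_bounds : nodal_bounds l r eps mu eta n x av bv A (Cnod al ga M C) e.
Proof.
  assert (N2 : 0 < / N ^ 2) by (apply Rinv_0_lt_compat, pow_lt; lra). pose proof (exp_pos 4) as P4.
  apply (consistency_nodal_bounds A A_bounds HsR); [unfold A; nra| | |exact tau_main_left|exact tau_main_mid|exact tau_main_right].
  - intros i Hi. pose proof (BL_after_step Hp Hs HsL i Hi) as Q.
    apply Rle_trans with (eta * (2 * exp 4 * / l)); [apply Rmult_le_compat_l; lra|].
    replace (eta * (2 * exp 4 * / l)) with (2 * exp 4 * (eta * / l)) by ring. apply Rmult_le_compat_l; lra.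
  - intros HlN. pose proof (BL_xn Hp Hs HsL) as Q. fold N in Q. pose proof (BL_pos Hp Hm n ltac:(lia)) as Pn.
    destruct A_bounds as [HA0 _]. apply Rle_trans with (4 * exp 4 * eta).
    + apply Rle_trans with (4 * N * (eta * (exp 4 * / N))).
      * apply Rmult_le_compat; [lra|nra|lra|]. apply Rmult_le_compat_l; lra.
      * right. field. lra.
    + apply Rmult_le_compat_l; [lra|]. nra.
Qed.

Let c := Cnod al ga M C.

Let c_pos : 0 < c := nb_c main_nodal_bounds.

Let Lg_le_ln y : N <= y -> Lg <= ln y.
Proof.
  intros Hy. rewrite <- (ln_exp Lg), (sm_exp Hs). apply ln_le; [unfold N in *; lra|exact Hy].
Qed.

(** For l <= N^2 already l A <= 2 eta. For larger [l], ln l >= ln N and ln r >= 2 ln N place both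
    fine parts of the mesh inside the zones of width tau_L and tau_R, where the weight absorbs
    [l]. *)
Lemma main_weight_lA t : 0 < t < 1 -> t <= x n \/ x (3 * n)%nat <= t -> w t * (l * A) <= K * (2 * eta).
Proof.
  intros Ht Hc. pose proof (lw_bound Hw t Ht) as B.
  assert (N2 : 0 < / N ^ 2) by (apply Rinv_0_lt_compat, pow_lt; lra).
  destruct (Rle_dec l (N ^ 2)) as [C1|C1].
  - apply weight_le; [exact Ht| |lra]. unfold A.
    replace (l * (eta * (/ l + / N ^ 2))) with (eta * (1 + l * / N ^ 2)) by (field; lra).
    assert (l * / N ^ 2 <= 1).
    { apply Rmult_le_reg_r with (N ^ 2); [apply pow_lt; lra|]. rewrite Rmult_assoc, Rinv_l; [lra|].
      apply pow_nonzero; lra. }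
    nra.
  - assert (Q : w t * l <= K).
    { assert (NN : N <= N ^ 2) by nra. destruct Hc as [Hc|Hc].
      - apply (lw_near0 Hw t Ht). rewrite (x_left Hs n), HsL in Hc by lia.
        eapply Rle_trans; [exact Hc|]. apply Rmult_le_compat_l; [left; apply Rdiv_lt_0_compat; lra|].
        apply Lg_le_ln. lra.
      - apply (lw_near1 Hw t Ht). rewrite (x_3n Hs), HsR in Hc.
        eapply Rle_trans; [|exact Hc].
        assert (Q : 2 * Lg <= ln r).
        { rewrite <- (ln_exp (2 * Lg)). apply ln_le; [apply exp_pos|].
          replace (2 * Lg) with (Lg + Lg) by ring. rewrite exp_plus, (sm_exp Hs). fold N. lra. }
        assert (2 / r * (2 * Lg) <= 2 / r * ln r) by (apply Rmult_le_compat_l; [left; apply Rdiv_lt_0_compat; lra|exact Q]).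
        replace (4 / r * Lg) with (2 / r * (2 * Lg)) by (field; lra). lra. }
    apply Rle_trans with (K * A); [|apply Rmult_le_compat_l; lra].
    rewrite <- Rmult_assoc. apply Rmult_le_compat_r; lra.
Qed.

(** For l <= 4 N, l A is O(eta) and the stability estimate applies. For larger [l] the nodal errors
    on the coarse part are O(eta / N), and dividing their difference by a cell width of at least 1/N
    loses nothing. *)
Lemma main_slope_mid j : (n <= j < 3 * n)%nat -> Rabs (slp x e j) <= Cmid al ga M c * eta.
Proof.
  intros Hj. pose proof main_nodal_bounds as NB. fold c in NB. pose proof (exp_pos 4) as P4.
  assert (N2 : 0 < / N ^ 2) by (apply Rinv_0_lt_compat, pow_lt; lra).
  pose proof (CM_pos Hdc NB) as PM. unfold Cmid.
  destruct (Rle_dec l (4 * N)) as [C1|C1].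
  - eapply Rle_trans; [apply (mid_slopes Hp Hm Hdc NB j C1 Hj)|].
    assert (l * A + eta <= 3 * eta).
    { unfold A. replace (l * (eta * (/ l + / N ^ 2))) with (eta * (1 + l * / N ^ 2)) by (field; lra).
      assert (l * / N ^ 2 <= 4 * N * / N ^ 2) by (apply Rmult_le_compat_r; lra).
      replace (4 * N * / N ^ 2) with (4 * / N) in * by (field; lra).
      assert (/ N <= / 4) by (apply Rinv_le_contravar; lra). nra. }
    apply Rle_trans with (CM al ga M c * (3 * eta)); [apply Rmult_le_compat_l; lra|].
    assert (0 <= 2 * c * (3 + exp 4) * eta) by (repeat apply Rmult_le_pos; lra). lra.
  - assert (AN : A <= 2 * (eta * / N)).
    { unfold A. assert (/ l <= / N) by (apply Rinv_le_contravar; lra).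
      assert (/ N ^ 2 <= / N) by (apply Rinv_le_contravar; [lra|nra]). nra. }
    assert (ieN : 0 < eta * / N) by (apply Rmult_lt_0_compat; [lra|apply Rinv_0_lt_compat; lra]).
    assert (Ee : forall i, (n <= i <= 3 * n)%nat -> Rabs (e i) <= c * ((3 + exp 4) * (eta * / N))).
    { intros i Hi. destruct (Nat.eq_dec i n) as [->|Ne].
      - eapply Rle_trans; [apply (nb_e_left NB); lia|].
        apply Rmult_le_compat_l; [lra|].
        pose proof (BL_xn Hp Hs HsL) as Q. fold N in Q.
        assert (eta * BL l x n <= eta * (exp 4 * / N)) by (apply Rmult_le_compat_l; lra). lra.
      - eapply Rle_trans; [apply (nb_e_mid NB); lia|].
        apply Rmult_le_compat_l; [lra|]. nra. }
    pose proof (Ee j ltac:(lia)) as B1. pose proof (Ee (S j) ltac:(lia)) as B2.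
    pose proof (cell_ge_mid Hs j Hj) as B3. fold N in B3.
    assert (0 < 1 / N) by (apply Rdiv_lt_0_compat; lra).
    unfold slp. set (Q := 2 * c * (3 + exp 4) * (eta * / N)).
    assert (HQ : 0 < Q) by (unfold Q; repeat apply Rmult_lt_0_compat; lra).
    apply Rle_trans with (Q / (1 / N)).
    + unfold Rdiv at 1. rewrite Rabs_mult, (Rabs_pos_eq (/ (x (S j) - x j))) by (left; apply Rinv_0_lt_compat; lra).
      apply Rmult_le_compat; [apply Rabs_pos|left; apply Rinv_0_lt_compat; lra| |apply Rinv_le_contravar; lra].
      eapply Rle_trans; [apply Rabs_minus_le; [exact B2|exact B1]|]. unfold Q. right. ring.
    + replace (Q / (1 / N)) with (2 * c * (3 + exp 4) * eta) by (unfold Q; field; lra).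
      apply Rmult_le_compat_r; lra.
Qed.

Lemma main_slope j t : 0 < t < 1 -> (j < 4 * n)%nat -> x j <= t <= x (S j) ->
  w t * Rabs (slp x e j) <= Cslope al ga M c * K * eta.
Proof.
  destruct (slope_constants_pos c c_pos) as [_ [PM _]]. destruct A_bounds as [HA _].
  apply (weighted_slope A c eta j t main_nodal_bounds HA ltac:(lra)).
  - intros i Hi. eapply Rle_trans; [apply main_slope_mid, Hi|]. apply Rmult_le_compat_l; lra.
  - eapply Rle_trans; [apply main_slope_mid; lia|]. apply Rmult_le_compat_l; [lra|]. nra.
  - intros s Hs1 Hs2. eapply Rle_trans; [apply main_weight_lA; assumption|]. apply Rmult_le_compat_l; lra.
Qed.

(** The same three alternatives as for the consistency error, now with the threshold 4 N for [l]. On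
    the fine cells the cell width resolves the local layer and the other one is negligible. *)
Lemma main_interpolation j t : 0 < t < 1 -> (j < 4 * n)%nat -> x j <= t <= x (S j) ->
  w t * Rabs (Derive u t - slp x (fun i => ut (x i)) j) <= 2 * C * (K * (Cint * eta)).
Proof.
  intros Ht Hj Htc. pose proof (lw_bound Hw t Ht) as B.
  destruct (cell_bounds j t Hj Htc) as [X0 [X1 X3]].
  pose proof (exp_pos 8) as P8. pose proof (exp_pos 12) as P12.
  pose proof (weight_cell j t Ht Hj) as Wh. set (h := x (S j) - x j) in *. assert (Hh : 0 < h) by (unfold h; lra).
  pose proof (EL_pos l (x j)) as PE. pose proof (ER_pos r (x (S j))) as PF.
  assert (ml : 0 <= Rmin (l * h) 1 <= 1) by (apply Rmin_1_bounds, Rmult_le_pos; lra).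
  assert (mr : 0 <= Rmin (r * h) 1 <= 1) by (apply Rmin_1_bounds, Rmult_le_pos; lra).
  assert (N2 : 0 < / N ^ 2) by (apply Rinv_0_lt_compat, pow_lt; lra).
  assert (rN : 0 < / N) by (apply Rinv_0_lt_compat; lra).
  assert (N2' : / N ^ 2 = / N * / N) by (field; lra).
  assert (N2e : / N ^ 2 <= eta) by (rewrite N2'; apply mult_le_1; lra).
  assert (q1 : 0 < K * (exp 8 * eta)) by (repeat apply Rmult_lt_0_compat; lra).
  assert (q2 : 0 < K * (exp 12 * eta)) by (repeat apply Rmult_lt_0_compat; lra).
  assert (q3 : 0 < K * eta) by (repeat apply Rmult_lt_0_compat; lra).
  assert (small : forall X, X <= 7 * eta -> w t * X <= K * (7 * eta)) by (intros; apply weight_le; lra).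
  destruct (le_lt_dec n j) as [C1|C1]; [destruct (le_lt_dec (3 * n) j) as [C2|C2]|].
  - eapply weight_scale; [exact Ht|
      apply (interpolation_layer HC Hp Hls X0 X1 X3 Htc Ht)|].
    fold h. pose proof (weight_ER_right j t Ht ltac:(lia) Htc) as Q. fold h in Q.
    assert (Q2 : l * EL l (x j) * Rmin (l * h) 1 <= 7 * eta).
    { pose proof (EL_after_step Hp Hs HsL j ltac:(lia)) as G. fold N in G.
      assert (l * EL l (x j) <= eta).
      { apply Rle_trans with (l * (/ N * / l)); [apply Rmult_le_compat_l; lra|].
        replace (l * (/ N * / l)) with (/ N) by (field; lra). lra. }
      apply mult_le_1; [split; [apply Rmult_le_pos; lra|lra]|lra]. }
    apply small in Q2. unfold Cint. lra.
  - assert (tn : x n <= t <= x (3 * n)%nat).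
    { pose proof (node_le Hs n j ltac:(lia)).
      pose proof (node_le Hs (S j) (3 * n) ltac:(lia)). lra. }
    assert (HhN : 1 / N <= h) by (apply (cell_ge_mid Hs j); lia).
    (* Beyond the transition point x_n = (2/l) ln N the half exponential left over by [weight_EL] is
       at most 1/N. For the right layer below it is the rate r/4 over the distance (4/r) ln N. *)
    assert (WL : w t * (l * EL l t) <= K * eta).
    { eapply Rle_trans; [apply weight_EL, Ht|]. apply Rmult_le_compat_l; [lra|].
      apply Rle_trans with (/ N); [|lra]. replace (/ N) with (/ N ^ 1) by (f_equal; ring).
      pose proof (exp_Lg_neg Hs 1) as G1. fold N in G1. rewrite <- G1. apply exp_mono.
      rewrite (x_left Hs n), HsL in tn by lia.
      assert (l / 2 * (2 / l * Lg) <= l / 2 * t) by (apply Rmult_le_compat_l; lra).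
      replace (l / 2 * (2 / l * Lg)) with Lg in * by (field; lra). simpl. lra. }
    assert (WR : w t * (r * ER r t) <= K * eta).
    { eapply Rle_trans; [apply weight_ER, Ht|]. apply Rmult_le_compat_l; [lra|].
      apply Rle_trans with (/ N); [|lra]. replace (/ N) with (/ N ^ 1) by (f_equal; ring).
      pose proof (exp_Lg_neg Hs 1) as G1. fold N in G1. rewrite <- G1. apply exp_mono.
      rewrite (x_3n Hs), HsR in tn.
      assert (r / 4 * (4 / r * Lg) <= r / 4 * (1 - t)) by (apply Rmult_le_compat_l; lra).
      replace (r / 4 * (4 / r * Lg)) with Lg in * by (field; lra). simpl. lra. }
    pose proof (EL_after Hp Hs HsL j ltac:(lia)) as E1. fold N in E1.
    pose proof (ER_before Hp Hs HsR (S j) ltac:(lia)) as F1. fold N in F1.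
    assert (NF : N * ER r (x (S j)) <= eta).
    { apply Rle_trans with (N * / N ^ 3); [apply Rmult_le_compat_l; lra|].
      replace (N * / N ^ 3) with (/ N ^ 2) by (field; lra). exact N2e. }
    assert (NE : N * EL l (x j) <= eta).
    { apply Rle_trans with (N * / N ^ 2); [apply Rmult_le_compat_l; lra|].
      replace (N * / N ^ 2) with (/ N) by (field; lra). exact HiN. }
    destruct (Rle_dec l (4 * N)) as [C3|C3].
    + assert (T1 : l * EL l (x j) * Rmin (l * h) 1 <= 7 * eta).
      { assert (l * EL l (x j) <= 4 * N * EL l (x j)) by (apply Rmult_le_compat_r; lra).
        apply mult_le_1; [split; [apply Rmult_le_pos; lra|lra]|lra]. }
      apply small in T1. destruct (Rle_dec r (4 * N ^ 2)) as [C4|C4].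
      * eapply weight_scale; [exact Ht|
          apply (interpolation_layer HC Hp Hls X0 X1 X3 Htc Ht)|].
        fold h.
        assert (T2 : r * ER r (x (S j)) * Rmin (r * h) 1 <= 7 * eta).
        { assert (r * ER r (x (S j)) <= 4 * N ^ 2 * / N ^ 3) by (apply Rmult_le_compat; lra).
          replace (4 * N ^ 2 * / N ^ 3) with (4 * / N) in * by (field; lra).
          apply mult_le_1; [split; [apply Rmult_le_pos; lra|lra]|lra]. }
        apply small in T2. unfold Cint. lra.
      * destruct (pars_case Hp) as [Er|Hmu]; [exfalso; lra|].
        eapply weight_scale; [exact Ht|
          apply (interpolation_split HC Hp Hls X0 X1 X3 Htc Ht N0 HhN Hmu)|].
        fold h.
        assert (T2 : l * ER r (x (S j)) <= 7 * eta).
        { assert (l * ER r (x (S j)) <= 4 * N * ER r (x (S j))) by (apply Rmult_le_compat_r; lra). lra. }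
        assert (T3 : N * ER r (x (S j)) <= 7 * eta) by lra.
        apply small in T2. apply small in T3. unfold Cint. lra.
    + eapply weight_scale; [exact Ht|
        apply (interpolation_direct HC Hp Hls X0 X1 X3 Htc Ht N0 HhN)|].
      fold h.
      assert (ivl : 0 < / l <= / N) by (split; [apply Rinv_0_lt_compat; lra|apply Rinv_le_contravar; lra]).
      assert (ivl2 : / l ^ 2 = / l * / l) by (field; lra). assert (ivl3 : / l ^ 3 = / l * (/ l * / l)) by (field; lra).
      assert (ivl1 : / l < 1) by (rewrite <- Rinv_1; apply Rinv_lt_contravar; lra).
      assert (T1 : / l ^ 2 <= 7 * eta) by (rewrite ivl2; apply mult_le_1; lra).
      assert (T2 : N * (/ l ^ 3 + EL l (x j) + ER r (x (S j))) <= 7 * eta).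
      { assert (N * / l ^ 3 <= eta); [|lra]. rewrite ivl3.
        assert (/ l * (/ l * / l) <= / N * (/ N * 1)).
        { apply Rmult_le_compat; [lra|apply Rmult_le_pos; lra|lra|apply Rmult_le_compat; lra]. }
        apply Rle_trans with (N * (/ N * (/ N * 1))); [apply Rmult_le_compat_l; lra|].
        replace (N * (/ N * (/ N * 1))) with (/ N) by (field; lra). lra. }
      apply small in T1. apply small in T2. unfold Cint. lra.
  - eapply weight_scale; [exact Ht|
      apply (interpolation_layer HC Hp Hls X0 X1 X3 Htc Ht)|].
    fold h. pose proof (dm_left Hm j ltac:(lia)) as Eh. fold h in Eh.
    pose proof (l_hL Hp Hs) as Q. fold N eta in Q.
    pose proof (EL_prev Hp Hs j t ltac:(lia) Htc) as E1.
    pose proof (weight_EL_le t Ht) as E2. pose proof (EL_pos l t) as Pt.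
    assert (T1 : w t * (l * EL l (x j) * Rmin (l * h) 1) <= K * (8 * exp 8 * eta)).
    { apply Rle_trans with (w t * (l * (exp 8 * EL l t) * (8 * eta))).
      - apply Rmult_le_compat_l; [lra|]. apply Rmult_le_compat; [apply Rmult_le_pos; lra|lra|apply Rmult_le_compat_l; lra|].
        rewrite Eh. eapply Rle_trans; [apply Rmin_l|exact Q].
      - replace (w t * (l * (exp 8 * EL l t) * (8 * eta))) with (w t * (l * EL l t) * (8 * exp 8 * eta)) by ring.
        apply Rmult_le_compat_r; [apply Rmult_le_pos; lra|exact E2]. }
    assert (T2 : r * ER r (x (S j)) * Rmin (r * h) 1 <= 7 * eta).
    { assert (X5 : x (S j) <= 5 / 8).
      { pose proof (node_le Hs (S j) (S n) ltac:(lia)). pose proof (x_n1_le Hs). lra. }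
      pose proof (r_ER_left Hp Hs HsR _ X5) as F. fold N in F.
      apply mult_le_1; [split; [apply Rmult_le_pos; lra|lra]|lra]. }
    apply small in T2. unfold Cint. lra.
Qed.

Lemma main_derivative_error j t : 0 < t < 1 -> (j < 4 * n)%nat -> x j <= t <= x (S j) ->
  Rabs (w t * (Derive u t - slp x U j)) <= (2 * C * Cint + Cslope al ga M c) * K * eta.
Proof.
  intros Ht Hj Htc. eapply Rle_trans.
  - apply derivative_error; [exact Ht|exact Hj|apply main_interpolation; assumption|apply main_slope; assumption].
  - right. ring.
Qed.

Lemma main_value_error j t : (j < 4 * n)%nat -> x j <= t <= x (S j) ->
  Rabs (ut t - (U j + slp x U j * (t - x j))) <= (136 * C + 3 * c) * eta.
Proof.
  intros Hj Ht. destruct (cell_bounds j t Hj Ht) as [X0 [X1 X3]]. rewrite Rmult_plus_distr_r.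
  assert (Ee := nodal_bounds_uniform _ _ main_nodal_bounds).
  pose proof (EL_pos l (x j)) as PE. pose proof (ER_pos r (x (S j))) as PF.
  set (h := x (S j) - x j) in *. assert (Hh : 0 < h) by (unfold h; lra).
  assert (ml : 0 <= Rmin (l * h) 1 <= 1) by (apply Rmin_1_bounds, Rmult_le_pos; lra).
  assert (mr : 0 <= Rmin (r * h) 1 <= 1) by (apply Rmin_1_bounds, Rmult_le_pos; lra).
  assert (N2 : / N ^ 2 <= / N) by (apply Rinv_le_contravar; [lra|nra]).
  assert (N3 : / N ^ 3 <= / N) by (apply Rinv_le_contravar; [lra|]; assert (1 <= N ^ 2) by (apply pow_R1_Rle; lra); simpl in *; nra).
  apply value_error; [exact Hj|exact Ht| | |apply Ee; lia|apply Ee; lia]; fold h.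
  - destruct (le_lt_dec n j) as [C1|C1].
    + pose proof (EL_after Hp Hs HsL j ltac:(lia)) as E1. fold N in E1. nra.
    + assert (EL l (x j) <= 1) by (apply EL_le_1; lra).
      pose proof (l_hL Hp Hs) as Q. fold N eta in Q.
      pose proof (dm_left Hm j ltac:(lia)) as Eh. fold h in Eh.
      pose proof (Rmin_l (l * h) 1). rewrite Eh in *. nra.
  - destruct (le_lt_dec (3 * n) j) as [C1|C1].
    + assert (ER r (x (S j)) <= 1) by (apply ER_le_1; lra).
      pose proof (r_hR Hp Hs) as Q. fold N eta in Q.
      pose proof (dm_right Hm j ltac:(lia)) as Eh. fold h in Eh.
      pose proof (Rmin_l (r * h) 1). rewrite Eh in *. nra.
    + pose proof (ER_before Hp Hs HsR (S j) ltac:(lia)) as F1. fold N in F1. nra.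
Qed.

End Main.

(* sigma_L = 1/4: then l <= 8 ln N, so that every factor [l] costs one logarithm. *)
Section Lossy.

Hypothesis HsL : INR n * hL = 1 / 4.
Hypothesis HsR : INR n * hR = 4 / r * Lg.

Lemma lossy_l : l <= 8 * Lg.
Proof.
  pose proof (sm_sL Hs) as Q. rewrite HsL in Q.
  apply Rmult_le_reg_r with (2 / l); [apply Rdiv_lt_0_compat; lra|].
  replace (l * (2 / l)) with 2 by (field; lra). lra.
Qed.

Lemma lossy_hL : hL = / N.
Proof.
  pose proof (N_eq (n := n)) as Q. fold N in Q. assert (1 <= INR n) by (apply (le_INR 1), Hn).
  apply Rmult_eq_reg_l with (INR n); [|lra]. rewrite HsL, Q. field. lra.
Qed.

Lemma lossy_cell_ge j : (j < 3 * n)%nat -> 1 / N <= x (S j) - x j.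
Proof.
  intros Hj. destruct (le_lt_dec n j) as [C1|C1].
  - apply (cell_ge_mid Hs j). lia.
  - rewrite (dm_left Hm j C1), lossy_hL. lra.
Qed.

Lemma lossy_lN : l <= 4 * N.
Proof. pose proof lossy_l. pose proof (Lg_half Hs) as Q. fold N in Q. lra. Qed.

(** As l <= 8 ln N, the left layer is resolved everywhere by l h = O(eta), and every cell left of
    x_3n has width at least 1/N, so the splitting is applicable on all of them. The gain 1/l is
    given up and the target is simply eta. *)
Lemma tau_lossy j : (S j <= 3 * n)%nat ->
  Rabs (op eps mu av bv x e j) <= Ctau al ga M C * eta.
Proof.
  intros Hj. assert (Hj4 : (S j < 4 * n)%nat) by lia.
  destruct (stencil j Hj4) as [X0 [X1 [X2 [X3 X4]]]].
  set (D := x (S (S j)) - x j) in *. assert (HD : 0 < D) by (unfold D; lra).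
  pose proof lossy_l as Hl8. pose proof (Lg_half Hs) as Hh2. fold N in Hh2.
  pose proof (eta_N Hs) as EN. fold N eta in EN.
  pose proof (ER_before_next Hp Hs HsR (S (S j)) ltac:(lia)) as F2. fold N in F2.
  pose proof (exp_pos 12) as P12. pose proof (exp_pos 8) as P8.
  pose proof (EL_pos l (x j)) as PE. pose proof (ER_pos r (x (S (S j)))) as PF.
  assert (E1 : EL l (x j) <= 1) by (apply EL_le_1; lra).
  assert (N2 : 0 < / N ^ 2) by (apply Rinv_0_lt_compat, pow_lt; lra).
  assert (N2' : / N ^ 2 = / N * / N) by (field; lra).
  assert (N2e : / N ^ 2 <= eta) by (rewrite N2'; nra).
  assert (N3e : / N ^ 3 <= eta).
  { replace (/ N ^ 3) with (/ N * / N ^ 2) by (field; lra). nra. }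
  assert (T1 : D / l <= 4 * eta) by (unfold Rdiv; nra).
  assert (HlN : l * / N <= 8 * eta).
  { unfold eta, Rdiv. rewrite <- Rmult_assoc. apply Rmult_le_compat_r; lra. }
  assert (T2 : EL l (x j) * Rmin (l * D) 1 <= 32 * eta).
  { apply Rle_trans with (1 * (l * D)); [|nra].
    apply Rmult_le_compat; [lra|apply Rmin_glb; nra|lra|apply Rmin_l]. }
  assert (m2 : 0 <= Rmin (r * D) 1 <= 1) by (apply Rmin_1_bounds, Rmult_le_pos; lra).
  assert (Hrl : 0 < r / l) by (apply Rdiv_lt_0_compat; lra).
  assert (q1 : 0 <= exp 12 * eta) by nra. assert (q2 : 0 <= exp 8 * eta) by nra.
  destruct (Rle_dec r (4 * N ^ 2)) as [HrN|HrN].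
  - apply tau_layer; [exact Hj4|]. fold D. unfold cons, KK.
    assert (T3 : r / l * (ER r (x (S (S j))) * Rmin (r * D) 1) <= 4 * exp 12 * eta).
    { apply Rle_trans with (4 * N ^ 2 * (exp 12 * / N ^ 3 * 1)).
      - apply Rmult_le_compat; [lra|apply Rmult_le_pos; lra| |].
        + unfold Rdiv. apply Rle_trans with (r * 1); [apply Rmult_le_compat_l; lra|lra].
        + apply Rmult_le_compat; lra.
      - replace (4 * N ^ 2 * (exp 12 * / N ^ 3 * 1)) with (4 * exp 12 * / N) by (field; lra).
        apply Rmult_le_compat_l; lra. }
    lra.
  - assert (ir : / r <= / (4 * N ^ 2)) by (apply Rinv_le_contravar; [|lra]; assert (0 < N ^ 2) by (apply pow_lt; lra); lra).
    rewrite Rinv_mult in ir. assert (ir0 : 0 < / r) by (apply Rinv_0_lt_compat; lra).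
    assert (Hne : r <> 2 * l) by (intros Er; lra).
    apply tau_split; [exact Hj4|apply lossy_cell_ge; lia|exact Hne|]. fold D. unfold KK.
    assert (T0 : / (l * r) <= eta) by (rewrite Rinv_mult, Rmult_comm; apply mult_le_1; lra).
    assert (Tlr : l / r <= eta).
    { unfold Rdiv. apply Rle_trans with (l * (/ 4 * / N ^ 2)); [apply Rmult_le_compat_l; lra|].
      rewrite N2'. replace (l * (/ 4 * (/ N * / N))) with (l * / N * (/ 4 * / N)) by ring.
      apply Rle_trans with (8 * eta * / 16); [apply Rmult_le_compat; [apply Rmult_le_pos; lra|lra|lra|lra]|lra]. }
    assert (Tlr0 : 0 < l / r) by (apply Rdiv_lt_0_compat; lra).
    assert (T3 : l / r * EL l (x j) <= eta) by (apply mult_le_1; lra).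
    assert (T4 : ER r (x (S (S j))) <= exp 12 * eta).
    { eapply Rle_trans; [exact F2|]. apply Rmult_le_compat_l; lra. }
    assert (T5 : N / l * ER r (x (S (S j))) <= exp 12 * eta).
    { apply Rle_trans with (N / l * (exp 12 * / N ^ 3)).
      - apply Rmult_le_compat_l; [apply Rlt_le, Rdiv_lt_0_compat; lra|exact F2].
      - replace (N / l * (exp 12 * / N ^ 3)) with (exp 12 * (/ N ^ 2 * / l)) by (field; lra).
        apply Rmult_le_compat_l; [lra|]. apply mult_le_1; lra. }
    lra.
Qed.

Lemma lossy_nodal_bounds : nodal_bounds l r eps mu eta n x av bv eta (Cnod al ga M C) e.
Proof.
  pose proof Ctau_pos as Ct. assert (E4 : 1 <= exp 4) by (pose proof (exp_ineq1_le 4); lra).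
  assert (BL1 : forall i, (i <= 4 * n)%nat -> 0 < eta * BL l x i <= eta).
  { intros i Hi. pose proof (BL_pos Hp Hm i Hi). pose proof (BL_le_1 i Hi). nra. }
  assert (N2 : 0 < / N ^ 2 <= 1).
  { split; [apply Rinv_0_lt_compat, pow_lt; lra|].
    rewrite <- Rinv_1. apply Rinv_le_contravar; [lra|apply pow_R1_Rle; lra]. }
  apply (consistency_nodal_bounds eta ltac:(lra) HsR).
  - nra.
  - intros i Hi. pose proof (BL1 i ltac:(lia)). nra.
  - intros _. pose proof (BL1 n ltac:(lia)) as Q.
    assert (l * (eta * BL l x n) <= l * eta) by (apply Rmult_le_compat_l; lra).
    assert (0 < l * eta) by nra. assert (1 * (eta + l * eta) <= exp 4 * (eta + l * eta)) by (apply Rmult_le_compat_r; lra). lra.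
  - intros j Hj. eapply Rle_trans; [apply tau_lossy; lia|]. apply Rmult_le_compat_l; [lra|].
    pose proof (BL1 (S j) ltac:(lia)). lra.
  - intros j Hj. apply tau_lossy. lia.
  - intros j Hj. eapply Rle_trans; [apply tau_right; lia|]. apply Rmult_le_compat_l; [lra|]. nra.
Qed.

Let c := Cnod al ga M C.

Let c_pos : 0 < c := nb_c lossy_nodal_bounds.

Let eta_le : eta <= eta * Lg.
Proof. nra. Qed.

(** With A = eta the stability estimates give l eta + eta, and l <= 8 ln N costs one logarithm. *)
Lemma lossy_slope j t : 0 < t < 1 -> (j < 4 * n)%nat -> x j <= t <= x (S j) ->
  w t * Rabs (slp x e j) <= Cslope al ga M c * K * (eta * Lg).
Proof.
  pose proof lossy_nodal_bounds as NB. fold c in NB.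
  pose proof lossy_l as Hl8. pose proof lossy_lN as HlN. pose proof (exp_pos 4) as P4.
  pose proof (CM_pos Hdc NB) as PM.
  assert (PMd : CM al ga M c <= Cmid al ga M c) by (unfold Cmid; nra).
  assert (lY : l * eta <= 8 * (eta * Lg)) by nra.
  assert (Q : forall i, (n <= i < 3 * n)%nat -> Rabs (slp x e i) <= Cmid al ga M c * (l * eta + eta)).
  { intros i Hi. eapply Rle_trans; [apply (mid_slopes Hp Hm Hdc NB i HlN Hi)|]. apply Rmult_le_compat_r; nra. }
  apply (weighted_slope eta c (eta * Lg) j t NB ltac:(lra) eta_le).
  - intros i Hi. eapply Rle_trans; [apply Q, Hi|]. apply Rmult_le_compat_l; lra.
  - apply Q. lia.
  - intros s Hs1 _. apply weight_le; nra.
Qed.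

Lemma lossy_interpolation j t : 0 < t < 1 -> (j < 4 * n)%nat -> x j <= t <= x (S j) ->
  w t * Rabs (Derive u t - slp x (fun i => ut (x i)) j) <= 2 * C * (K * (Cint * (eta * Lg))).
Proof.
  intros Ht Hj Htc. pose proof (lw_bound Hw t Ht) as B.
  destruct (cell_bounds j t Hj Htc) as [X0 [X1 X3]].
  pose proof lossy_l as Hl8. pose proof lossy_lN as HlN. fold N in HlN.
  pose proof (exp_pos 8) as P8. pose proof (exp_pos 12) as P12.
  pose proof (weight_cell j t Ht Hj) as Wh.
  pose proof (cell_le Hs j Hj) as Hh2. fold N in Hh2.
  set (h := x (S j) - x j) in *. assert (Hh : 0 < h) by (unfold h; lra).
  pose proof (EL_pos l (x j)) as PE. pose proof (ER_pos r (x (S j))) as PF.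
  assert (ml : 0 <= Rmin (l * h) 1 <= 1) by (apply Rmin_1_bounds, Rmult_le_pos; lra).
  assert (mr : 0 <= Rmin (r * h) 1 <= 1) by (apply Rmin_1_bounds, Rmult_le_pos; lra).
  assert (rN : 0 < / N) by (apply Rinv_0_lt_compat; lra).
  assert (EL1 : EL l (x j) <= 1) by (apply EL_le_1; lra).
  set (Y := eta * Lg) in *. assert (HY : 0 < Y) by (unfold Y; apply Rmult_lt_0_compat; lra).
  assert (q1 : 0 < K * (exp 8 * Y)) by (repeat apply Rmult_lt_0_compat; lra).
  assert (q2 : 0 < K * (exp 12 * Y)) by (repeat apply Rmult_lt_0_compat; lra).
  assert (q2' : K * (exp 12 * eta) <= K * (exp 12 * Y)) by (apply Rmult_le_compat_l; [lra|apply Rmult_le_compat_l; lra]).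
  assert (q3 : 0 < K * Y) by (apply Rmult_lt_0_compat; lra).
  assert (q3' : K * eta <= K * Y) by (apply Rmult_le_compat_l; lra).
  assert (small : forall X, X <= 128 * Y -> w t * X <= K * (128 * Y)) by (intros; apply weight_le; lra).
  assert (small7 : forall X, X <= 7 * Y -> w t * X <= K * (7 * Y)) by (intros; apply weight_le; lra).
  assert (T1 : l * EL l (x j) * Rmin (l * h) 1 <= 128 * Y).
  { assert (lE : 0 < l * EL l (x j) <= 8 * Lg) by (split; [apply Rmult_lt_0_compat|apply mult_le_1]; lra).
    assert (lh : l * h <= 16 * eta).
    { assert (l * / N <= 8 * eta) by (unfold eta, Rdiv; rewrite <- Rmult_assoc; apply Rmult_le_compat_r; lra).
      apply Rle_trans with (l * (2 * / N)); [apply Rmult_le_compat_l; lra|lra]. }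
    apply Rle_trans with (8 * Lg * (16 * eta)); [|unfold Y; lra].
    apply Rmult_le_compat; [lra|lra|lra|]. eapply Rle_trans; [apply Rmin_l|exact lh]. }
  apply small in T1.
  destruct (le_lt_dec (3 * n) j) as [C2|C2].
  - eapply weight_scale; [exact Ht|
      apply (interpolation_layer HC Hp Hls X0 X1 X3 Htc Ht)|].
    fold h. pose proof (weight_ER_right j t Ht ltac:(lia) Htc) as Q. fold h in Q.
    unfold Cint. lra.
  - assert (tn : t <= x (3 * n)%nat) by (pose proof (node_le Hs (S j) (3 * n) ltac:(lia)); lra).
    pose proof (ER_before Hp Hs HsR (S j) ltac:(lia)) as F1. fold N in F1.
    destruct (Rle_dec r (4 * N ^ 2)) as [C4|C4].
    + eapply weight_scale; [exact Ht|
        apply (interpolation_layer HC Hp Hls X0 X1 X3 Htc Ht)|].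
      fold h.
      assert (T2 : r * ER r (x (S j)) * Rmin (r * h) 1 <= 7 * Y).
      { assert (r * ER r (x (S j)) <= 4 * N ^ 2 * / N ^ 3) by (apply Rmult_le_compat; lra).
        replace (4 * N ^ 2 * / N ^ 3) with (4 * / N) in * by (field; lra).
        apply mult_le_1; [split; [apply Rmult_le_pos; lra|lra]|lra]. }
      apply small7 in T2. unfold Cint. lra.
    + destruct (pars_case Hp) as [Er|Hmu]; [exfalso; lra|].
      pose proof (lossy_cell_ge j ltac:(lia)) as HhN. fold h in HhN.
      eapply weight_scale; [exact Ht|
        apply (interpolation_split HC Hp Hls X0 X1 X3 Htc Ht N0 HhN Hmu)|].
      fold h.
      assert (WR : w t * (r * ER r t) <= K * eta).
      { eapply Rle_trans; [apply weight_ER, Ht|]. apply Rmult_le_compat_l; [lra|].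
        apply Rle_trans with (/ N); [|lra]. replace (/ N) with (/ N ^ 1) by (f_equal; ring).
        pose proof (exp_Lg_neg Hs 1) as G1. fold N in G1. rewrite <- G1. apply exp_mono.
        rewrite (x_3n Hs), HsR in tn.
        assert (r / 4 * (4 / r * Lg) <= r / 4 * (1 - t)) by (apply Rmult_le_compat_l; lra).
        replace (r / 4 * (4 / r * Lg)) with Lg in * by (field; lra). simpl. lra. }
      assert (NF : N * ER r (x (S j)) <= Y).
      { apply Rle_trans with (N * / N ^ 3); [apply Rmult_le_compat_l; lra|].
        replace (N * / N ^ 3) with (/ N * / N) by (field; lra).
        apply mult_le_1; lra. }
      assert (T2 : l * ER r (x (S j)) <= 7 * Y).
      { assert (l * ER r (x (S j)) <= 4 * N * ER r (x (S j))) by (apply Rmult_le_compat_r; lra). lra. }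
      assert (T3 : N * ER r (x (S j)) <= 7 * Y) by lra.
      apply small7 in T2. apply small7 in T3. unfold Cint. lra.
Qed.

Lemma lossy_derivative_error j t : 0 < t < 1 -> (j < 4 * n)%nat -> x j <= t <= x (S j) ->
  Rabs (w t * (Derive u t - slp x U j)) <= (2 * C * Cint + Cslope al ga M c) * K * (eta * Lg).
Proof.
  intros Ht Hj Htc. eapply Rle_trans.
  - apply derivative_error; [exact Ht|exact Hj|apply lossy_interpolation; assumption|apply lossy_slope; assumption].
  - right. ring.
Qed.

Lemma lossy_value_error j t : (j < 4 * n)%nat -> x j <= t <= x (S j) ->
  Rabs (ut t - (U j + slp x U j * (t - x j))) <= (136 * C + 3 * c) * eta.
Proof.
  intros Hj Ht. destruct (cell_bounds j t Hj Ht) as [X0 [X1 X3]]. rewrite Rmult_plus_distr_r.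
  assert (Ee := nodal_bounds_uniform _ _ lossy_nodal_bounds).
  pose proof lossy_l as Hl8. pose proof (cell_le Hs j Hj) as Hh2. fold N in Hh2.
  pose proof (EL_pos l (x j)) as PE. pose proof (ER_pos r (x (S j))) as PF.
  set (h := x (S j) - x j) in *. assert (Hh : 0 < h) by (unfold h; lra).
  assert (ml : 0 <= Rmin (l * h) 1 <= 1) by (apply Rmin_1_bounds, Rmult_le_pos; lra).
  assert (mr : 0 <= Rmin (r * h) 1 <= 1) by (apply Rmin_1_bounds, Rmult_le_pos; lra).
  assert (N3 : / N ^ 3 <= / N) by (apply Rinv_le_contravar; [lra|]; assert (1 <= N ^ 2) by (apply pow_R1_Rle; lra); simpl in *; nra).
  apply value_error; [exact Hj|exact Ht| | |apply Ee; lia|apply Ee; lia]; fold h.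
  - assert (EL l (x j) <= 1) by (apply EL_le_1; lra).
    assert (lh : l * h <= 16 * eta).
    { assert (l * / N <= 8 * eta) by (unfold eta, Rdiv; rewrite <- Rmult_assoc; apply Rmult_le_compat_r; lra).
      apply Rle_trans with (l * (2 * / N)); [apply Rmult_le_compat_l; lra|lra]. }
    pose proof (Rmin_l (l * h) 1). nra.
  - destruct (le_lt_dec (3 * n) j) as [C1|C1].
    + assert (ER r (x (S j)) <= 1) by (apply ER_le_1; lra).
      pose proof (r_hR Hp Hs) as Q. fold N eta in Q.
      pose proof (dm_right Hm j ltac:(lia)) as Eh. fold h in Eh.
      pose proof (Rmin_l (r * h) 1). rewrite Eh in *. nra.
    + pose proof (ER_before Hp Hs HsR (S j) ltac:(lia)) as F1. fold N in F1. nra.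
Qed.

End Lossy.

(* sigma_R = 1/4: the mesh is uniform and every factor [r] costs one logarithm. *)
Section Uniform.

Hypothesis Hcells : forall i, (i < 4 * n)%nat -> x (S i) - x i = / N.
Hypothesis Hr16 : r <= 16 * Lg.

(** The worst term, (r / l) r D, is bounded by r^2 D; one factor r <= 16 ln N combines with the mesh
    width to O(eta), the other is the logarithm that is lost. *)
Lemma tau_uniform j : (S j < 4 * n)%nat ->
  Rabs (op eps mu av bv x e j) <= 9 * Ctau al ga M C * (eta * Lg).
Proof.
  intros Hj. replace (9 * Ctau al ga M C * (eta * Lg)) with (Ctau al ga M C * (9 * (eta * Lg))) by ring.
  apply tau_layer; [exact Hj|].
  destruct (stencil j Hj) as [X0 [X1 [X2 [X3 _]]]].
  pose proof (Hcells j ltac:(lia)) as E1. pose proof (Hcells (S j) ltac:(lia)) as E2.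
  replace (x (S (S j)) - x j) with (2 * / N) by lra. set (D := 2 * / N).
  assert (HD : 0 < D) by (unfold D; lra).
  pose proof (EL_pos l (x j)) as PE. pose proof (ER_pos r (x (S (S j)))) as PF.
  assert (E1' : EL l (x j) <= 1) by (apply EL_le_1; lra).
  assert (F1' : ER r (x (S (S j))) <= 1) by (apply ER_le_1; lra).
  pose proof (exp_pos 12) as P12. pose proof (exp_pos 8) as P8.
  assert (HeL : eta <= eta * Lg) by nra.
  assert (Hrel : r * / N <= 16 * eta).
  { unfold eta, Rdiv. rewrite <- Rmult_assoc. apply Rmult_le_compat_r; lra. }
  assert (T1 : D / l <= 2 * (eta * Lg)) by (unfold D, Rdiv; nra).
  assert (T2 : EL l (x j) * Rmin (l * D) 1 <= 32 * (eta * Lg)).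
  { apply Rle_trans with (1 * (l * D)).
    - apply Rmult_le_compat; [lra|apply Rmin_glb; nra|lra|apply Rmin_l].
    - unfold D. nra. }
  assert (Hrl : 0 < r / l < r).
  { split; [apply Rdiv_lt_0_compat; lra|]. unfold Rdiv. nra. }
  assert (T3 : r / l * (ER r (x (S (S j))) * Rmin (r * D) 1) <= 512 * (eta * Lg)).
  { apply Rle_trans with (r * (1 * (r * D))).
    - apply Rmult_le_compat; [lra|apply Rmult_le_pos; [lra|apply Rmin_glb; nra]|lra|].
      apply Rmult_le_compat; [lra|apply Rmin_glb; nra|lra|apply Rmin_l].
    - unfold D. replace (r * (1 * (r * (2 * / N)))) with (2 * (r * (r * / N))) by ring.
      assert (r * (r * / N) <= 16 * Lg * (16 * eta)) by (apply Rmult_le_compat; nra). nra. }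
  unfold cons, KK.
  assert (0 <= exp 12 * (eta * Lg)) by (apply Rmult_le_pos; nra).
  assert (0 <= exp 8 * (eta * Lg)) by (apply Rmult_le_pos; nra).
  assert (B12 : 13 <= exp 12) by (pose proof (exp_ineq1_le 12); lra).
  assert (13 * (eta * Lg) <= exp 12 * (eta * Lg)) by (apply Rmult_le_compat_r; nra). lra.
Qed.

Lemma uniform_error i : (i <= 4 * n)%nat ->
  Rabs (e i) <= 72 / (ga * al) * (9 * Ctau al ga M C) * (3 * (eta * Lg)).
Proof.
  intros Hi. pose proof Ctau_pos as Ct.
  assert (Hk : 0 < ga * al) by nra.
  assert (He0 : e 0%nat = 0) by (unfold e; rewrite (dm_0 Hm), Hu0, HU0; ring).
  assert (He1 : e (4 * n)%nat = 0) by (unfold e; rewrite (dm_1 Hm), Hu1, HU1; ring).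
  assert (BLp : forall i, (i <= 4 * n)%nat -> 0 < BL l x i) by (apply (BL_pos Hp Hm)).
  assert (BRp : forall i, (i <= 4 * n)%nat -> 0 < BR r (4 * n) x i) by (apply (BR_pos Hp Hm)).
  assert (HeL : eta <= eta * Lg) by nra.
  eapply Rle_trans.
  - apply (nodal_error_bound Hp Hm Hdc (eta * Lg) (9 * Ctau al ga M C) e); auto; try lra.
    + intros j Hj. eapply Rle_trans; [apply tau_uniform; lia|]. apply Rmult_le_compat_l; [lra|].
      pose proof (BLp (S j) ltac:(lia)). nra.
    + intros j Hj. eapply Rle_trans; [apply tau_uniform; lia|]. apply Rmult_le_compat_l; [lra|].
      pose proof (BRp (S j) ltac:(lia)). assert (0 < r / l) by (apply Rdiv_lt_0_compat; lra).
      assert (0 < eta * (r / l * BR r (4 * n) x (S j))) by (apply Rmult_lt_0_compat; nra). lra.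
  - apply Rmult_le_compat_l.
    + apply Rmult_le_pos; [apply Rlt_le, Rdiv_lt_0_compat; lra|lra].
    + pose proof (BL_le_1 i Hi).
      pose proof (BR_le_1 i Hi).
      assert (eta * BL l x i <= eta * 1) by (apply Rmult_le_compat_l; lra).
      assert (eta * BR r (4 * n) x i <= eta * 1) by (apply Rmult_le_compat_l; lra). lra.
Qed.

(** The whole mesh is one uniform block region with cell width at most 16/r, so the flux argument
    applies to every cell; its factor [r] is the second logarithm. *)
Lemma uniform_slope j : (j < 4 * n)%nat ->
  Rabs (slp x e j) <= Cblk al ga M * (72 / (ga * al) * (27 * Ctau al ga M C) + 9 * Ctau al ga M C) * (16 * (eta * Lg ^ 2)).
Proof.
  intros Hj. pose proof Ctau_pos as Ct. assert (Hk : 0 < ga * al) by nra.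
  pose proof (Cblk_pos Hdc) as Cb.
  set (c1 := 72 / (ga * al) * (27 * Ctau al ga M C)). set (c2 := 9 * Ctau al ga M C).
  assert (Hc1 : 0 < c1) by (unfold c1; apply Rmult_lt_0_compat; [apply Rdiv_lt_0_compat|]; lra).
  assert (Hc2 : 0 < c2) by (unfold c2; lra).
  assert (HeL : 0 < eta * Lg) by nra.
  eapply Rle_trans.
  - apply (block_slope Hp Hm Hdc (c1 * (eta * Lg)) (c2 * (eta * Lg)) (/ N) e 0 (4 * n) j).
    + lra.
    + apply Rle_trans with (16 * eta / r).
      * apply Rmult_le_reg_r with r; [lra|]. replace (16 * eta / r * r) with (16 * eta) by (field; lra).
        assert (r * / N <= 16 * Lg * / N) by (apply Rmult_le_compat_r; lra). unfold eta, Rdiv. lra.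
      * apply Rmult_le_compat_r; [left; apply Rinv_0_lt_compat; lra|lra].
    + fold N. rewrite Rinv_r by lra. apply Rmult_le_reg_r with (4 * r); [lra|].
      replace (1 / (4 * r) * (4 * r)) with 1 by (field; lra). lra.
    + nra.
    + lia.
    + intros i Hi. apply Hcells. lia.
    + lia.
    + intros i Hi _. eapply Rle_trans; [apply uniform_error; lia|]. right. unfold c1. ring.
    + intros i _ Hi _. eapply Rle_trans; [apply tau_uniform; lia|]. right. unfold c2. ring.
  - rewrite Rmult_assoc. apply Rmult_le_compat_l; [lra|].
    assert (Q : r * (eta * Lg) <= 16 * (eta * Lg ^ 2)) by (simpl; nra).
    assert (Ql : l * (eta * Lg) <= r * (eta * Lg)) by (apply Rmult_le_compat_r; lra).
    assert (c1 * (r * (eta * Lg)) <= c1 * (16 * (eta * Lg ^ 2))) by (apply Rmult_le_compat_l; lra).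
    assert (c2 * (l * (eta * Lg)) <= c2 * (16 * (eta * Lg ^ 2))) by (apply Rmult_le_compat_l; lra). lra.
Qed.

Lemma uniform_interpolation j t : 0 < t < 1 -> (j < 4 * n)%nat -> x j <= t <= x (S j) ->
  w t * Rabs (Derive u t - slp x (fun i => ut (x i)) j) <= 2 * C * (K * (Cint * (eta * Lg ^ 2))).
Proof.
  intros Ht Hj Htc. pose proof (lw_bound Hw t Ht) as B.
  destruct (cell_bounds j t Hj Htc) as [X0 [X1 X3]].
  pose proof (exp_pos 8) as P8. pose proof (exp_pos 12) as P12.
  eapply weight_scale; [exact Ht|
    apply (interpolation_layer HC Hp Hls X0 X1 X3 Htc Ht)|].
  assert (HL2 : Lg <= Lg ^ 2) by nra.
  assert (eY : eta <= eta * Lg ^ 2) by nra. assert (eY1 : eta * Lg <= eta * Lg ^ 2) by nra.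
  rewrite (Hcells j Hj).
  assert (rN : 0 < / N) by (apply Rinv_0_lt_compat; lra).
  assert (EL1 : 0 < EL l (x j) <= 1) by (split; [apply EL_pos|apply EL_le_1; lra]).
  assert (ER1 : 0 < ER r (x (S j)) <= 1) by (split; [apply ER_pos|apply ER_le_1; lra]).
  assert (Hrel : r * / N <= 16 * eta) by (unfold eta, Rdiv; rewrite <- Rmult_assoc; apply Rmult_le_compat_r; lra).
  assert (HlN : l * / N <= r * / N) by (apply Rmult_le_compat_r; lra).
  assert (T : forall q E, 0 < q <= 16 * Lg -> 0 < E <= 1 -> q * / N <= 16 * eta -> q * E * Rmin (q * / N) 1 <= 256 * (eta * Lg)).
  { intros q E Hq HE Hq2. apply Rle_trans with (16 * Lg * (16 * eta)); [|lra].
    apply Rmult_le_compat; [apply Rmult_le_pos; lra|apply Rmin_1_bounds, Rmult_le_pos; lra|apply mult_le_1; lra|]. eapply Rle_trans; [apply Rmin_l|exact Hq2]. }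
  pose proof (T l _ ltac:(lra) EL1 ltac:(lra)) as T1. pose proof (T r _ ltac:(lra) ER1 Hrel) as T2.
  apply weight_le; [exact Ht| |unfold Cint; nra]. unfold Cint.
  assert (B12 : 13 <= exp 12) by (pose proof (exp_ineq1_le 12); lra).
  assert (0 <= exp 8 * (eta * Lg ^ 2)) by nra.
  assert (13 * (eta * Lg ^ 2) <= exp 12 * (eta * Lg ^ 2)) by (apply Rmult_le_compat_r; nra). lra.
Qed.

Definition Cuni : R :=
  Cblk al ga M * (72 / (ga * al) * (27 * Ctau al ga M C) + 9 * Ctau al ga M C) * 16.

Lemma uniform_derivative_error j t : 0 < t < 1 -> (j < 4 * n)%nat -> x j <= t <= x (S j) ->
  Rabs (w t * (Derive u t - slp x U j)) <= (2 * C * Cint + Cuni) * K * (eta * Lg ^ 2).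
Proof.
  intros Ht Hj Htc. eapply Rle_trans.
  - apply derivative_error; [exact Ht|exact Hj|apply uniform_interpolation; assumption|].
    apply weight_le; [exact Ht|apply uniform_slope; exact Hj|].
    eapply Rle_trans; [apply Rabs_pos|apply (uniform_slope j Hj)].
  - right. unfold Cuni. ring.
Qed.

Lemma uniform_value_error j t : (j < 4 * n)%nat -> x j <= t <= x (S j) ->
  Rabs (ut t - (U j + slp x U j * (t - x j)))
  <= (136 * C + 72 / (ga * al) * (27 * Ctau al ga M C)) * (eta * Lg).
Proof.
  intros Hj Ht. destruct (cell_bounds j t Hj Ht) as [X0 [X1 X3]].
  assert (eY : eta <= eta * Lg) by nra.
  apply Rle_trans with (136 * C * eta + 72 / (ga * al) * (9 * Ctau al ga M C) * (3 * (eta * Lg))).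
  - assert (Hrel : r * / N <= 16 * eta) by (unfold eta, Rdiv; rewrite <- Rmult_assoc; apply Rmult_le_compat_r; lra).
    assert (rN : 0 < / N) by (apply Rinv_0_lt_compat; lra).
    assert (HlN : l * / N <= r * / N) by (apply Rmult_le_compat_r; lra).
    assert (T : forall q E, 0 < q -> 0 < E <= 1 -> q * / N <= 16 * eta -> E * Rmin (q * / N) 1 <= 16 * eta).
    { intros q E Hq HE Hq2. apply Rle_trans with (1 * (16 * eta)); [|lra].
      apply Rmult_le_compat; [lra|apply Rmin_glb; nra|lra|]. eapply Rle_trans; [apply Rmin_l|exact Hq2]. }
    apply value_error; [exact Hj|exact Ht| | |apply uniform_error; lia|apply uniform_error; lia]; rewrite (Hcells j Hj).
    + apply T; [lra|split; [apply EL_pos|apply EL_le_1; lra]|lra].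
    + apply T; [lra|split; [apply ER_pos|apply ER_le_1; lra]|lra].
  - assert (136 * C * eta <= 136 * C * (eta * Lg)) by (apply Rmult_le_compat_l; lra). lra.
Qed.

End Uniform.

Definition Cerr : R :=
  (2 * C * Cint + Cslope al ga M (Cnod al ga M C) + Cuni) * K
  + (136 * C + 3 * Cnod al ga M C + 72 / (ga * al) * (27 * Ctau al ga M C)).

Definition errors_within (Y : R) : Prop :=
  (forall j t, 0 < t < 1 -> (j < 4 * n)%nat -> x j <= t <= x (S j) ->
     Rabs (w t * (Derive u t - slp x U j)) <= Cerr * Y) /\
  (forall j t, (j < 4 * n)%nat -> x j <= t <= x (S j) ->
     Rabs (ut t - (U j + slp x U j * (t - x j))) <= Cerr * Y).

(** The regimes are distinguished by which minima are capped at 1/4. A capped sigma_L costs up to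
    one logarithm and a capped sigma_R up to two, beyond eta = ln N / N. *)
Lemma cell_errors :
  INR n * hL = Rmin (1 / 4) (2 / l * Lg) -> INR n * hR = Rmin (1 / 4) (4 / r * Lg) ->
  2 * INR n * H = 1 - INR n * hL - INR n * hR ->
  (2 / l * Lg < 1 / 4 -> errors_within eta) /\ errors_within (eta * Lg ^ 2).
Proof.
  intros EL' ER' EH.
  pose proof Ctau_pos as Ct. pose proof (Cblk_pos Hdc) as Cb. assert (Hk : 0 < ga * al) by nra.
  pose proof (exp_pos 4) as P4. pose proof (exp_pos 8) as P8. pose proof (exp_pos 12) as P12. pose proof (exp_pos 16) as P16.
  pose proof (exp_pos 9) as P9.
  assert (k1 : 0 < 72 / (ga * al)) by (apply Rdiv_lt_0_compat; lra).
  assert (Cn : 0 < Cnod al ga M C).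
  { unfold Cnod. assert (0 < 72 / (ga * al) * Ctau al ga M C * (1 + 2 * exp 4 + exp 16))
      by (apply Rmult_lt_0_compat; [apply Rmult_lt_0_compat|]; lra). lra. }
  set (c := Cnod al ga M C) in *.
  assert (p1 : 0 < 2 * C * Cint) by (unfold Cint; repeat apply Rmult_lt_0_compat; lra).
  assert (p3 : 0 < Cuni).
  { unfold Cuni. repeat apply Rmult_lt_0_compat; try lra.
    assert (0 < 72 / (ga * al) * (27 * Ctau al ga M C)) by (apply Rmult_lt_0_compat; lra). lra. }
  assert (p4 : 0 < 72 / (ga * al) * (27 * Ctau al ga M C)) by (apply Rmult_lt_0_compat; lra).
  assert (p2 : 0 < Cslope al ga M c) by apply slope_constants_pos, Cn.
  assert (D1 : (2 * C * Cint + Cslope al ga M c) * K <= Cerr).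
  { unfold Cerr. fold c. assert (0 < Cuni * K) by (apply Rmult_lt_0_compat; lra). lra. }
  assert (D2 : (2 * C * Cint + Cuni) * K <= Cerr).
  { unfold Cerr. fold c. assert (0 < Cslope al ga M c * K) by (apply Rmult_lt_0_compat; lra). lra. }
  assert (D0 : 0 < (2 * C * Cint + Cslope al ga M c + Cuni) * K) by (apply Rmult_lt_0_compat; lra).
  assert (D3 : 136 * C + 3 * c <= Cerr) by (unfold Cerr; fold c; lra).
  assert (D4 : 136 * C + 72 / (ga * al) * (27 * Ctau al ga M C) <= Cerr) by (unfold Cerr; fold c; lra).
  assert (D5 : 0 < Cerr) by (unfold Cerr; fold c; lra).
  assert (HL2 : Lg <= Lg ^ 2) by nra.
  assert (Y1 : eta <= eta * Lg ^ 2) by nra. assert (Y2 : eta * Lg <= eta * Lg ^ 2) by nra.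
  assert (up : forall X q Y Z, X <= q * Y -> q <= Cerr -> 0 <= Y <= Z -> X <= Cerr * Z).
  { intros X q Y Z h1 h2 h3. apply Rle_trans with (Cerr * Y).
    - eapply Rle_trans; [exact h1|apply Rmult_le_compat_r; lra].
    - apply Rmult_le_compat_l; lra. }
  assert (Main : 2 / l * Lg < 1 / 4 -> forall Z, eta <= Z -> errors_within Z).
  { intros Hs4 Z HZ. rewrite Rmin_right in EL' by lra.
    (* By r >= 2 l, an uncapped left transition point entails an uncapped right one. *)
    assert (HR4 : 4 / r * Lg <= 2 / l * Lg).
    { apply Rmult_le_compat_r; [lra|]. apply Rmult_le_reg_r with (l * r); [apply Rmult_lt_0_compat; lra|].
      replace (4 / r * (l * r)) with (4 * l) by (field; lra). replace (2 / l * (l * r)) with (2 * r) by (field; lra). lra. }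
    rewrite Rmin_right in ER' by lra. split; intros.
    - eapply up; [apply main_derivative_error; eassumption|exact D1|lra].
    - eapply up; [apply main_value_error; eassumption|exact D3|lra]. }
  split; [intros Hs4; apply Main; [exact Hs4|lra]|].
  destruct (Rlt_dec (2 / l * Lg) (1 / 4)) as [C1|C1]; [apply Main; [exact C1|lra]|].
  rewrite Rmin_left in EL' by lra.
  destruct (Rlt_dec (4 / r * Lg) (1 / 4)) as [C2|C2].
  - rewrite Rmin_right in ER' by lra. split; intros.
    + eapply up; [apply lossy_derivative_error; eassumption|exact D1|split; [apply Rmult_le_pos; lra|exact Y2]].
    + eapply up; [apply lossy_value_error; eassumption|exact D3|lra].
  - rewrite Rmin_left in ER' by lra.
    assert (Hr16 : r <= 16 * Lg).
    { apply Rmult_le_reg_r with (/ (4 * r)); [apply Rinv_0_lt_compat; lra|].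
      replace (16 * Lg * / (4 * r)) with (4 / r * Lg) by (field; lra). replace (r * / (4 * r)) with (1 / 4) by (field; lra). lra. }
    assert (n1 : 1 <= INR n) by (apply (le_INR 1), Hn). pose proof (N_eq (n := n)) as NE. fold N in NE.
    assert (cells : forall i, (i < 4 * n)%nat -> x (S i) - x i = / N).
    { intros i Hi. apply Rmult_eq_reg_l with (4 * INR n); [|lra]. transitivity 1; [|rewrite <- NE, Rinv_r; lra].
      destruct (le_lt_dec n i) as [C3|C3]; [destruct (le_lt_dec (3 * n) i) as [C4|C4]|].
      - rewrite (dm_right Hm i) by lia. lra.
      - rewrite (dm_mid Hm i) by lia. lra.
      - rewrite (dm_left Hm i) by lia. lra. }
    split; intros.
    + eapply up; [apply uniform_derivative_error; eassumption|exact D2|lra].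
    + eapply up; [apply uniform_value_error; eassumption|exact D4|split; [apply Rmult_le_pos; lra|exact Y2]].
Qed.

End Regimes.
Arguments Cuni : clear implicits.
Arguments Cerr : clear implicits.
Arguments errors_within : clear implicits.

(** * The parameters, the weight and the mesh of the theorem *)

Section RhoTheta.

Variables (al ga eps mu : R).
Hypotheses (Hal : 0 < al) (Hga : 0 < ga) (Heps : 0 < eps) (Hmu : 0 <= mu).

Let th := theta al ga eps mu.
Let l := rho_L al ga eps mu.
Let r := rho_R al ga eps mu.

Lemma theta_ge_1 : 1 <= th.
Proof. apply Rmax_l. Qed.

Let Hth : 1 <= th := theta_ge_1.
Let Hk : 0 < ga * al.
Proof. nra. Qed.
Let Hq : 0 < ga * al / (th * eps).
Proof. apply Rdiv_lt_0_compat; nra. Qed.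

Lemma rho_R_eq : r = 2 * l * th.
Proof.
  unfold r, l, rho_R, rho_L. fold th.
  replace (th * ga * al / eps) with (th * th * (ga * al / (th * eps))) by (field; lra).
  rewrite sqrt_mult, sqrt_square by nra. field.
Qed.

Lemma rho_L_pos : 0 < l.
Proof. unfold l, rho_L. fold th. pose proof (sqrt_lt_R0 _ Hq). lra. Qed.

Lemma rho_L_sq : 4 * l * l * (th * eps) = ga * al.
Proof.
  unfold l, rho_L. fold th. set (q := ga * al / (th * eps)) in *.
  replace (4 * (/ 2 * sqrt q) * (/ 2 * sqrt q)) with (sqrt q * sqrt q) by field.
  rewrite sqrt_sqrt by lra. unfold q. field. lra.
Qed.

(** Inserting theta >= al mu^2 / (ga eps) into 4 l^2 theta eps = ga al gives (2 l mu)^2 <= ga^2. If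
    theta is the second entry of the maximum, equality holds, which is the second alternative of
    [pars_case]; if theta = 1, then r = 2 l. *)
Lemma rho_pars : 1 < l -> pars al ga l r eps mu.
Proof.
  intros Hl. pose proof rho_R_eq as Er. pose proof rho_L_sq as El.
  assert (Hr : 2 * l <= r) by (rewrite Er; nra).
  assert (Emax : 4 * l * l * (al * mu ^ 2 / (ga * eps)) * (ga * eps) = 4 * l * l * al * mu ^ 2) by (field; lra).
  assert (Hmu2 : (2 * l * mu) * (2 * l * mu) <= ga * ga).
  { assert (M1 : al * mu ^ 2 / (ga * eps) <= th) by apply Rmax_r.
    assert (4 * l * l * (al * mu ^ 2 / (ga * eps)) * (ga * eps) <= 4 * l * l * th * (ga * eps)).
    { apply Rmult_le_compat_r; [nra|]. apply Rmult_le_compat_l; [nra|exact M1]. }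
    apply Rmult_le_reg_r with al; [exact Hal|]. simpl in *. nra. }
  constructor; auto.
  - rewrite Er. apply Rmult_eq_reg_r with (4 * l * l * th); [|nra].
    replace (eps * (4 * l * l * th)) with (ga * al) by lra. field. lra.
  - apply Rmult_le_reg_r with (2 * l); [lra|]. replace (ga / (2 * l) * (2 * l)) with ga by (field; lra).
    apply Rsqr_incr_0_var; [unfold Rsqr; lra|lra].
  - unfold th, theta in *. destruct (Rle_dec (al * mu ^ 2 / (ga * eps)) 1) as [C1|C1].
    + left. rewrite Er, Rmax_left by lra. ring.
    + right. rewrite Rmax_right in El by lra.
      apply Rmult_eq_reg_r with (2 * l); [|lra]. replace (ga / (2 * l) * (2 * l)) with ga by (field; lra).
      apply Rsqr_inj; [nra|lra|]. unfold Rsqr. apply Rmult_eq_reg_r with al; [|lra].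
      assert (4 * l * l * (al * mu ^ 2 / (ga * eps) * eps) * ga = ga * al * ga) by (rewrite El; ring).
      replace (4 * l * l * (al * mu ^ 2 / (ga * eps) * eps) * ga) with (4 * l * l * al * mu ^ 2) in H by (field; lra).
      lra.
Qed.

(** With the next lemma this shows that near each boundary chi is a fixed multiple of the layer
    width, 1/l or 1/r. *)
Lemma sqrt_eps_theta : sqrt (eps * th) = sqrt (ga * al) / (2 * l).
Proof.
  pose proof rho_L_pos as Hl. rewrite <- rho_L_sq.
  replace (4 * l * l * (th * eps)) with ((2 * l) * (2 * l) * (eps * th)) by ring.
  rewrite (sqrt_mult (2 * l * (2 * l))), (sqrt_square (2 * l)) by nra. field. lra.
Qed.

Lemma sqrt_eps_over_theta : sqrt (eps / th) = sqrt (ga * al) / r.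
Proof.
  pose proof rho_L_pos as Hl. rewrite rho_R_eq, <- rho_L_sq.
  replace (4 * l * l * (th * eps)) with ((2 * l * th) * (2 * l * th) * (eps / th)) by (field; lra).
  assert (0 < 2 * l * th) by nra. assert (0 < eps / th) by (apply Rdiv_lt_0_compat; lra).
  rewrite (sqrt_mult (2 * l * th * (2 * l * th))), (sqrt_square (2 * l * th)) by nra. field. lra.
Qed.

(** The maximum of ln y / y is 1/e, and e >= (9/8)^8 >= 5/2. Consequently tau_L <= 4/5. *)
Lemma ln_over_le y : 0 < y -> ln y <= 2 / 5 * y.
Proof.
  intros Hy. pose proof (exp_ineq1_le (1 / 8)) as E.
  assert (E8 : exp 1 = exp (1 / 8) ^ 8).
  { simpl. rewrite Rmult_1_r, <- !exp_plus. f_equal. field. }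
  assert (5 / 2 <= exp 1).
  { rewrite E8. apply Rle_trans with ((9 / 8) ^ 8); [lra|apply pow_incr; lra]. }
  assert (Q : ln (2 / 5 * y) <= 2 / 5 * y - 1).
  { pose proof (exp_ineq1_le (ln (2 / 5 * y))) as G. rewrite exp_ln in G by lra. lra. }
  assert (Q2 : ln (5 / 2) <= 1) by (rewrite <- (ln_exp 1); apply ln_le; lra).
  replace (ln y) with (ln (5 / 2) + ln (2 / 5 * y)); [lra|].
  rewrite <- ln_mult by lra. f_equal. field.
Qed.

(** This explains tau_L and tau_R: beyond them even the halved exponential is below 1/q, so the
    weight 1 is admissible. *)
Lemma exp_half_ln (q s : R) : 1 < q -> 2 / q * ln q <= s -> q * exp (- (q / 2 * s)) <= 1.
Proof.
  intros Hq1 Hs. apply Rle_trans with (q * exp (- ln q)).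
  - apply Rmult_le_compat_l; [lra|]. apply exp_mono.
    assert (q / 2 * (2 / q * ln q) <= q / 2 * s) by (apply Rmult_le_compat_l; lra).
    replace (q / 2 * (2 / q * ln q)) with (ln q) in * by (field; lra). lra.
  - rewrite exp_Ropp, exp_ln by lra. right. field. lra.
Qed.

Lemma chi_layer_weight : 1 < l -> layer_weight (1 + 10 * sqrt (ga * al)) l r (chi al ga eps mu).
Proof.
  intros Hl. pose proof (sqrt_lt_R0 _ Hk) as Pk. set (k := sqrt (ga * al)) in *.
  assert (Hr : 2 * l <= r) by (rewrite rho_R_eq; nra).
  assert (V : forall t, (t <= 2 / l * ln l /\ chi al ga eps mu t = k / (2 * l)) \/
     (2 / l * ln l < t < 1 - 2 / r * ln r /\ chi al ga eps mu t = 1) \/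
     (2 / l * ln l < t /\ 1 - 2 / r * ln r <= t /\ chi al ga eps mu t = k / r)).
  { intros t. unfold chi. fold th. rewrite sqrt_eps_theta, sqrt_eps_over_theta.
    unfold tau_L, tau_R. fold l r. destruct Rle_dec as [C1|C1]; [left; auto|].
    destruct Rlt_dec as [C2|C2]; [right; left|right; right]; repeat split; try lra; reflexivity. }
  assert (kl : 0 < k / (2 * l) <= k).
  { split; [apply Rdiv_lt_0_compat; lra|]. apply Rmult_le_reg_r with (2 * l); [lra|].
    replace (k / (2 * l) * (2 * l)) with k by (field; lra). nra. }
  assert (kr : 0 < k / r <= k).
  { split; [apply Rdiv_lt_0_compat; lra|]. apply Rmult_le_reg_r with r; [lra|].
    replace (k / r * r) with k by (field; lra). nra. }
  assert (wb : forall t, 0 <= chi al ga eps mu t <= 1 + k).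
  { intros t. destruct (V t) as [[_ ->]|[[_ ->]|[_ [_ ->]]]]; lra. }
  assert (krl : k / r * l <= k).
  { apply Rle_trans with (k / r * r); [apply Rmult_le_compat_l; lra|]. right. field. lra. }
  assert (kll : k / (2 * l) * l <= k) by (replace (k / (2 * l) * l) with (k / 2) by (field; lra); lra).
  constructor.
  - lra.
  - intros t _. pose proof (wb t). lra.
  - intros t Ht. destruct (V t) as [[Hc E]|Hc].
    + rewrite E, <- Rmult_assoc.
      assert (exp (- (l / 2 * t)) <= 1) by (apply exp_le_1; assert (0 <= l / 2 * t) by (apply Rmult_le_pos; lra); lra).
      pose proof (exp_pos (- (l / 2 * t))). assert (0 < k / (2 * l) * l) by nra. nra.
    + assert (Hc' : 2 / l * ln l <= t) by lra. pose proof (exp_half_ln l t Hl Hc') as Q.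
      pose proof (wb t) as B. pose proof (exp_pos (- (l / 2 * t))).
      assert (0 < l * exp (- (l / 2 * t))) by nra. nra.
  - intros t Ht. pose proof (exp_pos (- (r / 2 * (1 - t)))) as Pe. pose proof (wb t) as B.
    destruct (Rle_dec t (1 - 2 / r * ln r)) as [C1|C1].
    + pose proof (exp_half_ln r (1 - t) ltac:(lra) ltac:(lra)) as Q.
      assert (0 < r * exp (- (r / 2 * (1 - t)))) by nra. nra.
    + destruct (V t) as [[Hc E]|[[Hc _]|[Hc [_ E]]]]; [|lra|].
      * rewrite E.
        (* The overlap of the two boundary zones, where the left formula for chi takes precedence
           and gives no factor 1/r. As tau_L <= 4/5, the point is at distance at least 1/5 from x =
           1, so r exp(-r/10) <= 10 replaces that factor; this is the 10 in the constant. *)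
        assert (t <= 4 / 5).
        { eapply Rle_trans; [exact Hc|]. apply Rle_trans with (2 / l * (2 / 5 * l)).
          - apply Rmult_le_compat_l; [left; apply Rdiv_lt_0_compat; lra|apply ln_over_le; lra].
          - right. field. lra. }
        assert (r * exp (- (r / 2 * (1 - t))) <= 10).
        { apply Rle_trans with (r * / (r / 10)); [|right; field; lra].
          apply Rmult_le_compat_l; [lra|]. eapply Rle_trans; [|apply exp_neg_le_inv; lra].
          apply exp_mono. assert (r / 2 * (1 / 5) <= r / 2 * (1 - t)) by (apply Rmult_le_compat_l; lra). lra. }
        assert (0 < r * exp (- (r / 2 * (1 - t)))) by nra.
        apply Rle_trans with (k * 10); [apply Rmult_le_compat; lra|lra].
      * rewrite E, <- Rmult_assoc. replace (k / r * r) with k by (field; lra).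
        assert (exp (- (r / 2 * (1 - t))) <= 1) by (apply exp_le_1; assert (0 <= r / 2 * (1 - t)) by (apply Rmult_le_pos; lra); lra).
        nra.
  - intros t Ht Hc. destruct (V t) as [[_ ->]|[[Hc' _]|[Hc' _]]]; lra.
  - intros t Ht Hc. destruct (V t) as [[_ ->]|[[Hc' _]|[_ [_ ->]]]]; lra.
Qed.

End RhoTheta.

(** * The piecewise uniform mesh satisfies the abstract mesh conditions *)

Section Mesh.

Variables (al ga l r eps mu sL sR : R) (n : nat).
Hypothesis Hp : pars al ga l r eps mu.
Hypothesis Hn : (1 <= n)%nat.

Let N := INR (4 * n).
Let Lg := ln N.
Let x := pw_uniform_mesh (4 * n) sL sR.
Let hL := sL / INR n.
Let H := (1 - sL - sR) / (2 * INR n).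
Let hR := sR / INR n.

Hypothesis EsL : sL = Rmin (1 / 4) (2 / l * Lg).
Hypothesis EsR : sR = Rmin (1 / 4) (4 / r * Lg).

Let Hl : 1 < l := pars_l Hp.
Let Hr : 2 * l <= r := pars_r Hp.
Let n1 : 1 <= INR n.
Proof. apply (le_INR 1), Hn. Qed.
Let N4 : N = 4 * INR n.
Proof. unfold N. rewrite mult_INR. simpl. lra. Qed.

Let Lg1 : 1 <= Lg.
Proof.
  unfold Lg. rewrite <- (ln_exp 1). apply ln_le; [apply exp_pos|]. pose proof exp_le_3. lra.
Qed.

Let LgN : Lg <= N.
Proof.
  unfold Lg. pose proof (exp_ineq1_le (ln N)) as Q. rewrite exp_ln in Q by lra. lra.
Qed.

Let bsL : 0 < sL <= 1 / 4 /\ sL <= 2 / l * Lg /\ / (4 * l) <= sL.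
Proof.
  assert (0 < 2 / l) by (apply Rdiv_lt_0_compat; lra).
  assert (0 < / (4 * l)) by (apply Rinv_0_lt_compat; lra).
  assert (Q : / (4 * l) <= sL).
  { rewrite EsL. apply Rmin_glb.
    - replace (1 / 4) with (/ 4) by lra. apply Rinv_le_contravar; lra.
    - apply Rle_trans with (2 / l * 1); [|apply Rmult_le_compat_l; lra].
      replace (/ (4 * l)) with (/ 8 * (2 / l)) by (field; lra). lra. }
  pose proof (Rmin_l (1 / 4) (2 / l * Lg)). pose proof (Rmin_r (1 / 4) (2 / l * Lg)). lra.
Qed.

Let bsR : 0 < sR <= 1 / 4 /\ sR <= 4 / r * Lg /\ / (4 * r) <= sR.
Proof.
  assert (0 < 4 / r) by (apply Rdiv_lt_0_compat; lra).
  assert (0 < / (4 * r)) by (apply Rinv_0_lt_compat; lra).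
  assert (Q : / (4 * r) <= sR).
  { rewrite EsR. apply Rmin_glb.
    - replace (1 / 4) with (/ 4) by lra. apply Rinv_le_contravar; lra.
    - apply Rle_trans with (4 / r * 1); [|apply Rmult_le_compat_l; lra].
      replace (/ (4 * r)) with (/ 16 * (4 / r)) by (field; lra). lra. }
  pose proof (Rmin_l (1 / 4) (4 / r * Lg)). pose proof (Rmin_r (1 / 4) (4 / r * Lg)). lra.
Qed.

Lemma mesh_left i : (i <= n)%nat -> x i = INR i * hL.
Proof.
  intros Hi. unfold x, pw_uniform_mesh. replace (4 * n / 4)%nat with n by (rewrite Nat.mul_comm, Nat.div_mul; lia).
  apply Nat.leb_le in Hi. rewrite Hi. fold N. rewrite N4. unfold hL. field. lra.
Qed.

Lemma mesh_mid i : (n <= i <= 3 * n)%nat -> x i = sL + INR (i - n) * H.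
Proof.
  intros Hi. destruct (Nat.eq_dec i n) as [->|Ne].
  - rewrite mesh_left, Nat.sub_diag by lia. unfold hL. simpl. field. lra.
  - unfold x, pw_uniform_mesh. replace (4 * n / 4)%nat with n by (rewrite Nat.mul_comm, Nat.div_mul; lia).
    replace (i <=? n)%nat with false by (symmetry; apply Nat.leb_gt; lia).
    replace (i <=? 3 * n)%nat with true by (symmetry; apply Nat.leb_le; lia).
    fold N. rewrite N4. unfold H. field. lra.
Qed.

Lemma mesh_right i : (3 * n <= i <= 4 * n)%nat -> x i = 1 - sR + INR (i - 3 * n) * hR.
Proof.
  intros Hi. destruct (Nat.eq_dec i (3 * n)) as [->|Ne].
  - rewrite mesh_mid, Nat.sub_diag by lia. replace (3 * n - n)%nat with (2 * n)%nat by lia.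
    rewrite mult_INR. unfold H. simpl. field. lra.
  - unfold x, pw_uniform_mesh. replace (4 * n / 4)%nat with n by (rewrite Nat.mul_comm, Nat.div_mul; lia).
    replace (i <=? n)%nat with false by (symmetry; apply Nat.leb_gt; lia).
    replace (i <=? 3 * n)%nat with false by (symmetry; apply Nat.leb_gt; lia).
    fold N. rewrite N4. unfold hR. field. lra.
Qed.

Lemma shishkin_smesh : smesh n l r Lg hL H hR x.
Proof.
  destruct bsL as [[b1 b2] [b3 b4]]. destruct bsR as [[c1 c2] [c3 c4]].
  assert (E1 : INR n * hL = sL) by (unfold hL; field; lra).
  assert (E2 : INR n * hR = sR) by (unfold hR; field; lra).
  assert (E3 : 2 * INR n * H = 1 - sL - sR) by (unfold H; field; lra).
  assert (PN : 0 < N) by lra.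
  constructor; try (fold N); try lra.
  - constructor; auto; fold N.
    + rewrite mesh_left by lia. simpl. ring.
    + rewrite mesh_right by lia. replace (4 * n - 3 * n)%nat with n by lia. lra.
    + apply Rdiv_lt_0_compat; lra.
    + apply Rdiv_lt_0_compat; lra.
    + apply Rdiv_lt_0_compat; lra.
    + intros i Hi. rewrite !mesh_left, S_INR by lia. ring.
    + intros i Hi. rewrite !mesh_mid by lia. replace (S i - n)%nat with (S (i - n)) by lia. rewrite S_INR. ring.
    + intros i Hi. rewrite !mesh_right by lia. replace (S i - 3 * n)%nat with (S (i - 3 * n)) by lia. rewrite S_INR. ring.
    + split; [apply Rdiv_lt_0_compat; lra|]. apply Rmult_le_reg_r with N; [lra|].
      replace (Lg / N * N) with Lg by (field; lra). lra.
    + apply Rmult_le_reg_l with (INR n); [lra|]. rewrite E1.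
      replace (INR n * (8 * (Lg / N) / l)) with (2 / l * Lg) by (rewrite N4; field; lra). exact b3.
    + apply Rmult_le_reg_l with (INR n); [lra|]. rewrite E2.
      replace (INR n * (16 * (Lg / N) / r)) with (4 / r * Lg) by (rewrite N4; field; lra). exact c3.
    + apply Rmult_le_reg_l with (2 * INR n); [lra|]. rewrite E3.
      replace (2 * INR n * (1 / N)) with (1 / 2) by (rewrite N4; field; lra). lra.
    + apply Rmult_le_reg_l with (2 * INR n); [lra|]. rewrite E3.
      replace (2 * INR n * (2 / N)) with 1 by (rewrite N4; field; lra). lra.
    + rewrite E1. unfold Rdiv. lra.
    + rewrite E2. unfold Rdiv. lra.
  - unfold Lg. apply exp_ln. lra.
Qed.

End Mesh.

(** * The piecewise linear interpolant, the norm and the theorem *)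

Lemma first_node_from_spec (x : nat -> R) (t : R) (k i : nat) :
  let c := first_node_from x t i k in
  (i <= c <= i + k)%nat /\ ((c < i + k)%nat -> t <= x c) /\ ((i < c)%nat -> x (c - 1)%nat < t).
Proof.
  revert i. induction k as [|k IH]; intros i; simpl; [repeat split; lia|].
  destruct (Rle_dec t (x i)) as [Ht|Ht]; [repeat split; intros; lra || lia|].
  destruct (IH (S i)) as [H1 [H2 H3]]. set (c := first_node_from x t (S i) k) in *.
  repeat split; try lia.
  - intros Hc. apply H2. lia.
  - intros Hc. destruct (Nat.eq_dec c (S i)) as [E|Ne]; [|apply H3; lia].
    replace (c - 1)%nat with i by lia. lra.
Qed.

Lemma cell_spec (N : nat) (x : nat -> R) (t : R) :
  (0 < N)%nat -> x 0%nat = 0 -> x N = 1 -> 0 <= t <= 1 ->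
  exists j, (j < N)%nat /\ cell N x t = S j /\ x j <= t <= x (S j).
Proof.
  intros HN H0 H1 Ht. unfold cell. destruct (first_node_from_spec x t (N - 1) 1) as [A [B D]].
  set (c := first_node_from x t 1 (N - 1)) in *. exists (c - 1)%nat.
  replace (S (c - 1)) with c by lia. repeat split; [lia| |].
  - destruct (Nat.eq_dec c 1) as [->|Ne]; [simpl; lra|]. left. apply D. lia.
  (* The search tests the nodes 1 to N - 1 and returns N by default, in which case the upper bound
     is x N = 1. *)
  - destruct (Nat.eq_dec c N) as [->|Ne]; [lra|]. apply B. lia.
Qed.

Lemma pl_slope_slp N x U t j : cell N x t = S j -> pl_slope N x U t = slp x U j.
Proof.
  intros E. unfold pl_slope, Defs.Dminus, Dplus, slp. rewrite E.
  replace (S j - 1)%nat with j by lia. replace (j + 1)%nat with (S j) by lia. reflexivity.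
Qed.

Lemma pl_interp_slp N x U t j : cell N x t = S j -> pl_interp N x U t = U j + slp x U j * (t - x j).
Proof.
  intros E. unfold pl_interp. rewrite (pl_slope_slp N x U t j E), E.
  replace (S j - 1)%nat with j by lia. reflexivity.
Qed.

Lemma sup_norm_le (D : R -> Prop) (v : R -> R) (B : R) :
  (forall t, D t -> Rabs (v t) <= B) -> Rbar_le (sup_norm D v) (Finite B).
Proof.
  intros Hv. unfold sup_norm, sup_on. apply Lub_Rbar_correct.
  intros y [t [Ht ->]]. simpl. apply Hv, Ht.
Qed.

Lemma error_norm_le (al ga eps mu E : R) (n : nat) (u ut : R -> R) (U : nat -> R) :
  let x := shishkin_mesh al ga eps mu (4 * n) in
  (1 <= n)%nat -> x 0%nat = 0 -> x (4 * n)%nat = 1 -> (forall t, 0 <= t <= 1 -> ut t = u t) ->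
  (forall j t, 0 < t < 1 -> (j < 4 * n)%nat -> x j <= t <= x (S j) ->
     Rabs (chi al ga eps mu t * (Derive u t - slp x U j)) <= E) ->
  (forall j t, (j < 4 * n)%nat -> x j <= t <= x (S j) ->
     Rabs (ut t - (U j + slp x U j * (t - x j))) <= E) ->
  Rbar_le (error_norm al ga eps mu (4 * n) u U) (Finite (2 * E)).
Proof.
  intros x Hn X0 X1 Hut HD HV. unfold error_norm, norm_1chi. fold x.
  replace (Finite (2 * E)) with (Rbar_plus (Finite E) (Finite E)) by (simpl; f_equal; ring).
  apply Rbar_plus_le_compat; apply sup_norm_le; intros t Ht; unfold in_Omega, in_clOmega in Ht.
  - destruct (cell_spec (4 * n) x t ltac:(lia) X0 X1 ltac:(lra)) as [j [Hj [Ec Hc]]].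
    rewrite (pl_slope_slp _ _ _ _ j Ec). apply HD; assumption.
  - destruct (cell_spec (4 * n) x t ltac:(lia) X0 X1 Ht) as [j [Hj [Ec Hc]]].
    rewrite (pl_interp_slp _ _ _ _ j Ec), <- Hut by exact Ht. apply HV; assumption.
Qed.

Lemma upwind_op eps mu a b f n (x U av bv : nat -> R) :
  upwind_solution eps mu a b f (4 * n) x U ->
  (forall i, (0 < i < 4 * n)%nat -> av i = a (x i)) -> (forall i, (0 < i < 4 * n)%nat -> bv i = b (x i)) ->
  forall j, (S j < 4 * n)%nat -> op eps mu av bv x U j = f (x (S j)).
Proof.
  intros [_ [_ HU]] Hav Hbv j Hj. specialize (HU (S j) ltac:(lia)). rewrite <- HU.
  unfold op, delta2, Defs.Dminus, Dplus, slp. rewrite Hav, Hbv by lia.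
  replace (S j - 1)%nat with j by lia. replace (S j + 1)%nat with (S (S j)) by lia.
  replace (j + 1)%nat with (S j) by lia. reflexivity.
Qed.

(* Keeps the nodes inside (0,1): the values of [a] and [b] at 0 and 1 are unconstrained. *)
Definition inner (n i : nat) : nat := Nat.max 1 (Nat.min i (4 * n - 1)).

Lemma mesh_dcoef (al ga M l r Lg hL H hR : R) (n : nat) (x : nat -> R) (a a1 a2 b b1 b2 : R -> R) :
  coefs al ga M a a1 a2 b b1 b2 -> smesh n l r Lg hL H hR x ->
  dcoef al ga M n x (fun i => a (x (inner n i))) (fun i => b (x (inner n i))).
Proof.
  intros Hc Hs. pose proof (sm_d Hs) as Hm.
  assert (In : forall i, (0 < inner n i < 4 * n)%nat).
  { intros i. pose proof (dm_n Hm). unfold inner. lia. }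
  assert (X : forall i, 0 < x (inner n i) < 1).
  { intros i. pose proof (In i) as Hi. split.
    - rewrite <- (dm_0 Hm). pose proof (cell_incr Hs 0 ltac:(lia)).
      pose proof (node_le Hs 1 (inner n i) ltac:(lia)). lra.
    - rewrite <- (dm_1 Hm). pose proof (cell_incr Hs (inner n i) ltac:(lia)).
      pose proof (node_le Hs (S (inner n i)) (4 * n) ltac:(lia)). lra. }
  pose proof (coefs_M Hc) as HM.
  constructor.
  - apply (coefs_al Hc).
  - apply (coefs_ga Hc).
  - exact HM.
  - intros i _. apply (coefs_a_lower Hc), X.
  - intros i _. apply (coefs_b_lower Hc), X.
  - intros i _. apply (coefs_a Hc), X.
  - intros i _. apply (coefs_b Hc), X.
  - intros i Hi. pose proof (cell_incr Hs i Hi) as D.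
    (* On the first and the last cell [inner] takes equal values at both ends and the difference
       vanishes; on all other cells it is the identity. *)
    destruct (Nat.eq_dec (inner n (S i)) (inner n i)) as [->|Ne].
    { rewrite Rminus_diag_eq, Rabs_R0 by reflexivity. nra. }
    assert (E1 : inner n i = i) by (unfold inner in *; lia).
    assert (E2 : inner n (S i) = S i) by (unfold inner in *; lia).
    pose proof (X i) as Xi. pose proof (X (S i)) as XSi. rewrite E1 in *. rewrite E2 in *.
    destruct (mvt_open a a1 (x i) (x (S i)) D) as [c [Hcc ->]].
    + intros y Hy. apply (derive_continuity_pt a y (a1 y)), (coefs_da Hc). lra.
    + intros y Hy. apply (coefs_da Hc). lra.
    + rewrite Rabs_mult, (Rabs_pos_eq (x (S i) - x i)) by lra.
      apply Rmult_le_compat_r; [lra|apply (coefs_a1 Hc); lra].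
Qed.

Theorem theorem12 :
  forall (alpha gamma : R) (a b f : R -> R),
    0 < alpha -> 0 < gamma ->
    smooth 7 a -> smooth 9 b -> smooth 9 f ->
    (forall x : R, in_Omega x -> alpha < a x) ->
    (forall x : R, in_Omega x -> gamma * a x < b x) ->
    exists C : R,
      forall (eps mu : R) (N : nat) (u : R -> R) (U : nat -> R),
        0 < eps <= 1 -> 0 <= mu <= 1 ->
        (forall x : R, in_Omega x ->
           0 < b x + 2 * mu * max_deriv a /\ 0 < b x - 2 * mu * max_deriv a) ->
        theta alpha gamma eps mu <= alpha / (gamma * eps) ->
        1 < rho_L alpha gamma eps mu ->
        1 < rho_R alpha gamma eps mu ->
        (0 < N)%nat -> Nat.divide 4 N ->
        bvp_solution eps mu a b f u ->
        upwind_solution eps mu a b f N (shishkin_mesh alpha gamma eps mu N) U ->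
        (sigma_R alpha gamma eps mu N <= sigma_L alpha gamma eps mu N ->
         sigma_L alpha gamma eps mu N < 1 / 4 ->
         Rbar_le (error_norm alpha gamma eps mu N u U)
                 (Finite (C * / INR N * ln (INR N)))) /\
        Rbar_le (error_norm alpha gamma eps mu N u U)
                (Finite (C * / INR N * (ln (INR N)) ^ 3)).
Proof.
Proof.
  intros al ga a b f Hal Hga Sa Sb Sf La Lb.
  destruct (solution_layers al ga a b f Hal Hga Sa Sb Sf La Lb)
    as [M [C [a1 [a2 [b1 [b2 [Hc [HC HS]]]]]]]].
  set (K := 1 + 10 * sqrt (ga * al)).
  (* The factor 2 stems from the norm being a sum of two suprema, each bounded by the same
     quantity. *)
  exists (2 * Cerr al ga M C K).
  intros eps mu N u U [Heps _] [Hmu _] _ _ Hl _ HN [n EN] Hu HU.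
  rewrite Nat.mul_comm in EN. subst N. assert (Hn : (1 <= n)%nat) by lia.
  pose proof (rho_pars al ga eps mu Hal Hga Heps Hmu Hl) as Hp.
  pose proof (chi_layer_weight al ga eps mu Hal Hga Heps Hl) as Hw. fold K in Hw.
  set (l := rho_L al ga eps mu) in *. set (r := rho_R al ga eps mu) in *.
  destruct (HS l r eps mu u Hp Hu) as [ut [u2 [u3 [v [v1 [v2 [v3 [g Hls]]]]]]]].
  set (sL := sigma_L al ga eps mu (4 * n)). set (sR := sigma_R al ga eps mu (4 * n)).
  pose proof (shishkin_smesh al ga l r eps mu sL sR n Hp Hn eq_refl eq_refl) as Hs.
  change (pw_uniform_mesh (4 * n) sL sR) with (shishkin_mesh al ga eps mu (4 * n)) in Hs.
  set (x := shishkin_mesh al ga eps mu (4 * n)) in *.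
  pose proof (mesh_dcoef al ga M l r _ _ _ _ n x a a1 a2 b b1 b2 Hc Hs) as Hdc.
  pose proof (sm_d Hs) as Hm.
  assert (In : forall i, (0 < i < 4 * n)%nat -> inner n i = i) by (intros i Hi; unfold inner; lia).
  assert (Hav : forall i, (0 < i < 4 * n)%nat -> a (x (inner n i)) = a (x i)) by (intros i Hi; now rewrite In).
  assert (Hbv : forall i, (0 < i < 4 * n)%nat -> b (x (inner n i)) = b (x i)) by (intros i Hi; now rewrite In).
  pose proof (ls_ut Hls) as Hut.
  destruct Hu as [_ [Hu0 [Hu1 _]]].
  pose proof (upwind_op eps mu a b f n x U _ _ HU Hav Hbv) as Hop.
  destruct HU as [HU0 [HU1 _]].
  assert (n1 : 1 <= INR n) by (apply (le_INR 1), Hn).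
  destruct (cell_errors Hal Hga
      (coefs_M Hc) HC Hp (coefs_a Hc) (coefs_b Hc)
      Hls Hs Hdc Hav Hbv ltac:(rewrite Hut; lra) ltac:(rewrite Hut; lra) HU0 HU1 Hop Hw)
    as [R1 R2].
  { transitivity sL; [field; lra|reflexivity]. }
  { transitivity sR; [field; lra|reflexivity]. }
  { field. lra. }
  assert (fin : forall Y, errors_within al ga M C n x U u ut K (chi al ga eps mu) Y ->
      Rbar_le (error_norm al ga eps mu (4 * n) u U) (Finite (2 * (Cerr al ga M C K * Y)))).
  { intros Y [E1 E2]. apply (error_norm_le al ga eps mu _ n u ut U Hn); auto;
      [apply (dm_0 Hm)|apply (dm_1 Hm)]. }
  assert (N0 : 0 < INR (4 * n)) by (apply lt_0_INR; lia).
  set (Lg := ln (INR (4 * n))) in *.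
  split.
  - intros _ Hs4. replace (2 * Cerr al ga M C K * / INR (4 * n) * Lg)
      with (2 * (Cerr al ga M C K * (Lg / INR (4 * n)))) by (field; lra).
    apply fin, R1. unfold sL, sigma_L in Hs4. fold l Lg in Hs4.
    destruct (Rle_dec (1 / 4) (2 / l * Lg)) as [Q|Q]; [rewrite Rmin_left in Hs4 by exact Q; lra|lra].
  - replace (2 * Cerr al ga M C K * / INR (4 * n) * Lg ^ 3)
      with (2 * (Cerr al ga M C K * (Lg / INR (4 * n) * Lg ^ 2))) by (field; lra).
    apply fin, R2.
Qed.
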